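(* Fix $\lambda\in(0,e/2)$, $\eta>0$, $m>1$. Let $\Psi:\mathbb{R}^d\to[0,\infty)$ be in $C^1(\mathbb{R}^d)$, such that $|\nabla\Psi(y)|\le K(1+|y|)$ for all $y\in\mathbb{R}^d$ for some $K>0$, and $\nabla\Psi$ is Lipschitz. For any $\rho_0\in\mathcal{D}_2(\mathbb{R}^d)$ with $J_{\lambda,\eta}(\rho_0)<\infty$, let $\rho:[0,\infty)\to\mathcal{D}_2(\mathbb{R}^d)$ be the solution to the Fokker-Planck equation $$\partial_tu-\operatorname{div}\big(u\nabla\Psi+\nabla(\lambda u+\eta u^m)\big)=0,\qquad u(0,\cdot)=\rho_0,$$ satisfying $\{\rho(t)\mathcal{L}^d\}_{t\ge0}\in AC^2_{\mathrm{loc}}([0,\infty);\mathcal{P}_2(\mathbb{R}^d))$ and $\int_0^T\int_{\mathbb{R}^d}|v_\rho|^2\rho\,dy\,dt<\infty$ for all $T>0$ (which exists, and is unique up to $\mathcal{L}^d$-null sets at each time), where $v_\rho(t,y):=-(\nabla\Psi+\lambda\nabla\rho/\rho+\eta\nabla\rho^m/\rho)(t,y)$. Then $$\frac{d}{dt}J_{\lambda,\eta}(\rho(t))=-\|v_\rho(t,\cdot)\|^2_{L^2(\mathbb{R}^d,\rho(t)\mathcal{L}^d)}\quad\text{for }\mathcal{L}^1\text{-a.e. }t>0.$$ Hence, $$J_{\lambda,\eta}(\rho(t))\le J_{\lambda,\eta}(\rho_0)-\int_0^t\|v_\rho(r,\cdot)\|^2_{L^2(\mathbb{R}^d,\rho(r)\mathcal{L}^d)}\,dr\quad\forall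 t\ge0.$$
   Context: Notation. $\mathcal{L}^d$ is Lebesgue measure on $\mathbb{R}^d$. $\mathcal{D}(\mathbb{R}^d)$ is the set of probability density functions on $\mathbb{R}^d$, and $\mathcal{D}_2(\mathbb{R}^d)$ the subset with $\int|y|^2\rho(y)dy<\infty$. $\mathcal{P}(\mathbb{R}^d)$ is the set of Borel probability measures; $\mathcal{P}_2(\mathbb{R}^d)$ is the subset with finite second moment, equipped with the Wasserstein-2 metric $\mathcal{W}_2$. $\rho\mathcal{L}^d$ is the measure with density $\rho$. $H(s)=\lambda s\ln s$ for $s>0$, $H(0)=0$; $F(s)=H(s)+\frac{\eta}{m-1}s^m$; $L_F(s):=sF'(s)-F(s)=\lambda s+\eta s^m$. For $\rho\in\mathcal{D}_2(\mathbb{R}^d)$, $J_{\lambda,\eta}(\rho)=\int\Psi\rho\,dy+\int H^+(\rho)\,dy-\int H^-(\rho)\,dy+\int\frac{\eta}{m-1}\rho^m\,dy\in(-\infty,\infty]$ ($H^-(\rho)$ is integrable). Solution of the Fokker-Planck equation. $\rho:[0,\infty)\to\mathcal{D}(\mathbb{R}^d)$ is a solution if: (i) $t\mapsto\rho(t)$ is continuous on $[0,\infty)$ under the weak-$*$ topology in $L^1(\mathbb{R}^d)$ (i.e. $t\mapsto\rho(t)\mathcal{L}^d$ is weakly continuous in $\mathcal{P}(\mathbb{R}^d)$), with $\rho(0)=\rho_0$; (ii) $L_F(\rho(t))\in W^{1,1}_{\mathrm{loc}}(\mathbb{R}^d)$ for all $t>0$ (this implies $\rho(t),\rho^m(t)\in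 W^{1,1}_{\mathrm{loc}}(\mathbb{R}^d)$, so that $v_\rho(t,\cdot)$ is defined $\rho(t)\mathcal{L}^d$-a.e. for $t>0$); (iii) for all $\varphi\in C_c^\infty((0,\infty)\times\mathbb{R}^d)$, $\int_0^\infty\int\{\rho\,\partial_t\varphi-(\rho\nabla\Psi+\nabla(\lambda\rho+\eta\rho^m))\cdot\nabla\varphi\}\,dy\,dt=0$. $\bm\nu\in AC^2_{\mathrm{loc}}([0,\infty);\mathcal{P}_2(\mathbb{R}^d))$ means there is $g\in L^2_{\mathrm{loc}}([0,\infty))$ with $\mathcal{W}_2(\bm\nu_t,\bm\nu_s)\le\int_s^tg(z)\,dz$ for all $0\le s\le t$. *)

(* Defs.v *)
From HB Require Import structures.
From mathcomp Require Import all_boot all_order all_algebra.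
From mathcomp Require Import all_classical all_reals all_analysis.
From mathcomp Require Import measurable_realfun.
From mathcomp Require Import ring.

Set Implicit Arguments.
Unset Strict Implicit.
Unset Printing Implicit Defensive.

Import Order.TTheory GRing.Theory Num.Theory.
Import numFieldNormedType.Exports.
Local Open Scope classical_set_scope.
Local Open Scope ring_scope.

(** R^d is represented by row vectors ['rV[R]_d].  Their library topology is
    the one of the sup norm, i.e. the usual one; the Euclidean norm and inner
    product are the explicit [enorm] and [edot] below. *)

Definition borel_mx_display : measure_display. Proof. exact: default_measure_display. Qed.

Section borel_mx.
Variables (R : realType) (m n : nat).

Let borel0 : <<s @open 'M[R]_(m, n) >> set0.
Proof. exact: sigma_algebra0. Qed.

Let borelC A : <<s @open 'M[R]_(m, n) >> A -> <<s @open 'M[R]_(m, n) >> (~` A).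
Proof. exact: sigma_algebraC. Qed.

Let borel_bigcup (F : (set 'M[R]_(m, n))^nat) :
  (forall i, <<s @open 'M[R]_(m, n) >> (F i)) ->
  <<s @open 'M[R]_(m, n) >> (\bigcup_i F i).
Proof. exact: sigma_algebra_bigcup. Qed.

HB.instance Definition _ := @isMeasurable.Build borel_mx_display
  'M[R]_(m, n) <<s @open 'M[R]_(m, n) >> borel0 borelC borel_bigcup.

End borel_mx.

Lemma measurable_to_rV (R : realType) (n : nat) d (T : measurableType d)
    (f : T -> 'rV[R]_n) :
  (forall i, measurable_fun [set: T] (fun x => f x 0 i)) ->
  measurable_fun [set: T] f.
Proof.
move=> mf; apply: (measurability (@open 'rV[R]_n)) => //.
move=> _ [U oU <-]; rewrite setTI.
pose C (p : 'rV[rat]_n * nat) : 'rV[R]_n := \row_i ratr (p.1 0 i).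
pose B (p : 'rV[rat]_n * nat) : set 'rV[R]_n := ball (C p) (p.2.+1%:R^-1 : R).
pose W (p : 'rV[rat]_n * nat) : set T :=
  if `[< B p `<=` U >] then f @^-1` (B p) else set0.
have -> : f @^-1` U = \bigcup_p W p.
  apply/seteqP; split => [x Ufx|x [p _]]; last first.
    by rewrite /W; case: asboolP => // BU fx; exact: BU.
  have /nbhs_ballP[e /= e0 eU] : nbhs (f x) U by exact: open_nbhs_nbhs.
  have [k ke] : exists k : nat, k.+1%:R^-1 < e / 2 :> R.
    have e20 : 0 < e / 2 by rewrite divr_gt0.
    have [N _ /(_ N (leqnn N))] := near_infty_natSinv_lt (PosNum e20).
    by exists N.
  have k0 : 0 < k.+1%:R^-1 :> R by rewrite invr_gt0.
  have /fin_all_exists[q qP] :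
      forall i, exists q : rat, `|f x 0 i - ratr q| < k.+1%:R^-1.
    move=> i; have [|q] := @rat_in_itvoo R (f x 0 i) (f x 0 i + k.+1%:R^-1).
      by rewrite ltrDl.
    rewrite in_itv/= => /andP[h1 h2]; exists q.
    by rewrite distrC gtr0_norm ?subr_gt0// ltrBlDl.
  have Bfx : B (\row_i q i, k) (f x).
    by split => // i j; rewrite !ord1 !mxE/= /ball/= distrC.
  exists (\row_i q i, k) => //; rewrite /W; case: asboolP => // BU; exfalso.
  apply: BU => y By; apply: eU; rewrite (splitr e).
  apply: (@ball_triangle _ _ (C (\row_i q i, k))).
    by apply: ball_sym; apply: le_ball Bfx; exact: ltW.
  by apply: le_ball By; exact: ltW.
apply: countable_bigcupT_measurable; first exact: countableP.
move=> p; rewrite /W; case: asboolP => // _.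
have -> : f @^-1` (B p) =
    \bigcap_(i in [set: 'I_n])
       ((fun x => f x 0 i) @^-1` ball (C p 0 i) (p.2.+1%:R^-1 : R)).
  apply/seteqP; split => [x [_ Bx] i _|x Bx]; first exact: Bx.
  by split => [|i j]; rewrite ?invr_gt0// !ord1; exact: Bx.
apply: fin_bigcap_measurable; first exact: finite_finset.
move=> i _; rewrite -[X in measurable X]setTI; apply: mf => //.
by apply: open_measurable; exact: ball_open.
Qed.

Lemma measurable_coord (R : realType) (m n : nat) i j :
  measurable_fun [set: 'M[R]_(m, n)] (fun x : 'M[R]_(m, n) => x i j).
Proof.
apply: (measurability _ (RGenOpens.measurableE R)).
move=> _ [_ [a [b ->]] <-]; rewrite setTI; apply: sub_sigma_algebra.
by move/continuousP: (@coord_continuous R m n i j); apply; exact: itv_open.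
Qed.

Section row_cons_measure.
Context (R : realType) (n : nat).
Local Open Scope ereal_scope.

Definition row_cons (p : R * 'rV[R]_n) : 'rV[R]_n.+1 :=
  \row_i oapp (fun j => p.2 0 j)%R p.1 (unlift ord0 i).

Definition row_uncons (x : 'rV[R]_n.+1) : R * 'rV[R]_n :=
  (x 0 ord0, \row_j x 0 (lift ord0 j))%R.

Lemma row_uncons_consK : cancel row_cons row_uncons.
Proof.
case=> a x; rewrite /row_uncons /row_cons; congr pair.
  by rewrite mxE unlift_none.
by apply/rowP => j; rewrite !mxE liftK.
Qed.

Lemma measurable_row_cons : measurable_fun [set: R * 'rV[R]_n] row_cons.
Proof.
apply: measurable_to_rV => i.
under eq_fun do rewrite mxE.
case: (unlift ord0 i) => [j|]; last exact: measurable_fst.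
apply: (@measurableT_comp _ _ _ _ _ _ (fun x : 'rV[R]_n => x 0%R j) _ snd).
  exact: measurable_coord.
exact: measurable_snd.
Qed.

Lemma measurable_row_uncons : measurable_fun [set: 'rV[R]_n.+1] row_uncons.
Proof.
apply: measurable_fun_pair; first exact: measurable_coord.
apply: measurable_to_rV => i; under eq_fun do rewrite mxE.
exact: measurable_coord.
Qed.

Variable mu : {sigma_finite_measure set 'rV[R]_n -> \bar R}.

Definition row_cons_measure : set 'rV[R]_n.+1 -> \bar R :=
  pushforward (@lebesgue_measure R \x mu) row_cons.

Let row_cons_measure0 : row_cons_measure set0 = 0.
Proof. by rewrite /row_cons_measure /pushforward preimage_set0 measure0. Qed.

Let row_cons_measure_ge0 A : 0 <= row_cons_measure A.
Proof. by rewrite /row_cons_measure /pushforward measure_ge0. Qed.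

Let row_cons_measure_sigma_additive : semi_sigma_additive row_cons_measure.
Proof.
move=> F mF tF mUF; rewrite /row_cons_measure /pushforward preimage_bigcup.
apply: measure_semi_sigma_additive.
- by move=> k; rewrite -[X in measurable X]setTI; exact: measurable_row_cons.
- apply/trivIsetP => /= i j _ _ ij; rewrite -preimage_setI.
  by move/trivIsetP : tF => /(_ _ _ _ _ ij) ->//; rewrite preimage_set0.
- rewrite -preimage_bigcup -[X in measurable X]setTI.
  exact: measurable_row_cons.
Qed.

HB.instance Definition _ := isMeasure.Build _ _ _ row_cons_measure
  row_cons_measure0 row_cons_measure_ge0 row_cons_measure_sigma_additive.

Let row_cons_measure_sigma_finite : sigma_finite setT row_cons_measure.
Proof.
have /sigma_finiteP[F [TF ndF Foo]] := sigma_finiteT (@lebesgue_measure R).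
have /sigma_finiteP[G [TG ndG Goo]] := sigma_finiteT mu.
exists (fun k => row_uncons @^-1` (F k `*` G k)).
  rewrite -preimage_bigcup -(preimage_setT row_uncons); congr (_ @^-1` _).
  rewrite -setXTT TF TG predeqE => -[x y]; split.
    move=> [/= [k _ Fkx] [l _ Gly]]; exists (maxn k l) => //; split.
    - by move: x Fkx; exact/subsetPset/ndF/leq_maxl.
    - by move: y Gly; exact/subsetPset/ndG/leq_maxr.
  by move=> [k _ []/= ? ?]; split; exists k.
move=> k; have [mFk Fkoo] := Foo k; have [mGk Gkoo] := Goo k.
split.
  rewrite -[X in measurable X]setTI.
  by apply: measurable_row_uncons => //; exact: measurableX.
rewrite /row_cons_measure /pushforward -comp_preimage.
rewrite (_ : row_uncons \o row_cons = id); last first.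
  by apply/funext => p; exact: row_uncons_consK.
by rewrite preimage_id product_measure1E// lte_mul_pinfty// ge0_fin_numE.
Qed.

HB.instance Definition _ := Measure_isSigmaFinite.Build _ _ _ row_cons_measure
  row_cons_measure_sigma_finite.

End row_cons_measure.

Fixpoint lebesgue_rV (R : realType) (d : nat) :
    {sigma_finite_measure set 'rV[R]_d -> \bar R} :=
  if d is n.+1 return {sigma_finite_measure set 'rV[R]_d -> \bar R}
  then row_cons_measure (lebesgue_rV R n) else \d_(0 : 'rV[R]_0).

Lemma lebesgue_rV_box (R : realType) (d : nat) (A : 'I_d -> set R) :
  (forall i, measurable (A i)) ->
  lebesgue_rV R d [set x | forall i, A i (x 0 i)] =
    (\prod_(i < d) @lebesgue_measure R (A i))%E.
Proof.
elim: d A => [|d IH] A mA.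
  rewrite big_ord0 /= diracE mem_set// => i; by case: i.
have mbox : measurable [set x : 'rV[R]_d | forall i, A (lift ord0 i) (x 0 i)].
  rewrite (_ : mkset _ = \bigcap_(i in [set: 'I_d])
      ((fun x : 'rV[R]_d => x 0 i) @^-1` A (lift ord0 i))); last first.
    by apply/seteqP; split => [x Ax i _|x Ax i]; exact: Ax.
  apply: fin_bigcap_measurable => [|i _]; first exact: finite_finset.
  by rewrite -[X in measurable X]setTI; exact: measurable_coord.
rewrite big_ord_recl -IH//= /row_cons_measure /pushforward -product_measure1E//;
  last exact: (mA ord0).
congr (_ _); apply/seteqP; split => [[a x] /= Aax|[a x] /= [Aa Ax] i].
  split => [|i]; first by have := Aax ord0; rewrite /row_cons mxE unlift_none.
  by have := Aax (lift ord0 i); rewrite /row_cons mxE liftK.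
by rewrite /row_cons mxE; case: unliftP => [j ->|->] //=; exact: Ax.
Qed.

Section calculus.
Context (R : realType).

Definition edot (d : nat) (x y : 'rV[R]_d) : R := \sum_i x 0 i * y 0 i.

Definition enorm (d : nat) (x : 'rV[R]_d) : R := Num.sqrt (edot x x).

Definition grad (d : nat) (f : 'rV[R]_d -> R) (y : 'rV[R]_d) : 'rV[R]_d :=
  \row_i 'D_(delta_mx 0 i) f y.

(** [Ck n f]: all iterated directional derivatives of order at most [n] exist
    everywhere and are continuous; on a finite-dimensional space this is the
    usual class C^n. *)
Fixpoint Ck (V : normedModType R) (n : nat) (f : V -> R) : Prop :=
  continuous f /\
  if n is k.+1 then
    forall v : V, (forall x, derivable f x v) /\ Ck k (fun x => 'D_v f x)
  else True.

Definition smooth (V : normedModType R) (f : V -> R) : Prop :=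
  forall n, Ck n f.

Definition test_function (V : normedModType R) (U : set V) (phi : V -> R) :
    Prop :=
  [/\ smooth phi, compact (closure [set x | phi x != 0]) &
      closure [set x | phi x != 0] `<=` U].

End calculus.

Section sobolev.
Context (R : realType) (d : nat).
Local Notation leb := (lebesgue_rV R d).
Implicit Types (f : 'rV[R]_d -> R) (G : 'rV[R]_d -> 'rV[R]_d).

Definition L1_loc f : Prop :=
  measurable_fun [set: 'rV[R]_d] f /\
  forall K : set 'rV[R]_d, compact K ->
    (\int[leb]_(y in K) `|f y|%:E < +oo)%E.

Definition is_weak_grad f G : Prop :=
  (forall i, L1_loc (fun y => G y 0 i)) /\
  forall phi : 'rV[R]_d -> R, test_function [set: 'rV[R]_d] phi ->
    forall i, \int[leb]_y (f y * 'D_(delta_mx 0 i) phi y) =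
              - \int[leb]_y (G y 0 i * phi y).

Definition W11_loc f : Prop := L1_loc f /\ exists G, is_weak_grad f G.

(** The weak gradient (unique up to null sets) of [f]; when [f] has none this
    is the zero field. *)
Definition wgrad f : 'rV[R]_d -> 'rV[R]_d :=
  xget (fun=> 0) [set G | is_weak_grad f G].

End sobolev.

Section wasserstein.
Context (R : realType) (d : nat).
Local Notation leb := (lebesgue_rV R d).
Local Open Scope ereal_scope.

Definition density (rho : 'rV[R]_d -> R) : Prop :=
  [/\ measurable_fun [set: 'rV[R]_d] rho, (forall y, 0 <= rho y)%R &
      \int[leb]_y (rho y)%:E = 1].

Definition density2 (rho : 'rV[R]_d -> R) : Prop :=
  density rho /\ \int[leb]_y (enorm y ^+ 2 * rho y)%:E < +oo.

Definition dmeasure (rho : 'rV[R]_d -> R) : set 'rV[R]_d -> \bar R :=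
  fun A => \int[leb]_(y in A) (rho y)%:E.

(** Measures enter as set functions, so that [dmeasure] needs no bundling; on
    [density2] functions they are probability measures with finite second
    moment. *)
Definition couplings (mu nu : set 'rV[R]_d -> \bar R) :
    set (probability ('rV[R]_d * 'rV[R]_d)%type R) :=
  [set gamma | forall A : set 'rV[R]_d, measurable A ->
     gamma (A `*` setT) = mu A /\ gamma (setT `*` A) = nu A].

Definition W2 (mu nu : set 'rV[R]_d -> \bar R) : \bar R :=
  (ereal_inf [set \int[gamma]_z (enorm (z.1 - z.2) ^+ 2)%:E
             | gamma in couplings mu nu]) `^ (2^-1).

Definition AC2_loc (nu : R -> set 'rV[R]_d -> \bar R) : Prop :=
  exists g : R -> R,
    [/\ measurable_fun (`[0%R, +oo[%classic : set R) g,
        (forall T : R, \int[lebesgue_measure]_(z in `[0%R, T]) (g z ^+ 2)%:E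
                       < +oo) &
        forall s t : R, (0 <= s)%R -> (s <= t)%R ->
          W2 (nu t) (nu s) <= \int[lebesgue_measure]_(z in `[s, t]) (g z)%:E].

End wasserstein.

Section fokker_planck.
Context (R : realType) (d : nat) (lambda eta m : R) (Psi : 'rV[R]_d -> R).
Local Notation leb := (lebesgue_rV R d).
Implicit Types rho : R -> 'rV[R]_d -> R.

(** [ln 0 = 0] in the library, so [entH 0 = 0]. *)
Definition entH (s : R) : R := lambda * s * ln s.

Definition entF (s : R) : R := entH s + eta / (m - 1) * s `^ m.

(** [LF s = s * F'(s) - F(s)], see [LFE] below; this form also covers [s = 0]. *)
Definition LF (s : R) : R := lambda * s + eta * s `^ m.

Lemma LFE (s : R) : m != 1 -> 0 < s -> LF s = s * derive1 entF s - entF s.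
Proof.
move=> m1 s0; have dln := is_derive1_ln s0; have dpow := is_derive1_powR m s0.
have dlam : is_derive s 1 (fun x : R => lambda * x) lambda.
  by apply: is_derive_eq; exact: mulr1.
have dF : is_derive s 1 entF
    ((lambda * s) * s^-1 + ln s * lambda + eta / (m - 1) * (m * s `^ (m - 1))).
  by rewrite /entF /entH; apply: is_deriveD.
have sm : s * s `^ (m - 1) = s `^ m.
  by rewrite -{1}(powRr1 (ltW s0)) -powRD ?(gt_eqF s0) ?implybT// addrC subrK.
rewrite derive1E derive_val /LF /entF /entH -sm.
have m10 : m - 1 != 0 by rewrite subr_eq0.
by field; rewrite (gt_eqF s0) m10.
Qed.

(** The integral of the negative part of [entH u] is finite for [u] in
    [density2], so [J] never meets the case oo - oo there. *)
Definition J (u : 'rV[R]_d -> R) : \bar R :=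
  (\int[leb]_y (Psi y * u y)%:E
   + \int[leb]_y (Num.max (entH (u y)) 0)%:E
   - \int[leb]_y (Num.max (- entH (u y)) 0)%:E
   + \int[leb]_y (eta / (m - 1) * u y `^ m)%:E)%E.

Definition weakly_continuous rho : Prop :=
  forall f : 'rV[R]_d -> R, continuous f -> (exists M, forall y, `|f y| <= M) ->
    {within [set t : R | 0 <= t],
      continuous (fun t : R => \int[leb]_y (f y * rho t y))}.

(** Weak form, tested against [phi] on (0, oo) x R^d.  The outer integral is
    extended-real valued, so that its vanishing entails its convergence. *)
Definition FP_weak rho : Prop :=
  forall phi : R * 'rV[R]_d -> R,
    test_function [set p : R * 'rV[R]_d | 0 < p.1] phi ->
    (\int[lebesgue_measure]_(t in `]0%R, +oo[) \int[leb]_y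
       (rho t y * derive1 (fun s : R => phi (s, y)) t
        - edot (rho t y *: grad Psi y + wgrad (fun z => LF (rho t z)) y)
               (grad (fun z => phi (t, z)) y))%:E = 0)%E.

Record FP_solution (rho0 : 'rV[R]_d -> R) rho : Prop := {
  FP_density : forall t, 0 <= t -> density (rho t);
  FP_continuous : weakly_continuous rho;
  FP_initial : {ae leb, forall y, rho 0 y = rho0 y};
  FP_regular : forall t, 0 < t -> W11_loc (fun y => LF (rho t y));
  FP_equation : FP_weak rho
}.

(** Where [rho t y = 0] the quotients are 0 by the library's convention; the
    velocity is only ever integrated against [rho t]. *)
Definition vel rho (t : R) (y : 'rV[R]_d) : 'rV[R]_d :=
  - (grad Psi y + (lambda / rho t y) *: wgrad (rho t) y
     + (eta / rho t y) *: wgrad (fun z => rho t z `^ m) y).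

(** squared norm of [vel rho t] in L^2(R^d, rho(t) L^d) *)
Definition vnorm2 rho (t : R) : \bar R :=
  (\int[leb]_y (enorm (vel rho t y) ^+ 2 * rho t y)%:E)%E.

End fokker_planck.

(* Main.v *)
(* Let q = rho grad Psi + grad L_F(rho) be the flux, so that d/dt rho = div q and
   |q|^2 / rho = |v|^2 rho; since L_F' >= lambda > 0, both q and p = grad rho are
   bounded by sqrt (rho k) with k integrable on [0, T] x R^d (the second moment of
   rho, controlled by the Wasserstein speed, bounds the part of k coming from
   grad Psi).  Convolving the equation in space with a mollifier makes rho absolutely
   continuous in time, and the chain rule gives, for beta in C^1_c and G in C^2 with
   r G''(r) bounded, the identity
     d/dt int beta G(rho) = - int q . (beta G''(rho) p + G'(rho) grad beta);
   the mollified right-hand sides converge because, by Jensen, the mollified q and p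
   obey the same bound with k mollified, and the mollified k converge in L^1.
   The identity is applied to beta = chi_n Psi / (1 + d_n Psi), G = id, and to
   beta = chi_n, G = F regularised at 0 and at infinity, where the radius of the
   cut-off chi_n is taken so large that the terms in grad chi_n vanish in the limit
   although the bounds on Psi / (1 + d_n Psi) and G' blow up.  All other terms are
   dominated by k uniformly in n, so the energy differences converge to
   - int_s^t |v|^2 rho.  Fatou's lemma propagates the finiteness of J from time 0,
   whence J(rho t) - J(rho s) = - int_s^t |v|^2 rho, and the Lebesgue differentiation
   theorem concludes. *)

From HB Require Import structures.
From mathcomp Require Import all_boot all_order all_algebra.
From mathcomp Require Import all_classical all_reals all_analysis.
From mathcomp Require Import measurable_realfun.
From mathcomp Require Import ring lra.
Require Import Defs.

Set Implicit Arguments.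
Unset Strict Implicit.
Unset Printing Implicit Defensive.

Import Order.TTheory GRing.Theory Num.Theory.
Import numFieldNormedType.Exports.
Local Open Scope classical_set_scope.
Local Open Scope ring_scope.

(** * Integration *)

(** The data are given one time at a time: weak continuity in [t], a density for each [t], and weak
    gradients that [wgrad] chooses separately at each time. Nothing is given as jointly measurable
    in (t, x), so Fubini cannot be applied to [rho] directly. Measurability in time is always
    reached from weak continuity: mollified functions are measurable in [t] and continuous in [x],
    hence jointly measurable, and gradients enter through pairings whose derivative sits on the test
    function.

    A second obstacle is that the natural bounds hold only at almost every time and point. Flux and
    gradient are therefore set to zero at times of infinite dissipation and where the density
    vanishes, so that the quadratic bounds hold everywhere and survive convolution.

    Finally, the entropy produces F''(rho) grad rho = (L_F'(rho) / rho) p, in which no factor is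
    bounded. The truncated entropies keep r G''(r) below a fixed multiple of L_F'(r), uniformly in
    the truncation, and L_F'(rho) p is controlled again as the difference q - rho grad Psi. *)

(* Measurability of the domain is part of the predicate, to spare side conditions. *)
Definition Rint d (T : measurableType d) (R : realType)
    (mu : {measure set T -> \bar R}) (D : set T) (f : T -> R) : Prop :=
  measurable D /\ mu.-integrable D (EFin \o f).

Section Rint_theory.
Context d (T : measurableType d) (R : realType).
Variables (mu : {measure set T -> \bar R}) (D : set T).
Implicit Types f g h : T -> R.
Local Notation Rint := (Rint mu D).

Lemma Rint_dom f : Rint f -> measurable D.
Proof. by case. Qed.

Lemma Rint_int f : Rint f -> mu.-integrable D (EFin \o f).
Proof. by case. Qed.

Lemma Rint_meas f : Rint f -> measurable_fun D f.
Proof. by move=> [_ /integrableP[/measurable_EFinP]]. Qed.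

Lemma Rint_lty f : Rint f -> (\int[mu]_(x in D) `|f x|%:E < +oo)%E.
Proof. by move=> [_ /integrableP[_]]. Qed.

Lemma RintP f : measurable D -> measurable_fun D f ->
  (\int[mu]_(x in D) `|f x|%:E < +oo)%E -> Rint f.
Proof. by move=> mD mf fi; split => //; apply/integrableP; split => //; exact/measurable_EFinP. Qed.

Lemma Rint_le f g : measurable_fun D f -> Rint g ->
  (forall x, D x -> `|f x| <= g x) -> Rint f.
Proof.
move=> mf [mD ig] fg; split=> //; apply: le_integrable ig => //; first exact/measurable_EFinP.
by move=> x Dx; rewrite /= lee_fin (le_trans (fg _ Dx))// ler_norm.
Qed.

Lemma Rint_aele f g : measurable_fun D f -> Rint g ->
  {ae mu, forall x, D x -> `|f x| <= g x} -> Rint f.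
Proof.
move=> mf ig fg; have mD := Rint_dom ig; apply: RintP => //; apply: le_lt_trans (Rint_lty ig).
apply: ae_ge0_le_integral => //.
- by apply/measurable_EFinP; exact: measurableT_comp.
- by apply/measurable_EFinP; apply: measurableT_comp => //; exact: Rint_meas.
by apply: filterS fg => x fg Dx; rewrite lee_fin (le_trans (fg Dx))// ler_norm.
Qed.

Lemma eq_Rint f g : (forall x, D x -> f x = g x) -> Rint f -> Rint g.
Proof.
move=> fg [mD fi]; split=> //; apply: eq_integrable fi => // x /set_mem Dx.
by rewrite /= fg.
Qed.

Lemma RintD f g : Rint f -> Rint g -> Rint (fun x => f x + g x).
Proof. by move=> [mD fi] [_ gi]; split=> //; rewrite /comp; under eq_fun do rewrite EFinD; exact: integrableD. Qed.

Lemma RintB f g : Rint f -> Rint g -> Rint (fun x => f x - g x).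
Proof. by move=> [mD fi] [_ gi]; split=> //; rewrite /comp; under eq_fun do rewrite EFinB; exact: integrableB. Qed.

Lemma RintN f : Rint f -> Rint (fun x => - f x).
Proof. by move=> [mD fi]; split=> //; rewrite /comp; under eq_fun do rewrite EFinN; exact: integrableN. Qed.

Lemma RintZ k f : Rint f -> Rint (fun x => k * f x).
Proof. by move=> [mD fi]; split=> //; rewrite /comp; under eq_fun do rewrite EFinM; exact: integrableZl. Qed.

Lemma RintZr k f : Rint f -> Rint (fun x => f x * k).
Proof. by move=> fi; apply: eq_Rint (RintZ k fi) => x _; rewrite mulrC. Qed.

Lemma Rint_abs f : Rint f -> Rint (fun x => `|f x|).
Proof. by move=> [mD fi]; split=> //; exact: integrable_norm. Qed.

Lemma Rint0 : measurable D -> Rint (fun=> 0).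
Proof. by move=> mD; split=> //; exact: integrable0. Qed.

Lemma Rint_sum (I : Type) (s : seq I) (F : I -> T -> R) : measurable D ->
  (forall i, Rint (F i)) -> Rint (fun x => \sum_(i <- s) F i x).
Proof.
move=> mD iF; elim: s => [|i s IH].
  by under [X in Rint X]eq_fun do rewrite big_nil; exact: Rint0.
by under [X in Rint X]eq_fun do rewrite big_cons; exact: RintD.
Qed.

Lemma RintMb f g (C : R) : Rint f -> measurable_fun D g ->
  (forall x, D x -> `|g x| <= C) -> Rint (fun x => g x * f x).
Proof.
move=> fi mg gC; apply: (@Rint_le _ (fun x => C * `|f x|)).
- by apply: measurable_funM => //; exact: Rint_meas.
- by apply: RintZ; exact: Rint_abs.
by move=> x Dx; rewrite normrM ler_wpM2r// gC.
Qed.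

Lemma Rint_EFin f : Rint f ->
  (\int[mu]_(x in D) (f x)%:E)%E = (\int[mu]_(x in D) f x)%:E.
Proof. by move=> [mD fi]; rewrite /Rintegral fineK//; exact: integrable_fin_num. Qed.

Lemma Rint_normE f : Rint f ->
  (\int[mu]_(x in D) `|f x|%:E)%E = (\int[mu]_(x in D) `|f x|)%:E.
Proof. by move=> fi; rewrite Rint_EFin//; exact: Rint_abs. Qed.

Lemma RIntD f g : Rint f -> Rint g ->
  \int[mu]_(x in D) (f x + g x) = \int[mu]_(x in D) f x + \int[mu]_(x in D) g x.
Proof. by move=> [mD fi] [_ gi]; rewrite RintegralD. Qed.

Lemma RIntB f g : Rint f -> Rint g ->
  \int[mu]_(x in D) (f x - g x) = \int[mu]_(x in D) f x - \int[mu]_(x in D) g x.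
Proof. by move=> [mD fi] [_ gi]; rewrite RintegralB. Qed.

Lemma RIntZ k f : Rint f ->
  \int[mu]_(x in D) (k * f x) = k * \int[mu]_(x in D) f x.
Proof. by move=> [mD fi]; rewrite RintegralZl. Qed.

Lemma RIntZr k f : Rint f ->
  \int[mu]_(x in D) (f x * k) = \int[mu]_(x in D) f x * k.
Proof. by move=> [mD fi]; rewrite RintegralZr. Qed.

Lemma RIntN f : Rint f -> \int[mu]_(x in D) (- f x) = - \int[mu]_(x in D) f x.
Proof.
move=> fi; rewrite -mulN1r -RIntZ//.
by under [RHS]eq_Rintegral do rewrite mulN1r.
Qed.

Lemma le_RInt f g : Rint f -> Rint g -> (forall x, D x -> f x <= g x) ->
  \int[mu]_(x in D) f x <= \int[mu]_(x in D) g x.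
Proof. by move=> [mD fi] [_ gi] fg; exact: le_Rintegral. Qed.

Lemma le_norm_RInt f : Rint f ->
  `|\int[mu]_(x in D) f x| <= \int[mu]_(x in D) `|f x|.
Proof. by move=> [mD fi]; exact: le_normr_Rintegral. Qed.

Lemma RInt_sum (I : Type) (s : seq I) (F : I -> T -> R) : measurable D ->
  (forall i, Rint (F i)) ->
  \int[mu]_(x in D) (\sum_(i <- s) F i x) = \sum_(i <- s) \int[mu]_(x in D) F i x.
Proof.
move=> mD iF; elim: s => [|i s IH].
  rewrite big_nil; under eq_Rintegral do rewrite big_nil.
  by rewrite /Rintegral integral0.
under eq_Rintegral do rewrite big_cons.
by rewrite big_cons -IH RIntD//; exact: Rint_sum.
Qed.

Lemma ae_eq_RInt f g : measurable D -> measurable_fun D f -> measurable_fun D g ->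
  {ae mu, forall x, D x -> f x = g x} ->
  \int[mu]_(x in D) f x = \int[mu]_(x in D) g x.
Proof.
move=> mD mf mg fg; congr fine; apply: ae_eq_integral => //.
- exact/measurable_EFinP.
- exact/measurable_EFinP.
by apply: filterS fg => x fg Dx; rewrite fg.
Qed.

Lemma ae_eq_Rint f g : measurable_fun D g -> Rint f ->
  {ae mu, forall x, D x -> f x = g x} -> Rint g.
Proof.
move=> mg fi fg; apply: (Rint_aele mg (Rint_abs fi)).
by apply: filterS fg => x fg Dx; rewrite fg.
Qed.

Lemma Rint_indic (A : set T) : measurable D -> measurable A -> (mu A < +oo)%E ->
  Rint (\1_A : T -> R).
Proof.
move=> mD mA Aoo; split => //; apply: (integrableS measurableT) => //.
apply/integrableP; split; first exact/measurable_EFinP/measurable_indic.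
by under eq_integral do rewrite gee0_abs ?lee_fin//; rewrite integral_indic// setIT.
Qed.

Lemma Rint_DCT (f_ : nat -> T -> R) f g :
  (forall n, measurable_fun D (f_ n)) -> measurable_fun D f ->
  {ae mu, forall x, D x -> f_ ^~ x @ \oo --> f x} -> Rint g ->
  {ae mu, forall x, D x -> forall n, `|f_ n x| <= g x} ->
  [/\ Rint f, forall n, Rint (f_ n) &
      \int[mu]_(x in D) f_ n x @[n --> \oo] --> \int[mu]_(x in D) f x].
Proof.
move=> mf_ mf ff ig fg; have mD := Rint_dom ig.
have fi n : Rint (f_ n).
  by apply: (Rint_aele (mf_ n) ig); apply: filterS fg => x + Dx; exact.
have [] := @dominated_convergence _ _ _ mu D mD (fun n => EFin \o f_ n) (EFin \o f) (EFin \o g).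
- by move=> n; exact/measurable_EFinP.
- exact/measurable_EFinP.
- apply: filterS ff => x ff Dx; apply: (cvg_comp _ _ (ff Dx)); exact: cvg_refl.
- exact: Rint_int ig.
- by apply: filterS fg => x fg n Dx; rewrite /= lee_fin; exact: fg.
move=> if_ _ cv; have {}if_ : Rint f by []; split => //.
by move: cv; rewrite /= (Rint_EFin if_) => /fine_cvg.
Qed.

(** This form serves to propagate finiteness of the energy: the approximants are nonnegative with
    uniformly bounded real integrals, while integrability of the limit is not known beforehand. *)
Lemma Rint_fatou (f_ : nat -> T -> R) f (c : R) :
  (forall n, Rint (f_ n)) -> (forall n x, D x -> 0 <= f_ n x) ->
  measurable_fun D f ->
  {ae mu, forall x, D x -> f_ ^~ x @ \oo --> f x} ->
  (forall n, \int[mu]_(x in D) f_ n x <= c) ->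
  Rint f /\ (\int[mu]_(x in D) `|f x|%:E <= c%:E)%E.
Proof.
move=> fi f0 mf ff fc; have mD := Rint_dom (fi 0%N).
suff H : (\int[mu]_(x in D) `|f x|%:E <= c%:E)%E.
  by split => //; apply: RintP => //; apply: le_lt_trans H _; rewrite ltry.
have -> : (\int[mu]_(x in D) `|f x|%:E = \int[mu]_(x in D) limn_einf (fun n => `|f_ n x|%:E))%E.
  have mf_ n : measurable_fun D (fun x => `|f_ n x|%:E).
    by apply/measurable_EFinP; apply: measurableT_comp => //; exact: Rint_meas.
  apply: ae_eq_integral => //.
  - by apply/measurable_EFinP; exact: measurableT_comp.
  - rewrite /limn_einf; apply: measurableT_comp => //.
    by apply: measurable_fun_limn_esup => n; exact: measurableT_comp.
  apply: filterS ff => x ff Dx.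
  have h : `|f_ n x|%:E @[n --> \oo] --> `|f x|%:E.
    by apply: (@cvg_comp _ _ _ (fun n => `|f_ n x|) EFin); [apply: cvg_norm; exact: ff|exact: cvg_refl].
  by rewrite (cvg_limn_einf_sup h).1.
apply: le_trans (fatou _ _ _ _) _ => //.
- by move=> n; apply/measurable_EFinP; apply: measurableT_comp => //; exact: Rint_meas.
rewrite limn_einf_lim; apply: lime_le; first exact: is_cvg_einfs.
apply: nearW => n; apply: (@le_trans _ _ (\int[mu]_(x in D) `|f_ n x|%:E)%E).
  by apply: ereal_inf_lbound; exists n => /=.
rewrite Rint_normE// lee_fin (le_trans _ (fc n))//.
by under eq_Rintegral => x /set_mem Dx do rewrite ger0_norm ?f0//.
Qed.

(** Along a subsequence whose integrals are below 2^-k the series of the [e_ (phi k)] has an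
    integrable sum. This sum dominates every term, and its tails tend to zero wherever it is
    finite. *)
Lemma Rint_fast_subseq (e_ : nat -> T -> R) :
  (forall n, Rint (e_ n)) -> (forall n x, D x -> 0 <= e_ n x) ->
  \int[mu]_(x in D) e_ n x @[n --> \oo] --> 0 ->
  exists phi : nat -> nat, [/\ forall k, (k <= phi k)%N,
    {ae mu, forall x, D x -> e_ (phi k) x @[k --> \oo] --> 0} &
    exists2 h, Rint h & {ae mu, forall x, D x -> forall k, e_ (phi k) x <= h x}].
Proof.
move=> ei e0 ecv; have mD := Rint_dom (ei 0%N).
have /choice[phi phiP] k : exists n, (k <= n)%N /\ \int[mu]_(x in D) e_ n x <= geometric 1 2^-1 k.
  have gk : 0 < geometric 1 2^-1 k :> R by rewrite /= mul1r exprn_gt0// invr_gt0.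
  have /cvgr0Pnorm_le/(_ _ gk)[N _ NP] := ecv.
  exists (maxn k N); split; first exact: leq_maxl.
  by apply: le_trans (ler_norm _) _; apply: NP; exact: leq_maxr.
pose h x := (\sum_(0 <= k <oo) (e_ (phi k) x)%:E)%E.
have me k : measurable_fun D (fun x => (e_ (phi k) x)%:E).
  by apply/measurable_EFinP; exact: Rint_meas.
have mh : measurable_fun D h.
  by apply: ge0_emeasurable_sum => // k x Dx _; rewrite lee_fin e0.
have ih : mu.-integrable D h.
  apply/integrableP; split => //.
  rewrite (_ : integral _ _ _ = \int[mu]_(x in D) h x)%E; last first.
    apply: eq_integral => x /set_mem Dx; rewrite gee0_abs//.
    by apply: nneseries_ge0 => k _ _; rewrite lee_fin e0.
  rewrite integral_nneseries//; last by move=> k x Dx; rewrite lee_fin e0.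
  apply: (@le_lt_trans _ _ (\sum_(0 <= k <oo) (geometric 1 2^-1 k)%:E)%E).
    apply: lee_nneseries => [k _ _|k _]; first by apply: integral_ge0 => x Dx; rewrite lee_fin e0.
    by rewrite (Rint_EFin (ei _)) lee_fin; case: (phiP k).
  apply: (@le_lt_trans _ _ (1 * (1 - 2^-1)^-1)%:E); last by rewrite ltry.
  apply: lime_le; first by apply: is_cvg_nneseries => k _ _; rewrite lee_fin geometric_ge0// invr_ge0.
  apply: nearW => n; rewrite sumEFin lee_fin.
  apply: geometric_le_lim => //.
  by rewrite ger0_norm ?invr_ge0// invf_lt1// ltr1n.
have hk x k : D x -> ((e_ (phi k) x)%:E <= \sum_(k <= j <oo) (e_ (phi j) x)%:E)%E.
  move=> Dx; apply: le_trans (nneseries_lim_ge k.+1 _).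
    by rewrite big_nat1.
  by move=> j _; rewrite lee_fin e0.
have hk0 x k : D x -> ((e_ (phi k) x)%:E <= h x)%E.
  move=> Dx; rewrite /h; apply: le_trans (nneseries_lim_ge k.+1 _) => //.
    rewrite big_nat_recr//= leeDr// sume_ge0// => j _; by rewrite lee_fin e0.
  by move=> j _; rewrite lee_fin e0.
have hfin := integrable_ae mD ih.
exists phi; split; first by move=> k; case: (phiP k).
  apply: filterS hfin => x hf Dx; have {}hf := hf Dx.
  have tl : (\sum_(k <= j <oo) (e_ (phi j) x)%:E)%E @[k --> \oo] --> 0%E.
    apply: nneseries_tail_cvg; last by move=> j _; rewrite lee_fin e0.
    by rewrite -/(h x) ltey_eq hf.
  have : (e_ (phi k) x)%:E @[k --> \oo] --> 0%E.
    apply: (squeeze_cvge _ (cvg_cst 0%E) tl); apply: nearW => k.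
    by rewrite hk// lee_fin e0.
  exact: fine_cvg.
exists (fine \o h).
  apply: RintP => //; first by apply: measurableT_comp => //; exact: measurable_fine.
  apply: le_lt_trans (integrableP _ _ _ ih).2; apply: ge0_le_integral => //.
  - apply/measurable_EFinP; apply: measurableT_comp => //.
    by apply: measurableT_comp => //; exact: measurable_fine.
  - exact: measurableT_comp.
  by move=> x _; rewrite [(fine \o h) x]/comp; case: (h x) => [r| |] //=; rewrite leey.
apply: filterS hfin => x hf Dx k; have {}hf := hf Dx.
by rewrite -lee_fin /= fineK// hk0.
Qed.

(* Generalized dominated convergence along an L1-vanishing error [e_]: by the
   subsequence principle, pointwise convergence is only needed along those
   subsequences on which the error vanishes at the given point. *)
Lemma Rint_GDCT (e_ g_ : nat -> T -> R) g h (C : R) :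
  (forall n, Rint (e_ n)) -> (forall n x, D x -> 0 <= e_ n x) ->
  \int[mu]_(x in D) e_ n x @[n --> \oo] --> 0 ->
  (forall n, measurable_fun D (g_ n)) -> measurable_fun D g -> Rint h -> 0 <= C ->
  (forall n, {ae mu, forall x, D x -> `|g_ n x| <= h x + C * e_ n x}) ->
  {ae mu, forall x, D x -> forall psi : nat -> nat, (forall k, (k <= psi k)%N) ->
     e_ (psi k) x @[k --> \oo] --> 0 -> g_ (psi k) x @[k --> \oo] --> g x} ->
  \int[mu]_(x in D) g_ n x @[n --> \oo] --> \int[mu]_(x in D) g x.
Proof.
move=> ei e0 ecv mg_ mg ih C0 dom pt; have mD := Rint_dom ih; apply: contrapT => /cvgrPdist_lt/existsNP[eps].
move=> /not_implyP[eps0 nearN].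
have /choice[psi psiP] k : exists n, (k <= n)%N /\
    eps <= `|\int[mu]_(x in D) g x - \int[mu]_(x in D) g_ n x|.
  apply: contrapT => H; apply: nearN; exists k => //= n kn.
  by rewrite ltNge; apply/negP => ?; apply: H; exists n.
have psig k : (k <= psi k)%N by case: (psiP k).
have ecv' : \int[mu]_(x in D) e_ (psi n) x @[n --> \oo] --> 0.
  apply: (@cvg_comp _ _ _ psi (fun n => \int[mu]_(x in D) e_ n x) \oo \oo) => //.
  move=> A [N _ NA]; exists N => // n /= Nn; apply: NA => /=.
  exact: leq_trans (psig n).
have [phi [phik ephi [h' ih' eh']]] := Rint_fast_subseq (fun n => ei (psi n)) (fun n => e0 (psi n)) ecv'.
have pp k : (k <= psi (phi k))%N by exact: leq_trans (psig _).
have cvg_ae : {ae mu, forall x, D x -> g_ (psi (phi k)) x @[k --> \oo] --> g x}.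
  by apply: filterS2 ephi pt => x ephi pt Dx; apply: (pt Dx _ pp); exact: ephi.
have dom_ae : {ae mu, forall x, D x -> forall n,
    `|g_ (psi (phi n)) x| <= h x + C * h' x}.
  have dom' : {ae mu, forall x, forall n, D x -> `|g_ n x| <= h x + C * e_ n x}.
    by apply: ae_foralln => n; exact: dom.
  apply: filterS2 eh' dom' => x eh' dom' Dx n; apply: le_trans (dom' _ Dx) _.
  by rewrite lerD2l ler_wpM2l// eh'.
have [_ _] := Rint_DCT (fun n => mg_ (psi (phi n))) mg cvg_ae (RintD ih (RintZ C ih')) dom_ae.
move=> /cvgrPdist_lt/(_ _ eps0)[N _ /(_ _ (leqnn N))] /=.
by rewrite ltNge => /negP; apply; case: (psiP (phi N)).
Qed.

End Rint_theory.

(** * Lebesgue measure on R^d: translations, balls and continuity of translations in L^1 *)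

Section translation.
Context (R : realType).

Lemma lebesgue_measure_translate (a : R) (A : set R) : measurable A ->
  lebesgue_measure ((fun x => x + a) @^-1` A) = lebesgue_measure A.
Proof.
have mD : measurable_fun [set: measurableTypeR R] (fun x : measurableTypeR R => (x + a : measurableTypeR R)).
  exact: measurable_funD.
move=> mA; apply/esym.
have := @lebesgue_measure_unique R
  (measure_function_pushforward__canonical__measure_function_Measure lebesgue_measure mD).
apply => // X [[x y] _ <-].
rewrite /= /pushforward (_ : _ @^-1` _ = `]x - a, y - a]%classic); last first.
  by apply/seteqP; split => t /=; rewrite !in_itv/= ltrBlDr lerBrDr.
rewrite !lebesgue_measure_itv/= !lte_fin ltrD2r; case: ifPn => // xy.
by rewrite !EFinD; congr (_%:E); ring.
Qed.

Lemma ge0_integral_translate1 (f : R -> \bar R) (a : R) :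
  measurable_fun setT f -> (forall x, 0 <= f x)%E ->
  (\int[lebesgue_measure]_x f (x + a)%R = \int[lebesgue_measure]_x f x)%E.
Proof.
have mD : measurable_fun [set: measurableTypeR R] (fun x : measurableTypeR R => (x + a : measurableTypeR R)).
  exact: measurable_funD.
move=> mf f0.
have := @ge0_integral_pushforward _ _ _ _ R _ mD lebesgue_measure setT f measurableT mf (fun x _ => f0 x).
rewrite preimage_setT => <-.
apply: eq_measure_integral => A mA _; exact: lebesgue_measure_translate.
Qed.

Lemma row_consD n (s : R) (y : 'rV[R]_n) (a : 'rV[R]_n.+1) :
  row_cons (s, y) + a = row_cons (s + (row_uncons a).1, y + (row_uncons a).2).
Proof.
apply/rowP => i; rewrite !mxE; case: unliftP => [j ->|->] //=; by rewrite !mxE.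
Qed.

Lemma ge0_integral_lebesgue_rVS n (f : 'rV[R]_n.+1 -> \bar R) :
  measurable_fun setT f -> (forall x, 0 <= f x)%E ->
  (\int[lebesgue_rV R n.+1]_x f x =
   \int[lebesgue_measure]_s \int[lebesgue_rV R n]_y f (row_cons (s, y)))%E.
Proof.
move=> mf f0.
transitivity (\int[pushforward (@lebesgue_measure R \x lebesgue_rV R n) (@row_cons R n)]_x f x)%E => //.
rewrite ge0_integral_pushforward//; last exact: measurable_row_cons.
rewrite preimage_setT fubini_tonelli1//=.
exact: measurableT_comp mf (@measurable_row_cons R n).
Qed.

Lemma measurable_addrV n (a : 'rV[R]_n) : measurable_fun setT (fun x : 'rV[R]_n => x + a).
Proof.
apply: measurable_to_rV => i; under eq_fun do rewrite mxE.
by apply: measurable_funD => //; exact: measurable_coord.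
Qed.

(** Induction on the dimension: Tonelli splits off the first coordinate, and by [row_consD] the
    translation acts on the two factors separately. *)
Lemma ge0_integral_translate n (f : 'rV[R]_n -> \bar R) (a : 'rV[R]_n) :
  measurable_fun setT f -> (forall x, 0 <= f x)%E ->
  (\int[lebesgue_rV R n]_x f (x + a)%R = \int[lebesgue_rV R n]_x f x)%E.
Proof.
elim: n f a => [|n IH] f a mf f0.
  by apply: eq_integral => x _; congr f; apply/rowP => -[].
have mfa : measurable_fun setT (fun x : 'rV[R]_n.+1 => f (x + a)).
  exact: measurableT_comp mf (measurable_addrV a).
rewrite (ge0_integral_lebesgue_rVS mf f0) (ge0_integral_lebesgue_rVS mfa (fun x => f0 _)).
have mfc : measurable_fun setT (fun p : R * 'rV[R]_n => f (row_cons p)).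
  exact: measurableT_comp mf (@measurable_row_cons R n).
under eq_integral => s _.
  under eq_integral do rewrite row_consD.
  rewrite (IH (fun y => f (row_cons (s + (row_uncons a).1, y)))); first last.
  - by [].
  - exact: (measurableT_comp mfc (measurable_pair1 _)).
  over.
rewrite (ge0_integral_translate1 (f := fun s => \int[lebesgue_rV R n]_y f (row_cons (s, y)))%E) //.
- exact: (measurable_fun_fubini_tonelli_F (fun p => f (row_cons p))).
- by move=> s; apply: integral_ge0.
Qed.

End translation.

Section rV.
Context (R : realType) (d : nat).
Local Notation leb := (lebesgue_rV R d).
Local Notation V := 'rV[R]_d.

Lemma rV_normP (x : V) (r : R) : 0 <= r -> (`|x| <= r) <-> (forall i, `|x 0 i| <= r).
Proof.
move=> r0; have -> : `|x| = mx_norm x by [].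
rewrite mx_normrE; split => [/bigmax_leP[_ H] i|H].
  exact: (H (0, i)).
by apply/bigmax_leP; split => // -[i j] _ /=; rewrite ord1.
Qed.

Lemma rV_coord_le (x : V) i : `|x 0 i| <= `|x|.
Proof. exact: (rV_normP x (normr_ge0 x)).1. Qed.

Lemma continuous_measurable_rV (f : V -> R) : continuous f -> measurable_fun setT f.
Proof.
move=> cf; apply: (measurability _ (RGenOpens.measurableE R)).
move=> _ [_ [a [b ->]] <-]; rewrite setTI; apply: sub_sigma_algebra.
by move/continuousP: cf; apply; exact: itv_open.
Qed.

Lemma open_measurable_rV (A : set V) : open A -> measurable A.
Proof. exact: sub_sigma_algebra. Qed.

Lemma leb_ball_lty (r : R) : (leb [set x : V | (`|x| <= r)%R] < +oo)%E.
Proof.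
have [r0|r0] := ltP r 0.
  rewrite (_ : [set _ | _] = set0) ?measure0//; apply/seteqP; split => // x /= xr.
  by have := le_trans (normr_ge0 x) xr; rewrite leNgt r0.
have -> : [set x : V | `|x| <= r] = [set x | forall i, [set t : R | `|t| <= r] (x 0 i)].
  by apply/seteqP; split => x /= /(rV_normP _ r0).
have -> : [set t : R | `|t| <= r] = `[-r, r]%classic.
  by apply/seteqP; split => t /=; rewrite in_itv/= ler_norml.
rewrite (@lebesgue_rV_box R d (fun=> `[-r, r]%classic))// big_const.
elim: #|_| => [|k IH] /=; first by rewrite ltry.
by rewrite lte_mul_pinfty// lebesgue_measure_itv/=; case: ifP => //; rewrite ltry.
Qed.

Lemma closed_ball_measurable (r : R) : measurable [set x : V | `|x| <= r].
Proof.
have := @continuous_measurable_rV (fun x => `|x|) (@norm_continuous _ _).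
move=> /(_ measurableT `]-oo, r]%classic (measurable_itv _)); rewrite setTI.
by congr measurable; apply/seteqP; split => x /=; rewrite in_itv.
Qed.

Lemma Rint_bounded_support (f : V -> R) (r C : R) : measurable_fun setT f ->
  (forall x, `|f x| <= C) -> (forall x, r < `|x| -> f x = 0) -> Rint leb setT f.
Proof.
move=> mf fC fr.
have mB := closed_ball_measurable r.
apply: (@Rint_le _ _ _ _ _ f (fun x => C * \1_[set x : V | `|x| <= r] x)) => //.
  by apply: RintZ; apply: Rint_indic => //; exact: leb_ball_lty.
move=> x _; rewrite indicE; case: (boolP (x \in _)) => xr; first by rewrite mulr1.
by rewrite mulr0 fr ?normr0//; move: xr; rewrite notin_setE /= => /negP; rewrite -ltNge.
Qed.

Lemma cball_compact (r : R) : compact [set x : V | `|x| <= r].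
Proof.
apply: bounded_closed_compact.
  by exists r; split; [exact: num_real|move=> M rM x /= /le_trans; apply; exact: ltW].
rewrite (_ : [set _ | _] = (fun x => `|x|) @^-1` [set t | t <= r])//.
by apply: closed_comp => [x _|]; [exact: norm_continuous|exact: closed_le].
Qed.

Lemma continuous_bounded_support (f : V -> R) (r : R) : continuous f ->
  (forall x, r < `|x| -> f x = 0) -> exists2 C, 0 < C & forall x, `|f x| <= C.
Proof.
move=> cf fr.
have /compact_bounded[M [_ HM]] : compact (f @` [set x : V | `|x| <= r]).
  by apply: continuous_compact; [exact: continuous_subspaceT|exact: cball_compact].
exists (`|M| + 1) => [|x]; first by rewrite ltr_wpDl.
have [xr|xr] := leP `|x| r; last by rewrite fr// normr0 addr_ge0.
by apply: HM; [rewrite (le_lt_trans (ler_norm M))// ltrDl|exists x].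
Qed.

Lemma continuous_bounded_on_ball (f : V -> R) (r : R) : continuous f ->
  exists2 C, 0 < C & forall x, `|x| <= r -> `|f x| <= C.
Proof.
move=> cf.
have /compact_bounded[M [_ HM]] : compact (f @` [set x : V | `|x| <= r]).
  by apply: continuous_compact; [exact: continuous_subspaceT|exact: cball_compact].
exists (`|M| + 1) => [|x xr]; first by rewrite ltr_wpDl.
by apply: HM; [rewrite (le_lt_trans (ler_norm M))// ltrDl|exists x].
Qed.

Lemma Rint_Cc (f : V -> R) (r : R) : continuous f ->
  (forall x, r < `|x| -> f x = 0) -> Rint leb setT f.
Proof.
move=> cf fr; have [C _ fC] := continuous_bounded_support cf fr.
exact: Rint_bounded_support (continuous_measurable_rV cf) fC fr.
Qed.

Lemma Rint_translate (f : V -> R) (a : V) : Rint leb setT f ->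
  Rint leb setT (fun x => f (x + a)).
Proof.
move=> fi; have mf := Rint_meas fi; apply: RintP => //.
  exact: measurableT_comp mf (measurable_addrV a).
rewrite (ge0_integral_translate (f := fun x => `|f x|%:E))//; first exact: Rint_lty fi.
by apply/measurable_EFinP; exact: measurableT_comp.
Qed.

Lemma Rintegral_translate (f : V -> R) (a : V) : Rint leb setT f ->
  \int[leb]_x f (x + a) = \int[leb]_x f x.
Proof.
move=> fi; have mf := Rint_meas fi.
have fp : Rint leb setT (fun x => Num.max (f x) 0).
  apply: (Rint_le _ (Rint_abs fi)).
    by apply: measurable_maxr.
  by move=> x _; rewrite ger0_norm ?le_max ?lexx ?orbT// ge_max ler_norm normr_ge0.
have fm : Rint leb setT (fun x => Num.max (- f x) 0).
  apply: (Rint_le _ (Rint_abs fi)).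
    by apply: measurable_maxr => //; exact: measurableT_comp.
  by move=> x _; rewrite ger0_norm ?le_max ?lexx ?orbT// ge_max normr_ge0 -normrN ler_norm.
have E (x : V) : f x = Num.max (f x) 0 - Num.max (- f x) 0.
  have [h|/ltW h] := leP 0 (f x).
    have /max_idPr -> : - f x <= 0 by rewrite oppr_le0.
    by rewrite subr0.
  have /max_idPl -> : 0 <= - f x by rewrite oppr_ge0.
  by rewrite sub0r opprK.
have T (g : V -> R) : Rint leb setT g -> (forall x, 0 <= g x) ->
    \int[leb]_x g (x + a) = \int[leb]_x g x.
  move=> gi g0; congr fine; rewrite (ge0_integral_translate (f := fun x => (g x)%:E))//.
  by apply/measurable_EFinP; exact: Rint_meas gi.
under eq_Rintegral do rewrite E.
under [RHS]eq_Rintegral do rewrite E.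
rewrite !RIntB//; last 2 first.
- exact: Rint_translate fp.
- exact: Rint_translate fm.
congr (_ - _); [apply: (T _ fp)|apply: (T _ fm)] => x; by rewrite le_max lexx orbT.
Qed.


(** A predicate rather than a theorem at first, because it is carried from open sets to all
    integrable functions by its closure under linear combinations and L^1 limits. *)
Definition L1tcont (f : V -> R) : Prop := Rint leb setT f /\
  forall w : nat -> V, w n @[n --> \oo] --> (0 : V) ->
    \int[leb]_x `|f (x + w n) - f x| @[n --> \oo] --> 0.

Lemma Rint_tdiff (f : V -> R) (a : V) : Rint leb setT f ->
  Rint leb setT (fun x => `|f (x + a) - f x|).
Proof. by move=> fi; apply: Rint_abs; apply: RintB => //; exact: Rint_translate. Qed.

Lemma L1tcontB f g : L1tcont f -> L1tcont g -> L1tcont (fun x => f x - g x).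
Proof.
move=> [fi fc] [gi gc]; split => [|w w0]; first exact: RintB.
apply: (@squeeze_cvgr _ _ _ _ (fun=> 0) (fun n => \int[leb]_x `|f (x + w n) - f x| + \int[leb]_x `|g (x + w n) - g x|)).
- apply: nearW => n; rewrite Rintegral_ge0//=; rewrite -RIntD; last 2 first.
    exact: Rint_tdiff.
    exact: Rint_tdiff.
  apply: le_RInt.
  + by apply: (Rint_tdiff (f := fun x => f x - g x)); exact: RintB.
  + by apply: RintD; exact: Rint_tdiff.
  move=> x _; rewrite (_ : _ - _ - _ = (f (x + w n) - f x) - (g (x + w n) - g x)); last by ring.
  exact: ler_normB.
- exact: cvg_cst.
by rewrite -[X in _ --> X]addr0; apply: cvgD; [exact: fc|exact: gc].
Qed.

Lemma L1tcontZ k f : L1tcont f -> L1tcont (fun x => k * f x).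
Proof.
move=> [fi fc]; split => [|w w0]; first exact: RintZ.
have E n : \int[leb]_x `|k * f (x + w n) - k * f x| = `|k| * \int[leb]_x `|f (x + w n) - f x|.
  by under eq_Rintegral => x _ do rewrite -mulrBr normrM; rewrite RIntZ//; exact: Rint_tdiff.
rewrite (_ : (fun n => _) = (fun n => `|k| * \int[leb]_x `|f (x + w n) - f x|)); last exact/funext.
rewrite -[X in _ --> X](mulr0 `|k|); apply: cvgM; [exact: cvg_cst|exact: fc].
Qed.

Lemma L1tcont0 : L1tcont (fun=> 0).
Proof.
split => [|w w0]; first exact: Rint0.
under eq_cvg => n do (under eq_Rintegral => x _ do rewrite subrr normr0; rewrite Rintegral_cst// mul0r).
exact: cvg_cst.
Qed.

Lemma L1tcontD f g : L1tcont f -> L1tcont g -> L1tcont (fun x => f x + g x).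
Proof.
move=> fc gc; have := L1tcontB fc (L1tcontZ (-1) gc).
by congr L1tcont; apply/funext => x; rewrite mulN1r opprK.
Qed.

Lemma L1tcont_sum (I : Type) (s : seq I) (F : I -> V -> R) :
  (forall i, L1tcont (F i)) -> L1tcont (fun x => \sum_(i <- s) F i x).
Proof.
move=> cF; elim: s => [|i s IH].
  by under [X in L1tcont X]eq_fun do rewrite big_nil; exact: L1tcont0.
by under [X in L1tcont X]eq_fun do rewrite big_cons; exact: L1tcontD.
Qed.

Lemma L1tcont_lim f (g : nat -> V -> R) : Rint leb setT f -> (forall n, L1tcont (g n)) ->
  \int[leb]_x `|f x - g n x| @[n --> \oo] --> 0 -> L1tcont f.
Proof.
move=> fi gc fg; split => // w w0; apply/cvgr0Pnorm_le => e e0.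
have e30 : 0 < e / 3 by rewrite divr_gt0.
have /cvgr0Pnorm_le/(_ _ e30)[N _ /(_ N (leqnn N)) /= HN] := fg.
have [gi /(_ _ w0)/cvgr0Pnorm_le/(_ _ e30)[M _ HM]] := gc N.
exists M => // n /= Mn; rewrite ger0_norm ?Rintegral_ge0//.
have fgi : Rint leb setT (fun x => `|f x - g N x|) by apply: Rint_abs; exact: RintB.
have fgti := Rint_translate (w n) fgi.
have gti := Rint_tdiff (w n) gi.
apply: (@le_trans _ _ (\int[leb]_x ((`|f (x + w n) - g N (x + w n)| + `|g N (x + w n) - g N x|) + `|f x - g N x|))).
  apply: le_RInt; first exact: Rint_tdiff.
    by apply: RintD => //; exact: RintD.
  move=> x _; rewrite [X in _ <= _ + X]distrC.
  rewrite (_ : f (x + w n) - f x = ((f (x + w n) - g N (x + w n)) + (g N (x + w n) - g N x)) + (g N x - f x)); last by ring.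
  by rewrite (le_trans (ler_normD _ _))// lerD2r ler_normD.
rewrite !RIntD//; last exact: RintD.
rewrite (Rintegral_translate (w n) fgi).
have := HM n Mn; have := HN; rewrite !ger0_norm ?Rintegral_ge0// => h1 h2.
lra.
Qed.

(** Scheffé's argument. Openness controls only the points that leave [O]: the positive part [h]
    tends to zero pointwise and is dominated by the indicator of [O]. An indicator and its translate
    have the same integral, so the absolute difference integrates to twice the integral of [h]. *)
Lemma L1tcont_open (O : set V) : open O -> (leb O < +oo)%E -> L1tcont (\1_O : V -> R).
Proof.
move=> oO Ooo; have mO := open_measurable_rV oO.
have iO : Rint leb setT (\1_O : V -> R) by exact: Rint_indic.
split => // w w0.
have itr n := Rint_translate (w n) iO.
pose h n x : R := Num.max (\1_O x - \1_O (x + w n)) 0.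
have mh n : measurable_fun setT (h n).
  by rewrite /h; apply: measurable_maxr => //; apply: (@Rint_meas _ _ _ leb); exact: RintB.
have ih0 x n : `|h n x| <= \1_O x.
  by rewrite /h !indicE; do 2 case: (_ \in _); rewrite /= ?subrr ?subr0 ?maxxx ?normr0 ?sub0r//;
   rewrite ?(max_idPl ler01) ?(max_idPr (_ : -1 <= 0 :> R)) ?normr1 ?normr0 ?oppr_le0.
have [_ hi hcv] : [/\ Rint leb setT (fun=> 0 : R), forall n, Rint leb setT (h n) &
    \int[leb]_x h n x @[n --> \oo] --> \int[leb]_x (0 : R)].
  apply: (Rint_DCT mh _ _ iO) => //; last by apply: aeW => x _ n; exact: ih0.
  apply: aeW => x _; have [xO|xO] := pselect (O x).
    have : \forall n \near \oo, O (x + w n).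
      have cv : x + w n @[n --> \oo] --> x by rewrite -[X in _ --> X]addr0; apply: cvgD => //; exact: cvg_cst.
      by apply: cv; exact: open_nbhs_nbhs.
    move=> H; apply: (cvg_trans (G := (fun=> 0 : R) @ \oo)); last exact: cvg_cst.
    apply: near_eq_cvg; apply: filterS H => n On.
    by rewrite /h !indicE !mem_set// subrr maxxx.
  rewrite (_ : (fun n => h n x) = fun=> 0); first exact: cvg_cst.
  apply/funext => n; rewrite /h [\1_O x]indicE memNset// sub0r; apply/max_idPr.
  by rewrite oppr_le0.
have : 2 * \int[leb]_x h n x @[n --> \oo] --> (2 * 0 : R).
  by apply: cvgM; [exact: cvg_cst|move: hcv; rewrite Rintegral_cst// mul0r].
rewrite mulr0; apply: cvg_trans; apply: near_eq_cvg; apply: nearW => n.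
have E (x : V) : `|\1_O (x + w n) - \1_O x| = (\1_O (x + w n) - \1_O x) + 2 * h n x :> R.
  rewrite /h; have [h0|h0] := leP (\1_O x - \1_O (x + w n)) 0.
    by rewrite mulr0 addr0 ger0_norm// -oppr_le0 opprB.
  rewrite ltr0_norm -?oppr_gt0 ?opprB//; ring.
under [RHS]eq_Rintegral do rewrite E.
rewrite RIntD; [|exact: RintB|exact: RintZ].
by rewrite RIntB// (Rintegral_translate _ iO) subrr add0r RIntZ.
Qed.

Let U k := [set x : V | `|x| < k%:R].

Let openU k : open (U k).
Proof.
rewrite (_ : U k = (fun x => `|x|) @^-1` [set t | t < k%:R])//.
by apply: open_comp => [x _|]; [exact: norm_continuous|exact: open_lt].
Qed.

Let finU k (A : set V) : measurable A -> (leb (A `&` U k) < +oo)%E.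
Proof.
move=> mA; have mU := open_measurable_rV (@openU k).
apply: le_lt_trans (leb_ball_lty k%:R); apply: le_measure; rewrite ?inE //.
- exact: measurableI.
- exact: closed_ball_measurable.
by move=> x [_ /ltW].
Qed.

(** Dynkin system argument from the open sets. Intersecting with the balls [U k] keeps all measures
    finite, so that proper differences of sets become differences of integrable indicators and
    increasing unions become L^1 limits. *)
Let L1tcont_boxed (A : set V) : measurable A ->
  forall k, L1tcont (\1_(A `&` U k) : V -> R).
Proof.
pose H := [set A : set V | measurable A /\ forall k, L1tcont (\1_(A `&` U k) : V -> R)].
have mU k := open_measurable_rV (@openU k).
suff : @measurable _ V `<=` H by move=> h /h[].
apply: (@lambda_system_subset _ (@open V)).
- exact: openI.
- split => //.
  + split => // k; rewrite setTI; apply: L1tcont_open => //.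
    by rewrite -[U k]setTI; exact: finU.
  + move=> A1 B BA [mA1 cA] [mB cB]; split; first exact: measurableD.
    move=> k; have := L1tcontB (cA k) (cB k); congr L1tcont; apply/funext => x.
    rewrite !indicE; have [xU|xU] := pselect (U k x); last first.
      by rewrite !memNset ?subrr// => -[].
    have [xB|xB] := pselect (B x).
      rewrite (mem_set (conj (BA _ xB) xU : (A1 `&` U k) x)).
      by rewrite (mem_set (conj xB xU : (B `&` U k) x)) memNset ?subrr// => -[[]].
    rewrite [x \in B `&` _]memNset ?subr0; last by case.
    by congr (nat_of_bool _)%:R; apply/idP/idP; rewrite !inE => -[]; [|case].
  + move=> F ndF HF; split; first by apply: bigcup_measurable => n _; case: (HF n).
    move=> k; have mF : measurable (\bigcup_n F n) by apply: bigcup_measurable => n _; case: (HF n).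
    have iF : Rint leb setT (\1_(\bigcup_n F n `&` U k) : V -> R).
      by apply: Rint_indic => //; [exact: measurableI|exact: finU].
    apply: (L1tcont_lim iF (fun n => (HF n).2 k)).
    have iFn n : Rint leb setT (\1_(F n `&` U k) : V -> R) by case: ((HF n).2 k).
    have := @Rint_DCT _ _ R leb setT (fun n x => `|\1_(\bigcup_n F n `&` U k) x - \1_(F n `&` U k) x|) (fun=> 0) _ _ _ _ iF.
    case => //.
    * by move=> n; apply: (@Rint_meas _ _ _ leb); apply: Rint_abs; exact: RintB.
    * apply: aeW => x _; have [xF|xF] := pselect ((\bigcup_n F n `&` U k) x).
        have [[N _ FN] xk] := xF.
        apply: (cvg_trans (G := (fun=> 0 : R) @ \oo)); last exact: cvg_cst.
        apply: near_eq_cvg; exists N => // n /= Nn.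
        rewrite !indicE !mem_set// ?subrr ?normr0//; split => //.
        by move/ndF : Nn => /subsetPset; apply.
      rewrite (_ : (fun n => _) = fun=> 0); first exact: cvg_cst.
      apply/funext => n; rewrite !indicE (memNset xF) memNset ?subrr ?normr0//.
      by move=> [Fx Ux]; apply: xF; split => //; exists n.
    * apply: aeW => x _ n; rewrite normr_id !indicE.
      have [xF|xF] := boolP (x \in F n `&` U k).
        rewrite mem_set ?subrr ?normr0//; move: xF; rewrite inE => -[Fx Ux]; split => //; by exists n.
      by rewrite subr0 ger0_norm.
    by rewrite Rintegral_cst// mul0r.
- move=> O oO; split; first exact: open_measurable_rV.
  move=> k; apply: L1tcont_open; first exact: openI.
  by apply: finU; exact: open_measurable_rV.
- by [].
Qed.

Import HBSimple.

(** The cut-off to balls precedes the approximation by simple functions, since level sets are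
    available only in the boxed form of [L1tcont_boxed]. *)
Lemma L1_translation_continuous (f : V -> R) : Rint leb setT f -> L1tcont f.
Proof.
move=> fi; have mU k := open_measurable_rV (@openU k).
suff H k : L1tcont (fun x => \1_(U k) x * f x).
  apply: (L1tcont_lim fi H).
  have mf k : measurable_fun setT (fun x => `|f x - \1_(U k) x * f x|).
    apply: measurableT_comp => //; apply: measurable_funB; first exact: Rint_meas fi.
    by apply: measurable_funM; [exact: measurable_indic|exact: Rint_meas fi].
  have := @Rint_DCT _ _ R leb setT _ (fun=> 0) _ mf _ _ (Rint_abs fi).
  case => //; last by move=> _ _; rewrite Rintegral_cst// mul0r.
    apply: aeW => x _.
    apply: (cvg_trans (G := (fun=> 0 : R) @ \oo)); last exact: cvg_cst.
    apply: near_eq_cvg; exists (Num.truncn `|x|).+1 => // n /= Nn.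
    rewrite indicE mem_set ?mul1r ?subrr ?normr0//.
    rewrite /U/= (lt_le_trans (truncnS_gt _))// ler_nat//.
  apply: aeW => x _ n; rewrite normr_id indicE; case: (_ \in _); rewrite ?mul1r ?subrr ?normr0//.
  by rewrite mul0r subr0.
have fUi : Rint leb setT (fun x => \1_(U k) x * f x).
  apply: (RintMb (C := 1) fi); first exact: measurable_indic.
  by move=> x _; rewrite indicE; case: (_ \in _); rewrite ?normr1 ?normr0.
have [g [gi _ gcv]] := approximation_sfun_integrable measurableT (Rint_int fi).
apply: (L1tcont_lim (g := fun n x => \1_(U k) x * g n x) fUi).
  move=> n; rewrite (_ : (fun x => _) = fun x => \sum_(y <- finmap.enum_fset (fset_set (range (g n)))) y * \1_(g n @^-1` [set y] `&` U k) x).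
    apply: L1tcont_sum => y; apply: L1tcontZ; apply: L1tcont_boxed.
    exact: measurable_sfunP.
  apply/funext => x; rewrite {1}(fimfunE (g n) x) fsbig_finite//=.
  rewrite big_distrr/=; apply: eq_bigr => y _.
  by rewrite mulrCA indicI /=; congr (_ * _); rewrite mulrC.
have gcv' : \int[leb]_x `|f x - g n x| @[n --> \oo] --> 0.
  apply: fine_cvg; exact: gcv.
apply: (@squeeze_cvgr _ _ _ _ (fun=> 0) (fun n => \int[leb]_x `|f x - g n x|)) => //; last exact: cvg_cst.
have gi' n : Rint leb setT (g n) by split => //; exact: gi.
apply: nearW => n; rewrite Rintegral_ge0//=; apply: le_RInt.
- apply: Rint_abs; apply: RintB => //; apply: (RintMb (C := 1) (gi' n)); first exact: measurable_indic.
  by move=> x _; rewrite indicE; case: (_ \in _); rewrite ?normr1 ?normr0.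
- by apply: Rint_abs; exact: RintB.
move=> x _; rewrite -mulrBr normrM ler_piMl// indicE; case: (_ \in _); rewrite ?normr1 ?normr0//.
Qed.

Lemma L1_translation_eps (f : V -> R) (e : R) : Rint leb setT f -> 0 < e ->
  exists2 r, 0 < r & forall w, `|w| <= r -> \int[leb]_x `|f (x + w) - f x| <= e.
Proof.
move=> fi e0; apply: contrapT => H.
have /choice[w wP] n : exists w : V, `|w| <= n.+1%:R^-1 /\ e < \int[leb]_x `|f (x + w) - f x|.
  apply: contrapT => K; apply: H; exists n.+1%:R^-1; first by rewrite invr_gt0.
  by move=> w wn; rewrite leNgt; apply/negP => ?; apply: K; exists w.
have w0 : w n @[n --> \oo] --> (0 : V).
  apply: norm_cvg0; apply: (@squeeze_cvgr _ _ _ _ (fun=> 0) (fun n => n.+1%:R^-1)).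
  - by apply: nearW => n; rewrite normr_ge0; case: (wP n).
  - exact: cvg_cst.
  exact: cvg_harmonic.
have [_ /(_ _ w0)/cvgr0Pnorm_le/(_ _ e0)[N _ /(_ N (leqnn N))]] := L1_translation_continuous fi.
rewrite /= ger0_norm ?Rintegral_ge0// leNgt => /negP; apply; by case: (wP N).
Qed.

End rV.

Section weight.
Context (R : realType).

Lemma expR_sqr_lty :
  (\int[@lebesgue_measure R]_x (normal_pdf 0 1 x)%:E < +oo)%E.
Proof. by rewrite integral_normal_pdf ltry. Qed.

(* An integrable positive weight with Gaussian decay, by induction on the
   dimension through Fubini. *)
Lemma gaussian_weight n : exists w : 'rV[R]_n -> R,
  [/\ measurable_fun setT w, forall x, 0 < w x,
      (\int[lebesgue_rV R n]_x (w x)%:E < +oo)%E &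
      exists C : R, forall x, - ln (w x) <= C + edot x x].
Proof.
elim: n => [|n [w [mw w0 wi [C wC]]]].
  exists (fun=> 1); split => //.
    by rewrite integral_cst//= diracT mule1 ltry.
  by exists 0 => x; rewrite ln1 oppr0 add0r /edot big_ord0.
pose g := @normal_pdf R 0 1.
have g0 x : 0 < g x.
  rewrite /g normal_pdfE// mulr_gt0//; first by rewrite normal_peak_gt0.
  exact: expR_gt0.
have mg : measurable_fun setT g by exact: measurable_normal_pdf.
have mrow : measurable_fun setT (fun x : 'rV[R]_n.+1 => g (row_uncons x).1 * w (row_uncons x).2).
  apply: measurable_funM.
    apply: (measurableT_comp mg).
    exact: (measurableT_comp measurable_fst (@measurable_row_uncons R n)).
  apply: (measurableT_comp mw).
  exact: (measurableT_comp measurable_snd (@measurable_row_uncons R n)).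
exists (fun x => g (row_uncons x).1 * w (row_uncons x).2); split => //.
- by move=> x; rewrite mulr_gt0.
- rewrite (ge0_integral_lebesgue_rVS (f := fun x => (g (row_uncons x).1 * w (row_uncons x).2)%:E)).
  + under eq_integral => s _.
      under eq_integral => y _ do rewrite row_uncons_consK /= EFinM.
      rewrite ge0_integralZl//; first over.
      * exact/measurable_EFinP.
      * by move=> y _; rewrite lee_fin ltW.
      * by rewrite lee_fin ltW.
    rewrite ge0_integralZr//.
    * by rewrite lte_mul_pinfty// ?expR_sqr_lty// ?ge0_fin_numE ?expR_sqr_lty//; apply: integral_ge0 => x _; rewrite lee_fin ltW.
    * exact/measurable_EFinP.
    * by move=> x _; rewrite lee_fin ltW.
    * by apply: integral_ge0 => x _; rewrite lee_fin ltW.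
  + exact/measurable_EFinP.
  + by move=> x; rewrite lee_fin ltW// mulr_gt0.
exists (C - ln (normal_peak 1)) => x.
rewrite lnM ?posrE// opprD.
have := wC (row_uncons x).2; rewrite /edot big_ord_recl /=.
under eq_bigr do rewrite !mxE.
move=> h.
have : - ln (g (x 0 ord0)) <= - ln (normal_peak 1) + x 0 ord0 * x 0 ord0.
  rewrite /g normal_pdfE// lnM ?posrE ?normal_peak_gt0 ?expR_gt0//.
  rewrite opprD lerD2l /normal_fun expRK -mulNr opprK subr0 expr1n -expr2.
  by rewrite ler_pdivrMr// ler_peMr ?sqr_ge0// ler1n.
lra.
Qed.

End weight.

(** * Smooth functions and mollifiers *)

Section Ck_algebra.
Context (R : realType) (V : normedModType R).
Implicit Types f g : V -> R.

Lemma Ck_continuous n f : Ck n f -> continuous f.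
Proof. by case: n => [|n] []. Qed.

Lemma CkW n f : Ck n.+1 f -> Ck n f.
Proof.
elim: n f => [|n IH] f [cf H]; first by split.
by split=> // v; have [df kf] := H v; split=> //; exact: IH.
Qed.

Lemma Ck_cst n (c : R) : Ck n (fun _ : V => c).
Proof.
elim: n c => [|n IH] c; split => //; try by move=> x; exact: cst_continuous.
move=> v; split=> [x|]; first exact: derivable_cst.
by under [X in Ck _ X]eq_fun do rewrite derive_cst; exact: IH.
Qed.

Lemma CkD n f g : Ck n f -> Ck n g -> Ck n (fun x => f x + g x).
Proof.
elim: n f g => [|n IH] f g [cf Hf] [cg Hg].
  by split => // x; apply: cvgD; [exact: cf|exact: cg].
split=> [x|v]; first by apply: cvgD; [exact: cf|exact: cg].
have [df kf] := Hf v; have [dg kg] := Hg v.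
split=> [x|]; first exact: derivableD.
by under [X in Ck _ X]eq_fun do rewrite deriveD//; exact: IH.
Qed.

Lemma CkM n f g : Ck n f -> Ck n g -> Ck n (fun x => f x * g x).
Proof.
elim: n f g => [|n IH] f g Kf Kg; have cf := Ck_continuous Kf; have cg := Ck_continuous Kg.
  by split => // x; apply: cvgM; [exact: cf|exact: cg].
have fW := CkW Kf; have gW := CkW Kg; case: Kf Kg => _ Hf [_ Hg].
split=> [x|v]; first by apply: cvgM; [exact: cf|exact: cg].
have [df kf] := Hf v; have [dg kg] := Hg v.
split=> [x|]; first exact: derivableM.
by under [X in Ck _ X]eq_fun do rewrite deriveM//; apply: CkD; exact: IH.
Qed.

Lemma Ck_prod n (I : Type) (s : seq I) (F : I -> V -> R) :
  (forall i, Ck n (F i)) -> Ck n (fun x => \prod_(i <- s) F i x).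
Proof.
move=> KF; elim: s => [|i s IH].
  by under [X in Ck _ X]eq_fun do rewrite big_nil; exact: Ck_cst.
by under [X in Ck _ X]eq_fun do rewrite big_cons; exact: CkM.
Qed.

Lemma derive_translate f (a v x : V) : 'D_v (fun x => f (x - a)) x = 'D_v f (x - a).
Proof.
rewrite /derive (_ : (fun h => _) = (fun h : R => h^-1 *: ((f \o shift (x - a)) (h *: v) - f (x - a))))//.
by apply/funext => h /=; rewrite addrA.
Qed.

(* [l] affine: difference quotients of [g \o l] are difference quotients of [g]. *)
Lemma Ck_comp_affine (W : normedModType R) n (g : W -> R) (l : V -> W) (L : V -> W) :
  continuous l -> (forall (h : R) x v, l (h *: v + x) = h *: L v + l x) ->
  Ck n g -> Ck n (g \o l).
Proof.
move=> cl ll; elim: n g => [|n IH] g [cg Hg].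
  by split => // x; apply: continuous_comp; [exact: cl|exact: cg].
split=> [x|v]; first by apply: continuous_comp; [exact: cl|exact: cg].
have [dg kg] := Hg (L v).
have E x : (fun h : R => h^-1 *: (((g \o l) \o shift x) (h *: v) - (g \o l) x)) =
   (fun h : R => h^-1 *: ((g \o shift (l x)) (h *: L v) - g (l x))).
  by apply/funext => h /=; rewrite ll.
split=> [x|]; first by rewrite /derivable E; exact: dg.
rewrite (_ : (fun x => _) = (fun s => 'D_(L v) g s) \o l); first exact: IH.
by apply/funext => x; rewrite /derive E.
Qed.

Lemma Ck_translate n f (a : V) : Ck n f -> Ck n (fun x => f (x - a)).
Proof.
apply: (@Ck_comp_affine V n f (fun x => x - a) id) => [x|h x v]; last by rewrite addrA.
by apply: cvgB; [exact: cvg_id|exact: cvg_cst].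
Qed.

End Ck_algebra.

Section smooth_line.
Context (R : realType).

Lemma is_derive_dir (f : R -> R) (x a v : R) : is_derive x 1 f a -> is_derive x v f (v * a).
Proof.
move=> fa; have df : differentiable f x by apply/derivable1_diffP.
apply: DeriveDef; first exact: diff_derivable.
rewrite deriveE// -[v]mulr1 -[v * 1]/(v *: 1) linearZ/= -deriveE// derive_val.
by rewrite /GRing.scale /= mulr1.
Qed.

(** [Ck] asks for derivatives in every direction [v]; on the line these are [v] times the next term
    of the sequence, so closure under products suffices. *)
Lemma smooth_seq (h : nat -> R -> R) :
  (forall j (x : R), is_derive x 1 (h j) (h j.+1 x)) -> forall n j, Ck n (h j).
Proof.
move=> dh.
have ch j : continuous (h j).
  by move=> x; apply/differentiable_continuous/derivable1_diffP; case: (dh j x).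
elim=> [|n IH] j; split => // v.
have dv x := is_derive_dir v (dh j x).
split=> [x|]; first by case: (dv x).
under [X in Ck _ X]eq_fun do rewrite (@derive_val _ _ _ _ _ _ _ (dv _)).
by apply: CkM; [exact: Ck_cst|exact: IH].
Qed.

Definition flat (p : {poly R}) (x : R) : R :=
  if 0 < x then p.[x^-1] * expR (- x^-1) else 0.

Lemma pow_expRN_le (i : nat) (u : R) : 0 < u -> u ^+ i * expR (- u) <= (i.+1)`!%:R / u.
Proof.
move=> u0; rewrite expRN ler_pdivrMr ?expR_gt0// mulrAC ler_pdivlMr// -exprSr.
rewrite -ler_pdivrMl ?ltr0n ?fact_gt0// mulrC.
by apply: le_trans (expR_ge1Dxn i (ltW u0)); rewrite lerDr.
Qed.

(** The exponential beats every power of 1/x. A linear bound is enough: applied to ['X * p] it also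
    gives differentiability at 0. *)
Lemma flat_bound p : exists2 C, 0 <= C & forall x : R, `|flat p x| <= C * `|x|.
Proof.
exists (\sum_(i < size p) `|p`_i| * (i.+1)`!%:R); first by apply: sumr_ge0 => i _; exact: mulr_ge0.
move=> x; rewrite /flat; case: ifPn => [x0|_]; last first.
  by rewrite normr0 mulr_ge0//; apply: sumr_ge0 => i _; exact: mulr_ge0.
rewrite horner_coef mulr_suml (le_trans (ler_norm_sum _ _ _))// mulr_suml.
apply: ler_sum => i _; rewrite -!mulrA normrM ler_wpM2l//.
rewrite ger0_norm ?mulr_ge0 ?expR_ge0 ?exprn_ge0 ?invr_ge0 ?(ltW x0)//.
have := @pow_expRN_le i x^-1; rewrite invr_gt0 invrK => /(_ x0).
by rewrite (gtr0_norm x0).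
Qed.

Lemma flat_derive (p : {poly R}) (x : R) : is_derive x 1 (flat p) (flat ('X^2 * (p - p^`())) x).
Proof.
have [x0|x0|->] := ltgtP x 0.
- have -> : flat ('X^2 * (p - p^`())) x = 0 by rewrite /flat ltNge (ltW x0).
  apply: (@near_eq_is_derive _ _ _ (cst 0)).
  near=> y; rewrite /flat; case: ifPn => // y0; exfalso.
  have : y < 0 by near: y; exact: lt_nbhsl.
  by rewrite ltNge (ltW y0).
- rewrite {2}/flat x0.
  have xn0 : x != 0 by rewrite gt_eqF.
  have dinv : is_derive x 1 (fun y : R => y^-1) (- x ^- 2).
    by apply: is_derive_eq (is_deriveV xn0 (is_derive_id _ _)) _; rewrite scaleNr; congr (- _); exact: mulr1.
  have d1 : is_derive x 1 (horner p \o (fun y : R => y^-1)) (p^`().[x^-1] * - x ^- 2).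
    exact: (is_derive1_comp (is_derive_poly _ _)).
  have d2 : is_derive x 1 (expR \o (fun y : R => - y^-1)) (expR (- x^-1) * x ^- 2).
    have dn : is_derive x 1 (fun y : R => - y^-1) (x ^- 2).
      by apply: is_derive_eq (is_deriveN dinv) _; rewrite opprK.
    exact: (is_derive1_comp (is_derive_expR _)).
  have dd : is_derive x 1 (fun y : R => p.[y^-1] * expR (- y^-1))
      (('X^2 * (p - p^`())).[x^-1] * expR (- x^-1)).
    apply: is_derive_eq (is_deriveM d1 d2) _.
    by rewrite /= !hornerE /GRing.scale /=; field.
  apply: near_eq_is_derive dd.
  near=> y; rewrite /flat; case: ifPn => // /negP y0; exfalso; apply: y0.
  by near: y; exact: lt_nbhsr.
- have -> : flat ('X^2 * (p - p^`())) 0 = 0 by rewrite /flat ltxx.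
  (* For positive h the difference quotient at 0 is [flat ('X * p) h], because division by h
     multiplies the polynomial in 1/h by ['X]. *)
  have [C C0 HC] := flat_bound ('X * p).
  have cv : h^-1 *: ((flat p \o shift 0) (h *: (1 : R)) - flat p 0) @[h --> (0 : R)^'] --> (0 : R).
    apply: norm_cvg0; apply: (@squeeze_cvgr _ _ _ _ (fun=> 0) (fun h => C * `|h|)).
    + near=> h; rewrite normr_ge0 /= addr0 {2}/flat ltxx subr0.
      apply: le_trans (HC h); rewrite /flat -[h *: 1]/(h * 1) mulr1; case: ifPn => h0.
        by rewrite !hornerE /GRing.scale /= -mulrA.
      by rewrite scaler0 normr0.
    + exact: cvg_cst.
    have : C * `|h| @[h --> (0 : R)^'] --> C * `|0 : R|.
      by apply: cvgM; [exact: cvg_cst|apply: cvg_norm; exact: nbhs_dnbhs].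
    by rewrite normr0 mulr0.
  by apply: DeriveDef; [apply/cvg_ex; exists 0|apply/cvg_lim].
Unshelve. all: by end_near. Qed.

Lemma flat_smooth n p : Ck n (flat p).
Proof.
pose h j := flat (iter j (fun p => 'X^2 * (p - p^`())) p).
by apply: (@smooth_seq h _ n 0) => j x; exact: flat_derive.
Qed.

Definition bump (x : R) : R := flat 1 (1 + x) * flat 1 (1 - x).

Lemma bump_smooth n : Ck n bump.
Proof.
apply: CkM.
  apply: (@Ck_comp_affine _ _ _ n (flat 1) (fun x : R => 1 + x) id) => [x|h x v|].
  - by apply: cvgD; [exact: cvg_cst|exact: cvg_id].
  - by rewrite addrCA.
  - exact: flat_smooth.
apply: (@Ck_comp_affine _ _ _ n (flat 1) (fun x : R => 1 - x) -%R) => [x|h x v|].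
- by apply: cvgB; [exact: cvg_cst|exact: cvg_id].
- by rewrite scalerN opprD addrCA.
- exact: flat_smooth.
Qed.

Lemma flat1_ge0 x : 0 <= flat 1 x.
Proof. by rewrite /flat hornerC mul1r; case: ifP => // _; exact: expR_ge0. Qed.

Lemma flat1_gt0 x : 0 < x -> 0 < flat 1 x.
Proof. by rewrite /flat hornerC mul1r => ->; exact: expR_gt0. Qed.

Lemma bump_ge0 x : 0 <= bump x.
Proof. by rewrite mulr_ge0// flat1_ge0. Qed.

Lemma bump_gt0 x : `|x| < 1 -> 0 < bump x.
Proof. by rewrite ltr_norml => /andP[x1 x2]; rewrite mulr_gt0// flat1_gt0//; lra. Qed.

Lemma bump_eq0 x : 1 <= `|x| -> bump x = 0.
Proof.
rewrite ler_normr /bump /flat => /orP[] h.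
  by rewrite [0 < 1 - x]ltNge subr_le0 h /= mulr0.
by rewrite [0 < 1 + x]ltNge (_ : 1 + x <= 0) ?mul0r//; lra.
Qed.

Lemma bumpN x : bump (- x) = bump x.
Proof. by rewrite /bump opprK mulrC. Qed.

End smooth_line.

Section mollifier.
Context (R : realType) (d : nat).
Local Notation leb := (lebesgue_rV R d).
Local Notation V := 'rV[R]_d.

Lemma test_function_rV (phi : V -> R) (r : R) : smooth phi ->
  (forall x, r < `|x| -> phi x = 0) -> test_function [set: V] phi.
Proof.
move=> sphi phir; split => //.
have cl : closed [set x : V | `|x| <= r].
  by apply: compact_closed; [exact: norm_hausdorff|exact: cball_compact].
apply: (@subclosed_compact _ _ [set x : V | `|x| <= r]).
- exact: closed_closure.
- exact: cball_compact.
rewrite [X in _ `<=` X](closure_id _).1//.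
apply: closure_subset => x /=; apply: contraNP => xr; apply/eqP; apply: phir.
by rewrite ltNge; apply/negP.
Qed.

Lemma smooth_supp_derive (phi : V -> R) (r : R) (v : V) :
  (forall x, r < `|x| -> phi x = 0) -> forall x, r < `|x| -> 'D_v phi x = 0.
Proof.
move=> phir x rx.
have : is_derive x v phi 0.
  apply: (@near_eq_is_derive _ _ _ (cst 0)).
  have o : open [set y : V | r < `|y|].
    rewrite (_ : [set y : V | r < `|y|] = (fun y => `|y|) @^-1` [set t | r < t])//.
    by apply: open_comp => [y _|]; [exact: norm_continuous|exact: open_gt].
  have := open_nbhs_nbhs (conj o rx : open_nbhs x [set y : V | r < `|y|]).
  by apply: filterS => y /= ry; rewrite phir.
by move=> h; exact: derive_val.
Qed.

Lemma rV_coord_continuous i : continuous (fun y : V => y 0 i : R).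
Proof. exact: coord_continuous. Qed.

(** A product over the coordinates matches the sup norm of row vectors: the support is a ball of
    that norm, and smoothness follows from the one-dimensional case. *)
Definition pre_moll (n : nat) (y : V) : R := \prod_i bump (n.+1%:R * y 0 i).

Lemma pre_moll_smooth n k : Ck k (pre_moll n).
Proof.
apply: Ck_prod => i.
have := @Ck_comp_affine R V _ k (@bump R) (fun y : V => n.+1%:R * y 0 i) (fun y => n.+1%:R * y 0 i).
apply.
- move=> x; apply: (@continuous_comp _ _ _ (fun y : V => y 0 i : R) ( *%R n.+1%:R)).
    exact: rV_coord_continuous.
  exact: mulrl_continuous.
- by move=> h x v; rewrite !mxE mulrDr /GRing.scale /= mulrCA.
- exact: bump_smooth.
Qed.

Lemma pre_moll_ge0 n y : 0 <= pre_moll n y.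
Proof. by apply: prodr_ge0 => i _; exact: bump_ge0. Qed.

Lemma pre_moll_supp n y : n.+1%:R^-1 < `|y| -> pre_moll n y = 0.
Proof.
move=> yn; have [i yi] : exists i, n.+1%:R^-1 < `|y 0 i|.
  apply: contrapT => H; move: yn; rewrite ltNge => /negP; apply.
  apply/rV_normP; first by rewrite invr_ge0.
  by move=> i; rewrite leNgt; apply/negP => h; apply: H; exists i.
rewrite /pre_moll (bigD1 i)//= bump_eq0 ?mul0r//.
rewrite normrM ger0_norm// -ler_pdivrMl// mulr1; exact: ltW.
Qed.

Lemma pre_moll_int n : Rint leb setT (pre_moll n).
Proof.
by apply: Rint_Cc; [exact: Ck_continuous (pre_moll_smooth n 0)|exact: pre_moll_supp].
Qed.

(** A nonnegative function of zero integral vanishes almost everywhere, whereas this one is positive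
    on a box of half-width [e], half the radius of its support, whose measure is computed by
    [lebesgue_rV_box]. *)
Lemma pre_moll_int_gt0 n : 0 < \int[leb]_y pre_moll n y.
Proof.
rewrite lt0r Rintegral_ge0 ?andbT; last by move=> *; exact: pre_moll_ge0.
apply/eqP => I0.
have mp := Rint_meas (pre_moll_int n).
have : (\int[leb]_y `|(pre_moll n y)%:E| = 0)%E.
  under eq_integral do rewrite gee0_abs ?lee_fin ?pre_moll_ge0//.
  by rewrite Rint_EFin ?I0//; exact: pre_moll_int.
move/(ae_eq_integral_abs leb measurableT (_ : measurable_fun _ (EFin \o pre_moll n))) => h.
have {}h := h ltac:(exact/measurable_EFinP).
pose e : R := (2 * n.+1%:R)^-1.
have e0 : 0 < e by rewrite invr_gt0 mulr_gt0.
pose B := [set x : V | forall i, `[- e, e]%classic (x 0 i)].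
have BE : B = [set x : V | `|x| <= e].
  apply/seteqP; split => x /=.
    by move=> Bx; apply/rV_normP => [|i]; [exact: ltW|rewrite ler_norml; have := Bx i; rewrite /= in_itv].
  by move=> /(rV_normP _ (ltW e0)) H i; rewrite /= in_itv/= -ler_norml.
have : leb B = 0%E.
  apply: measure_negligible; first by rewrite BE; exact: closed_ball_measurable.
  apply: negligibleS h => x; rewrite BE /= => xe /(_ I) [].
  apply/eqP; rewrite gt_eqF// /pre_moll prodr_gt0// => i _; apply: bump_gt0.
  rewrite normrM ger0_norm// -ltr_pdivlMl// mulr1 (le_lt_trans (rV_coord_le _ _))//.
  by rewrite (le_lt_trans xe)// /e ltf_pV2 ?posrE// ?mulr_gt0// ltr_pMl// ltr1n.
rewrite (@lebesgue_rV_box R d (fun=> `[- e, e]%classic))//.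
rewrite (eq_bigr (fun=> (e + e)%:E)); last first.
  by move=> i _; rewrite lebesgue_measure_itv/= lte_fin gtrN// -EFinB opprK.
rewrite prodEFin => -[] /eqP; rewrite prodf_seq_eq0 => /hasP[i _].
by rewrite /= gt_eqF// addr_gt0.
Qed.

(* Packed behind an existential so that [moll] never unfolds during matching. *)
Lemma moll_exists : exists m : nat -> V -> R, forall n,
  [/\ forall k, Ck k (m n), forall y, 0 <= m n y,
      forall y, n.+1%:R^-1 < `|y| -> m n y = 0,
      forall y, m n (- y) = m n y &
      Rint leb setT (m n) /\ \int[leb]_y m n y = 1].
Proof.
exists (fun n y => (\int[leb]_y pre_moll n y)^-1 * pre_moll n y) => n; split.
- by move=> k; apply: CkM; [exact: Ck_cst|exact: pre_moll_smooth].
- by move=> y; rewrite mulr_ge0 ?pre_moll_ge0// invr_ge0 ltW// pre_moll_int_gt0.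
- by move=> y h; rewrite pre_moll_supp// mulr0.
- move=> y; rewrite /pre_moll; congr (_ * _); apply: eq_bigr => i _.
  by rewrite mxE mulrN bumpN.
- split; first by apply: RintZ; exact: pre_moll_int.
  by rewrite RIntZ ?mulVf ?gt_eqF ?pre_moll_int_gt0//; exact: pre_moll_int.
Qed.

Definition moll : nat -> V -> R := projT1 (cid moll_exists).

Lemma moll_smooth n k : Ck k (moll n).
Proof. by rewrite /moll; case: cid => m /= /(_ n)[]. Qed.

Lemma moll_continuous n : continuous (moll n).
Proof. exact: Ck_continuous (moll_smooth n 0). Qed.

Lemma moll_ge0 n y : 0 <= moll n y.
Proof. by rewrite /moll; case: cid => m /= /(_ n)[]. Qed.

Lemma moll_supp n y : n.+1%:R^-1 < `|y| -> moll n y = 0.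
Proof. by rewrite /moll; case: cid => m /= /(_ n)[_ _ H _ _]; exact: H. Qed.

Lemma mollN n y : moll n (- y) = moll n y.
Proof. by rewrite /moll; case: cid => m /= /(_ n)[]. Qed.

Lemma moll_Rint n : Rint leb setT (moll n).
Proof. by rewrite /moll; case: cid => m /= /(_ n)[_ _ _ _ []]. Qed.

Lemma moll_mass n : \int[leb]_y moll n y = 1.
Proof. by rewrite /moll; case: cid => m /= /(_ n)[_ _ _ _ []]. Qed.

Lemma test_function_translate (phi : V -> R) (r : R) (a : V) : smooth phi ->
  (forall x, r < `|x| -> phi x = 0) -> test_function [set: V] (fun x => phi (x - a)).
Proof.
move=> sphi phir; apply: (@test_function_rV _ (r + `|a|)) => [k|x ra].
  exact: Ck_translate.
by apply: phir; apply: lt_le_trans (lerB_dist _ _); rewrite ltrBrDr.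
Qed.

Lemma test_function_time (alpha : R -> R) (phi : V -> R) (a b r : R) : 0 < a ->
  (forall k, Ck k alpha) -> smooth phi ->
  (forall t, ~~ (a <= t <= b) -> alpha t = 0) ->
  (forall x, r < `|x| -> phi x = 0) ->
  test_function [set p : R * V | 0 < p.1] (fun p => alpha p.1 * phi p.2).
Proof.
move=> a0 salpha sphi alphaE phir.
have clB : closed [set x : V | `|x| <= r].
  by apply: compact_closed; [exact: norm_hausdorff|exact: cball_compact].
pose K := `[a, b]%classic `*` [set x : V | `|x| <= r].
have cK : compact K by apply: compact_setX; [exact: segment_compact|exact: cball_compact].
have clK : closed K by apply: compact_closed; [exact: norm_hausdorff|].
have sK : closure [set p : R * V | alpha p.1 * phi p.2 != 0] `<=` K.
  rewrite [X in _ `<=` X](closure_id _).1//; apply: closure_subset => -[t x] /=.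
  rewrite mulf_eq0 negb_or => /andP[al ph]; split => /=.
    by rewrite in_itv/=; apply: contraNT al => /alphaE ->.
  by rewrite leNgt; apply/negP => /phir p0; rewrite p0 eqxx in ph.
split.
- move=> k; apply: CkM.
    have := @Ck_comp_affine R _ _ k alpha (fun p : R * V => p.1) (fun p => p.1).
    by apply => // x; exact: cvg_fst.
  have := @Ck_comp_affine R _ _ k phi (fun p : R * V => p.2) (fun p => p.2).
  by apply => // x; exact: cvg_snd.
- by apply: (subclosed_compact _ cK sK); exact: closed_closure.
- by move=> p /sK[/=]; rewrite in_itv/= => /andP[+ _] _; exact: lt_le_trans.
Qed.

End mollifier.

Section time_cutoff.
Context (R : realType).
Local Notation mu := (@lebesgue_measure R).

Let bump_cts : continuous (@bump R).
Proof. exact: Ck_continuous (@bump_smooth R 0). Qed.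

Let bump_int (a b : R) : Rint mu `[a, b] (@bump R).
Proof.
split => //; apply: continuous_compact_integrable; first exact: segment_compact.
exact: continuous_subspaceT.
Qed.

(** The base point -2 lies strictly to the left of the support of [bump]: to its right the
    fundamental theorem of calculus applies, and up to it [Phi] is locally zero, so the derivative
    exists on the whole line. *)
Let Phi (x : R) : R := \int[mu]_(t in `[-2, x]) bump t.

Let Phi0 x : x <= -1 -> Phi x = 0.
Proof.
move=> x1; rewrite /Phi (@eq_Rintegral _ _ _ mu _ (fun=> 0)); first by rewrite Rintegral_cst// mul0r.
move=> t; rewrite inE/= in_itv/= => /andP[_ tx]; apply: bump_eq0.
by rewrite ler_normr; apply/orP; right; rewrite lerNr (le_trans tx).
Qed.

Let dPhi (x : R) : is_derive x 1 Phi (bump x).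
Proof.
have [x2|x2] := ltP (-2) x; last first.
  rewrite bump_eq0; last by rewrite ler_normr; apply/orP; right; lra.
  apply: (@near_eq_is_derive _ _ _ (cst 0)).
  near=> y; rewrite Phi0//; apply: ltW; near: y; apply: lt_nbhsl; lra.
have := @continuous_FTC1 R (@bump R) (BLeft (-2)) x (x + 1).
case; [by rewrite ltrDl|by case: (bump_int (-2) (x + 1))|by rewrite /= lte_fin|exact: bump_cts|].
by move=> dF E; apply: DeriveDef; [exact: dF|rewrite -derive1E; exact: E].
Unshelve. all: by end_near. Qed.

Lemma is_derive_continuous (f f' : R -> R) :
  (forall x : R, is_derive x 1 f (f' x)) -> continuous f.
Proof.
by move=> df x; apply/differentiable_continuous/derivable1_diffP; case: (df x).
Qed.

Lemma MVT_is_derive (f f' : R -> R) (a b : R) : a <= b ->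
  (forall x : R, a <= x <= b -> is_derive x 1 f (f' x)) ->
  exists2 x, a <= x <= b & f b - f a = f' x * (b - a).
Proof.
move=> ab df; have H1 x : x \in `]a, b[ -> is_derive x 1 f (f' x).
  by rewrite in_itv/= => /andP[/ltW ax /ltW xb]; apply: df; rewrite ax.
have H2 : {within `[a, b], continuous f}.
  apply: derivable_within_continuous => x; rewrite in_itv/= => xab.
  by case: (df _ xab).
by have [x + E] := MVT_segment ab H1 H2; rewrite in_itv/= => xab; exists x.
Qed.

(** The normalised primitive of [bump]. Rescaled, it yields time cut-offs whose derivatives are
    approximate identities. *)
Lemma smooth_step : exists S B : R -> R,
  [/\ forall k, Ck k S, forall x : R, is_derive x 1 S (B x), continuous B,
      forall x, 0 <= B x & forall x, 0 <= S x <= 1] /\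
  [/\ forall x, x <= -1 -> S x = 0, forall x, 1 <= x -> S x = 1 &
      forall x, 1 <= `|x| -> B x = 0].
Proof.
have mono (x y : R) : x <= y -> Phi x <= Phi y.
  move=> xy; have [t _ E] := MVT_is_derive xy (fun z _ => dPhi z).
  by rewrite -subr_ge0 E mulr_ge0 ?bump_ge0// subr_ge0.
have Phi1 x : 1 <= x -> Phi x = Phi 1.
  move=> x1; have [t /andP[t1 _] E] := MVT_is_derive x1 (fun z _ => dPhi z).
  apply/eqP; rewrite -subr_eq0 E bump_eq0 ?mul0r//.
  by rewrite ler_normr t1.
have c0 : 0 < Phi 1.
  apply: (@lt_le_trans _ _ (Phi 2^-1)); last by apply: mono; rewrite invf_le1 ?ler1n.
  have h : - 2^-1 <= 2^-1 :> R by lra.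
  have [t tE E] := MVT_is_derive h (fun z _ => dPhi z).
  apply: (@lt_le_trans _ _ (Phi 2^-1 - Phi (- 2^-1))).
    rewrite E opprK mulr_gt0//.
    by rewrite bump_gt0// (@le_lt_trans _ _ 2^-1) ?ler_norml// invf_lt1 ?ltr1n.
  by rewrite gerBl -(Phi0 (lexx (-1))) mono//; lra.
have dS (x : R) : is_derive x 1 (fun x => (Phi 1)^-1 * Phi x) ((Phi 1)^-1 * bump x).
  by have := is_deriveZ (Phi 1)^-1 (dPhi x).
exists (fun x => (Phi 1)^-1 * Phi x), (fun x => (Phi 1)^-1 * bump x).
split; split => //.
- case=> [|k]; first by split => //; exact: is_derive_continuous dS.
  split; first exact: is_derive_continuous dS.
  move=> v; have dv x := is_derive_dir v (dS x).
  split=> [x|]; first by case: (dv x).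
  under [X in Ck _ X]eq_fun do rewrite (@derive_val _ _ _ _ _ _ _ (dv _)).
  by do 2 (apply: CkM; first exact: Ck_cst); exact: bump_smooth.
- by move=> x; apply: cvgM; [exact: cvg_cst|exact: bump_cts].
- by move=> x; rewrite mulr_ge0 ?bump_ge0// invr_ge0 ltW.
- move=> x; have [x1|/ltW x1] := leP x (-1); first by rewrite (Phi0 x1) mulr0 lexx ler01.
  have Px := mono _ _ x1; rewrite (Phi0 (lexx (-1))) in Px.
  rewrite mulr_ge0 ?invr_ge0 ?(ltW c0)//=.
  rewrite mulrC ler_pdivrMr// mul1r.
  by have [/mono//|/ltW h] := leP x 1; rewrite (Phi1 x h).
- by move=> x /Phi0 ->; rewrite mulr0.
- by move=> x x1; rewrite (Phi1 x x1) mulVf// gt_eqF.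
- by move=> x /bump_eq0 ->; rewrite mulr0.
Qed.

End time_cutoff.

Section continuity.
Context (R : realType) (V : normedModType R).
Implicit Types f g : V -> R.

(** Dominated convergence is a statement about sequences, so continuity of parameter integrals is
    obtained in this form. *)
Lemma seq_continuous (F : V -> R) :
  (forall (x : V) (w : nat -> V), w n @[n --> \oo] --> x -> F (w n) @[n --> \oo] --> F x) ->
  continuous F.
Proof.
move=> H x; apply/cvgrPdist_lt => e e0; apply: contrapT => K.
have /choice[w wP] n : exists w : V, `|x - w| < n.+1%:R^-1 /\ e <= `|F x - F w|.
  apply: contrapT => L; apply: K; apply/nbhs_ballP.
  exists n.+1%:R^-1 => /=; first by rewrite invr_gt0.
  move=> w; rewrite -ball_normE /= => xw; rewrite ltNge; apply/negP => ?.
  by apply: L; exists w.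
have wx : w n @[n --> \oo] --> x.
  apply/cvgrPdist_lt => e' e'0.
  have [N _ HN] := near_infty_natSinv_lt (PosNum e'0).
  exists N => // n /= Nn; apply: lt_trans (HN _ Nn); by case: (wP n).
have /cvgrPdist_lt/(_ _ e0)[N _ /(_ N (leqnn N))] := H x w wx.
by rewrite /= ltNge => /negP; apply; case: (wP N).
Qed.

Lemma cts_translate (W : topologicalType) (phi : V -> W) (x : V) :
  continuous phi -> continuous (fun z => phi (z - x)).
Proof.
move=> cp z; apply: (continuous_comp (f := fun z : V => z - x)); last exact: cp.
by apply: cvgB; [exact: cvg_id|exact: cvg_cst].
Qed.

Lemma cts_seqB f (w : nat -> V) (x z : V) : continuous f ->
  w n @[n --> \oo] --> x -> f (z - w n) @[n --> \oo] --> f (z - x).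
Proof.
move=> cf wx; have H : z - w n @[n --> \oo] --> z - x by apply: cvgB => //; exact: cvg_cst.
exact: (cvg_comp _ _ H (cf _)).
Qed.

Lemma ctsD f g : continuous f -> continuous g -> continuous (fun x => f x + g x).
Proof. by move=> cf cg x; apply: cvgD; [exact: cf|exact: cg]. Qed.

Lemma ctsB f g : continuous f -> continuous g -> continuous (fun x => f x - g x).
Proof. by move=> cf cg x; apply: cvgB; [exact: cf|exact: cg]. Qed.

Lemma ctsN f : continuous f -> continuous (fun x => - f x).
Proof. by move=> cf x; apply: cvgN; exact: cf. Qed.

Lemma ctsM f g : continuous f -> continuous g -> continuous (fun x => f x * g x).
Proof. by move=> cf cg x; apply: cvgM; [exact: cf|exact: cg]. Qed.

Lemma cts_cst (c : R) : continuous (fun _ : V => c).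
Proof. by move=> x; exact: cvg_cst. Qed.

Lemma cts_sum (I : Type) (s : seq I) (F : I -> V -> R) :
  (forall i, continuous (F i)) -> continuous (fun x => \sum_(i <- s) F i x).
Proof.
move=> cF; elim: s => [|i s IH].
  by under [X in continuous X]eq_fun do rewrite big_nil; exact: cts_cst.
by under [X in continuous X]eq_fun do rewrite big_cons; exact: ctsD.
Qed.

(** With [is_derive_of_line], this transfers directional derivatives to functions of one real
    variable, where the chain rule and differentiation under the integral are available. *)
Lemma is_derive_line (F : V -> R) (x v : V) (h : R) : derivable F (x + h *: v) v ->
  is_derive h (1 : R) (fun h : R => F (x + h *: v)) ('D_v F (x + h *: v)).
Proof.
move=> dF.
have E : (fun k : R => k^-1 *: (((fun h : R => F (x + h *: v)) \o shift h) (k *: (1 : R)) - F (x + h *: v)))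
  = (fun k : R => k^-1 *: ((F \o shift (x + h *: v)) (k *: v) - F (x + h *: v))).
  apply/funext => k /=; congr (_ *: (F _ - _)).
  by rewrite -[k *: 1]/(k * 1) mulr1 scalerDl addrCA.
by apply: DeriveDef; [rewrite /derivable E; exact: dF|rewrite /derive E].
Qed.

Lemma is_derive_of_line (F : V -> R) (x v : V) (l : R) :
  is_derive (0 : R) (1 : R) (fun h : R => F (x + h *: v)) l -> is_derive x v F l.
Proof.
move=> [dF <-].
have E : (fun k : R => k^-1 *: ((F \o shift x) (k *: v) - F x)) =
   (fun k : R => k^-1 *: (((fun h : R => F (x + h *: v)) \o shift 0) (k *: (1 : R)) - F (x + 0 *: v))).
  apply/funext => k /=; rewrite -[k *: 1]/(k * 1) mulr1 addr0 scale0r addr0.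
  by rewrite [k *: v + x]addrC.
by apply: DeriveDef; [rewrite /derivable E; exact: dF|rewrite /derive E].
Qed.

End continuity.

(** * Convolution *)

Section convolution.
Context (R : realType) (d : nat).
Local Notation leb := (lebesgue_rV R d).
Local Notation V := 'rV[R]_d.
Implicit Types f phi : V -> R.

Definition vanishes_off (r : R) phi := forall x, r < `|x| -> phi x = 0.

Definition C1dir (v : V) phi := [/\ continuous phi, forall x, derivable phi x v &
  continuous ('D_v phi)].

Lemma closed_measurable_rV (A : set V) : closed A -> measurable A.
Proof.
move=> cA; rewrite -(setCK A); apply: measurableC; apply: open_measurable_rV.
exact: closed_openC.
Qed.

Lemma compact_measurable_rV (A : set V) : compact A -> measurable A.
Proof.
by move=> cA; apply: closed_measurable_rV; apply: compact_closed => //; exact: norm_hausdorff.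
Qed.

Lemma L1_loc_ball f (r : R) : L1_loc f -> Rint leb [set x : V | `|x| <= r] f.
Proof.
move=> [mf fK]; apply: RintP; first exact: closed_ball_measurable.
  exact: measurable_funTS.
by apply: fK; exact: cball_compact.
Qed.

Lemma L1_loc_mul f (g : V -> R) (r C : R) : L1_loc f -> measurable_fun setT g ->
  (forall x, `|g x| <= C) -> vanishes_off r g -> Rint leb setT (fun x => f x * g x).
Proof.
move=> fl mg gC gr; have [mf _] := fl.
have mB := @closed_ball_measurable R d r.
have C0 : 0 <= C by apply: le_trans (gC 0); exact: normr_ge0.
have i1 : Rint leb setT ((fun x => C * `|f x|) \_ [set x : V | `|x| <= r]).
  have [_] := RintZ C (Rint_abs (L1_loc_ball r fl)).
  by move=> /(integrable_mkcond _ mB); rewrite restrict_EFin; split.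
apply: (Rint_le _ i1); first exact: measurable_funM.
move=> x _; rewrite normrM patchE; case: ifPn => xr.
  by rewrite mulrC ler_wpM2r.
rewrite gr ?normr0 ?mulr0//; move: xr; rewrite notin_setE /= => /negP.
by rewrite -ltNge.
Qed.

Lemma L1_loc_Cc f (g : V -> R) (r : R) : L1_loc f -> continuous g -> vanishes_off r g ->
  Rint leb setT (fun x => f x * g x).
Proof.
move=> fl cg gr; have [C _ gC] := continuous_bounded_support cg gr.
by apply: (L1_loc_mul fl _ gC gr); exact: continuous_measurable_rV.
Qed.

Lemma Rint_L1_loc f : Rint leb setT f -> L1_loc f.
Proof.
move=> fi; split; first exact: Rint_meas fi.
move=> K cK; apply: le_lt_trans (Rint_lty fi); apply: ge0_subset_integral => //.
- exact: compact_measurable_rV.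
- by apply/measurable_EFinP; apply: measurableT_comp => //; exact: Rint_meas fi.
Qed.

Lemma vanishes_translate (r : R) phi (x : V) : vanishes_off r phi ->
  vanishes_off (r + `|x|) (fun z => phi (z - x)).
Proof. by move=> pr z rz; apply: pr; apply: lt_le_trans (lerB_dist _ _); rewrite ltrBrDr. Qed.

(** Convolution with the reflected kernel, which for the even mollifiers is the usual one. In this
    form it is a pairing of [f] with a translated test function, to which weak formulations apply
    directly. *)
Definition cv phi f (x : V) : R := \int[leb]_z (f z * phi (z - x)).

Section kernel.
Variables (phi : V -> R) (r : R).
Hypotheses (cphi : continuous phi) (phir : vanishes_off r phi).

Lemma cv_Rint f x : L1_loc f -> Rint leb setT (fun z => f z * phi (z - x)).
Proof.
move=> fl; apply: (L1_loc_Cc (r := r + `|x|) fl); first exact: (@cts_translate _ _ _ phi).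
exact: vanishes_translate.
Qed.

Lemma cv_continuous f : L1_loc f -> continuous (cv phi f).
Proof.
move=> fl; apply: seq_continuous => x w wx.
have [C C0 pC] := continuous_bounded_support cphi phir.
have [M [_ HM]] := cvg_seq_bounded (cvgP _ wx).
pose M1 := `|M| + 1; have {}HM n : `|w n| <= M1.
  by apply: HM => //; rewrite (le_lt_trans (ler_norm M))// ltrDl.
have mB := @closed_ball_measurable R d (r + M1).
have i1 : Rint leb setT (fun z => `|f z * (C * \1_[set x : V | `|x| <= r + M1] z)|).
  apply: Rint_abs; apply: (L1_loc_mul (r := r + M1) (C := C) fl).
  - by apply: measurable_funM => //; exact: measurable_indic.
  - move=> z; rewrite indicE; case: (_ \in _); rewrite ?mulr1 ?mulr0 ?normr0 ?ger0_norm//; exact: ltW.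
  - by move=> z rz; rewrite indicE memNset ?mulr0//= => /(lt_le_trans rz); rewrite ltxx.
have [] // := @Rint_DCT _ _ R leb setT (fun n z => f z * phi (z - w n)) (fun z => f z * phi (z - x)) _ _ _ _ i1.
- by move=> n; apply: (@Rint_meas _ _ _ leb); exact: cv_Rint.
- by apply: (@Rint_meas _ _ _ leb); exact: cv_Rint.
- apply: aeW => z _; apply: cvgM; first exact: cvg_cst.
  exact: cts_seqB.
apply: aeW => z _ n; rewrite !normrM ler_wpM2l// indicE.
have [zr|zr] := boolP (z \in _).
  by rewrite normr1 mulr1 (ger0_norm (ltW C0)).
rewrite normr0 mulr0 phir ?normr0//; move: zr; rewrite notin_setE /= => /negP.
rewrite -ltNge => zr; apply: lt_le_trans (lerB_dist _ _); rewrite ltrBrDr.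
by apply: le_lt_trans zr; rewrite lerD2l.
Qed.

End kernel.

Lemma vanishes_derive (r : R) phi v : vanishes_off r phi -> vanishes_off r ('D_v phi).
Proof. exact: smooth_supp_derive. Qed.

(** Differentiation under the integral along the line x + h v. The minus sign comes from the
    argument z - x of the kernel. *)
Lemma cv_derive phi (r : R) (v : V) f (x : V) : C1dir v phi -> vanishes_off r phi ->
  L1_loc f -> is_derive x v (cv phi f) (- cv ('D_v phi) f x).
Proof.
move=> [cphi dphi cDphi] phir fl.
have Dr := vanishes_derive v phir.
have [C C0 DC] := continuous_bounded_support cDphi Dr.
pose g (h : R) (z : V) := f z * phi (z - (x + h *: v)).
have dg z h : is_derive h (1 : R) (g ^~ z) (f z * - 'D_v phi (z - (x + h *: v))).
  have -> : g ^~ z = (fun h : R => f z * ((fun k : R => phi (z - x + k *: v)) \o -%R) h).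
    by apply/funext => k; rewrite /g /= opprD addrA scaleNr.
  have H : is_derive h 1 ((fun k : R => phi (z - x + k *: v)) \o -%R) ('D_v phi (z - x + (- h) *: v) * - 1).
    by apply: is_derive1_comp; apply: is_derive_line; exact: dphi.
  apply: is_derive_eq (is_deriveZ (f z) H) _.
  by rewrite mulrN1 scaleNr opprD addrA.
(* For |h| < 1 all the translated kernels vanish outside the ball of this radius, so one indicator
   dominates them. *)
pose M := r + (`|x| + `|v|).
have mB := @closed_ball_measurable R d M.
have i1 : Rint leb setT (fun z => `|f z * (C * \1_[set x : V | `|x| <= M] z)|).
  apply: Rint_abs; apply: (L1_loc_mul (r := M) (C := C) fl).
  - by apply: measurable_funM => //; exact: measurable_indic.
  - move=> z; rewrite indicE; case: (_ \in _); rewrite ?mulr1 ?mulr0 ?normr0 ?ger0_norm//; exact: ltW.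
  - by move=> z rz; rewrite indicE memNset ?mulr0//= => /(lt_le_trans rz); rewrite ltxx.
have ub h z : `]-1, 1[%classic h -> setT z -> `|partial1of2 g h z| <= `|f z * (C * \1_[set x : V | `|x| <= M] z)|.
  rewrite /= in_itv/= -ltr_norml => h1 _.
  rewrite partial1of2E (@derive_val _ _ _ _ _ _ _ (dg z h)) !normrM normrN ler_wpM2l// indicE.
  have [zr|zr] := boolP (z \in _).
    by rewrite normr1 mulr1 (ger0_norm (ltW C0)).
  rewrite normr0 mulr0 Dr ?normr0//; move: zr; rewrite notin_setE /= => /negP.
  rewrite -ltNge => zr; apply: lt_le_trans (lerB_dist _ _); rewrite ltrBrDr.
  apply: le_lt_trans zr; rewrite lerD2l (le_trans (ler_normD _ _))// lerD2l normrZ.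
  by rewrite ler_piMl// ltW.
have ig h : `]-1, 1[%classic h -> leb.-integrable setT (EFin \o g h).
  by move=> _; apply: Rint_int; apply: (cv_Rint cphi phir).
have I0 : `]-1, 1[%classic (0 : R) by rewrite /= in_itv/= ltrN10 ltr01.
have dg1 h z : `]-1, 1[%classic h -> setT z -> derivable (g ^~ z) h 1.
  by move=> _ _; case: (dg z h).
have G0 z : 0 <= `|f z * (C * \1_[set x : V | `|x| <= M] z)| by exact: normr_ge0.
have dF := @derivable_under_integral R _ _ leb g setT measurableT 0 (-1) 1 I0 ig dg1 _ G0 (Rint_int i1) ub.
have DF := @differentiation_under_integral R _ _ leb g setT measurableT 0 (-1) 1 I0 ig dg1 _ G0 (Rint_int i1) ub.
apply: is_derive_of_line; apply: DeriveDef; first exact: dF.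
rewrite -derive1E; apply: etrans DF _.
rewrite /cv -RIntN; last exact: cv_Rint cDphi Dr _ _ fl.
by apply: eq_Rintegral => z _; rewrite partial1of2E (@derive_val _ _ _ _ _ _ _ (dg z 0)) scale0r addr0 mulrN.
Qed.

(** By translation invariance [cv F 1] is constant, equal to the integral of [F]. Its derivative
    vanishes, and by [cv_derive] this derivative is minus the integral sought. No coordinatewise
    Fubini is required. *)
Lemma Rintegral_derive (F : V -> R) (r : R) (v : V) : C1dir v F -> vanishes_off r F ->
  \int[leb]_x 'D_v F x = 0.
Proof.
move=> CF Fr; have [cF dF cDF] := CF.
have l1 : L1_loc (fun _ : V => 1 : R).
  split=> // K cK; rewrite normr1 integral_cst ?mul1e//; last exact: compact_measurable_rV.
  have /compact_bounded[M [_ HM]] := cK.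
  apply: le_lt_trans (leb_ball_lty d (`|M| + 1)); apply: le_measure; rewrite ?inE.
  - exact: compact_measurable_rV.
  - exact: closed_ball_measurable.
  - by move=> x /HM; apply; rewrite (le_lt_trans (ler_norm M))// ltrDl.
have iF : Rint leb setT F by exact: Rint_Cc cF Fr.
have E : cv F (fun=> 1) = fun=> \int[leb]_x F x.
  apply/funext => x; rewrite /cv -[RHS](Rintegral_translate (- x) iF).
  by apply: eq_Rintegral => z _; rewrite mul1r.
have := cv_derive 0 CF Fr l1; rewrite E => D.
have : 'D_v (fun=> \int[leb]_x F x) (0 : V) = 0 by exact: derive_cst.
rewrite (@derive_val _ _ _ _ _ _ _ D) => /eqP; rewrite oppr_eq0 => /eqP <-.
by rewrite /cv; apply: eq_Rintegral => z _; rewrite mul1r subr0.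
Qed.

Lemma measurable_subrV2 : measurable_fun setT (fun p : V * V => p.2 - p.1).
Proof.
apply: measurable_to_rV => i; under eq_fun do rewrite !mxE.
apply: measurable_funB.
  apply: (@measurableT_comp _ _ _ _ _ _ (fun x : V => x 0 i) _ snd); [exact: measurable_coord|exact: measurable_snd].
apply: (@measurableT_comp _ _ _ _ _ _ (fun x : V => x 0 i) _ fst); [exact: measurable_coord|exact: measurable_fst].
Qed.

Lemma measurable_addrV2 : measurable_fun setT (fun p : V * V => p.2 + p.1).
Proof.
apply: measurable_to_rV => i; under eq_fun do rewrite !mxE.
apply: measurable_funD.
  apply: (@measurableT_comp _ _ _ _ _ _ (fun x : V => x 0 i) _ snd); [exact: measurable_coord|exact: measurable_snd].
apply: (@measurableT_comp _ _ _ _ _ _ (fun x : V => x 0 i) _ fst); [exact: measurable_coord|exact: measurable_fst].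
Qed.

Local Notation conv n := (cv (@moll R d n)).

Lemma moll_vanishes n : vanishes_off n.+1%:R^-1 (@moll R d n).
Proof. exact: moll_supp. Qed.

Lemma moll_C1dir n v : C1dir v (@moll R d n).
Proof.
have [c H] := @moll_smooth R d n 1; split => //; first by move=> x; case: (H v).
by have [_ []] := H v.
Qed.

Lemma conv_continuous n f : L1_loc f -> continuous (conv n f).
Proof. by apply: cv_continuous; [exact: moll_continuous|exact: moll_vanishes]. Qed.

Lemma conv_Rint n f x : L1_loc f -> Rint leb setT (fun z => f z * moll n (z - x)).
Proof. by apply: cv_Rint; [exact: moll_continuous|exact: moll_vanishes]. Qed.

Lemma conv_ge0 n f x : (forall y, 0 <= f y) -> 0 <= conv n f x.
Proof. by move=> f0; apply: Rintegral_ge0 => z _; rewrite mulr_ge0// moll_ge0. Qed.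

Lemma moll_massN n x : \int[leb]_y moll n (x - y) = 1.
Proof.
under eq_Rintegral do rewrite -mollN opprB.
by rewrite (Rintegral_translate _ (moll_Rint R d n)) moll_mass.
Qed.

Lemma moll_RintN n (x : V) : Rint leb setT (fun y => moll n (x - y)).
Proof.
under [X in Rint _ _ X]eq_fun do rewrite -mollN opprB.
exact: Rint_translate (moll_Rint R d n).
Qed.

Lemma ge0_integral_conv n f : Rint leb setT f -> (forall x, 0 <= f x) ->
  Rint leb setT (conv n f) /\ \int[leb]_x conv n f x = \int[leb]_x f x.
Proof.
move=> fi f0; have fl := Rint_L1_loc fi.
have mc := continuous_measurable_rV (@conv_continuous n _ fl).
suff E : (\int[leb]_x (conv n f x)%:E = \int[leb]_x (f x)%:E)%E.
  split; last by rewrite /Rintegral E.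
  apply: RintP => //.
  under eq_integral do rewrite ger0_norm ?conv_ge0//.
  by rewrite E Rint_EFin// ltry.
have mF : measurable_fun setT (fun p : V * V => (f p.2 * moll n (p.2 - p.1))%:E).
  apply/measurable_EFinP; apply: measurable_funM.
    by apply: (measurableT_comp (Rint_meas fi)); exact: measurable_snd.
  apply: (measurableT_comp (continuous_measurable_rV (@moll_continuous R d n))).
  exact: measurable_subrV2.
transitivity (\int[leb]_x \int[leb]_z (f z * moll n (z - x))%:E)%E.
  by apply: eq_integral => x _; rewrite (Rint_EFin (conv_Rint n x fl)).
rewrite (fubini_tonelli (fun p : V * V => (f p.2 * moll n (p.2 - p.1))%:E)) //=; last first.
  by move=> p; rewrite lee_fin mulr_ge0// moll_ge0.
apply: eq_integral => z _.
rewrite (Rint_EFin (f := fun x : V => f z * moll n (z - x))); last by apply: RintZ; exact: moll_RintN.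
by rewrite RIntZ ?moll_massN ?mulr1//; exact: moll_RintN.
Qed.

Lemma convB_diff n f x : L1_loc f ->
  `|conv n f x - f x| <= \int[leb]_w (`|f (x + w) - f x| * moll n w).
Proof.
move=> fl; have [mf _] := fl.
have i1 : Rint leb setT (fun w => f (x + w) * moll n w).
  have := Rint_translate x (conv_Rint n x fl).
  by congr Rint; apply/funext => w; rewrite addrK addrC.
have i2 : Rint leb setT (fun w => f x * moll n w) by apply: RintZ; exact: moll_Rint.
have E1 : conv n f x = \int[leb]_w (f (x + w) * moll n w).
  rewrite /cv -[LHS](Rintegral_translate x (conv_Rint n x fl)).
  by apply: eq_Rintegral => w _; rewrite addrK addrC.
have E2 : f x = \int[leb]_w (f x * moll n w).
  by rewrite RIntZ ?moll_mass ?mulr1//; exact: moll_Rint.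
have E : conv n f x - f x = \int[leb]_w (f (x + w) * moll n w - f x * moll n w).
  by rewrite RIntB// -E1 -E2.
rewrite E (le_trans (le_norm_RInt _))//; first exact: RintB.
rewrite le_eqVlt; apply/orP; left; apply/eqP/eq_Rintegral => w _.
by rewrite -mulrBl normrM [`|moll n w|]ger0_norm// moll_ge0.
Qed.

(** After Tonelli the error is an average, weighted by the mollifier, of the L^1 norms of f(. + w) -
    f, and these are small for the small [w] in the support. *)
Lemma conv_L1_cvg f : Rint leb setT f ->
  \int[leb]_x `|conv n f x - f x| @[n --> \oo] --> 0.
Proof.
move=> fi; apply/cvgr0Pnorm_le => e e0; have fl := Rint_L1_loc fi.
have mf := Rint_meas fi.
have [r r0 Hr] := L1_translation_eps fi e0.
have [N _ HN] := near_infty_natSinv_lt (PosNum r0).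
exists N => // n /= Nn; rewrite ger0_norm ?Rintegral_ge0//.
have nr : n.+1%:R^-1 < r by exact: (HN n Nn).
have mD : measurable_fun setT (fun x => `|conv n f x - f x|).
  apply: measurableT_comp => //; apply: measurable_funB => //.
  exact: continuous_measurable_rV (@conv_continuous n _ fl).
pose g (p : V * V) := (`|f (p.1 + p.2) - f p.1| * moll n p.2).
have mg : measurable_fun setT (fun p => (g p)%:E).
  apply/measurable_EFinP; apply: measurable_funM.
    apply: measurableT_comp => //; apply: measurable_funB.
      apply: (measurableT_comp mf); under eq_fun do rewrite addrC; exact: measurable_addrV2.
    by apply: (measurableT_comp mf); exact: measurable_fst.
  by apply: (measurableT_comp (continuous_measurable_rV (@moll_continuous R d n))); exact: measurable_snd.
have g0' p : 0 <= g p by rewrite mulr_ge0// moll_ge0.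
have g0 p : (0 <= (g p)%:E)%E by rewrite lee_fin.
suff H : (\int[leb]_x `|conv n f x - f x|%:E <= e%:E)%E.
  have i : Rint leb setT (fun x => `|conv n f x - f x|).
    apply: RintP => //; under eq_integral do rewrite normr_id.
    by apply: le_lt_trans H _; rewrite ltry.
  by rewrite -lee_fin -Rint_EFin.
apply: (@le_trans _ _ (\int[leb]_x \int[leb]_w (g (x, w))%:E)%E).
  apply: ge0_le_integral => //.
  - exact/measurable_EFinP.
  - exact: (measurable_fun_fubini_tonelli_F (fun p => (g p)%:E)).
  move=> x _.
  (* [convB_diff] compares real integrals; the extended integral of a non-integrable [g (x, .)] is
     infinite, and then the bound is trivial. *)
  have [i|ni] := pselect (Rint leb setT (fun w => g (x, w))).
    by rewrite Rint_EFin// lee_fin convB_diff.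
  have mgx : measurable_fun setT (fun w => g (x, w)).
    by apply/measurable_EFinP; exact: (measurableT_comp mg (measurable_pair1 _)).
  rewrite (_ : integral _ _ _ = +oo%E) ?leey//.
  apply/eqP; rewrite eq_le leey/= leNgt; apply/negP => h; apply: ni.
  apply: RintP => //; under eq_integral => w _ do rewrite (ger0_norm (g0' (x, w))).
  exact: h.
rewrite (fubini_tonelli (fun p => (g p)%:E))//=.
apply: (@le_trans _ _ (\int[leb]_w (e * moll n w)%:E)%E).
  apply: ge0_le_integral => //.
  - by move=> w _; apply: integral_ge0.
  - exact: (measurable_fun_fubini_tonelli_G (fun p => (g p)%:E)).
  - by apply/measurable_EFinP; apply: (@Rint_meas _ _ _ leb); apply: RintZ; exact: moll_Rint.
  move=> w _; rewrite (Rint_EFin (f := fun x => g (x, w))); last first.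
    exact: (RintZr (moll n w) (Rint_tdiff w fi)).
  rewrite lee_fin /g /= RIntZr; last exact: Rint_tdiff.
  have [wn|wn] := leP `|w| n.+1%:R^-1.
    by rewrite ler_wpM2r ?moll_ge0// Hr// (le_trans wn)// ltW.
  by rewrite moll_supp// !mulr0.
rewrite Rint_EFin; last by apply: RintZ; exact: moll_Rint.
by rewrite RIntZ ?moll_mass ?mulr1//; exact: moll_Rint.
Qed.

Lemma conv_local n f (r : R) x : `|x| <= r ->
  conv n (fun z => f z * \1_[set y : V | `|y| <= r + 1] z) x = conv n f x.
Proof.
move=> xr; apply: eq_Rintegral => z _; rewrite indicE.
have [zr|zr] := boolP (z \in _); first by rewrite mulr1.
rewrite mulr0 mul0r moll_supp ?mulr0//.
move: zr; rewrite notin_setE /= => /negP; rewrite -ltNge => zr.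
apply: (@le_lt_trans _ _ 1); first by rewrite invf_le1// ler1n.
by apply: lt_le_trans (lerB_dist _ _); rewrite ltrBrDr (le_lt_trans _ zr)// addrC lerD2r.
Qed.

Lemma Rint_ball_indic f (r : R) : L1_loc f ->
  Rint leb setT (fun z => f z * \1_[set y : V | `|y| <= r] z).
Proof.
move=> fl; apply: (L1_loc_mul (r := r) (C := 1) fl).
- by apply: measurable_indic; exact: closed_ball_measurable.
- by move=> z; rewrite indicE; case: (_ \in _); rewrite ?normr0 ?normr1.
- by move=> z rz; rewrite indicE memNset//= => /(lt_le_trans rz); rewrite ltxx.
Qed.

(** The mollifiers have radius at most 1, so on the ball of radius [r] only the values of [f] on the
    ball of radius r + 1 matter, and there [f] is integrable. *)
Lemma conv_L1loc_cvg f (r : R) : L1_loc f ->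
  \int[leb]_x (`|conv n f x - f x| * \1_[set y : V | `|y| <= r] x) @[n --> \oo] --> 0.
Proof.
move=> fl; have f1i := Rint_ball_indic (r + 1) fl.
set f1 := (fun z => f z * _) in f1i.
have i1 n : Rint leb setT (fun x => `|conv n f1 x - f1 x|).
  have := ge0_integral_conv n (Rint_abs f1i) (fun x => normr_ge0 _) => -[i _].
  apply: (Rint_le _ (RintD i (Rint_abs f1i))).
    apply: measurableT_comp => //; apply: measurable_funB; last exact: Rint_meas f1i.
    exact: continuous_measurable_rV (@conv_continuous n _ (Rint_L1_loc f1i)).
  move=> x _; rewrite normr_id (le_trans (ler_normB _ _))// lerD2r.
  have := le_norm_RInt (conv_Rint n x (Rint_L1_loc f1i)).
  by under [X in _ <= X -> _]eq_Rintegral => z _ do rewrite normrM [`|moll _ _|]ger0_norm ?moll_ge0//.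
have mB := @closed_ball_measurable R d r.
apply: (@squeeze_cvgr _ _ _ _ (fun=> 0) (fun n => \int[leb]_x `|conv n f1 x - f1 x|)).
- apply: nearW => n; rewrite Rintegral_ge0 ?andTb; last by move=> x _; rewrite mulr_ge0// indicE ler0n.
  have E x : `|conv n f x - f x| * \1_[set y : V | `|y| <= r] x =
             \1_[set y : V | `|y| <= r] x * `|conv n f1 x - f1 x|.
    rewrite indicE; have [xr|xr] := boolP (x \in _); last by rewrite mulr0 mul0r.
    rewrite mulr1 mul1r; move: xr; rewrite inE /= => xr.
    rewrite /f1 conv_local// indicE mem_set ?mulr1//=.
    by rewrite (le_trans xr)// lerDl.
  under eq_Rintegral do rewrite E.
  apply: le_RInt => //.
  + apply: (RintMb (C := 1) (i1 n)); first exact: measurable_indic.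
    by move=> x _; rewrite indicE; case: (_ \in _); rewrite ?normr0 ?normr1.
  + by move=> x _; rewrite ler_piMl// indicE; case: (_ \in _).
- exact: cvg_cst.
exact: conv_L1_cvg.
Qed.

(** Optimising the free weight at s = |u| / p recovers the quadratic inequality. For p = 0 the
    weight (q + 1) / |u| forces u = 0. *)
Lemma cauchy_schwarz_scalar (u p q : R) : 0 <= p -> 0 <= q ->
  (forall s, 0 < s -> 2 * `|u| <= s * p + s^-1 * q) -> u ^+ 2 <= p * q.
Proof.
move=> p0 q0 H; rewrite -real_normK ?num_real//; set U := `|u| in H *.
have U0 : 0 <= U by exact: normr_ge0.
have [pz|pp] := eqVneq p 0.
  rewrite pz mul0r; have [->|Un] := eqVneq U 0; first by rewrite expr0n.
  have Up : 0 < U by rewrite lt0r Un.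
  have s0 : 0 < (q + 1) / U by rewrite divr_gt0// ltr_wpDl.
  have := H _ s0; rewrite pz mulr0 add0r invf_div mulrAC ler_pdivlMr ?ltr_wpDl//; nra.
have pgt : 0 < p by rewrite lt0r pp.
have [->|Un] := eqVneq U 0; first by rewrite expr0n mulr_ge0.
have Up : 0 < U by rewrite lt0r Un.
have s0 : 0 < U / p by rewrite divr_gt0.
have := H _ s0; rewrite divfK ?gt_eqF// invf_div mulrAC.
rewrite -lerBlDl (_ : 2 * U - U = U); last by ring.
by rewrite ler_pdivlMr// -expr2.
Qed.

(** Jensen's inequality in a form that is linear in the data: pointwise, 2|u| is at most s p + q / s
    for every s > 0, which can be integrated against the mollifier before [s] is optimised. *)
Lemma conv_cauchy_schwarz n (u p q : V -> R) x : L1_loc u -> L1_loc p -> L1_loc q ->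
  (forall y, 0 <= p y) -> (forall y, 0 <= q y) -> (forall y, u y ^+ 2 <= p y * q y) ->
  conv n u x ^+ 2 <= conv n p x * conv n q x.
Proof.
move=> ul pl ql p0 q0 upq.
have iu := conv_Rint n x ul; have ip := conv_Rint n x pl; have iq := conv_Rint n x ql.
apply: cauchy_schwarz_scalar; [exact: conv_ge0|exact: conv_ge0|move=> s s0].
rewrite -!RIntZ// -RIntD; [|exact: RintZ|exact: RintZ].
apply: (@le_trans _ _ (2 * \int[leb]_z `|u z * moll n (z - x)|)).
  by rewrite ler_wpM2l// le_norm_RInt.
rewrite -RIntZ; last exact: Rint_abs.
apply: le_RInt.
- by apply: RintZ; exact: Rint_abs.
- by apply: RintD; exact: RintZ.
move=> z _; have mz := @moll_ge0 R d n (z - x).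
suff H : 2 * `|u z| <= s * p z + s^-1 * q z.
  rewrite normrM (ger0_norm mz) !mulrA -mulrDl.
  exact: ler_wpM2r.
have sp : 0 <= s * p z by rewrite mulr_ge0 // ltW.
have sq : 0 <= s^-1 * q z by rewrite mulr_ge0// invr_ge0 ltW.
have : `|u z| ^+ 2 <= (s * p z) * (s^-1 * q z).
  by rewrite real_normK ?num_real// mulrACA divff ?gt_eqF// mul1r.
move: sp sq; set A := s * p z; set B := s^-1 * q z; move=> A0 B0 AB.
have h1 : 0 <= 2 * `|u z| by rewrite mulr_ge0.
have h2 : 0 <= A + B by exact: addr_ge0.
rewrite -ler_sqr ?nnegrE//.
have := sqr_ge0 (A - B); rewrite exprMn; nra.
Qed.

End convolution.

Section is_derive_comp.
Context (R : realType) (V : normedModType R).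

Lemma cvg0D (u v : nat -> R) : u n @[n --> \oo] --> (0 : R) -> v n @[n --> \oo] --> (0 : R) ->
  u n + v n @[n --> \oo] --> (0 : R).
Proof. by move=> u0 v0; rewrite -[X in _ --> X](addr0 0); exact: cvgD. Qed.

Lemma is_derive_comp (F : V -> R) (g : R -> R) (x v : V) (a b : R) :
  is_derive x v F a -> is_derive (F x) (1 : R) g b ->
  is_derive x v (fun y => g (F y)) (b * a).
Proof.
move=> dF dg; apply: is_derive_of_line.
have E : x + (0 : R) *: v = x by rewrite scale0r addr0.
have H : is_derive (0 : R) (1 : R) (fun h : R => F (x + h *: v)) a.
  apply: is_derive_eq (is_derive_line _) _; rewrite E; first by case: dF.
  exact: derive_val.
by apply: (is_derive1_comp (f := g) (g := fun h : R => F (x + h *: v))); rewrite E.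
Qed.

End is_derive_comp.

(** * Weak gradients *)

Section weak_gradient.
Context (R : realType) (d : nat).
Local Notation leb := (lebesgue_rV R d).
Local Notation V := 'rV[R]_d.
Local Notation conv n := (cv (@moll R d n)).
Local Notation e_ i := (delta_mx 0 i : V).
Local Notation ball_ r := [set y : V | `|y| <= r].
Implicit Types (f g : V -> R) (G : V -> V).

Lemma L1_loc_le f g : measurable_fun setT g -> L1_loc f ->
  (forall x, `|g x| <= `|f x|) -> L1_loc g.
Proof.
move=> mg [mf fK] gf; split=> // K cK; apply: le_lt_trans (fK _ cK).
apply: ge0_le_integral => //; first exact: compact_measurable_rV.
- by apply/measurable_EFinP; apply: measurableT_comp => //; exact: measurable_funTS.
- by apply/measurable_EFinP; apply: measurableT_comp => //; exact: measurable_funTS.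
by move=> x _; rewrite lee_fin.
Qed.

Lemma L1_loc_Rint f (K : set V) : compact K -> L1_loc f -> Rint leb K f.
Proof.
move=> cK [mf fK]; apply: RintP; [exact: compact_measurable_rV|exact: measurable_funTS|exact: fK].
Qed.

Lemma L1_locP f : measurable_fun setT f -> (forall K, compact K -> Rint leb K f) -> L1_loc f.
Proof. by move=> mf H; split => // K /H/Rint_lty. Qed.

Lemma L1_locD f g : L1_loc f -> L1_loc g -> L1_loc (fun x => f x + g x).
Proof.
move=> fl gl; apply: L1_locP; first by apply: measurable_funD; [case: fl|case: gl].
by move=> K cK; apply: RintD; exact: L1_loc_Rint.
Qed.

Lemma L1_locZ k f : L1_loc f -> L1_loc (fun x => k * f x).
Proof.
move=> fl; apply: L1_locP; first by apply: measurable_funM => //; case: fl.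
by move=> K cK; apply: RintZ; exact: L1_loc_Rint.
Qed.

Lemma L1_locB f g : L1_loc f -> L1_loc g -> L1_loc (fun x => f x - g x).
Proof.
move=> fl gl; have := L1_locD fl (L1_locZ (-1) gl).
by congr L1_loc; apply/funext => x; rewrite mulN1r.
Qed.

Lemma L1_loc_abs f : L1_loc f -> L1_loc (fun x => `|f x|).
Proof.
move=> fl; apply: (L1_loc_le _ fl); first by apply: measurableT_comp => //; case: fl.
by move=> x; rewrite normr_id.
Qed.

Lemma L1_locMb f g (C : R) : L1_loc f -> measurable_fun setT g ->
  (forall x, `|g x| <= C) -> L1_loc (fun x => g x * f x).
Proof.
move=> fl mg gC; apply: (L1_loc_le _ (L1_locZ C fl)).
  by apply: measurable_funM => //; case: fl.
by move=> x; rewrite !normrM ler_wpM2r// (le_trans (gC x))// ler_norm.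
Qed.

Lemma L1_loc_cst (c : R) : L1_loc (fun _ : V => c).
Proof.
split=> // K cK; rewrite integral_cst//; last exact: compact_measurable_rV.
have /compact_bounded[M [_ HM]] := cK.
suff : (leb K < +oo)%E by move=> h; rewrite lte_mul_pinfty.
apply: le_lt_trans (leb_ball_lty d (`|M| + 1)); apply: le_measure; rewrite ?inE.
- exact: compact_measurable_rV.
- exact: closed_ball_measurable.
- by move=> x /HM; apply; rewrite (le_lt_trans (ler_norm M))// ltrDl.
Qed.

Lemma continuous_L1_loc f : continuous f -> L1_loc f.
Proof.
move=> cf; split; first exact: continuous_measurable_rV.
move=> K cK; have /compact_bounded[M [_ HM]] := cK.
have [C C0 fC] := continuous_bounded_on_ball (`|M| + 1) cf.
have [_ /(_ K cK)] := L1_loc_cst C; apply: le_lt_trans.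
apply: ge0_le_integral => //; first exact: compact_measurable_rV.
- apply/measurable_EFinP; apply: measurableT_comp => //; apply: measurable_funTS.
  exact: continuous_measurable_rV.
move=> x Kx; rewrite lee_fin (le_trans (fC x _)) ?ler_norm//.
by apply: HM => //; rewrite (le_lt_trans (ler_norm M))// ltrDl.
Qed.

Lemma test_functionP (phi : V -> R) : test_function [set: V] phi ->
  exists2 r, vanishes_off r phi & forall v, C1dir v phi.
Proof.
move=> [sphi cphi _]; have /compact_bounded[M [_ HM]] := cphi.
exists (`|M| + 1) => [x Mx|v]; last first.
  have [c H] := sphi 1%N; split => //; first by move=> x; case: (H v).
  by have [_ []] := H v.
apply/eqP; apply: contraTT Mx => px; rewrite -leNgt.
apply: HM; first by rewrite (le_lt_trans (ler_norm M))// ltrDl.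
exact: subset_closure.
Qed.

Lemma moll_test n (x : V) : test_function [set: V] (fun z => @moll R d n (z - x)).
Proof.
apply: (test_function_translate (r := n.+1%:R^-1)); first exact: moll_smooth.
exact: moll_supp.
Qed.

Lemma conv_weak_grad n f G x i : L1_loc f -> is_weak_grad f G ->
  is_derive x (e_ i) (conv n f) (conv n (fun y => G y 0 i) x).
Proof.
move=> fl [Gl wG].
have := cv_derive x (@moll_C1dir R d n (e_ i)) (@moll_vanishes R d n) fl.
move=> H; apply: is_derive_eq H _; rewrite /cv.
have := wG _ (moll_test n x) i.
under eq_Rintegral do rewrite derive_translate.
by move=> ->; rewrite opprK.
Qed.

Lemma ae_eq_local f g : measurable_fun setT f -> measurable_fun setT g ->
  (forall r : R, \int[leb]_x (`|f x - g x| * \1_(ball_ r) x) = 0) ->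
  (L1_loc f) -> (L1_loc g) -> {ae leb, forall x, f x = g x}.
Proof.
move=> mf mg H fl gl.
have : {ae leb, forall x, forall n : nat, `|x| <= n%:R -> f x = g x}.
  apply: ae_foralln => n.
  have mI : measurable_fun setT (fun x => `|f x - g x| * \1_(ball_ n%:R) x).
    apply: measurable_funM; last by apply: measurable_indic; exact: closed_ball_measurable.
    by apply: measurableT_comp => //; exact: measurable_funB.
  have i := Rint_ball_indic n%:R (L1_loc_abs (L1_locB fl gl)).
  have : (\int[leb]_x `|(`|f x - g x| * \1_(ball_ n%:R) x)%:E| = 0)%E.
    under eq_integral do rewrite gee0_abs ?lee_fin ?mulr_ge0//.
    by rewrite Rint_EFin// H.
  move/(ae_eq_integral_abs leb measurableT (_ : measurable_fun _ (EFin \o (fun x => `|f x - g x| * \1_(ball_ n%:R) x)))) => h.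
  have {h} := h ltac:(exact/measurable_EFinP).
  apply: filterS => x /(_ I) [] /eqP + xn.
  by rewrite indicE mem_set// mulr1 normr_eq0 subr_eq0 => /eqP.
apply: filterS => x H1; apply: (H1 (Num.truncn `|x|).+1).
by apply: ltW; exact: truncnS_gt.
Qed.

Lemma ae_eq_of_conv f g : L1_loc f -> L1_loc g ->
  (forall n x, conv n f x = conv n g x) -> {ae leb, forall x, f x = g x}.
Proof.
move=> fl gl H; apply: ae_eq_local; [by case: fl|by case: gl| |by []|by []].
move=> r; set I := \int[leb]_x _.
have fg n : I <= \int[leb]_x (`|conv n f x - f x| * \1_(ball_ r) x) + \int[leb]_x (`|conv n g x - g x| * \1_(ball_ r) x).
  have i1 (h : V -> R) : L1_loc h -> Rint leb setT (fun x => `|conv n h x - h x| * \1_(ball_ r) x).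
    move=> hl; apply: Rint_ball_indic; apply: L1_loc_abs; apply: L1_locB => //.
    by apply: continuous_L1_loc; exact: conv_continuous.
  rewrite -RIntD; [|exact: i1|exact: i1].
  apply: le_RInt; first by apply: Rint_ball_indic; apply: L1_loc_abs; exact: L1_locB.
    by apply: RintD; exact: i1.
  move=> x _; rewrite -mulrDl ler_wpM2r// H distrC (le_trans _ (ler_normB _ _))//.
  by rewrite (_ : _ - _ - _ = g x - f x) ?ler_norm//; rewrite ?(distrC (g x)) //; ring.
apply/eqP; rewrite eq_le; apply/andP; split; last by apply: Rintegral_ge0 => x _; rewrite mulr_ge0.
apply: (cvgr_to_ge (cvg0D (conv_L1loc_cvg r fl) (conv_L1loc_cvg r gl))).
exact: nearW.
Qed.

(** Both fields have the same mollifications, namely the classical derivatives of [conv n f]. *)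
Lemma is_weak_grad_unique f G G' : L1_loc f -> is_weak_grad f G -> is_weak_grad f G' ->
  {ae leb, forall x, G x = G' x}.
Proof.
move=> fl wG wG'.
have : {ae leb, forall x, forall i, G x 0 i = G' x 0 i}.
  apply: (filter_forall (f := fun i x => G x 0 i = G' x 0 i)) => i.
  have [Gl _] := wG; have [Gl' _] := wG'.
  apply: ae_eq_of_conv => // n x.
  have h1 := conv_weak_grad n x i fl wG; have h2 := conv_weak_grad n x i fl wG'.
  by rewrite -(@derive_val _ _ _ _ _ _ _ h1) -(@derive_val _ _ _ _ _ _ _ h2).
by apply: filterS => x H; apply/rowP => i; exact: H.
Qed.

Lemma C1dir_is_derive v f f' : continuous f -> (forall x, is_derive x v f (f' x)) ->
  continuous f' -> C1dir v f /\ 'D_v f = f'.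
Proof.
move=> cf df cf'; have E : 'D_v f = f'.
  by apply/funext => x; have := df x => h; exact: derive_val.
by split => //; split; [by []|by move=> x; case: (df x)|rewrite E].
Qed.

Lemma C1dirM v f g : C1dir v f -> C1dir v g -> C1dir v (fun x => f x * g x).
Proof.
move=> [cf df cDf] [cg dg cDg]; split.
- exact: ctsM.
- by move=> x; exact: derivableM.
rewrite (_ : 'D_v _ = fun x => f x * 'D_v g x + g x * 'D_v f x).
  by apply: ctsD; exact: ctsM.
by apply/funext => x; rewrite deriveM.
Qed.

Lemma integration_by_parts_rV (r : R) v f g : C1dir v f -> C1dir v g -> vanishes_off r g ->
  \int[leb]_x (f x * 'D_v g x) = - \int[leb]_x ('D_v f x * g x).
Proof.
move=> Cf Cg gr.
have fgr : vanishes_off r (fun x => f x * g x) by move=> x xr; rewrite gr ?mulr0.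
have := Rintegral_derive (C1dirM Cf Cg) fgr.
have [cf df cDf] := Cf; have [cg dg cDg] := Cg.
have Dgr := vanishes_derive v gr.
under eq_Rintegral do rewrite deriveM//.
have i1 : Rint leb setT (fun x => f x * 'D_v g x).
  by apply: (Rint_Cc (r := r)); [exact: ctsM|move=> x xr; rewrite Dgr ?mulr0].
have i2 : Rint leb setT (fun x => g x * 'D_v f x).
  by apply: (Rint_Cc (r := r)); [exact: ctsM|move=> x xr; rewrite gr ?mul0r].
rewrite RIntD//= => /eqP; rewrite addr_eq0 => /eqP ->; congr (- _).
by apply: eq_Rintegral => x _; rewrite mulrC.
Qed.

(** The classical chain rule holds for [conv n f]. In the limit a bounded factor converging only
    along subsequences multiplies a factor converging in L^1, which is the situation of
    [Rint_GDCT]. *)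
Lemma chain_rule_weak_grad f G (g g1 : R -> R) (C : R) : L1_loc f -> is_weak_grad f G ->
  (forall x : R, is_derive x 1 g (g1 x)) -> continuous g1 -> (forall x, `|g1 x| <= C) ->
  L1_loc (fun x => g (f x)) /\ is_weak_grad (fun x => g (f x)) (fun x => g1 (f x) *: G x).
Proof.
move=> fl wG dg cg1 g1C; have [Gl wG'] := wG; have [mf _] := fl.
have C0 : 0 <= C by exact: le_trans (normr_ge0 _) (g1C 0).
have cg : continuous g := is_derive_continuous dg.
have gL a b : `|g a - g b| <= C * `|a - b|.
  wlog ab : a b / b <= a.
    move=> W; have [/W//|/ltW/W] := leP b a; by rewrite distrC [X in _ <= _ * X]distrC.
  have [x _ ->] := MVT_is_derive ab (fun x _ => dg x).
  by rewrite normrM ler_wpM2r.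
have mg : measurable_fun setT g by exact: continuous_measurable_fun.
have mg1 : measurable_fun setT g1 by exact: continuous_measurable_fun.
have gfl : L1_loc (fun x => g (f x)).
  have : L1_loc (fun x => C * `|f x| + `|g 0|).
    by apply: L1_locD; [apply: L1_locZ; exact: L1_loc_abs|exact: L1_loc_cst].
  move=> cl; apply: (L1_loc_le _ cl); first exact: measurableT_comp mg mf.
  move=> x; rewrite [X in _ <= X]ger0_norm ?addr_ge0 ?mulr_ge0//.
  have := gL (f x) 0; rewrite subr0; have := ler_normD (g (f x) - g 0) (g 0); rewrite subrK; lra.
have Gl' i : L1_loc (fun y => (g1 (f y) *: G y) 0 i).
  under [X in L1_loc X]eq_fun do rewrite mxE.
  exact: (L1_locMb (Gl i) (measurableT_comp mg1 mf) (fun x => g1C _)).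
split => //; split => // phi tphi i.
have [r pr /(_ (e_ i))pC1] := test_functionP tphi; have [cp dp cDp] := pC1.
have Dpr := vanishes_derive (e_ i) pr.
have [P P0 pP] := continuous_bounded_support cp pr.
have [Q Q0 pQ] := continuous_bounded_support cDp Dpr.
(* A single error for the function and its gradient: along any subsequence on which it vanishes at
   [x], both mollifications converge there. *)
pose e n x := `|conv n f x - f x| * \1_(ball_ r) x + `|conv n (fun y => G y 0 i) x - G x 0 i| * \1_(ball_ r) x.
have ie n : Rint leb setT (e n).
  apply: RintD; apply: Rint_ball_indic; apply: L1_loc_abs; apply: L1_locB => //; apply: continuous_L1_loc; exact: conv_continuous.
have e0 n x : 0 <= e n x by rewrite addr_ge0// mulr_ge0.
have ecv : \int[leb]_x e n x @[n --> \oo] --> 0.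
  apply: cvg_trans (cvg0D (conv_L1loc_cvg r fl) (conv_L1loc_cvg r (Gl i))).
  apply: near_eq_cvg; apply: nearW => n.
  rewrite /e RIntD//; apply: Rint_ball_indic; apply: L1_loc_abs; apply: L1_locB => //; apply: continuous_L1_loc; exact: conv_continuous.
have ibp n : \int[leb]_x (g (conv n f x) * 'D_(e_ i) phi x) =
    - \int[leb]_x (g1 (conv n f x) * conv n (fun y => G y 0 i) x * phi x).
  have cfn := @conv_continuous R d n f fl.
  have cgfn : continuous (fun x => g (conv n f x)).
    by move=> x; apply: (continuous_comp (cfn x)); exact: cg.
  have cg1fn : continuous (fun x => g1 (conv n f x)).
    by move=> x; apply: (continuous_comp (cfn x)); exact: cg1.
  have cGn := @conv_continuous R d n _ (Gl i).
  have dgfn x : is_derive x (e_ i) (fun x => g (conv n f x)) (g1 (conv n f x) * conv n (fun y => G y 0 i) x).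
    exact: (is_derive_comp (conv_weak_grad n x i fl wG) (dg _)).
  have [Cgf Egf] := C1dir_is_derive cgfn dgfn (ctsM cg1fn cGn).
  rewrite (integration_by_parts_rV Cgf pC1 pr); congr (- _); apply: eq_Rintegral => x _.
  by congr (_ * _); exact: (@derive_val _ _ _ _ _ _ _ (dgfn x)).
have pt1 x psi : (forall k, (k <= psi k)%N) -> e (psi k) x @[k --> \oo] --> 0 -> `|x| <= r ->
    conv (psi k) f x @[k --> \oo] --> f x /\ conv (psi k) (fun y => G y 0 i) x @[k --> \oo] --> G x 0 i.
  move=> _ ex xr; split; apply/subr_cvg0; apply: norm_cvg0; apply: (squeeze_cvgr _ (cvg_cst 0) ex);
    by apply: nearW => k; rewrite normr_ge0 /e indicE mem_set//= !mulr1 ?lerDl ?lerDr.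
have off x : ~ (`|x| <= r) -> phi x = 0 /\ 'D_(e_ i) phi x = 0.
  by move/negP; rewrite -ltNge => xr; split; [exact: pr|exact: Dpr].
have mconv n h : L1_loc h -> measurable_fun setT (conv n h).
  by move=> hl; apply: continuous_measurable_rV; exact: conv_continuous.
have mphi := continuous_measurable_rV cp; have mDphi := continuous_measurable_rV cDp.
have L : \int[leb]_x (g (conv n f x) * 'D_(e_ i) phi x) @[n --> \oo] --> \int[leb]_x (g (f x) * 'D_(e_ i) phi x).
  apply: (Rint_GDCT (h := fun x => `|g (f x) * 'D_(e_ i) phi x|) (C := C * Q) ie) => //.
  - move=> n; apply: measurable_funM => //; apply: (measurableT_comp mg); exact: mconv.
  - by apply: measurable_funM => //; exact: (measurableT_comp mg).
  - apply: Rint_abs; exact: (L1_loc_mul gfl mDphi pQ Dpr).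
  - by rewrite mulr_ge0// ltW.
  - move=> n; apply: aeW => x _; have [xr|xr] := pselect (`|x| <= r); last first.
      by have [_ ->] := off x xr; rewrite !mulr0 normr0 add0r mulr_ge0// mulr_ge0// ltW.
    have H1 := gL (conv n f x) (f x).
    have H2 : `|conv n f x - f x| <= e n x by rewrite /e indicE mem_set//= !mulr1 lerDl.
    rewrite !normrM -lerBlDl -mulrBl (le_trans (ler_wpM2r (normr_ge0 _) (lerB_dist _ _)))//.
    rewrite (le_trans (ler_wpM2r (normr_ge0 _) H1))// -!mulrA ler_wpM2l// mulrC.
    by rewrite ler_pM.
  - apply: aeW => x _ psi psik ex; have [xr|xr] := pselect (`|x| <= r); last first.
      have [_ ->] := off x xr; rewrite !mulr0 (_ : (fun k => _) = fun=> 0); first exact: cvg_cst.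
      by apply/funext => k; rewrite mulr0.
    have [cf _] := pt1 x psi psik ex xr.
    apply: cvgM; last exact: cvg_cst.
    exact: (cvg_comp _ _ cf (cg _)).
have Rr : \int[leb]_x (g1 (conv n f x) * conv n (fun y => G y 0 i) x * phi x) @[n --> \oo] -->
    \int[leb]_x ((g1 (f x) *: G x) 0 i * phi x).
  apply: (Rint_GDCT (h := fun x => C * `|G x 0 i * phi x|) (C := C * P) ie) => //.
  - move=> n; apply: measurable_funM => //; apply: measurable_funM; last exact: mconv.
    by apply: (measurableT_comp mg1); exact: mconv.
  - by apply: measurable_funM => //; case: (Gl' i).
  - by apply: RintZ; apply: Rint_abs; exact: (L1_loc_mul (Gl i) mphi pP pr).
  - by rewrite mulr_ge0// ltW.
  - move=> n; apply: aeW => x _; have [xr|xr] := pselect (`|x| <= r); last first.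
      by have [-> _] := off x xr; rewrite !mulr0 normr0 mulr0 add0r mulr_ge0// mulr_ge0// ltW.
    have H2 : `|conv n (fun y => G y 0 i) x - G x 0 i| <= e n x by rewrite /e indicE mem_set//= !mulr1 lerDr.
    rewrite !normrM -!mulrA (le_trans (ler_wpM2r _ (g1C _)))// ?mulr_ge0//.
    rewrite -mulrDr ler_wpM2l//.
    rewrite -lerBlDl -mulrBl (le_trans (ler_wpM2r (normr_ge0 _) (lerB_dist _ _)))//.
    by rewrite mulrC ler_pM.
  - apply: aeW => x _ psi psik ex; have [xr|xr] := pselect (`|x| <= r); last first.
      have [-> _] := off x xr; rewrite !mulr0 (_ : (fun k => _) = fun=> 0); first exact: cvg_cst.
      by apply/funext => k; rewrite mulr0.
    have [cf cG] := pt1 x psi psik ex xr.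
    apply: cvgM; last exact: cvg_cst.
    rewrite mxE; apply: cvgM => //; exact: (cvg_comp _ _ cf (cg1 _)).
apply: (cvg_unique _ L); first exact: norm_hausdorff.
rewrite (_ : (fun n => _) = (fun n => - \int[leb]_x (g1 (conv n f x) * conv n (fun y => G y 0 i) x * phi x))); last exact/funext.
exact: cvgN.
Qed.

Lemma is_weak_gradZ f G k : L1_loc f -> is_weak_grad f G -> is_weak_grad (fun x => k * f x) (fun x => k *: G x).
Proof.
move=> fl [Gl wG]; split=> [i|phi tphi i].
  by under [X in L1_loc X]eq_fun do rewrite mxE; exact: L1_locZ.
have [r pr /(_ (e_ i))[cp dp cDp]] := test_functionP tphi.
under eq_Rintegral do rewrite -mulrA.
rewrite RIntZ; last exact: (L1_loc_Cc fl cDp (vanishes_derive _ pr)).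
rewrite wG// mulrN; congr (- _); rewrite -RIntZ; last exact: (L1_loc_Cc (Gl i) cp pr).
by apply: eq_Rintegral => x _; rewrite mxE mulrA.
Qed.

Lemma is_weak_gradB f g G H : L1_loc f -> L1_loc g -> is_weak_grad f G -> is_weak_grad g H ->
  is_weak_grad (fun x => f x - g x) (fun x => G x - H x).
Proof.
move=> fl gl [Gl wG] [Hl wH]; split=> [i|phi tphi i].
  by under [X in L1_loc X]eq_fun do rewrite !mxE; exact: L1_locB.
have [r pr /(_ (e_ i))[cp dp cDp]] := test_functionP tphi.
have Dpr := vanishes_derive (e_ i) pr.
under eq_Rintegral do rewrite mulrBl.
rewrite RIntB; [|exact: (L1_loc_Cc fl cDp Dpr)|exact: (L1_loc_Cc gl cDp Dpr)].
rewrite wG// wH// opprK addrC -opprB; congr (- _).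
rewrite -RIntB; [|exact: (L1_loc_Cc (Gl i) cp pr)|exact: (L1_loc_Cc (Hl i) cp pr)].
by apply: eq_Rintegral => x _; rewrite !mxE mulrBl.
Qed.

(* [x - a atan (x / a)] is a C1 approximation of [x] whose derivative vanishes at 0
   only, so that in the limit a -> 0 the gradient of [f] is supported in [f <> 0]. *)
Lemma weak_grad_zero f G : L1_loc f -> is_weak_grad f G ->
  {ae leb, forall x, f x = 0 -> G x = 0}.
Proof.
move=> fl wG; have [Gl wG'] := wG; have [mf _] := fl.
pose a (k : nat) : R := k.+1%:R^-1.
have a0 k : 0 < a k by rewrite invr_gt0.
have acv : a k @[k --> \oo] --> 0 by exact: cvg_harmonic.
pose h k (x : R) := x - a k * atan (x / a k).
pose h1 k (x : R) := x ^+ 2 / (x ^+ 2 + a k ^+ 2).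
have den k (x : R) : 0 < x ^+ 2 + a k ^+ 2 by rewrite ltr_wpDl ?sqr_ge0 ?exprn_gt0.
have dh k (x : R) : is_derive x 1 (h k) (h1 k x).
  have d1 : is_derive x 1 (fun y : R => y / a k) (a k)^-1.
    rewrite (_ : (fun y => _) = (a k)^-1 \*: id); last by apply/funext => y /=; rewrite mulrC.
    by apply: is_derive_eq (is_deriveZ _ (is_derive_id _ _)) _; rewrite /GRing.scale /= mulr1.
  have d2 : is_derive x 1 (atan \o (fun y : R => y / a k)) ((1 + (x / a k) ^+ 2)^-1 * (a k)^-1).
    by apply: is_derive1_comp.
  have d3 := is_deriveB (@is_derive_id R R x 1) (is_deriveZ (a k) d2).
  apply: is_derive_eq d3 _; rewrite /GRing.scale /= /h1.
  have := den k x; have := a0 k; move=> ak dk; field.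
  by rewrite !gt_eqF//= addrC dk.
have h1b k x : `|h1 k x| <= 1.
  by rewrite ger0_norm ?divr_ge0 ?sqr_ge0 ?(ltW (den _ _))// ler_pdivrMr// mul1r lerDl sqr_ge0.
have ch1 k : continuous (h1 k).
  move=> x; apply: cvgM; first exact: exprn_continuous.
  apply: cvgV; first by rewrite gt_eqF.
  by apply: cvgD; [exact: exprn_continuous|exact: cvg_cst].
have wk k := chain_rule_weak_grad fl wG (dh k) (ch1 k) (h1b k).
have hf k x : `|h k x - x| <= a k * 2.
  rewrite /h addrAC subrr add0r normrN normrM (ger0_norm (ltW (a0 k))) ler_wpM2l ?(ltW (a0 k))//.
  have := atan_gtNpi2 (x / a k); have := atan_ltpi2 (x / a k); have := @pihalf_lt2 R; rewrite ler_norml.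
  lra.
have hcv x : h k x @[k --> \oo] --> x.
  apply/subr_cvg0; apply: norm_cvg0; apply: (@squeeze_cvgr _ _ _ _ (fun=> 0) (fun k => a k * 2)).
  - by apply: nearW => k; rewrite normr_ge0 hf.
  - exact: cvg_cst.
  by rewrite -[X in _ --> X](mul0r 2); apply: cvgM => //; exact: cvg_cst.
have h1cv x : h1 k x @[k --> \oo] --> (if x == 0 then 0 else 1 : R).
  case: ifPn => [/eqP ->|x0].
    by rewrite (_ : (fun k => _) = fun=> 0); [exact: cvg_cst|apply/funext => k; rewrite /h1 expr0n mul0r].
  have x20 : x ^+ 2 != 0 by rewrite expf_eq0.
  rewrite -[X in _ --> X](divff x20); apply: cvgM; first exact: cvg_cst.
  apply: cvgV => //; rewrite -[X in _ --> X]addr0; apply: cvgD; first exact: cvg_cst.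
  rewrite (_ : (fun k => a k ^+ 2) = (fun k => a k * a k)); last exact/funext.
  by rewrite -[X in _ --> X](mulr0 (0 : R)); exact: cvgM.
pose G0 x := (if f x == 0 then 0 else 1 : R) *: G x.
have mi : measurable_fun setT (fun x => if f x == 0 then 0 else 1 : R).
  rewrite (_ : (fun x => _) = \1_(f @^-1` [set~ 0])); last first.
    apply/funext => x; rewrite indicE; case: ifPn => [/eqP fx|/eqP fx].
      by rewrite memNset//= => /(_ fx).
    by rewrite mem_set.
  apply: measurable_indic; rewrite -[X in measurable X]setTI; apply: mf => //.
  by apply: measurableC; exact: measurable_set1.
have ib x : `|(if f x == 0 then 0 else 1 : R)| <= 1 by case: ifP => _; rewrite ?normr0 ?normr1.
have G0l i : L1_loc (fun x => G0 x 0 i).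
  by under [X in L1_loc X]eq_fun do rewrite mxE; exact: (L1_locMb (Gl i) mi ib).
suff wG0 : is_weak_grad f G0.
  have := is_weak_grad_unique fl wG wG0; apply: filterS => x + fx.
  by rewrite /G0 fx eqxx scale0r.
split=> // phi tphi i.
have [r pr /(_ (e_ i))[cp dp cDp]] := test_functionP tphi.
have Dpr := vanishes_derive (e_ i) pr.
have i1 := L1_loc_Cc fl cDp Dpr; have i2 := L1_loc_Cc (Gl i) cp pr.
have ihk k := L1_loc_Cc (wk k).1 cDp Dpr.
have iDphi : Rint leb setT ('D_(e_ i) phi) by exact: Rint_Cc cDp Dpr.
have L : \int[leb]_x (h k (f x) * 'D_(e_ i) phi x) @[k --> \oo] --> \int[leb]_x (f x * 'D_(e_ i) phi x).
  have [] // := @Rint_DCT _ _ R leb setT (fun k x => h k (f x) * 'D_(e_ i) phi x) _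
    (fun x => `|f x * 'D_(e_ i) phi x| + 2 * `|'D_(e_ i) phi x|) (fun k => Rint_meas (ihk k)) (Rint_meas i1).
  - by apply: aeW => x _; apply: cvgM; [exact: hcv|exact: cvg_cst].
  - by apply: RintD; [exact: Rint_abs|apply: RintZ; exact: Rint_abs].
  apply: aeW => x _ k; rewrite !normrM -mulrDl ler_wpM2r//.
  have := hf k (f x); have := ler_normD (h k (f x) - f x) (f x); rewrite subrK.
  have : a k <= 1 by rewrite /a invf_le1// ler1n.
  lra.
have Rr : \int[leb]_x ((h1 k (f x) *: G x) 0 i * phi x) @[k --> \oo] --> \int[leb]_x (G0 x 0 i * phi x).
  have iG0 := L1_loc_Cc (G0l i) cp pr.
  have ih1k k := L1_loc_Cc ((wk k).2.1 i) cp pr.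
  have [] // := @Rint_DCT _ _ R leb setT (fun k x => (h1 k (f x) *: G x) 0 i * phi x) _
    (fun x => `|G x 0 i * phi x|) (fun k => Rint_meas (ih1k k)) (Rint_meas iG0).
  - apply: aeW => x _; apply: cvgM; last exact: cvg_cst.
    under eq_cvg do rewrite mxE.
    by rewrite mxE; apply: cvgM; [exact: h1cv|exact: cvg_cst].
  - exact: Rint_abs.
  by apply: aeW => x _ k; rewrite mxE -mulrA normrM ler_piMl.
apply: (cvg_unique _ L); first exact: norm_hausdorff.
rewrite (_ : (fun k => _) = (fun k => - \int[leb]_x ((h1 k (f x) *: G x) 0 i * phi x))); last first.
  by apply/funext => k; rewrite (wk k).2.2.
exact: cvgN.
Qed.

End weak_gradient.

(** * Powers of the positive part and inversion of the nonlinearity L_F *)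

Section positive_power.
Context (R : realType).

(** The positive part is taken first, so that for a > 0 the power extends continuously by 0 to the
    whole line, where the chain rules are stated. *)
Definition ppow (a x : R) : R := Num.max x 0 `^ a.

Lemma ppow_gt0E a x : 0 <= x -> ppow a x = x `^ a.
Proof. by move=> x0; rewrite /ppow (max_idPl x0). Qed.

Lemma ppow_le0 a x : a != 0 -> x <= 0 -> ppow a x = 0.
Proof. by move=> a0 x0; rewrite /ppow (max_idPr x0) powR0. Qed.

Lemma ppow_ge0 a x : 0 <= ppow a x.
Proof. exact: powR_ge0. Qed.

Lemma ppow_continuous a : 0 < a -> continuous (ppow a).
Proof.
move=> a0; suff H (x : R) : {for x, continuous (ppow a)} by move=> x; exact: H.
 have an0 : a != 0 by rewrite gt_eqF.
have [x0|x0|->] := ltgtP x 0.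
- have dp : is_derive x 1 (ppow a) 0.
    apply: (@near_eq_is_derive _ _ _ (cst 0)); near=> y; rewrite ppow_le0//.
    by apply: ltW; near: y; exact: lt_nbhsl.
  by apply/differentiable_continuous/derivable1_diffP; case: dp.
- have cp : {for x, continuous (fun y : R => y `^ a)}.
    by apply/differentiable_continuous/derivable1_diffP; apply: derivable_powR; rewrite in_itv/= x0.
  rewrite /prop_for /continuous_at ppow_gt0E ?ltW//; apply: cvg_trans cp.
  apply: near_eq_cvg; near=> y; rewrite ppow_gt0E//.
  by apply: ltW; near: y; exact: lt_nbhsr.
- rewrite /prop_for /continuous_at ppow_le0//; apply/cvgr0Pnorm_lt => e e0.
  have /cvgr0Pnorm_lt/(_ _ e0) := powR_cvg0 a0.
  move=> [δ /= δ0 H]; exists δ => // y; rewrite /= sub0r normrN => yd.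
  have [y0|y0] := ltP 0 y; last by rewrite ppow_le0// normr0.
  by rewrite ppow_gt0E ?ltW//; apply: H => //=; rewrite sub0r normrN.
Unshelve. all: by end_near. Qed.

Lemma ppow_derive (a x : R) : 1 < a -> is_derive x 1 (ppow a) (a * ppow (a - 1) x).
Proof.
move=> a1; have a0 : 0 < a by exact: lt_trans a1.
have an0 : a != 0 by rewrite gt_eqF.
have a10 : 0 < a - 1 by rewrite subr_gt0.
have a1n0 : a - 1 != 0 by rewrite gt_eqF.
have [x0|x0|->] := ltgtP x 0.
- rewrite ppow_le0 ?(ltW x0)// mulr0; apply: (@near_eq_is_derive _ _ _ (cst 0)).
  by near=> y; rewrite ppow_le0//; apply: ltW; near: y; exact: lt_nbhsl.
- rewrite ppow_gt0E ?ltW//; apply: near_eq_is_derive (is_derive1_powR a x0).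
  by near=> y; rewrite ppow_gt0E//; apply: ltW; near: y; exact: lt_nbhsr.
- rewrite ppow_le0// mulr0.
  have cv : h^-1 *: ((ppow a \o shift 0) (h *: (1 : R)) - ppow a 0) @[h --> (0 : R)^'] --> (0 : R).
    have C : ppow (a - 1) h @[h --> (0 : R)^'] --> (0 : R).
      have := @ppow_continuous _ a10 0; rewrite /continuous_at ppow_le0// => H.
      by apply: cvg_trans H; apply: cvg_app; exact: nbhs_dnbhs.
    apply: cvg_trans C; apply: near_eq_cvg; near=> h.
    rewrite /= addr0 -[h *: 1]/(h * 1) mulr1 [ppow a 0]ppow_le0// subr0 /GRing.scale /=.
    have h0 : h != 0 by near: h; exact: nbhs_dnbhs_neq.
    have [hl|hg] := leP h 0; first by rewrite !ppow_le0// mulr0.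
    by rewrite !ppow_gt0E ?ltW// -(mulr_powRB1 (ltW hg) a0) mulKf.
  by apply: DeriveDef; [apply/cvg_ex; exists 0|apply/cvg_lim].
Unshelve. all: by end_near. Qed.

End positive_power.

Section porous.
Context (R : realType) (lambda eta m : R).
Hypotheses (lambda0 : 0 < lambda) (eta0 : 0 < eta) (m1 : 1 < m).

Let m0 : 0 < m. Proof. exact: lt_trans m1. Qed.
Let m10 : 0 < m - 1. Proof. by rewrite subr_gt0. Qed.

(* The extension of [LF] to the line; it is a C1 diffeomorphism. *)
Definition LFx (r : R) := lambda * r + eta * ppow m r.

Definition dLFx (r : R) := lambda + eta * m * ppow (m - 1) r.

Lemma LFxE r : 0 <= r -> LFx r = LF lambda eta m r.
Proof. by move=> r0; rewrite /LFx ppow_gt0E. Qed.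

Lemma LFx_derive (r : R) : is_derive r 1 LFx (dLFx r).
Proof.
have H := is_deriveD (is_deriveZ lambda (is_derive_id r (1 : R))) (is_deriveZ eta (ppow_derive r m1)).
by apply: is_derive_eq H _; rewrite /dLFx /GRing.scale /= mulr1 mulrA.
Qed.

Lemma dLFx_ge r : lambda <= dLFx r.
Proof. by rewrite lerDl !mulr_ge0// ?ppow_ge0// ltW. Qed.

Lemma dLFx_gt0 r : 0 < dLFx r.
Proof. exact: lt_le_trans (dLFx_ge r). Qed.

Lemma dLFx_continuous : continuous dLFx.
Proof.
move=> r; apply: cvgD; first exact: cvg_cst.
by apply: cvgM; [exact: cvg_cst|exact: ppow_continuous].
Qed.

Lemma LFx_mono a b : b <= a -> lambda * (a - b) <= LFx a - LFx b.
Proof.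
move=> ba; have [x _ ->] := MVT_is_derive ba (fun x _ => LFx_derive x).
by rewrite ler_wpM2r ?subr_ge0// dLFx_ge.
Qed.

Lemma LFx_expand a b : lambda * `|a - b| <= `|LFx a - LFx b|.
Proof.
wlog ba : a b / b <= a.
  by move=> W; have [/W//|/ltW/W] := leP b a; rewrite distrC [X in _ <= X -> _]distrC.
have := LFx_mono ba; rewrite ger0_norm ?subr_ge0// => h; exact: le_trans (ler_norm _).
Qed.

Lemma LFx_surj s : exists r, LFx r = s.
Proof.
(* At N and -N the linear part alone has modulus |s|; the power term vanishes on the negative side
   and is nonnegative on the positive side. *)
pose N := `|s| / lambda.
have N0 : 0 <= N by rewrite divr_ge0// ltW.
have c : {within `[- N, N], continuous LFx}.
  by apply: continuous_subspaceT; exact: is_derive_continuous LFx_derive.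
have LN : LFx (- N) <= - `|s|.
  rewrite /LFx ppow_le0 ?gt_eqF ?oppr_le0// mulr0 addr0 mulrN /N.
  by rewrite mulrCA divff ?gt_eqF// mulr1.
have LP : `|s| <= LFx N.
  rewrite /LFx {1}/N mulrCA divff ?gt_eqF// mulr1 lerDl mulr_ge0 ?ppow_ge0//; exact: ltW.
have NN : - N <= N by rewrite ge0_cp.
have sN : Num.min (LFx (- N)) (LFx N) <= s <= Num.max (LFx (- N)) (LFx N).
  have s1 := ler_norm s; have s2 := ler_norm (- s); rewrite normrN in s2.
  rewrite ge_min le_max; apply/andP; split; apply/orP; [left|right]; lra.
by have [r _ E] := IVT NN c sN; exists r.
Qed.

(** The inverse of [LFx]. Its derivative is at most 1 / lambda, so weak differentiability passes
    from L_F(u) to u by the chain rule. *)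
Definition Phi : R -> R := projT1 (choice LFx_surj).

Lemma LFxK s : LFx (Phi s) = s.
Proof. by rewrite /Phi; case: choice. Qed.

Lemma PhiK r : Phi (LFx r) = r.
Proof.
apply/eqP; rewrite -subr_eq0 -normr_eq0 eq_le normr_ge0 andbT.
have := LFx_expand (Phi (LFx r)) r; rewrite LFxK subrr normr0.
by rewrite pmulr_rle0.
Qed.

Lemma Phi_derive (s : R) : is_derive s 1 Phi (dLFx (Phi s))^-1.
Proof.
rewrite -{1}[s]LFxK; apply: (is_derive_inverse (f := LFx)).
- by near=> x; exact: PhiK.
- by near=> x; exact: is_derive_continuous LFx_derive x.
- exact: LFx_derive.
- by rewrite gt_eqF// dLFx_gt0.
Unshelve. all: by end_near. Qed.

Lemma dPhi_continuous : continuous (fun s => (dLFx (Phi s))^-1).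
Proof.
move=> s; apply: cvgV; first by rewrite gt_eqF// dLFx_gt0.
apply: (continuous_comp (f := Phi)); last exact: dLFx_continuous.
exact: is_derive_continuous Phi_derive s.
Qed.

Lemma dPhi_bound s : `|(dLFx (Phi s))^-1| <= lambda^-1.
Proof.
rewrite ger0_norm ?invr_ge0 ?(ltW (dLFx_gt0 _))//.
by rewrite lef_pV2 ?posrE ?dLFx_gt0// dLFx_ge.
Qed.

Section slice.
Context (d : nat).
Local Notation leb := (lebesgue_rV R d).
Local Notation V := 'rV[R]_d.

Lemma wgradP (f : V -> R) (G : V -> V) : is_weak_grad f G -> is_weak_grad f (wgrad f).
Proof. by move=> wG; rewrite /wgrad; case: xgetP => [H ->//|/(_ G)]. Qed.

(** The function u is a C^1 Lipschitz function of L_F(u), whereas its power is not covered by the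
    chain rule in u; it is recovered by linearity as (L_F(u) - lambda u) / eta. The last clause
    makes the default quotients on the zero set of u harmless. *)
Lemma slice_weak_grad (u : V -> R) : (forall x, 0 <= u x) ->
  W11_loc (fun x => LF lambda eta m (u x)) ->
  let G := wgrad (fun x => LF lambda eta m (u x)) in
  [/\ L1_loc u, L1_loc (fun x => u x `^ m), is_weak_grad u (wgrad u),
      is_weak_grad (fun x => LF lambda eta m (u x)) G &
      {ae leb, forall x, [/\ lambda *: wgrad u x + eta *: wgrad (fun z => u z `^ m) x = G x,
        G x = (lambda + eta * m * u x `^ (m - 1)) *: wgrad u x &
        u x = 0 -> G x = 0 /\ wgrad u x = 0]}].
Proof.
move=> u0 [fl [G0 wG0]] G; set f := (fun x => _) in fl G wG0 *.
have wG : is_weak_grad f G := wgradP wG0.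
have uE x : u x = Phi (f x) by rewrite /f -LFxE// PhiK.
have [ul wu] := chain_rule_weak_grad fl wG Phi_derive dPhi_continuous dPhi_bound.
have uE' : (fun x => Phi (f x)) = u by apply/funext => x; rewrite -uE.
rewrite uE' in ul wu.
have wu' := wgradP wu.
have umE : (fun x => u x `^ m) = (fun x => eta^-1 * (f x - lambda * u x)).
  by apply/funext => x; rewrite /f /LF addrAC subrr add0r mulKf// gt_eqF.
have lul := L1_locZ lambda ul.
have wlu := is_weak_gradZ lambda ul wu'.
have wum := is_weak_gradZ eta^-1 (L1_locB fl lul) (is_weak_gradB fl lul wG wlu).
have uml : L1_loc (fun x => u x `^ m) by rewrite umE; apply: L1_locZ; exact: L1_locB.
rewrite -umE in wum.
split => //.
have a1 := is_weak_grad_unique uml wum (wgradP wum).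
have a2 := is_weak_grad_unique ul wu wu'.
have a3 := weak_grad_zero ul wu'.
have a12 : {ae leb, forall x, (eta^-1 *: (G x - lambda *: wgrad u x) = wgrad (fun z => u z `^ m) x) /\
    ((dLFx (Phi (f x)))^-1 *: G x = wgrad u x)} by apply: filterS2 a1 a2.
apply: filterS2 a12 a3 => x [e1 e2] e3.
have Gx : G x = (lambda + eta * m * u x `^ (m - 1)) *: wgrad u x.
  rewrite -e2 -uE /dLFx ppow_gt0E// scalerA divff ?scale1r//.
  by have := dLFx_gt0 (u x); rewrite /dLFx ppow_gt0E// => /gt_eqF ->.
split => //.
- by rewrite -e1 scalerA divff ?gt_eqF// scale1r addrC subrK.
- by move=> ux; rewrite Gx e3// scaler0.
Qed.

End slice.

End porous.

(** * Joint measurability of Carathéodory functions *)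

Section caratheodory.
Context (R : realType) (d : nat) d0 (T : measurableType d0).
Local Notation V := 'rV[R]_d.

Let fl (k : nat) (x : V) : 'rV[int]_d := \row_i Num.floor (k.+1%:R * x 0 i).
Let pt (k : nat) (c : 'rV[int]_d) : V := \row_i ((c 0 i)%:~R / k.+1%:R).

Let ptfl k (x : V) : `|x - pt k (fl k x)| <= k.+1%:R^-1.
Proof.
apply/rV_normP; first by rewrite invr_ge0.
move=> i; rewrite !mxE.
have k0 : 0 < k.+1%:R :> R by [].
have /andP[h1 h2] := mem_rg1_floor (k.+1%:R * x 0 i).
have -> : x 0 i - (Num.floor (k.+1%:R * x 0 i))%:~R / k.+1%:R =
    (k.+1%:R * x 0 i - (Num.floor (k.+1%:R * x 0 i))%:~R) / k.+1%:R.
  by rewrite mulrBl mulrAC divff ?mul1r ?gt_eqF.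
rewrite normrM (ger0_norm (_ : 0 <= k.+1%:R^-1)) ?invr_ge0// ler_piMl ?invr_ge0//.
by rewrite ger0_norm ?subr_ge0// lerBlDr addrC ltW.
Qed.

(** Rounding x to the lattice of mesh 1 / (k + 1) turns [F] into a function whose preimages are
    countable unions of rectangles. This is the only source of joint measurability for the mollified
    curves. *)
Lemma measurable_caratheodory (F : T * V -> R) :
  (forall x, measurable_fun setT (fun t => F (t, x))) ->
  (forall t, continuous (fun x => F (t, x))) ->
  measurable_fun setT F.
Proof.
move=> mF cF.
pose Fk k (p : T * V) := F (p.1, pt k (fl k p.2)).
apply: (measurable_fun_cvg (h := Fk)); last first.
  move=> [t x] _; rewrite /Fk /=.
  have cv : pt k (fl k x) @[k --> \oo] --> x.
    apply/subr_cvg0; apply: norm_cvg0.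
    apply: (@squeeze_cvgr _ _ _ _ (fun=> 0) (fun k => k.+1%:R^-1)).
    - by apply: nearW => k; rewrite normr_ge0 /= distrC.
    - exact: cvg_cst.
    - exact: cvg_harmonic.
  exact: (cvg_comp _ _ cv (cF t x)).
move=> k _ B mB; rewrite setTI.
have -> : Fk k @^-1` B = \bigcup_(c : 'rV[int]_d)
    ([set t | B (F (t, pt k c))] `*` [set x | fl k x = c]).
  apply/seteqP; split => [[t x] /= BF|[t x] [c _ [/= h1 h2]]]; first by exists (fl k x).
  by rewrite /Fk /= h2.
apply: countable_bigcupT_measurable; first exact: countableP.
move=> c; apply: measurableX.
  by rewrite -[X in measurable X]setTI; exact: mF.
rewrite (_ : [set x | _] = \bigcap_(i in [set: 'I_d]) ((fun x : V => k.+1%:R * x 0 i) @^-1` [set y | Num.floor y = c 0 i])).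
  apply: fin_bigcap_measurable; first exact: finite_finset.
  move=> i _; rewrite -[X in measurable X]setTI.
  have mc : measurable_fun setT (fun x : V => k.+1%:R * x 0 i).
    by apply: measurable_funM => //; exact: measurable_coord.
  apply: mc => //.
  rewrite (_ : [set y | _] = `[(c 0 i)%:~R, (c 0 i + 1)%:~R[%classic); first exact: measurable_itv.
  apply/seteqP; split => y /=; first by move=> yc; rewrite in_itv/= -floor_eq yc eqxx.
  by rewrite in_itv/= -floor_eq => /eqP.
apply/seteqP; split => x /=.
  by move=> <- i _ /=; rewrite mxE.
by move=> H; apply/rowP => i; rewrite mxE; exact: (H i).
Qed.

End caratheodory.

(** * Calculus in the time variable *)

Section time_calculus.
Context (R : realType).
Local Notation mu := (@lebesgue_measure R).
Implicit Types f D : R -> R.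

Lemma Rint_itvS f (a b s t : R) : Rint mu `[a, b] f -> a <= s -> t <= b -> Rint mu `[s, t] f.
Proof.
move=> [_ fi] as_ tb; split => //; apply: integrableS fi => //.
by apply: subset_itv; rewrite bnd_simp.
Qed.

Lemma RInt_itv_split f (a b c : R) : Rint mu `[a, b] f -> a <= c -> c <= b ->
  \int[mu]_(x in `[a, b]) f x = \int[mu]_(x in `[a, c]) f x + \int[mu]_(x in `[c, b]) f x.
Proof.
move=> fi ac cb.
have := @Rintegral_itvB R f (BLeft a) (BRight b) c (Rint_int fi).
rewrite !bnd_simp => /(_ ac cb) /eqP; rewrite subr_eq addrC => /eqP ->.
rewrite Rintegral_itv_obnd_cbnd//; apply: integrableS (Rint_int fi) => //.
by apply: subset_itv; rewrite bnd_simp// ac.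
Qed.

(** Cutting at a point where [M] takes the mean of its end values halves the quadratic bound;
    iterated bisection sends it to zero. *)
Lemma constant_of_square_modulus (f M : R -> R) (a b C : R) : a <= b ->
  {within `[a, b], continuous M} ->
  (forall s t, a <= s -> s <= t -> t <= b -> M s <= M t) ->
  (forall s t, a <= s -> s <= t -> t <= b -> `|f t - f s| <= C * (M t - M s) ^+ 2) ->
  f b = f a.
Proof.
move=> ab cM ndM H.
have claim n s t : a <= s -> s <= t -> t <= b ->
    `|f t - f s| <= C * (M t - M s) ^+ 2 * 2^-1 ^+ n.
  elim: n s t => [|n IH] s t as_ st tb; first by rewrite expr0 mulr1 H.
  have Mst := ndM s t as_ st tb.
  have cM' : {within `[s, t], continuous M}.
    by apply: continuous_subspaceW cM; apply: subset_itv; rewrite bnd_simp.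
  have mid : Num.min (M s) (M t) <= (M s + M t) / 2 <= Num.max (M s) (M t).
    by rewrite ge_min le_max; apply/andP; split; apply/orP; [left|right]; lra.
  have [c] := IVT st cM' mid; rewrite in_itv/= => /andP[sc ct] Mc.
  have h1 := IH s c as_ sc (le_trans ct tb).
  have h2 := IH c t (le_trans as_ sc) ct tb.
  have -> : f t - f s = (f t - f c) + (f c - f s) by ring.
  apply: le_trans (ler_normD _ _) _; apply: le_trans (lerD h2 h1) _.
  rewrite Mc [2^-1 ^+ n.+1]exprS le_eqVlt; apply/orP; left; apply/eqP.
  by field.
apply/eqP; rewrite -subr_eq0 -normr_eq0 eq_le normr_ge0 andbT.
have cv : C * (M b - M a) ^+ 2 * 2^-1 ^+ n @[n --> \oo] --> (0 : R).
  rewrite -[X in _ --> X](mulr0 (C * (M b - M a) ^+ 2)); apply: cvgM; first exact: cvg_cst.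
  by apply: cvg_expr; rewrite ger0_norm ?invr_ge0// invf_lt1// ltr1n.
apply: (cvgr_to_ge cv); apply: nearW => n; exact: claim.
Qed.

Lemma RInt_indef_continuous f (a b : R) : a <= b -> Rint mu `[a, b] f ->
  {within `[a, b], continuous (fun t => \int[mu]_(x in `[a, t]) f x)}.
Proof. by move=> ab [_ fi]; exact: parameterized_integral_continuous. Qed.

(** The defect of the chain rule has a quadratic modulus with respect to the variation [M] of [H],
    hence is constant. This avoids differentiating [H] almost everywhere. *)
Lemma AC_chain_rule (g g1 H D : R -> R) (a b L : R) : a <= b -> 0 <= L ->
  Rint mu `[a, b] D ->
  (forall s t, a <= s -> s <= t -> t <= b -> H t - H s = \int[mu]_(x in `[s, t]) D x) ->
  (forall t, a <= t -> t <= b -> 0 <= H t) ->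
  (forall x y, 0 <= x -> 0 <= y -> `|g1 y - g1 x| <= L * `|y - x|) ->
  (forall x y, 0 <= x -> 0 <= y -> `|g y - g x - g1 x * (y - x)| <= L * (y - x) ^+ 2) ->
  Rint mu `[a, b] (fun t => g1 (H t) * D t) ->
  g (H b) - g (H a) = \int[mu]_(t in `[a, b]) (g1 (H t) * D t).
Proof.
move=> ab L0 iD HD H0 g1L gL igD.
pose M t := \int[mu]_(x in `[a, t]) `|D x|.
pose f t := g (H t) - g (H a) - \int[mu]_(r in `[a, t]) (g1 (H r) * D r).
have iaD := Rint_abs iD.
have Mst s t : a <= s -> s <= t -> t <= b -> M t - M s = \int[mu]_(x in `[s, t]) `|D x|.
  move=> as_ st tb; rewrite /M (@RInt_itv_split _ a t s)//; last exact: Rint_itvS iaD _ tb.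
  by rewrite addrAC subrr add0r.
have ndM s t : a <= s -> s <= t -> t <= b -> M s <= M t.
  by move=> as_ st tb; rewrite -subr_ge0 Mst// Rintegral_ge0.
have Hd s t : a <= s -> s <= t -> t <= b -> `|H t - H s| <= M t - M s.
  move=> as_ st tb; rewrite HD// Mst//; apply: le_norm_RInt; exact: Rint_itvS iD _ _.
suff : f b = f a.
  rewrite /f subrr sub0r set_itv1 Rintegral_set1 oppr0 => /eqP.
  by rewrite subr_eq0 => /eqP.
(* One [L] pays for the Taylor remainder of [g], the other for the oscillation of [g1 (H r)] on the
   interval. *)
apply: (@constant_of_square_modulus f M a b (2 * L)) => //.
  exact: RInt_indef_continuous.
move=> s t as_ st tb.
have sb := le_trans st tb; have at_ := le_trans as_ st.
have H0s := H0 s as_ sb; have H0t := H0 t at_ tb.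
have -> : f t - f s = (g (H t) - g (H s) - g1 (H s) * (H t - H s)) -
    \int[mu]_(r in `[s, t]) ((g1 (H r) - g1 (H s)) * D r).
  have iDst : Rint mu `[s, t] D by exact: Rint_itvS iD _ _.
  have igst : Rint mu `[s, t] (fun t => g1 (H t) * D t) by exact: Rint_itvS igD _ _.
  rewrite /f (@RInt_itv_split _ a t s)//; last exact: Rint_itvS igD _ tb.
  under [X in _ = _ - X]eq_Rintegral do rewrite mulrBl.
  rewrite RIntB//; last exact: RintZ.
  by rewrite RIntZ// -HD//; ring.
have Dst := ndM s t as_ st tb.
have Hst := Hd s t as_ st tb.
apply: le_trans (ler_normB _ _) _.
have iDst : Rint mu `[s, t] D by exact: Rint_itvS iD _ _.
have igst : Rint mu `[s, t] (fun t => g1 (H t) * D t) by exact: Rint_itvS igD _ _.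
have iaDst := Rint_abs iDst.
have i2 : Rint mu `[s, t] (fun r => (g1 (H r) - g1 (H s)) * D r).
  rewrite (_ : (fun r => _) = (fun r => g1 (H r) * D r - g1 (H s) * D r)).
    by apply: RintB => //; exact: RintZ.
  by apply/funext => r; rewrite mulrBl.
have d0 : 0 <= M t - M s by rewrite subr_ge0.
have b2 : `|\int[mu]_(r in `[s, t]) ((g1 (H r) - g1 (H s)) * D r)| <= L * (M t - M s) ^+ 2.
  apply: le_trans (le_norm_RInt i2) _.
  rewrite expr2 mulrA {2}(Mst s t as_ st tb) -RIntZ//.
  apply: le_RInt => [||r]; [exact: Rint_abs|exact: RintZ|].
  rewrite /= in_itv/= => /andP[sr rt].
  rewrite normrM ler_wpM2r//.
  have ar := le_trans as_ sr; have rb := le_trans rt tb.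
  apply: le_trans (g1L _ _ H0s (H0 r ar rb)) _; rewrite ler_wpM2l//.
  apply: le_trans (Hd s r as_ sr rb) _; rewrite lerD2r; exact: ndM.
have b1 : `|g (H t) - g (H s) - g1 (H s) * (H t - H s)| <= L * (M t - M s) ^+ 2.
  apply: le_trans (gL _ _ H0s H0t) _; rewrite ler_wpM2l// -[leLHS]real_normK ?num_real//.
  by rewrite ler_pXn2r ?nnegrE.
lra.
Qed.

End time_calculus.

Section duBoisReymond.
Context (R : realType).
Local Notation mu := (@lebesgue_measure R).
Implicit Types f D : R -> R.

Lemma Rint_continuous_itv f (a b : R) : {within `[a, b], continuous f} -> Rint mu `[a, b] f.
Proof.
move=> cf; split => //; apply: continuous_compact_integrable => //; exact: segment_compact.
Qed.

Lemma RInt_FTC2 (F f : R -> R) (a b : R) : a <= b ->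
  (forall x : R, is_derive x 1 F (f x)) -> continuous f ->
  \int[mu]_(x in `[a, b]) f x = F b - F a.
Proof.
rewrite le_eqVlt => /predU1P[<- _ _|ab dF cf].
  by rewrite set_itv1 Rintegral_set1 subrr.
have cF : continuous F by exact: is_derive_continuous dF.
rewrite /Rintegral (@continuous_FTC2 _ f F)//.
- by apply: continuous_subspaceT.
- split; first by move=> x _; case: (dF x).
    exact/cvg_at_right_filter/cF.
  exact/cvg_at_left_filter/cF.
- by move=> x _; rewrite derive1E; exact: derive_val.
Qed.

Lemma near_div_natS (c r : R) : 0 < r -> \forall n \near \oo, c / n.+1%:R < r.
Proof.
move=> r0; have : c / n.+1%:R @[n --> \oo] --> (0 : R).
  by rewrite -[X in _ --> X](mulr0 c); apply: cvgM; [exact: cvg_cst|exact: cvg_harmonic].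
by move/cvgr_lt; apply.
Qed.

(** The point [c] may be an endpoint: the weights need only have unit mass inside the interval for
    large [n]. The width 3 / (n + 1) is that of the transition layers in [du_bois_reymond]. *)
Lemma approx_identity_itv (w : nat -> R -> R) A (a b c : R) : a <= c <= b ->
  {within `[a, b], continuous A} ->
  (forall n, continuous (w n)) -> (forall n x, 0 <= w n x) ->
  (forall n x, 3 / n.+1%:R <= `|x - c| -> w n x = 0) ->
  (\forall n \near \oo, \int[mu]_(x in `[a, b]) w n x = 1) ->
  \int[mu]_(x in `[a, b]) (w n x * A x) @[n --> \oo] --> A c.
Proof.
move=> /andP[ac cb] cA cw w0 wE w1.
have ab := le_trans ac cb.
have iw n : Rint mu `[a, b] (w n) by apply: Rint_continuous_itv; exact: continuous_subspaceT.
have iwA n : Rint mu `[a, b] (fun x => w n x * A x).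
  apply: Rint_continuous_itv => x; apply: continuousM; last exact: cA.
  by move: x; apply: continuous_subspaceT; exact: cw.
have cab : c \in (`[a, b]%classic : set R) by rewrite inE /= in_itv/= ac.
apply/cvgrPdist_le => e e0.
have : \forall x \near within `[a, b] (nbhs c), `|A c - A x| <= e.
  have /cvgrPdist_le := cA c; rewrite {1}/nbhs /= nbhs_subspace_in; last by rewrite inE in cab.
  exact.
rewrite /within /= => -[r /= r0 rP].
near=> n.
have nr : 3 / n.+1%:R < r by near: n; exact: near_div_natS.
have E1 : \int[mu]_(x in `[a, b]) w n x = 1 by near: n.
have -> : A c - \int[mu]_(x in `[a, b]) (w n x * A x) =
   \int[mu]_(x in `[a, b]) (w n x * A c - w n x * A x).
  by rewrite RIntB//; [rewrite RIntZr// E1 mul1r|exact: RintZr].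
have i3 : Rint mu `[a, b] (fun x => w n x * A c - w n x * A x) by apply: RintB => //; exact: RintZr.
apply: le_trans (le_norm_RInt i3) _.
rewrite -[leRHS]mul1r -E1 -RIntZr//.
apply: le_RInt => [||x xab]; [exact: Rint_abs|exact: RintZr|].
rewrite -mulrBr normrM ger0_norm//.
have [|xc] := lerP (3 / n.+1%:R) `|x - c|; first by move=> /wE ->; rewrite !mul0r.
rewrite ler_wpM2l//; apply: rP => //=.
by rewrite /ball_ distrC (lt_trans xc).
Unshelve. all: by end_near.
Qed.

(** The test functions approximate the indicator of [s, t] from inside, so that s = 0 is allowed
    although they must be supported in positive times. Their derivatives are differences of
    approximate identities at the two endpoints, where continuity of [A] is used. *)
Lemma du_bois_reymond (A B : R -> R) (s t : R) : 0 <= s -> s <= t ->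
  {within `[s, t], continuous A} -> Rint mu `[s, t] B ->
  (forall (alpha alpha' : R -> R) a b, 0 < a -> (forall k, Ck k alpha) ->
    (forall x : R, is_derive x 1 alpha (alpha' x)) ->
    (forall x, ~~ (a <= x <= b) -> alpha x = 0) ->
    (\int[mu]_(r in `]0%R, +oo[) (alpha' r * A r - alpha r * B r)%:E = 0)%E) ->
  A t - A s = - \int[mu]_(r in `[s, t]) B r.
Proof.
move=> s0; rewrite le_eqVlt => /predU1P[<- _ _ _|st cA iB H].
  by rewrite set_itv1 Rintegral_set1 subrr oppr0.
have [S [S' [[Ss dS cS' S'0 S01] [Sm1 S1 S'E]]]] := smooth_step R.
(* The shift by 2 puts the transition layer at distance between 1 / (n + 1) and 3 / (n + 1) from the
   endpoint, strictly inside the interval; [l2] mirrors it at [t]. *)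
pose l1 (n : nat) (x : R) : R := n.+1%:R * (x - s) - 2.
pose l2 (n : nat) (x : R) : R := n.+1%:R * (x - t) + 2.
have dl1 n (x : R) : is_derive x 1 (S \o l1 n) (n.+1%:R * S' (l1 n x)).
  have d1 : is_derive x 1 (l1 n) n.+1%:R by apply: is_derive_eq; rewrite /= ?addr0 ?subr0 ?mulr1; exact: mulr1.
  by apply: (is_derive_eq (is_derive1_comp (dS (l1 n x)) d1)); rewrite mulrC.
have dl2 n (x : R) : is_derive x 1 (S \o l2 n) (n.+1%:R * S' (l2 n x)).
  have d1 : is_derive x 1 (l2 n) n.+1%:R by apply: is_derive_eq; rewrite /= ?addr0 ?subr0 ?mulr1; exact: mulr1.
  by apply: (is_derive_eq (is_derive1_comp (dS (l2 n x)) d1)); rewrite mulrC.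
pose w1 n (x : R) := n.+1%:R * S' (l1 n x).
pose w2 n (x : R) := n.+1%:R * S' (l2 n x).
pose al n (x : R) := S (l1 n x) + (-1) * S (l2 n x).
have cl1 n : continuous (l1 n).
  by move=> x; apply: cvgB; [apply: cvgMr; apply: cvgB; [exact: cvg_id|exact: cvg_cst]|exact: cvg_cst].
have cl2 n : continuous (l2 n).
  by move=> x; apply: cvgD; [apply: cvgMr; apply: cvgB; [exact: cvg_id|exact: cvg_cst]|exact: cvg_cst].
have cw1 n : continuous (w1 n).
  by move=> x; apply: cvgMr; apply: (cvg_comp _ _ (cl1 n x)); exact: cS'.
have cw2 n : continuous (w2 n).
  by move=> x; apply: cvgMr; apply: (cvg_comp _ _ (cl2 n x)); exact: cS'.
have w10 n x : 0 <= w1 n x by rewrite mulr_ge0.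
have w20 n x : 0 <= w2 n x by rewrite mulr_ge0.
have n0 n : 0 < n.+1%:R :> R by [].
(* Twice the outer distance 3 / (n + 1): beyond this [n] the two layers do not overlap. *)
have stk : \forall n \near \oo, 6 / n.+1%:R < t - s by apply: near_div_natS; rewrite subr_gt0.
have cv1 : \int[mu]_(x in `[s, t]) (w1 n x * A x) @[n --> \oo] --> A s.
  apply: approx_identity_itv => //; first by rewrite lexx ltW.
    move=> n x; rewrite ler_pdivrMr// => xs; rewrite /w1 S'E ?mulr0//.
    rewrite -(@ger0_norm _ n.+1%:R)// -normrM mulrC in xs; rewrite /l1.
    move: xs; rewrite ler_normr => /orP[] xs.
      by rewrite ler_normr; apply/orP; left; lra.
    by rewrite ler_normr; apply/orP; right; lra.
  near=> n.
  have nst : 6 / n.+1%:R < t - s by near: n.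
  rewrite (RInt_FTC2 (F := S \o l1 n)) ?ltW// /=.
  have h1 : 1 <= l1 n t by rewrite /l1; move: nst; rewrite ltr_pdivrMr//; lra.
  have h2 : l1 n s <= -1 by rewrite /l1 subrr; lra.
  by rewrite (S1 _ h1) (Sm1 _ h2) subr0.
have cv2 : \int[mu]_(x in `[s, t]) (w2 n x * A x) @[n --> \oo] --> A t.
  apply: approx_identity_itv => //; first by rewrite lexx ltW.
    move=> n x; rewrite ler_pdivrMr// => xs; rewrite /w2 S'E ?mulr0//.
    rewrite -(@ger0_norm _ n.+1%:R)// -normrM mulrC in xs; rewrite /l2.
    move: xs; rewrite ler_normr => /orP[] xs.
      by rewrite ler_normr; apply/orP; left; lra.
    by rewrite ler_normr; apply/orP; right; lra.
  near=> n.
  have nst : 6 / n.+1%:R < t - s by near: n.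
  rewrite (RInt_FTC2 (F := S \o l2 n)) ?ltW// /=.
  have h1 : 1 <= l2 n t by rewrite /l2 subrr; lra.
  have h2 : l2 n s <= -1 by rewrite /l2; move: nst; rewrite ltr_pdivrMr//; lra.
  by rewrite (S1 _ h1) (Sm1 _ h2) subr0.
have al1 n x : `|al n x| <= 1.
  have /andP[? ?] := S01 (l1 n x); have /andP[? ?] := S01 (l2 n x).
  by rewrite ler_norml /al; apply/andP; split; lra.
have cal n : continuous (al n).
  have cS := Ck_continuous (Ss 0%N).
  move=> x; apply: cvgD; last apply: cvgMr.
    by apply: (cvg_comp _ _ (cl1 n x)); exact: cS.
  by apply: (cvg_comp _ _ (cl2 n x)); exact: cS.
have [iB' ialB cv3] : [/\ Rint mu `[s, t] B, forall n, Rint mu `[s, t] (fun r => al n r * B r) &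
   \int[mu]_(r in `[s, t]) (al n r * B r) @[n --> \oo] --> \int[mu]_(r in `[s, t]) B r].
  apply: Rint_DCT (Rint_abs iB) _ => //.
  - move=> n; apply: measurable_funM; last exact: Rint_meas iB.
    by apply: measurable_funTS; exact: continuous_measurable_fun.
  - exact: Rint_meas iB.
  - have aec (c : R) : {ae mu, forall x : R, x != c}.
      exists [set c]; split => //; first exact: lebesgue_measure_set1.
      by move=> x /= /negP/negPn/eqP ->.
    apply: (negligibleS _ (negligibleU (aec s) (aec t))) => x /= nx.
    apply: contrapT => /not_orP[/contrapT xs /contrapT xt]; apply: nx.
    rewrite /= in_itv/= => /andP[sx tx].
    have {}sx : s < x by rewrite lt_neqAle eq_sym xs.
    have {}tx : x < t by rewrite lt_neqAle xt.
    apply: cvg_near_cst; near=> n.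
    have n1 : 3 / n.+1%:R < x - s by near: n; apply: near_div_natS; rewrite subr_gt0.
    have n2 : 3 / n.+1%:R < t - x by near: n; apply: near_div_natS; rewrite subr_gt0.
    rewrite ltr_pdivrMr// in n1; rewrite ltr_pdivrMr// in n2.
    have h1 : 1 <= l1 n x by rewrite /l1; lra.
    have h2 : l2 n x <= -1 by rewrite /l2; lra.
    by rewrite /al (S1 _ h1) (Sm1 _ h2) mulr0 addr0 mul1r.
  - by apply: aeW => x _ n; rewrite normrM ler_piMl.
have iwA1 n : Rint mu `[s, t] (fun x => w1 n x * A x).
  apply: Rint_continuous_itv => x; apply: continuousM; last exact: cA.
  by move: x; apply: continuous_subspaceT; exact: cw1.
have iwA2 n : Rint mu `[s, t] (fun x => w2 n x * A x).
  apply: Rint_continuous_itv => x; apply: continuousM; last exact: cA.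
  by move: x; apply: continuous_subspaceT; exact: cw2.
have E : \forall n \near \oo, \int[mu]_(x in `[s, t]) (w1 n x * A x) -
    \int[mu]_(x in `[s, t]) (w2 n x * A x) = \int[mu]_(r in `[s, t]) (al n r * B r).
  near=> n.
  have nst : 6 / n.+1%:R < t - s by near: n.
  have off x : ~~ (s + n.+1%:R^-1 <= x <= t - n.+1%:R^-1) ->
      [/\ al n x = 0, w1 n x = 0 & w2 n x = 0].
    rewrite ltr_pdivrMr// in nst.
    have nn : n.+1%:R^-1 * n.+1%:R = 1 :> R by rewrite mulVf ?gt_eqF.
    rewrite negb_and -!ltNge => /orP[]; rewrite -(ltr_pM2r (n0 n)) ?mulrDl ?mulNr nn => h.
      have h1 : l1 n x <= -1 by rewrite /l1; lra.
      have h2 : l2 n x <= -1 by rewrite /l2; lra.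
      rewrite /al /w1 /w2 (Sm1 _ h1) (Sm1 _ h2) !S'E ?mulr0 ?addr0//.
        by rewrite ler_normr; apply/orP; right; lra.
      by rewrite ler_normr; apply/orP; right; lra.
    have h1 : 1 <= l1 n x by rewrite /l1; lra.
    have h2 : 1 <= l2 n x by rewrite /l2; lra.
    rewrite /al /w1 /w2 (S1 _ h1) (S1 _ h2) !S'E ?mulr0 ?mulr1 ?subrr//.
      by rewrite ler_normr; apply/orP; left; lra.
    by rewrite ler_normr; apply/orP; left; lra.
  have i3 : Rint mu `[s, t] (fun r => (w1 n r + (-1) * w2 n r) * A r - al n r * B r).
    apply: RintB => //; rewrite (_ : (fun r => _) = (fun r => w1 n r * A r - w2 n r * A r)); first exact: RintB.
    by apply/funext => r; ring.
  have := H (al n) (fun x => w1 n x + (-1) * w2 n x) (s + n.+1%:R^-1) (t - n.+1%:R^-1).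
  have h1 : 0 < s + n.+1%:R^-1 by rewrite ltr_wpDl// invr_gt0.
  have h2 : forall k, Ck k (al n).
    move=> k.
    have hl1 (h : R) (x v : R^o) : l1 n (h *: v + x) = h *: (n.+1%:R * v : R^o) + l1 n x.
      by rewrite /l1 /GRing.scale /=; ring.
    have hl2 (h : R) (x v : R^o) : l2 n (h *: v + x) = h *: (n.+1%:R * v : R^o) + l2 n x.
      by rewrite /l2 /GRing.scale /=; ring.
    have k1 := @Ck_comp_affine R R^o R^o k S (l1 n) (fun v => n.+1%:R * v) (cl1 n) hl1 (Ss k).
    have k2 := @Ck_comp_affine R R^o R^o k S (l2 n) (fun v => n.+1%:R * v) (cl2 n) hl2 (Ss k).
    by apply: CkD => //; apply: CkM => //; exact: Ck_cst.
  have h3 (x : R) : is_derive x 1 (al n) (w1 n x + (-1) * w2 n x).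
    have d1 := dl1 n x; have d2 := dl2 n x.
    have d3 : is_derive x 1 (fun x => -1 * S (l2 n x)) (-1 * w2 n x).
      exact: (@is_deriveZ _ _ _ (S \o l2 n) (-1) x 1 _ d2).
    exact: is_deriveD.
  move=> /(_ h1 h2 h3 (fun x xn => let: And3 h _ _ := off x xn in h)) E.
  apply/eqP; rewrite -RIntB// -subr_eq0 -RIntB//; last exact: RintB.
  rewrite /Rintegral; apply/eqP; rewrite -[RHS](congr1 fine E); congr fine.
  rewrite integral_mkcond [RHS]integral_mkcond; apply: eq_integral => x _.
  rewrite /patch !mem_setE !in_itv/= andbT.
  have [/off[E1 E2 E3]|] := boolP (~~ (s + n.+1%:R^-1 <= x <= t - n.+1%:R^-1)).
    by rewrite E1 E2 E3 !(mul0r,mulr0,subrr,addr0); do 2 case: ifP.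
  rewrite negbK => /andP[x1 x2].
  have -> : s <= x by rewrite (le_trans _ x1)// lerDl.
  have -> : x <= t by rewrite (le_trans x2)// gerBl.
  by rewrite (lt_le_trans h1 x1) /=; congr EFin; ring.
have cv4 : \int[mu]_(x in `[s, t]) (w1 n x * A x) - \int[mu]_(x in `[s, t]) (w2 n x * A x)
    @[n --> \oo] --> A s - A t by apply: cvgB.
have cv5 : \int[mu]_(r in `[s, t]) (al n r * B r) @[n --> \oo] --> A s - A t.
  by apply: cvg_trans cv4; apply: near_eq_cvg; apply: filterS E => n.
by rewrite -(cvg_unique (@Rhausdorff R) cv5 cv3) opprB.
Unshelve. all: by end_near.
Qed.

End duBoisReymond.

Section parametric.
Context (R : realType) (d : nat).
Local Notation mu := (@lebesgue_measure R).
Local Notation leb := (lebesgue_rV R d).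
Local Notation V := 'rV[R]_d.

(** Positive and negative parts are handled separately by Tonelli, and [fine] is measurable, so the
    statement covers also the parameters at which the integral takes its default value. *)
Lemma measurable_Rint_param d0 (T : measurableType d0) (F : T * V -> R) :
  measurable_fun setT F -> measurable_fun setT (fun t => \int[leb]_x F (t, x)).
Proof.
move=> mF; apply: measurableT_comp => //.
have mE : measurable_fun setT (EFin \o F) by exact/measurable_EFinP.
have -> : (fun t => \int[leb]_x (F (t, x))%:E)%E =
    (fun t => \int[leb]_x ((EFin \o F)^\+ (t, x)) - \int[leb]_x ((EFin \o F)^\- (t, x)))%E.
  apply/funext => t; rewrite [LHS]integralE; congr (_ - _)%E; apply: eq_integral => x _; rewrite ?funeposE ?funenegE.
  by [].
  by [].
apply: emeasurable_funB.
  by apply: (measurable_fun_fubini_tonelli_F (m2 := leb) ((EFin \o F)^\+)%E) => //; exact: measurable_funepos.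
by apply: (measurable_fun_fubini_tonelli_F (m2 := leb) ((EFin \o F)^\-)%E) => //; exact: measurable_funeneg.
Qed.

(** The bound is required on [s, t] only, so the time restriction is put into the integrand as the
    indicator [I1] before Fubini's theorem on the full product is applied. *)
Lemma Fubini_product_bound (F : R * V -> R) (c : R -> R) (g : V -> R) (s t : R) :
  measurable_fun setT F -> Rint mu `[s, t] c -> Rint leb setT g -> (forall x, 0 <= g x) ->
  (forall r x, s <= r <= t -> `|F (r, x)| <= c r * g x) ->
  [/\ forall x, Rint mu `[s, t] (fun r => F (r, x)),
      forall r, s <= r <= t -> Rint leb setT (fun x => F (r, x)),
      Rint leb setT (fun x => \int[mu]_(r in `[s, t]) F (r, x)),
      Rint mu `[s, t] (fun r => \int[leb]_x F (r, x)) &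
      \int[leb]_x \int[mu]_(r in `[s, t]) F (r, x) =
      \int[mu]_(r in `[s, t]) \int[leb]_x F (r, x)].
Proof.
move=> mF ic ig g0 Fcg.
have mFr r : measurable_fun setT (fun x => F (r, x)) by exact: measurableT_comp mF (measurable_pair1 _).
have mFx x : measurable_fun setT (fun r => F (r, x)) by exact: measurableT_comp mF (measurable_pair2 _).
have mI : measurable (`[s, t]%classic : set R) by exact: measurable_itv.
have h1 x : Rint mu `[s, t] (fun r => F (r, x)).
  have icx : Rint mu `[s, t] (fun r => c r * g x) by exact: RintZr.
  apply: (Rint_le _ icx); first by apply: (@measurable_funTS _ _ _ _ _ _ (mFx x)).
  by move=> r /=; rewrite in_itv/= => rst; exact: Fcg.
have h2 r : s <= r <= t -> Rint leb setT (fun x => F (r, x)).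
  move=> rst; apply: (@Rint_le _ _ _ _ _ _ (fun x => c r * g x)) => //.
  - exact: RintZ.
  - by move=> x _; exact: Fcg.
pose I1 := \1_(`[s, t]%classic : set R) : R -> R.
pose F' (p : R * V) := I1 p.1 * F p.
have mF' : measurable_fun setT F'.
  by apply: measurable_funM => //; apply: measurableT_comp => //; exact: measurable_indic.
have mEF' : measurable_fun setT (EFin \o F') by exact/measurable_EFinP.
have I1i r : r \in `[s, t] -> I1 r = 1 by move=> rst; rewrite /I1 indicE mem_set.
have I1o r : r \notin `[s, t] -> I1 r = 0 by move=> rst; rewrite /I1 indicE memNset// => h; rewrite h in rst.
have iF' : (mu \x leb)%E.-integrable setT (EFin \o F').
  apply/(@integrable12ltyP _ _ _ _ _ mu leb _ mEF').
  apply: (@le_lt_trans _ _ (\int[mu]_(r in `[s, t]) (`|c r| * \int[leb]_x g x)%:E)%E).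
    rewrite [leRHS]integral_mkcond; apply: ge0_le_integral => //.
    - by move=> r _; exact: integral_ge0.
    - by apply: (measurable_fun_fubini_tonelli_F (m2 := leb) (fun p => `|(EFin \o F') p|)%E) => //; exact: measurableT_comp.
    - apply/(measurable_restrictT _ mI)/measurable_EFinP; apply: measurable_funM => //.
      by apply: measurableT_comp => //; exact: Rint_meas ic.
    move=> r _; rewrite /patch; case: ifPn => [/set_mem rst|nr].
      rewrite EFinM -(Rint_EFin ig) -ge0_integralZl//; last by move=> x _; rewrite lee_fin.
        apply: ge0_le_integral => //.
        - by apply: measurableT_comp => //; exact: (measurableT_comp mEF' (measurable_pair1 r)).
        - by apply: measurable_funeM; apply/measurable_EFinP; exact: Rint_meas ig.
        move=> x _; rewrite /= /F' /= I1i// mul1r -EFinM lee_fin; apply: le_trans (Fcg r x _) _.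
          by move: rst; rewrite /= in_itv.
        by rewrite ler_wpM2r// ler_norm.
      by apply/measurable_EFinP; exact: Rint_meas ig.
    by rewrite mem_setE in nr; rewrite integral0_eq// => x _; rewrite /= /F' /= I1o ?mul0r ?normr0.
  have ic' : Rint mu `[s, t] (fun r => `|c r| * \int[leb]_x g x) by apply: RintZr; exact: Rint_abs.
  by rewrite (Rint_EFin ic') ltry.
have F1 r : (\int[leb]_x (EFin \o F') (r, x))%E = (I1 r * \int[leb]_x F (r, x))%:E.
  have [rst|nr] := boolP (r \in `[s, t]).
    have rst' : s <= r <= t by move: rst; rewrite in_itv.
    rewrite I1i// mul1r -(Rint_EFin (h2 r rst')).
    by apply: eq_integral => x _; rewrite /= /F' /= I1i// mul1r.
  by rewrite I1o// mul0r integral0_eq// => x _; rewrite /= /F' /= I1o ?mul0r.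
have F2 x : (\int[mu]_r (EFin \o F') (r, x))%E = (\int[mu]_(r in `[s, t]) F (r, x))%:E.
  rewrite -(Rint_EFin (h1 x)) [RHS]integral_mkcond; apply: eq_integral => r _.
  rewrite /patch mem_setE /= /F' /=; case: ifPn => rst; first by rewrite I1i// mul1r.
  by rewrite I1o// mul0r.
have i1 := integrable_fubini_F iF'.
have h3 : Rint leb setT (fun x => \int[mu]_(r in `[s, t]) F (r, x)).
  apply: (@Rint_le _ _ _ _ _ _ (fun x => (\int[mu]_(r in `[s, t]) `|c r|) * g x)).
  - apply/measurable_EFinP; apply: eq_measurable_fun (measurable_fubini_G iF') => x _.
    by rewrite /fubini_G F2.
  - exact: RintZ.
  move=> x _; apply: le_trans (le_norm_RInt (h1 x)) _.
  have iac := Rint_abs ic; rewrite -RIntZr//; apply: le_RInt => [||r /=].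
  - exact: Rint_abs.
  - exact: RintZr.
  rewrite in_itv/= => rst; apply: le_trans (Fcg r x rst) _.
  by rewrite ler_wpM2r// ler_norm.
have h4 : Rint mu setT (fun r => I1 r * \int[leb]_x F (r, x)).
  split => //; apply: eq_integrable i1 => // r _; rewrite /fubini_F F1//.
have h5 : Rint mu `[s, t] (fun r => \int[leb]_x F (r, x)).
  have : Rint mu `[s, t] (fun r => I1 r * \int[leb]_x F (r, x)).
    by case: h4 => _ h4; split => //; exact: integrableS h4.
  by apply: eq_Rint => r /= rst; rewrite I1i// mul1r.
split => //.
have := Fubini iF'.
under eq_integral do rewrite F1; under [X in _ = X -> _]eq_integral do rewrite F2.
rewrite (Rint_EFin h3) (Rint_EFin h4) => -[<-].
rewrite /Rintegral [in RHS]integral_mkcond; congr fine; apply: eq_integral => r _.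
rewrite /patch mem_setE; case: ifPn => rst; first by rewrite I1i// mul1r.
by rewrite I1o// mul0r.
Qed.

End parametric.

(** * Energy balance of a mollified continuity equation *)

Section half_line_calculus.
Context (R : realType).

(** The bound on [r * G2 r] is the essential one: with q^2 and p^2 at most u b, it makes G''(u) q p
    at most L b. The bound on [G2] alone serves the chain rule in time. *)
Definition C2_half_line (G G1 G2 : R -> R) (L : R) :=
  [/\ 0 <= L, forall r : R, 0 <= r -> is_derive r 1 G (G1 r),
      forall r : R, 0 <= r -> is_derive r 1 G1 (G2 r),
      forall r : R, 0 <= r -> {for r, continuous G2} &
      forall r : R, 0 <= r -> [/\ `|G1 r| <= L, `|G2 r| <= L & `|r * G2 r| <= L]].

Lemma MVT_half_line (f f' : R -> R) (x y : R) :
  (forall r : R, 0 <= r -> is_derive r 1 f (f' r)) -> 0 <= x -> 0 <= y ->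
  exists z, [/\ 0 <= z, `|z - x| <= `|y - x| & f y - f x = f' z * (y - x)].
Proof.
move=> df x0 y0; have [xy|/ltW yx] := leP x y.
  have [z /andP[xz zy] E] := MVT_is_derive xy (fun z (H : x <= z <= y) => df z (le_trans x0 (andP H).1)).
  by exists z; split => //; [exact: le_trans xz|rewrite !ger0_norm ?subr_ge0// lerD2r].
have [z /andP[yz zx] E] := MVT_is_derive yx (fun z (H : y <= z <= x) => df z (le_trans y0 (andP H).1)).
exists z; split; first exact: le_trans yz.
  by rewrite distrC [leRHS]distrC !ger0_norm ?subr_ge0// lerB.
by rewrite -opprB E -mulrN opprB.
Qed.

Lemma measurable_half_line d0 (T : measurableType d0) (g : R -> R) (f : T -> R) :
  (forall r : R, 0 <= r -> {for r, continuous g}) -> measurable_fun setT f ->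
  (forall x, 0 <= f x) -> measurable_fun setT (fun x => g (f x)).
Proof.
move=> cg mf f0; have cg' : continuous (fun r : R => g (Num.max r 0)).
  move=> r; apply: (@continuous_comp _ _ _ (fun r : R => Num.max r 0)).
    by apply: continuous_max; [exact: cvg_id|exact: cvg_cst].
  by apply: cg; rewrite le_max lexx orbT.
have -> : (fun x => g (f x)) = (fun r : R => g (Num.max r 0)) \o f.
  by apply/funext => x /=; rewrite max_l.
exact: measurableT_comp (continuous_measurable_fun cg') mf.
Qed.

Section C2_half_line_theory.
Variables (G G1 G2 : R -> R) (L : R).
Hypothesis GL : C2_half_line G G1 G2 L.

Lemma C2_half_line_continuous r : 0 <= r ->
  [/\ {for r, continuous G}, {for r, continuous G1} & {for r, continuous G2}].
Proof.
case: GL => _ dG dG1 cG2 _ r0; split; last exact: cG2.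
  by apply/differentiable_continuous/derivable1_diffP; case: (dG r r0).
by apply/differentiable_continuous/derivable1_diffP; case: (dG1 r r0).
Qed.

Lemma C2_half_line_lip x y : 0 <= x -> 0 <= y -> `|G y - G x| <= L * `|y - x|.
Proof.
case: GL => _ dG _ _ bG x0 y0; have [z [z0 _ ->]] := MVT_half_line dG x0 y0.
by rewrite normrM ler_wpM2r//; case: (bG z z0).
Qed.

Lemma C2_half_line_lip1 x y : 0 <= x -> 0 <= y -> `|G1 y - G1 x| <= L * `|y - x|.
Proof.
case: GL => _ _ dG _ bG x0 y0; have [z [z0 _ ->]] := MVT_half_line dG x0 y0.
by rewrite normrM ler_wpM2r//; case: (bG z z0).
Qed.

Lemma C2_half_line_taylor x y : 0 <= x -> 0 <= y ->
  `|G y - G x - G1 x * (y - x)| <= L * (y - x) ^+ 2.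
Proof.
case: (GL) => L0 dG _ _ bG x0 y0; have [z [z0 zx ->]] := MVT_half_line dG x0 y0.
rewrite -mulrBl normrM -(real_normK (num_real (y - x))) expr2 mulrA ler_wpM2r//.
by apply: le_trans (C2_half_line_lip1 x0 z0) _; rewrite ler_wpM2l.
Qed.

Lemma C2_half_line_bound x : 0 <= x -> `|G x| <= `|G 0| + L * x.
Proof.
move=> x0; have := C2_half_line_lip (lexx 0) x0; rewrite subr0 (ger0_norm x0) => h.
rewrite -lerBlDl; apply: le_trans h; exact: lerB_dist.
Qed.

End C2_half_line_theory.
End half_line_calculus.

Section product_bounds.
Context (R : realType).
Implicit Types x w y z : R.

Lemma sqr_le_mul_add x y z : 0 <= y -> 0 <= z -> x ^+ 2 <= y * z -> `|x| <= y + z.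
Proof.
move=> y0 z0 h; rewrite -(@ler_pXn2r _ 2)// ?nnegrE ?addr_ge0// real_normK ?num_real//.
apply: le_trans h _; have := sqr_ge0 y; have := sqr_ge0 z; have := mulr_ge0 y0 z0.
by rewrite sqrrD -[_ *+ 2]mulr_natr; lra.
Qed.

Lemma sqr_le_mul_mul x w y : 0 <= y -> x ^+ 2 <= y -> w ^+ 2 <= y -> `|x * w| <= y.
Proof.
move=> y0 xy wy.
have := sqr_ge0 (`|x| - `|w|); rewrite normrM.
rewrite sqrrB !real_normK ?num_real//; set a := `|x| * `|w|; rewrite -[_ *+ 2]mulr_natr; lra.
Qed.

End product_bounds.

Section kernel_bound.
Context (R : realType) (d : nat).
Local Notation leb := (lebesgue_rV R d).
Local Notation V := 'rV[R]_d.

Lemma cv_bound (phi f : V -> R) (C : R) x : Rint leb setT f -> measurable_fun setT phi ->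
  (forall z, `|phi z| <= C) -> `|cv phi f x| <= C * \int[leb]_z `|f z|.
Proof.
move=> fi mphi phiC.
have mphix : measurable_fun setT (fun z : V => phi (z - x)) by exact: measurableT_comp mphi (measurable_addrV (- x)).
have i1 : Rint leb setT (fun z => f z * phi (z - x)).
  rewrite (_ : (fun z => _) = (fun z : V => phi (z - x) * f z)).
    exact: (RintMb fi mphix (fun z _ => phiC _)).
  by apply/funext => z; rewrite mulrC.
have iaf := Rint_abs fi.
apply: le_trans (le_norm_RInt i1) _; rewrite -RIntZ//.
apply: le_RInt => [||z _]; [exact: Rint_abs|exact: RintZ|].
by rewrite normrM mulrC ler_wpM2r.
Qed.

Lemma conv_norm_bound n (f : V -> R) : Rint leb setT f ->
  Rint leb setT (cv (@moll R d n) f) /\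
  \int[leb]_x `|cv (@moll R d n) f x| <= \int[leb]_x `|f x|.
Proof.
move=> fi; have lf := Rint_L1_loc fi; have iaf := Rint_abs fi.
have [i1 <-] := ge0_integral_conv n iaf (fun x => normr_ge0 _).
have h x : `|cv (@moll R d n) f x| <= cv (@moll R d n) (fun x => `|f x|) x.
  have i2 := conv_Rint n x lf; apply: le_trans (le_norm_RInt i2) _.
  have i3 := conv_Rint n x (Rint_L1_loc iaf).
  apply: le_RInt => [||z _]; [exact: Rint_abs|by []|].
  by rewrite normrM (ger0_norm (moll_ge0 _ _)).
have i2 : Rint leb setT (cv (@moll R d n) f).
  apply: (Rint_le _ i1) => [|x _]; last exact: h.
  by apply: continuous_measurable_rV; exact: (@conv_continuous R d n f lf).
by split => //; apply: le_RInt => //; exact: Rint_abs.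
Qed.

End kernel_bound.

Lemma cvg_sumR (R : realType) (I : Type) (s : seq I) (f : nat -> I -> R) (l : I -> R) :
  (forall i, f n i @[n --> \oo] --> l i) ->
  \sum_(i <- s) f n i @[n --> \oo] --> \sum_(i <- s) l i.
Proof.
move=> fl; elim: s => [|i s IH].
  by rewrite big_nil; under eq_fun do rewrite big_nil; exact: cvg_cst.
by rewrite big_cons; under eq_fun do rewrite big_cons; apply: cvgD.
Qed.

Section master.
Context (R : realType) (d : nat).
Local Notation mu := (@lebesgue_measure R).
Local Notation leb := (lebesgue_rV R d).
Local Notation V := 'rV[R]_d.
Local Notation conv n := (cv (@moll R d n)).
Local Notation e_ i := (delta_mx 0 i : V).

(** Here [u] is the density, [q] the flux, [p] the gradient of [u], [b] a majorant integrable in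
    space and [c] a bound on its mass integrable in time. By [hgrad], times without information on
    the gradient must carry zero flux. *)
Variables (u : R -> V -> R) (q p : R -> 'I_d -> V -> R) (b : R -> V -> R) (c : R -> R).
Hypotheses (u0 : forall t x, 0 <= u t x) (ui : forall t, Rint leb setT (u t))
  (u1 : forall t, \int[leb]_x u t x = 1)
  (b0 : forall t x, 0 <= b t x) (bi : forall t, Rint leb setT (b t))
  (bc : forall t, \int[leb]_x b t x <= c t)
  (mq : forall t i, measurable_fun setT (q t i))
  (mp : forall t i, measurable_fun setT (p t i))
  (qub : forall t i x, q t i x ^+ 2 <= u t x * b t x)
  (pub : forall t i x, p t i x ^+ 2 <= u t x * b t x)
  (mcu : forall n x, measurable_fun setT (fun t => conv n (u t) x))
  (mcq : forall n i x, measurable_fun setT (fun t => conv n (q t i) x))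
  (mcp : forall n i x, measurable_fun setT (fun t => conv n (p t i) x))
  (mcDq : forall n (i : 'I_d) x, measurable_fun setT (fun t => cv ('D_(e_ i) (@moll R d n)) (q t i) x))
  (hgrad : forall t, (forall i x, q t i x = 0) \/
     forall n (i : 'I_d) x, is_derive x (e_ i) (conv n (u t)) (conv n (p t i) x))
  (evol : forall n x s t, 0 <= s -> s <= t -> conv n (u t) x - conv n (u s) x =
     - \int[mu]_(r in `[s, t]) \sum_i cv ('D_(e_ i) (@moll R d n)) (q r i) x)
  (ic : forall T, Rint mu `[0, T] c).

Let iq t i : Rint leb setT (q t i).
Proof.
apply: (Rint_le (mq t i) (RintD (ui t) (bi t))) => x _; exact: sqr_le_mul_add.
Qed.

Let ip t i : Rint leb setT (p t i).
Proof.
apply: (Rint_le (mp t i) (RintD (ui t) (bi t))) => x _; exact: sqr_le_mul_add.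
Qed.

Let q1 t i : \int[leb]_x `|q t i x| <= 1 + c t.
Proof.
apply: (@le_trans _ _ (\int[leb]_x (u t x + b t x))).
  apply: le_RInt => [||x _]; [exact: Rint_abs|exact: RintD|exact: sqr_le_mul_add].
by rewrite RIntD// u1 lerD2l.
Qed.

Let c0 t : 0 <= c t.
Proof. by apply: le_trans (bc t); exact: Rintegral_ge0. Qed.

Let h0 n t x : 0 <= conv n (u t) x. Proof. exact: conv_ge0. Qed.
Let hb0 n t x : 0 <= conv n (b t) x. Proof. exact: conv_ge0. Qed.

Let cu n t : continuous (conv n (u t)).
Proof. exact/(@conv_continuous R d n)/Rint_L1_loc. Qed.
Let cq n t i : continuous (conv n (q t i)).
Proof. exact/(@conv_continuous R d n)/Rint_L1_loc. Qed.
Let cp n t i : continuous (conv n (p t i)).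
Proof. exact/(@conv_continuous R d n)/Rint_L1_loc. Qed.

Let Dm n (i : 'I_d) : V -> R := 'D_(e_ i) (@moll R d n).
Let cDm n (i : 'I_d) : continuous (Dm n i).
Proof. by case: (@moll_C1dir R d n (e_ i)). Qed.
Let Dm_off n (i : 'I_d) : vanishes_off n.+1%:R^-1 (Dm n i).
Proof. exact/vanishes_derive/moll_vanishes. Qed.
Let cDq n t (i : 'I_d) : continuous (cv (Dm n i) (q t i)).
Proof. exact: (@cv_continuous R d _ _ (@cDm n i) (@Dm_off n i) _ (Rint_L1_loc (iq t i))). Qed.

Let hq n t i x : conv n (q t i) x ^+ 2 <= conv n (u t) x * conv n (b t) x.
Proof. by apply: conv_cauchy_schwarz => //; exact: Rint_L1_loc. Qed.
Let hp n t i x : conv n (p t i) x ^+ 2 <= conv n (u t) x * conv n (b t) x.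
Proof. by apply: conv_cauchy_schwarz => //; exact: Rint_L1_loc. Qed.

Section test.
Variables (beta : V -> R) (r : R) (G G1 G2 : R -> R) (L : R).
Hypotheses (Cbeta : forall i : 'I_d, C1dir (e_ i) beta) (beta_r : vanishes_off r beta)
  (cbeta : continuous beta) (GL : C2_half_line G G1 G2 L).

Let L0 : 0 <= L. Proof. by case: GL. Qed.
Let Db (i : 'I_d) : V -> R := 'D_(e_ i) beta.
Let Db_off (i : 'I_d) : vanishes_off r (Db i). Proof. exact: vanishes_derive. Qed.
Let cDb (i : 'I_d) : continuous (Db i). Proof. by case: (Cbeta i). Qed.

Let cG1u n t : continuous (fun x => G1 (conv n (u t) x)).
Proof.
move=> x; apply: (@continuous_comp _ _ _ (conv n (u t))); first exact: cu.
by case: (C2_half_line_continuous GL (h0 n t x)).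
Qed.

Let cG2u n t : continuous (fun x => G2 (conv n (u t) x)).
Proof.
move=> x; apply: (@continuous_comp _ _ _ (conv n (u t))); first exact: cu.
by case: (C2_half_line_continuous GL (h0 n t x)).
Qed.

Let integrand n t i x := conv n (q t i) x *
  (beta x * (G2 (conv n (u t) x) * conv n (p t i) x) + G1 (conv n (u t) x) * Db i x).

(** Undoes the derivative on the kernel that the evolution equation produces: it is moved to the
    product of the cut-off and G'(u). *)
Let mollified_ibp n t (i : 'I_d) :
  \int[leb]_x integrand n t i x =
  \int[leb]_x (cv (Dm n i) (q t i) x * (beta x * G1 (conv n (u t) x))).
Proof.
(* At the exceptional times the flux vanishes, and both sides are zero. *)
have [q0|gr] := hgrad t.
  have z (phi : V -> R) x : cv phi (q t i) x = 0.
    by rewrite /cv; under eq_Rintegral do rewrite q0 mul0r; rewrite Rintegral_cst ?mul0r.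
  by apply: eq_Rintegral => x _; rewrite /integrand !z !mul0r.
have [CG1 DG1] := C1dir_is_derive (@cG1u n t)
  (fun x => let: conj _ h := conj I (is_derive_comp (gr n i x)
     (let: And5 _ _ h _ _ := GL in h _ (h0 n t x))) in h)
  (ctsM (@cG2u n t) (@cp n t i)).
have [CQ DQ] := C1dir_is_derive (@cq n t i)
  (fun x => cv_derive x (@moll_C1dir R d n (e_ i)) (@moll_vanishes R d n) (Rint_L1_loc (iq t i)))
  (ctsN (@cDq n t i)).
have off : vanishes_off r (fun x => beta x * G1 (conv n (u t) x)).
  by move=> x rx; rewrite beta_r// mul0r.
transitivity (\int[leb]_x (conv n (q t i) x * 'D_(e_ i) (fun x => beta x * G1 (conv n (u t) x)) x)).
  apply: eq_Rintegral => x _; rewrite /integrand; congr (_ * _).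
  case: (Cbeta i) => _ db _; case: CG1 => _ dG1 _.
  by have := deriveM (db x) (dG1 x) => /= ->; congr (_ * _ + _); exact: (congr1 (fun f => f x) (esym DG1)).
transitivity (- \int[leb]_x ('D_(e_ i) (conv n (q t i)) x * (beta x * G1 (conv n (u t) x)))).
  exact: (integration_by_parts_rV CQ (C1dirM (Cbeta i) CG1) off).
rewrite -RIntN; last first.
  apply: (Rint_Cc (r := r)) => [|x rx]; last by rewrite off// mulr0.
  apply: ctsM; first by case: CQ.
  by apply: ctsM => //; exact: cG1u.
by apply: eq_Rintegral => x _; rewrite (congr1 (fun f => f x) DQ) mulNr opprK.
Qed.

Let jm (f : R -> V -> R) : (forall x, measurable_fun setT (f ^~ x)) -> (forall t, continuous (f t)) ->
  measurable_fun setT (fun z : R * V => f z.1 z.2).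
Proof. by move=> mf cf; apply: measurable_caratheodory. Qed.

Let mG1u n : measurable_fun setT (fun z : R * V => G1 (conv n (u z.1) z.2)).
Proof.
apply: measurable_half_line => [s s0||z]; [|by apply: (jm (f := fun t => conv n (u t)))|exact: h0].
by case: (C2_half_line_continuous GL s0).
Qed.

Let mG2u n : measurable_fun setT (fun z : R * V => G2 (conv n (u z.1) z.2)).
Proof.
apply: measurable_half_line => [s s0||z]; [|by apply: (jm (f := fun t => conv n (u t)))|exact: h0].
by case: (C2_half_line_continuous GL s0).
Qed.

Let msnd (f : V -> R) : continuous f -> measurable_fun setT (fun z : R * V => f z.2).
Proof. by move=> cf; exact: measurableT_comp (continuous_measurable_rV cf) measurable_snd. Qed.

Let mintegrand n i : measurable_fun setT (fun z : R * V => integrand n z.1 i z.2).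
Proof.
apply: measurable_funM; first by apply: (jm (f := fun t => conv n (q t i))).
apply: measurable_funD; apply: measurable_funM => //; try exact: msnd.
by apply: measurable_funM => //; apply: (jm (f := fun t => conv n (p t i))).
Qed.

Let iintegrand n t i : Rint leb setT (integrand n t i).
Proof.
apply: (Rint_Cc (r := r)) => [|x rx].
  apply: ctsM; first exact: cq.
  apply: ctsD; apply: ctsM => //; first by apply: ctsM; [exact: cG2u|exact: cp].
by rewrite /integrand beta_r// Db_off// mul0r add0r !mulr0.
Qed.

Let iGu n t : Rint leb setT (fun x => beta x * G (conv n (u t) x)).
Proof.
apply: (Rint_Cc (r := r)) => [|x rx]; last by rewrite beta_r// mul0r.
apply: ctsM => // x; apply: (@continuous_comp _ _ _ (conv n (u t))); first exact: cu.
by case: (C2_half_line_continuous GL (h0 n t x)).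
Qed.

(** At fixed [x] the mollified density is absolutely continuous in time, so the chain rule is
    applied pointwise in [x]; space derivatives return only after Fubini, at fixed time. *)
Let mollified_formula n s t : 0 <= s -> s <= t ->
  \int[leb]_x (beta x * G (conv n (u t) x)) - \int[leb]_x (beta x * G (conv n (u s) x)) =
  - \int[mu]_(a in `[s, t]) \sum_i \int[leb]_x integrand n a i x.
Proof.
move=> s0 st; have t0 := le_trans s0 st.
have ics : Rint mu `[s, t] c by exact: Rint_itvS (ic t) _ _.
have ic1 : Rint mu `[s, t] (fun a => 1 + c a).
  apply: RintD => //; apply: Rint_continuous_itv; exact/continuous_subspaceT/cst_continuous.
(* These bounds deteriorate with [n], which is fixed here: they only ensure integrability. *)
have /fin_all_exists2[K K0 DK] : forall i : 'I_d, exists2 K, 0 < K & forall x, `|Dm n i x| <= K.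
  by move=> i; exact: (continuous_bounded_support (@cDm n i) (@Dm_off n i)).
pose D a x := \sum_i cv (Dm n i) (q a i) x.
pose KK := \sum_i K i.
have Dle a x : `|D a x| <= KK * (1 + c a).
  apply: le_trans (ler_norm_sum _ _ _) _; rewrite mulr_suml; apply: ler_sum => i _.
  apply: le_trans (cv_bound _ (iq a i) (continuous_measurable_rV (@cDm n i)) (DK i)) _.
  by rewrite ler_wpM2l//; exact: ltW.
have mD : measurable_fun setT (fun z : R * V => D z.1 z.2).
  apply: measurable_sum => i; apply: (jm (f := fun t => cv (Dm n i) (q t i))) => //.
  by move=> x; exact: mcDq.
have [B B0 betaB] := continuous_bounded_support cbeta beta_r.
have ibeta := Rint_abs (Rint_Cc cbeta beta_r).
pose F (z : R * V) := - (D z.1 z.2 * (beta z.2 * G1 (conv n (u z.1) z.2))).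
have mF : measurable_fun setT F.
  apply: measurableT_comp => //; apply: measurable_funM => //; apply: measurable_funM => //.
  exact: msnd.
have iKc : Rint mu `[s, t] (fun a => KK * (1 + c a)) by exact: RintZ.
have G1L x : 0 <= x -> `|G1 x| <= L by case: GL => _ _ _ _ H /H[].
have [H1 H2 H3 H4 H5] := Fubini_product_bound mF (RintZr L iKc) ibeta (fun x => normr_ge0 _)
  (fun a x _ => ltac:(
     rewrite /F /= normrN normrM normrM -mulrA ler_pM// mulrC ler_wpM2r//; exact: G1L)).
rewrite -RIntB//.
transitivity (\int[leb]_x \int[mu]_(a in `[s, t]) F (a, x)).
  apply: eq_Rintegral => x _; rewrite -mulrBr.
  have mDx : measurable_fun setT (D^~ x) := measurableT_comp mD (measurable_pair2 x).
  have iDx : Rint mu `[s, t] (D^~ x).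
    by apply: (Rint_le _ iKc) => [|a _]; [exact: (@measurable_funTS _ _ _ _ _ _ mDx)|exact: Dle].
  have iNDx : Rint mu `[s, t] (fun a => - D a x) by exact: RintN.
  have iGD : Rint mu `[s, t] (fun a => G1 (conv n (u a) x) * - D a x).
    apply: (RintMb iNDx) => [|a _]; last exact: G1L.
    exact: (@measurable_funTS _ _ _ _ _ _ (measurableT_comp (mG1u n) (measurable_pair2 x))).
  rewrite (AC_chain_rule (g1 := G1) (H := fun a => conv n (u a) x) (D := fun a => - D a x) st L0)//.
  - by rewrite -RIntZ//; apply: eq_Rintegral => a _; rewrite /F /=; ring.
  - move=> s' t' ss' st' tt'; rewrite evol ?(le_trans s0 ss')// RIntN//.
    exact: Rint_itvS iDx ss' tt'.
  - by move=> y z y0 z0; exact: (C2_half_line_lip1 GL y0 z0).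
  - by move=> y z y0 z0; exact: (C2_half_line_taylor GL y0 z0).
have EF a : \int[leb]_x F (a, x) = - \sum_i \int[leb]_x integrand n a i x.
  have iA i : Rint leb setT (fun x => cv (Dm n i) (q a i) x * (beta x * G1 (conv n (u a) x))).
    apply: (Rint_Cc (r := r)) => [|x rx]; last by rewrite beta_r// mul0r mulr0.
    by apply: ctsM; [exact: cDq|apply: ctsM => //; exact: cG1u].
  under [in RHS]eq_bigr do rewrite mollified_ibp.
  rewrite -RInt_sum// -RIntN; last exact: Rint_sum.
  by apply: eq_Rintegral => x _; rewrite /F /= mulr_suml.
rewrite H5 -RIntN; first by apply: eq_Rintegral => a _; rewrite EF.
by apply: eq_Rint (RintN H4) => a _; rewrite EF opprK.
Qed.

Let lim_integrand t i x := q t i x *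
  (beta x * (G2 (u t x) * p t i x) + G1 (u t x) * Db i x).

Let G1L x : 0 <= x -> `|G1 x| <= L. Proof. by case: GL => _ _ _ _ H /H[]. Qed.
Let rG2L x : 0 <= x -> `|x * G2 x| <= L. Proof. by case: GL => _ _ _ _ H /H[]. Qed.

(** The mollified flux and gradient inherit the bound by u b, so their product absorbs the factor u
    needed to control G''(u). The right-hand side converges in L^1 as the mollification is
    removed. *)
Let dominated n t i x B B' : 0 <= B -> (forall x, `|beta x| <= B) -> (forall x, `|Db i x| <= B') ->
  `|integrand n t i x| <= B * L * conv n (b t) x + L * B' * `|conv n (q t i) x|.
Proof.
move=> B0 betaB DbB; rewrite /integrand mulrDr; apply: le_trans (ler_normD _ _) _; apply: lerD.
  have -> : conv n (q t i) x * (beta x * (G2 (conv n (u t) x) * conv n (p t i) x)) =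
    beta x * (G2 (conv n (u t) x) * (conv n (q t i) x * conv n (p t i) x)) by ring.
  rewrite normrM -mulrA ler_pM//.
  rewrite normrM; have hb := mulr_ge0 (h0 n t x) (hb0 n t x).
  have pq := sqr_le_mul_mul hb (hq n t i x) (hp n t i x).
  apply: le_trans (ler_wpM2l (normr_ge0 _) pq) _.
  rewrite mulrA ler_wpM2r// -[X in _ * X]ger0_norm// -normrM mulrC; exact: rG2L.
by rewrite normrM mulrC ler_wpM2r// normrM ler_pM//; exact: G1L.
Qed.

Let fixed_time_cvg t i :
  \int[leb]_x integrand n t i x @[n --> \oo] --> \int[leb]_x lim_integrand t i x.
Proof.
have [B B0 betaB] := continuous_bounded_support cbeta beta_r.
have [B' B'0 DbB] := continuous_bounded_support (@cDb i) (@Db_off i).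
pose err n (f : V -> R) x := `|conv n f x - f x|.
have ierr n f : Rint leb setT f -> Rint leb setT (err n f).
  by move=> fi; apply: Rint_abs; apply: RintB => //; case: (conv_norm_bound n fi).
(* The errors of [q] and [b] enter the domination, those of [u], [p] and [q] the pointwise
   convergence. *)
pose e_ n x := (err n (u t) x + err n (p t i) x) + (err n (q t i) x + err n (b t) x).
have ie12 n : Rint leb setT (fun x => err n (u t) x + err n (p t i) x).
  by apply: RintD; exact: ierr.
have ie34 n : Rint leb setT (fun x => err n (q t i) x + err n (b t) x).
  by apply: RintD; exact: ierr.
have err0 n f x : 0 <= err n f x by exact: normr_ge0.
apply: (@Rint_GDCT _ _ _ leb setT e_ _ _ (fun x => B * L * b t x + L * B' * `|q t i x|) (B * L + L * B')).
- by move=> n; exact: RintD.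
- by move=> n x _; rewrite !addr_ge0.
- rewrite (_ : (fun n => _) = (fun n => (\int[leb]_x err n (u t) x + \int[leb]_x err n (p t i) x) +
     (\int[leb]_x err n (q t i) x + \int[leb]_x err n (b t) x))).
    by apply: cvg0D; apply: cvg0D; exact: conv_L1_cvg.
  by apply/funext => n; rewrite RIntD// !RIntD//; exact: ierr.
- by move=> n; apply: Rint_meas (iintegrand n t i).
- have mu_ := @Rint_meas _ _ _ leb _ _ (ui t).
  apply: measurable_funM => //; apply: measurable_funD; apply: measurable_funM.
  + exact: continuous_measurable_rV.
  + apply: measurable_funM => //; apply: measurable_half_line => // s s0.
    by case: (C2_half_line_continuous GL s0).
  + apply: measurable_half_line => // s s0.
    by case: (C2_half_line_continuous GL s0).
  + exact: continuous_measurable_rV.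
- apply: RintD; apply: RintZ => //; exact: Rint_abs.
- by rewrite addr_ge0 ?mulr_ge0// ltW.
- move=> n; apply: aeW => x _; apply: le_trans (dominated n t x (ltW B0) betaB DbB) _.
  have k1 : 0 <= B * L by rewrite mulr_ge0// ltW.
  have k2 : 0 <= L * B' by rewrite mulr_ge0// ltW.
  have hb : conv n (b t) x <= b t x + e_ n x.
    rewrite -lerBlDl; apply: le_trans (ler_norm _) _; rewrite -/(err n (b t) x) /e_.
    have := err0 n (u t) x; have := err0 n (p t i) x; have := err0 n (q t i) x; lra.
  have hqq : `|conv n (q t i) x| <= `|q t i x| + e_ n x.
    rewrite -lerBlDl; apply: le_trans (lerB_dist _ _) _; rewrite -/(err n (q t i) x) /e_.
    have := err0 n (u t) x; have := err0 n (p t i) x; have := err0 n (b t) x; lra.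
  apply: le_trans (lerD (ler_wpM2l k1 hb) (ler_wpM2l k2 hqq)) _.
  by rewrite le_eqVlt; apply/orP; left; apply/eqP; ring.
apply: aeW => x _ psi _ ex.
have comp f : (forall n, err n f x <= e_ n x) -> conv (psi k) f x @[k --> \oo] --> f x.
  move=> fe; apply/subr_cvg0; apply: norm_cvg0.
  apply: (@squeeze_cvgr _ _ _ _ (fun=> 0) (fun k => e_ (psi k) x)) => //; last exact: cvg_cst.
  by apply: nearW => k; rewrite normr_ge0 /= fe.
have l (f : V -> R) n := err0 n f x.
have cvu : conv (psi k) (u t) x @[k --> \oo] --> u t x.
  by apply: comp => n; rewrite /e_; have := l (p t i) n; have := l (q t i) n; have := l (b t) n; lra.
have cvp : conv (psi k) (p t i) x @[k --> \oo] --> p t i x.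
  by apply: comp => n; rewrite /e_; have := l (u t) n; have := l (q t i) n; have := l (b t) n; lra.
have cvq : conv (psi k) (q t i) x @[k --> \oo] --> q t i x.
  by apply: comp => n; rewrite /e_; have := l (u t) n; have := l (p t i) n; have := l (b t) n; lra.
have [_ cG1 cG2] := C2_half_line_continuous GL (u0 t x).
apply: cvgM => //; apply: cvgD.
  by apply: cvgMr; apply: cvgM => //; exact: (cvg_comp _ _ cvu cG2).
by apply: cvgMl; exact: (cvg_comp _ _ cvu cG1).
Qed.

Let initial_cvg t :
  \int[leb]_x (beta x * G (conv n (u t) x)) @[n --> \oo] --> \int[leb]_x (beta x * G (u t x)).
Proof.
have [B B0 betaB] := continuous_bounded_support cbeta beta_r.
have ieru n : Rint leb setT (fun x => `|conv n (u t) x - u t x|).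
  by apply: Rint_abs; apply: RintB => //; case: (conv_norm_bound n (ui t)).
apply: (@Rint_GDCT _ _ _ leb setT (fun n x => `|conv n (u t) x - u t x|) _ _
  (fun x => `|beta x| * `|G 0| + B * L * u t x) (B * L)) => //.
- exact: conv_L1_cvg.
- by move=> n; exact: Rint_meas (iGu n t).
- apply: measurable_funM; first exact: continuous_measurable_rV.
  apply: measurable_half_line => [s s0||x] //; last exact: Rint_meas (ui t).
  by case: (C2_half_line_continuous GL s0).
- apply: RintD; last exact: RintZ.
  by apply: RintZr; exact/Rint_abs/(Rint_Cc cbeta beta_r).
- by rewrite mulr_ge0// ltW.
- move=> n; apply: aeW => x _; rewrite normrM.
  apply: le_trans (ler_wpM2l (normr_ge0 _) (C2_half_line_bound GL (h0 n t x))) _.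
  rewrite mulrDr -addrA lerD2l -!mulrA -mulrDr ler_pM// ?mulr_ge0//.
  rewrite -mulrDr ler_wpM2l// -lerBlDl; exact: ler_norm.
apply: aeW => x _ psi _ ex; apply: cvgMr.
have cvu : conv (psi k) (u t) x @[k --> \oo] --> u t x by apply/subr_cvg0; exact: norm_cvg0.
by have [cG _ _] := C2_half_line_continuous GL (u0 t x); exact: (cvg_comp _ _ cvu cG).
Qed.

Lemma energy_balance s t : 0 <= s -> s <= t ->
  Rint mu `[s, t] (fun a => \sum_i \int[leb]_x (q a i x *
    (beta x * (G2 (u a x) * p a i x) + G1 (u a x) * 'D_(e_ i) beta x))) /\
  \int[leb]_x (beta x * G (u t x)) - \int[leb]_x (beta x * G (u s x)) =
  - \int[mu]_(a in `[s, t]) \sum_i \int[leb]_x (q a i x *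
    (beta x * (G2 (u a x) * p a i x) + G1 (u a x) * 'D_(e_ i) beta x)).
Proof.
move=> s0 st; have t0 := le_trans s0 st.
have ics : Rint mu `[s, t] c by exact: Rint_itvS (ic t) _ _.
have ic1 : Rint mu `[s, t] (fun a => 1 + c a).
  apply: RintD => //; apply: Rint_continuous_itv; exact/continuous_subspaceT/cst_continuous.
have [B B0 betaB] := continuous_bounded_support cbeta beta_r.
have /fin_all_exists2[K K0 DK] : forall i : 'I_d, exists2 K, 0 < K & forall x, `|Db i x| <= K.
  by move=> i; exact: (continuous_bounded_support (@cDb i) (@Db_off i)).
have mI n : measurable_fun setT (fun a => \sum_i \int[leb]_x integrand n a i x).
  apply: measurable_sum => i; exact: (measurable_Rint_param (mintegrand n i)).
have cvI a : \sum_i \int[leb]_x integrand n a i x @[n --> \oo] -->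
    \sum_i \int[leb]_x lim_integrand a i x.
  by apply: cvg_sumR => i; exact: fixed_time_cvg.
(* A majorant independent of [n]: mollification preserves the mass of [b] and does not increase that
   of |q|, which is at most 1 + c. *)
have ig : Rint mu `[s, t] (fun a => \sum_i (B * L * c a + L * K i * (1 + c a))).
  by apply: Rint_sum => // i; apply: RintD; exact: RintZ.
have [] := @Rint_DCT _ _ R mu `[s, t] (fun n a => \sum_i \int[leb]_x integrand n a i x)
  (fun a => \sum_i \int[leb]_x lim_integrand a i x) _ _ _ _ ig.
- by move=> n; exact: (@measurable_funTS _ _ _ _ _ _ (mI n)).
- apply: (@measurable_funTS _ _ _ _ _ _ _); apply: (measurable_fun_cvg mI) => a _; exact: cvI.
- by apply: aeW => a _; exact: cvI.
- apply: aeW => a _ n; apply: le_trans (ler_norm_sum _ _ _) _; apply: ler_sum => i _.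
  have ii := iintegrand n a i; apply: le_trans (le_norm_RInt ii) _.
  have [ib1 Eb] := ge0_integral_conv n (bi a) (b0 a).
  have [iq1 Eq] := conv_norm_bound n (iq a i).
  have k1 : 0 <= B * L by rewrite mulr_ge0// ltW.
  have k2 : 0 <= L * K i by rewrite mulr_ge0// ltW.
  apply: (@le_trans _ _ (\int[leb]_x (B * L * conv n (b a) x + L * K i * `|conv n (q a i) x|))).
    apply: le_RInt => [||x _]; first exact: Rint_abs.
      by apply: RintD; apply: RintZ => //; exact: Rint_abs.
    exact: dominated (ltW B0) betaB (DK i).
  rewrite RIntD//; [|exact: RintZ|by apply: RintZ; exact: Rint_abs].
  rewrite !RIntZ//; last exact: Rint_abs.
  by rewrite lerD// ler_wpM2l// ?Eb//; exact: le_trans Eq (q1 a i).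
move=> iI _ cv1; split => //.
apply: (@cvg_unique _ (@Rhausdorff R)
  ((fun n => \int[leb]_x (beta x * G (conv n (u t) x)) - \int[leb]_x (beta x * G (conv n (u s) x))) @ \oo)).
  by apply: cvgB; exact: initial_cvg.
rewrite (_ : (fun n => _) = (fun n => - \int[mu]_(a in `[s, t]) \sum_i \int[leb]_x integrand n a i x)).
  exact: cvgN.
by apply/funext => n; exact: mollified_formula.
Qed.

End test.
End master.

(** * Measurability in time of nonlinear functionals of a curve *)

Section curves.
Context (R : realType) (d : nat).
Local Notation mu := (@lebesgue_measure R).
Local Notation leb := (lebesgue_rV R d).
Local Notation V := 'rV[R]_d.
Local Notation conv n := (cv (@moll R d n)).

Lemma within_ge0_continuous (g : R -> R) : {within [set t : R | 0 <= t], continuous g} ->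
  continuous (fun t : R => g (Num.max t 0)).
Proof.
move=> cg t; pose A := [set t : R | 0 <= t].
have At : A (Num.max t 0) by rewrite /A /= le_max lexx orbT.
have h1 : g @ within A (nbhs (Num.max t 0)) --> g (Num.max t 0).
  by have /subspace_continuousP := cg; apply.
have h2 : (fun t : R => Num.max t 0) @ t --> within A (nbhs (Num.max t 0)).
  move=> B /= BA.
  have cmax : (fun t : R => Num.max t 0) @ t --> Num.max t 0.
    by apply: continuous_max; [exact: cvg_id|exact: cvg_cst].
  have := cmax _ BA; rewrite /= !nbhs_filterE /=; apply: filterS => s /=; apply.
  by rewrite /A /= le_max lexx orbT.
exact: (cvg_comp _ _ h2 h1).
Qed.

Let ball_ind (r : R) : V -> R := \1_[set x : V | `|x| <= r].

Let mball r : measurable_fun setT (ball_ind r).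
Proof. by apply: measurable_indic; exact: closed_ball_measurable. Qed.

Let mconv (f : R -> V -> R) n : (forall n x, measurable_fun setT (fun t => conv n (f t) x)) ->
  (forall t, L1_loc (f t)) -> measurable_fun setT (fun z : R * V => conv n (f z.1) z.2).
Proof.
move=> mf fl; apply: (@measurable_caratheodory _ _ _ _ (fun z : R * V => conv n (f z.1) z.2)) => //=.
by move=> t; exact: (@conv_continuous R d n _ (fl t)).
Qed.

Let err (r : R) n (f : V -> R) x := `|conv n f x - f x| * ball_ind r x.

Let err_cvg (f : V -> R) (psi : nat -> nat) (r : R) x (e : nat -> R) : `|x| <= r ->
  (forall n, err r n f x <= e n) -> e (psi k) @[k --> \oo] --> 0 ->
  conv (psi k) f x @[k --> \oo] --> f x.
Proof.
move=> xr fe e0; apply/subr_cvg0; apply: norm_cvg0.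
apply: (@squeeze_cvgr _ _ _ _ (fun=> 0) (fun k => e (psi k))) => //; last exact: cvg_cst.
apply: nearW => k; rewrite normr_ge0 /=.
by have := fe (psi k); rewrite /err /ball_ind indicE mem_set// mulr1.
Qed.

Let ierr r n f : L1_loc f -> Rint leb setT (err r n f).
Proof.
move=> fl; have cl : L1_loc (conv n f) by apply: continuous_L1_loc; exact: (@conv_continuous R d n f fl).
by have := Rint_ball_indic r (L1_loc_abs (L1_locB cl fl)).
Qed.

(** Weak measurability of the curve says nothing about a nonlinear [g] directly. The mollified curve
    is jointly measurable, and removing the mollification at each fixed time keeps measurability in
    the limit. *)
Lemma measurable_bounded_functional (u : R -> V -> R) (g : R -> R) (zeta : V -> R) (r C : R) :
  (forall t, L1_loc (u t)) -> (forall n x, measurable_fun setT (fun t => conv n (u t) x)) ->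
  continuous g -> (forall s, `|g s| <= C) -> continuous zeta -> vanishes_off r zeta ->
  measurable_fun setT (fun t => \int[leb]_x (g (u t x) * zeta x)).
Proof.
move=> ul mc cg gC cz zr.
have mz := continuous_measurable_rV cz.
apply: (measurable_fun_cvg (h := fun n t => \int[leb]_x (g (conv n (u t) x) * zeta x))).
  move=> n; apply: (measurable_Rint_param (F := fun z => g (conv n (u z.1) z.2) * zeta z.2)).
  apply: measurable_funM.
    exact: measurableT_comp (continuous_measurable_fun cg) (mconv n mc ul).
  exact: measurableT_comp mz measurable_snd.
move=> t _; apply: (@Rint_GDCT _ _ _ leb setT (fun n => err r n (u t)) _ _ (fun x => C * `|zeta x|) 0).
- by move=> n; exact: ierr.
- by move=> n x _; rewrite mulr_ge0// /ball_ind indicE.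
- exact: conv_L1loc_cvg.
- move=> n; apply: measurable_funM => //; apply: continuous_measurable_rV => x.
  apply: (@continuous_comp _ _ _ (conv n (u t))); last exact: cg.
  exact: (@conv_continuous R d n _ (ul t)).
- by apply: measurable_funM => //; apply: measurableT_comp (continuous_measurable_fun cg) _; case: (ul t).
- by apply: RintZ; apply: Rint_abs; exact: Rint_Cc cz zr.
- by [].
- by move=> n; apply: aeW => x _; rewrite mul0r addr0 normrM ler_wpM2r.
apply: aeW => x _ psi _ ex; have [xr|rx] := leP `|x| r.
  have cvu := err_cvg xr (fun n => lexx _) ex.
  apply: cvgMl; exact: (cvg_comp _ _ cvu (cg (u t x))).
by rewrite zr// mulr0; under eq_fun do rewrite mulr0; exact: cvg_cst.
Qed.

(** The cap [K] and the shift [e] of the denominator make the integrand bounded and continuous in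
    (q, u); the unregularised quotient is reached by monotone convergence in [diss_measurable]. *)
Lemma measurable_kinetic_functional (I : finType) (u : R -> V -> R) (q : R -> I -> V -> R) (r K e : R) :
  0 < e -> 0 <= K -> (forall t x, 0 <= u t x) ->
  (forall t, L1_loc (u t)) -> (forall n x, measurable_fun setT (fun t => conv n (u t) x)) ->
  (forall t i, L1_loc (q t i)) -> (forall n i x, measurable_fun setT (fun t => conv n (q t i) x)) ->
  measurable_fun setT (fun t => \int[leb]_x
    (Num.min ((\sum_i q t i x ^+ 2) / (u t x + e)) K * ball_ind r x)).
Proof.
move=> e0 K0 u0 ul mcu ql mcq.
pose Phi (s w : R) := Num.min (s / (w + e)) K.
have Phi_b s w : 0 <= s -> 0 <= w -> `|Phi s w| <= K.
  move=> s0 w0; rewrite ger0_norm ?ge_min ?lexx ?orbT//.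
  by rewrite le_min K0 andbT divr_ge0// addr_ge0// ltW.
have mPhi d0 (T : measurableType d0) (s w : T -> R) : measurable_fun setT s -> measurable_fun setT w ->
    (forall x, 0 <= w x) -> measurable_fun setT (fun x => Phi (s x) (w x)).
  move=> ms mw w0; apply: measurable_minr => //; apply: measurable_funM => //.
  apply: (@measurable_half_line _ _ _ (fun y => (y + e)^-1)) => // y y0.
  apply: continuousV; first by rewrite gt_eqF// ltr_wpDl.
  by apply: cvgD; [exact: cvg_id|exact: cvg_cst].
have cu0 n t x : 0 <= conv n (u t) x by exact: conv_ge0.
have sq0 (f : I -> R) : 0 <= \sum_i f i ^+ 2 by apply: sumr_ge0 => i _; exact: sqr_ge0.
apply: (measurable_fun_cvg (h := fun n t => \int[leb]_x
    (Phi (\sum_i conv n (q t i) x ^+ 2) (conv n (u t) x) * ball_ind r x))).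
  move=> n; apply: (measurable_Rint_param (F := fun z =>
    Phi (\sum_i conv n (q z.1 i) z.2 ^+ 2) (conv n (u z.1) z.2) * ball_ind r z.2)).
  apply: measurable_funM; last exact: measurableT_comp (mball r) measurable_snd.
  apply: mPhi => //; last exact: mconv.
  apply: measurable_sum => i; apply: measurable_funX.
  by apply: (mconv (f := fun t => q t i)).
move=> t _.
apply: (@Rint_GDCT _ _ _ leb setT (fun n x => err r n (u t) x + \sum_i err r n (q t i) x) _ _
   (fun x => K * ball_ind r x) 0).
- by move=> n; apply: RintD; [exact: ierr|apply: Rint_sum => // i; exact: ierr].
- by move=> n x _; apply: addr_ge0; [|apply: sumr_ge0 => i _]; rewrite mulr_ge0// /ball_ind indicE.
- rewrite (_ : (fun n => _) = (fun n => \int[leb]_x err r n (u t) x + \sum_i \int[leb]_x err r n (q t i) x)).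
    apply: cvg0D; first exact: conv_L1loc_cvg.
    have E0 : \sum_(i : I) (0 : R) = 0 by rewrite big1.
    rewrite -[X in _ --> X]E0; apply: (cvg_sumR (l := fun=> 0)) => i; exact: conv_L1loc_cvg.
  apply/funext => n; rewrite RIntD; [|exact: ierr|by apply: Rint_sum => // i; exact: ierr].
  by rewrite RInt_sum// => i; exact: ierr.
- move=> n; apply: measurable_funM => //; apply: mPhi => //.
    apply: measurable_sum => i; apply: measurable_funX.
    by apply: continuous_measurable_rV; exact: (@conv_continuous R d n _ (ql t i)).
  by apply: continuous_measurable_rV; exact: (@conv_continuous R d n _ (ul t)).
- apply: measurable_funM => //; apply: mPhi => //; last by case: (ul t).
  by apply: measurable_sum => i; apply: measurable_funX; case: (ql t i).
- by apply: RintZ; apply: Rint_indic => //; [exact: closed_ball_measurable|exact: leb_ball_lty].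
- by [].
- move=> n; apply: aeW => x _; rewrite mul0r addr0 normrM.
  by rewrite (ger0_norm (_ : 0 <= ball_ind r x)) ?ler_wpM2r ?Phi_b// /ball_ind indicE.
apply: aeW => x _ psi _ ex; have [xr|rx] := leP `|x| r; last first.
  have -> : ball_ind r x = 0 by rewrite /ball_ind indicE memNset//= => h; move: rx; rewrite ltNge h.
  by rewrite mulr0; under eq_fun do rewrite mulr0; exact: cvg_cst.
have e0' n f : 0 <= err r n f x by rewrite mulr_ge0// /ball_ind indicE.
have s0 n : 0 <= \sum_i err r n (q t i) x by exact: sumr_ge0.
have cvu : conv (psi k) (u t) x @[k --> \oo] --> u t x.
  by apply: (err_cvg (e := fun n => err r n (u t) x + \sum_i err r n (q t i) x) xr _ ex) => n; rewrite lerDl.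
have cvq i : conv (psi k) (q t i) x @[k --> \oo] --> q t i x.
  apply: (err_cvg (e := fun n => err r n (u t) x + \sum_i err r n (q t i) x) xr _ ex) => n; apply: ler_wpDl => //.
  by rewrite (bigD1 i)//= lerDl; exact: sumr_ge0.
apply: cvgMl; rewrite /Phi.
have c2 : (\sum_i conv (psi k) (q t i) x ^+ 2) / (conv (psi k) (u t) x + e) @[k --> \oo] -->
    (\sum_i q t i x ^+ 2) / (u t x + e).
  apply: cvgM; first by apply: cvg_sumR => i; exact: (cvgM (cvq i) (cvq i)).
  apply: cvgV; first by rewrite gt_eqF// ltr_wpDl.
  by apply: cvgD => //; exact: cvg_cst.
have cm : continuous (fun y : R => Num.min y K).
  by move=> y; apply: continuous_min; [exact: cvg_id|exact: cvg_cst].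
exact: (cvg_comp _ _ c2 (cm _)).
Qed.

End curves.

(** * Second moments along Wasserstein curves *)

Section transport_of_density.
Context d1 d2 (S : measurableType d1) (T : measurableType d2) (R : realType).
Variables (gamma : {measure set S -> \bar R}) (nu : {measure set T -> \bar R}).
Variables (phi : S -> T) (u f : T -> R).
Import HBNNSimple.

(** The marginals of a coupling are known only as set functions, so the change of variables is built
    up from simple functions. *)
Lemma ge0_integral_transport : measurable_fun setT phi -> measurable_fun setT u ->
  measurable_fun setT f -> (forall y, 0 <= u y) -> (forall y, 0 <= f y) ->
  (forall A, measurable A -> gamma (phi @^-1` A) = \int[nu]_(y in A) (u y)%:E)%E ->
  (\int[gamma]_z (f (phi z))%:E = \int[nu]_y (f y * u y)%:E)%E.
Proof.
move=> mphi mu mf u0 f0 H.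
have mF : measurable_fun setT (EFin \o f) by exact/measurable_EFinP.
pose f_ := nnsfun_approx measurableT mF.
have cvf y : (f_ n y)%:E @[n --> \oo] --> (f y)%:E.
  by apply: (cvg_nnsfun_approx measurableT mF) => // x _; rewrite /= lee_fin.
have mfn n : measurable_fun setT (f_ n) by exact: measurable_funP.
transitivity (limn (fun n => \int[gamma]_z (f_ n (phi z))%:E))%E.
  rewrite -monotone_convergence//.
  - by apply: eq_integral => z _; apply/esym/cvg_lim => //; exact: cvf.
  - by move=> n; apply/measurable_EFinP; exact: measurableT_comp.
  - by move=> n y _; rewrite lee_fin.
  - by move=> y _ m n mn; rewrite lee_fin; exact/lefP/nd_nnsfun_approx.
transitivity (limn (fun n => \int[nu]_y (f_ n y * u y)%:E))%E; last first.
  rewrite -monotone_convergence//.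
  - apply: eq_integral => y _; apply/cvg_lim => //.
    have := cvf y => /fine_cvg /= cvfy.
    apply: (@cvg_comp _ _ _ (fun n => f_ n y * u y) EFin _ (nbhs (f y * u y))) => //.
    by apply: cvgMl.
  - by move=> n; apply/measurable_EFinP; exact: measurable_funM.
  - by move=> n y _; rewrite lee_fin mulr_ge0.
  - by move=> y _ m n mn; rewrite lee_fin ler_wpM2r//; exact/lefP/nd_nnsfun_approx.
congr (limn _); apply/funext => n.
have mpre r : measurable (f_ n @^-1` [set r]) by rewrite -[X in measurable X]setTI; exact: mfn.
have mpre' r : measurable (phi @^-1` (f_ n @^-1` [set r])).
  by rewrite -[X in measurable X]setTI; exact: mphi.
have k0 k y : (0 <= (k * \1_(f_ n @^-1` [set k]) y)%:E)%E by rewrite nnfun_muleindic_ge0.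
transitivity (\sum_(k \in range (f_ n)) \int[gamma]_z (k * \1_(f_ n @^-1` [set k]) (phi z))%:E)%E.
  rewrite -ge0_integral_fsum//.
  - by apply: eq_integral => z _; rewrite fsumEFin// -fimfunE.
  - move=> k; apply/measurable_EFinP; apply: measurable_funM => //.
    by apply: measurableT_comp mphi; exact: measurable_indic.
transitivity (\sum_(k \in range (f_ n)) \int[nu]_y (k * \1_(f_ n @^-1` [set k]) y * u y)%:E)%E; last first.
  rewrite -ge0_integral_fsum//.
  - by apply: eq_integral => y _; rewrite fsumEFin// -mulr_fsuml// -fimfunE.
  - move=> k; apply/measurable_EFinP; apply: measurable_funM => //; apply: measurable_funM => //.
  - by move=> k y _; rewrite EFinM; apply: mule_ge0; [exact: k0|rewrite lee_fin].
apply: eq_fsbigr => k /set_mem [y _ fy].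
have kge : 0 <= k by rewrite -fy.
under eq_integral do rewrite EFinM.
rewrite ge0_integralZl//; last first.
  by apply/measurable_EFinP; apply: measurableT_comp mphi; exact: measurable_indic.
under [RHS]eq_integral do rewrite -mulrA EFinM.
rewrite ge0_integralZl//; last 2 first.
- by apply/measurable_EFinP; apply: measurable_funM.
- by move=> z _; rewrite lee_fin mulr_ge0.
congr (_ * _)%E.
have -> : (\int[gamma]_z (\1_(f_ n @^-1` [set k]) (phi z))%:E)%E = gamma (phi @^-1` (f_ n @^-1` [set k])).
  by rewrite -[X in gamma X]setIT -(integral_indic gamma measurableT (mpre' k)).
rewrite H// integral_mkcond; apply: eq_integral => z _.
by rewrite /patch indicE; case: ifPn => _; rewrite ?mul1r ?mul0r.
Qed.

End transport_of_density.

Section second_moment.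
Context (R : realType) (d : nat).
Local Notation leb := (lebesgue_rV R d).
Local Notation V := 'rV[R]_d.

Lemma edot_ge0 (x : V) : 0 <= edot x x.
Proof. by apply: sumr_ge0 => i _; rewrite -expr2 sqr_ge0. Qed.

Lemma enorm_sqr (x : V) : enorm x ^+ 2 = edot x x.
Proof. by rewrite sqr_sqrtr// edot_ge0. Qed.

Lemma enormN (x : V) : enorm (- x) = enorm x.
Proof. by rewrite /enorm /edot; under eq_bigr do rewrite !mxE mulrNN. Qed.

Lemma measurable_edot : measurable_fun setT (fun x : V => edot x x).
Proof. by apply: measurable_sum => i; apply: measurable_funM; exact: measurable_coord. Qed.

Lemma measurable_enorm_sqr : measurable_fun setT (fun x : V => enorm x ^+ 2).
Proof. by under eq_fun do rewrite enorm_sqr; exact: measurable_edot. Qed.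

Lemma enorm_sqr_le (x y : V) : enorm x ^+ 2 <= 2 * enorm y ^+ 2 + 2 * enorm (x - y) ^+ 2.
Proof.
rewrite !enorm_sqr /edot !mulr_sumr -big_split; apply: ler_sum => i _ /=; rewrite !mxE.
have := sqr_ge0 (x 0 i - 2 * y 0 i); rewrite !expr2; lra.
Qed.

Definition moment2 (u : V -> R) := \int[leb]_y (enorm y ^+ 2 * u y).

Lemma density_Rint (u : V -> R) : density u -> Rint leb setT u /\ \int[leb]_y u y = 1.
Proof.
move=> [mu u0 iu]; have E : (\int[leb]_y `|u y|%:E = 1)%E.
  by rewrite -iu; apply: eq_integral => y _; rewrite ger0_norm.
have i1 : Rint leb setT u by apply: RintP => //; rewrite E ltry.
by split => //; rewrite /Rintegral iu.
Qed.

Lemma density2_Rint (u : V -> R) : density2 u -> Rint leb setT (fun y => enorm y ^+ 2 * u y).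
Proof.
move=> [[mu u0 _] h]; apply: RintP => //.
  by apply: measurable_funM => //; exact: measurable_enorm_sqr.
rewrite (eq_integral (fun y => (enorm y ^+ 2 * u y)%:E))// => y _.
by rewrite ger0_norm// mulr_ge0// sqr_ge0.
Qed.

Lemma W2_moment2 (u w : V -> R) (N : R) : density2 u -> density2 w -> 0 <= N ->
  (W2 (dmeasure u) (dmeasure w) <= N%:E)%E -> moment2 u <= 2 * moment2 w + 2 * N ^+ 2.
Proof.
move=> du dw N0 HW; have iu := density2_Rint du; have iw := density2_Rint dw.
case: du dw => -[mu u0 _] _ [[mw w0 _] _].
set S := [set (\int[gamma]_z (enorm (z.1 - z.2) ^+ 2)%:E)%E | gamma in couplings (dmeasure u) (dmeasure w)].
have S0 : (0 <= ereal_inf S)%E.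
  by apply/ereal_infP => _ [gamma _ <-]; apply: integral_ge0 => z _; rewrite lee_fin sqr_ge0.
have infS : (ereal_inf S <= (N ^+ 2)%:E)%E.
  move: HW; rewrite /W2 -/S; move: S0; case: (ereal_inf S) => [r| |] //=.
    rewrite !lee_fin => r0 h.
    have -> : r = (r `^ 2^-1) ^+ 2 by rewrite -powR_mulrn ?powR_ge0// -powRrM mulVf ?powRr1.
    by rewrite ler_pXn2r// nnegrE ?powR_ge0.
  by rewrite invr_eq0 pnatr_eq0 /=.
apply/ler_addgt0Pr => e e0.
(* The excess is e / 2 because the transport cost enters with the factor 2. *)
have [_ [gamma Hg <-] lt] : exists2 y, S y & (y < (N ^+ 2 + e / 2)%:E)%E.
  apply: ereal_inf_lt; apply: le_lt_trans infS _; rewrite lte_fin ltrDl; lra.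
have E1 : (\int[gamma]_z (enorm z.1 ^+ 2)%:E = \int[leb]_y (enorm y ^+ 2 * u y)%:E)%E.
  apply: (ge0_integral_transport (phi := fst) (f := fun y : V => enorm y ^+ 2)) => //.
  - exact: measurable_enorm_sqr.
  - by move=> y; rewrite sqr_ge0.
  - move=> A mA; have [h _] := Hg A mA; transitivity (gamma (A `*` setT)); last exact: h.
    congr (gamma _).
    by apply/seteqP; split => z /= => [|[]].
have E2 : (\int[gamma]_z (enorm z.2 ^+ 2)%:E = \int[leb]_y (enorm y ^+ 2 * w y)%:E)%E.
  apply: (ge0_integral_transport (phi := snd) (f := fun y : V => enorm y ^+ 2)) => //.
  - exact: measurable_enorm_sqr.
  - by move=> y; rewrite sqr_ge0.
  - move=> A mA; have [_ h] := Hg A mA; transitivity (gamma (setT `*` A)); last exact: h.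
    congr (gamma _).
    by apply/seteqP; split => z /= => [|[]].
rewrite /moment2 -lee_fin -(Rint_EFin iu) -E1.
have m1 : measurable_fun setT (fun z : V * V => enorm z.1 ^+ 2).
  exact: measurableT_comp measurable_enorm_sqr measurable_fst.
have m2 : measurable_fun setT (fun z : V * V => enorm z.2 ^+ 2).
  exact: measurableT_comp measurable_enorm_sqr measurable_snd.
have m3 : measurable_fun setT (fun z : V * V => enorm (z.1 - z.2) ^+ 2).
  have -> : (fun z : V * V => enorm (z.1 - z.2) ^+ 2) = (fun z : V * V => enorm (z.2 - z.1) ^+ 2).
    by apply/funext => z; rewrite -enormN opprB.
  exact: measurableT_comp measurable_enorm_sqr (@measurable_subrV2 R d).
apply: (@le_trans _ _ (\int[gamma]_z (2 * enorm z.2 ^+ 2 + 2 * enorm (z.1 - z.2) ^+ 2)%:E)%E).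
  apply: ge0_le_integral => //.
  - by move=> z _; rewrite lee_fin sqr_ge0.
  - by apply/measurable_EFinP.
  - by apply/measurable_EFinP; apply: measurable_funD; apply: measurable_funM.
  - by move=> z _; rewrite lee_fin enorm_sqr_le.
rewrite (eq_integral (fun z : V * V => 2%:E * (enorm z.2 ^+ 2)%:E + 2%:E * (enorm (z.1 - z.2) ^+ 2)%:E)%E); last first.
  by move=> z _; rewrite -!EFinM -EFinD.
have ge0 (a : R) : (0 <= (a ^+ 2)%:E)%E by rewrite lee_fin sqr_ge0.
have m2' : measurable_fun setT (fun z : V * V => (enorm z.2 ^+ 2)%:E) by apply/measurable_EFinP.
have m3' : measurable_fun setT (fun z : V * V => (enorm (z.1 - z.2) ^+ 2)%:E) by apply/measurable_EFinP.
rewrite ge0_integralD//; try exact: measurable_funeM; try (by move=> z _; exact: mule_ge0).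
rewrite !ge0_integralZl//.
rewrite E2 (Rint_EFin iw) -EFinM -[leRHS]EFinD -addrA [leRHS]EFinD; apply: leeD => //.
have hlt := ltW lt; apply: le_trans (lee_wpmul2l _ hlt) _; first by rewrite lee_fin.
by rewrite -EFinM lee_fin; lra.
Qed.

End second_moment.

Lemma norm_mul_le1 (R : realType) (x y : R) : 0 <= x -> x <= 1 -> 0 <= y -> `|x * y| <= y.
Proof. by move=> x0 x1 y0; rewrite ger0_norm ?mulr_ge0// ler_piMl. Qed.

(** * Truncations *)

Section truncated_energy.
Context (R : realType) (lambda eta m delta : R).
Hypotheses (lambda0 : 0 < lambda) (eta0 : 0 < eta) (m1 : 1 < m) (d0 : 0 < delta) (d1 : delta < 1).

(** An increasing Möbius map of the half-line into [delta, 1 / delta] that fixes 1 and moves every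
    other point towards 1. Hence ln (tau r) is bounded, has the sign of ln r and does not exceed it
    in modulus. *)
Definition tau (r : R) := (r + delta) / (1 + delta * r).
(** The logarithmic derivative of [tau], a bounded substitute for 1 / r. *)
Definition tslope (r : R) := (1 - delta ^+ 2) / ((1 + delta * r) * (r + delta)).
Definition tslope' (r : R) :=
  - tslope r * ((1 + delta ^+ 2 + 2 * delta * r) / ((1 + delta * r) * (r + delta))).
(** The density F(r) with [tau r] in place of [r] inside the bracket only. Keeping the outer factor
    [r] preserves the value 0 at 0 and gives linear growth; the formula is smooth across 0. *)
Definition Gd (r : R) := r * (lambda * ln (tau r) + eta / (m - 1) * tau r `^ (m - 1)).
Definition Gd1 (r : R) := lambda * ln (tau r) + eta / (m - 1) * tau r `^ (m - 1) +
  r * tslope r * (lambda + eta * tau r `^ (m - 1)).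
Definition Gd2 (r : R) := (2 * tslope r + r * tslope' r) * (lambda + eta * tau r `^ (m - 1)) +
  r * tslope r * (eta * (m - 1) * (tau r `^ (m - 1) * tslope r)).

Let m10 : 0 < m - 1. Proof. by rewrite subr_gt0. Qed.
Let den1 r : 0 <= r -> 0 < 1 + delta * r.
Proof. by move=> r0; rewrite ltr_wpDr// mulr_ge0// ltW. Qed.
Let den2 r : 0 <= r -> 0 < r + delta. Proof. by move=> r0; rewrite ltr_wpDl. Qed.
Let dd : 0 < 1 - delta ^+ 2. Proof. by rewrite subr_gt0 expr_lt1// ltW. Qed.

Lemma tau_gt0 r : 0 <= r -> 0 < tau r.
Proof. by move=> r0; rewrite divr_gt0 ?den1 ?den2. Qed.

Lemma tau_le_max r : 0 <= r -> tau r <= Num.max r 1.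
Proof.
move=> r0; rewrite ler_pdivrMr ?den1//.
have [r1|r1] := leP 1 r.
  have : 0 <= delta * ((r - 1) * (r + 1)).
    by rewrite mulr_ge0 ?(ltW d0)// mulr_ge0 ?subr_ge0// addr_ge0.
  lra.
rewrite ?max_r ?(ltW r1)// mul1r.
have : 0 <= (1 - delta) * (1 - r) by rewrite mulr_ge0// subr_ge0 ltW.
lra.
Qed.

Lemma tau_ge_min r : 0 <= r -> Num.min r 1 <= tau r.
Proof.
move=> r0; rewrite ler_pdivlMr ?den1//.
have [r1|/ltW r1] := leP r 1.
  have : 0 <= delta * ((1 - r) * (1 + r)).
    by rewrite mulr_ge0 ?(ltW d0)// mulr_ge0 ?subr_ge0// addr_ge0.
  lra.
rewrite ?min_r// mul1r.
have : 0 <= (1 - delta) * (r - 1) by rewrite mulr_ge0 ?subr_ge0 ?(ltW d1).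
lra.
Qed.

Lemma tau_ge r : 0 <= r -> delta <= tau r.
Proof.
move=> r0; rewrite ler_pdivlMr ?den1// mulrDr mulr1 addrC lerD2r mulrA -expr2.
by rewrite ler_piMl// expr_le1// ltW.
Qed.

Lemma tau_le r : 0 <= r -> tau r <= delta^-1.
Proof.
move=> r0; rewrite ler_pdivrMr ?den1// mulrDr mulr1 mulrA mulVf ?gt_eqF// mul1r addrC lerD2r.
by rewrite (le_trans (ltW d1))// invf_ge1// ltW.
Qed.

Lemma tslope_gt0 r : 0 <= r -> 0 < tslope r.
Proof. by move=> r0; rewrite divr_gt0// mulr_gt0 ?den1 ?den2. Qed.

Lemma r_tslope_le1 r : 0 <= r -> r * tslope r <= 1.
Proof.
move=> r0; have p := mulr_gt0 (den1 r0) (den2 r0).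
rewrite /tslope mulrA ler_pdivrMr// mul1r.
have : 0 <= delta by exact: ltW.
have := mulr_ge0 (ltW d0) (sqr_ge0 r); have := mulr_ge0 r0 (sqr_ge0 delta).
rewrite !expr2; lra.
Qed.

Lemma tslope_le r : 0 <= r -> tslope r <= delta^-1.
Proof.
move=> r0; have p := mulr_gt0 (den1 r0) (den2 r0).
rewrite ler_pdivrMr// ler_pdivlMl//.
have := mulr_ge0 (ltW d0) (sqr_ge0 r); have := mulr_ge0 r0 (sqr_ge0 delta).
have := mulr_ge0 (sqr_ge0 delta) (ltW d0).
have := ltW d0; lra.
Qed.

Lemma r_tslope'_le r : 0 <= r -> `|r * tslope' r| <= 2 * tslope r.
Proof.
move=> r0; have p := mulr_gt0 (den1 r0) (den2 r0); have s0 := tslope_gt0 r0.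
have n0 : 0 <= 1 + delta ^+ 2 + 2 * delta * r.
  by rewrite !addr_ge0 ?sqr_ge0// !mulr_ge0// ltW.
rewrite /tslope' mulNr mulrN normrN mulrCA mulrC ger0_norm; last first.
  by rewrite mulr_ge0 ?(ltW s0)// mulr_ge0// divr_ge0// ltW.
rewrite ler_wpM2r ?(ltW s0)// mulrA ler_pdivrMr//.
have := ltW d0; have := mulr_ge0 (ltW d0) (sqr_ge0 r); have := mulr_ge0 r0 (sqr_ge0 delta).
rewrite !expr2; lra.
Qed.

Lemma tau_derive (r : R) : 0 <= r -> is_derive r 1 tau (tau r * tslope r).
Proof.
move=> r0; have n1 := den1 r0; have n2 := den2 r0.
have h1 : is_derive r 1 (fun r : R => r + delta) 1.
  by apply: is_derive_eq; rewrite addr0.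
have h2 : is_derive r 1 (fun r : R => 1 + delta * r) delta.
  have h := is_deriveD (is_derive_cst (1 : R) r 1) (is_deriveZ delta (is_derive_id r (1 : R))).
  by apply: is_derive_eq h _; rewrite add0r /GRing.scale /= mulr1.
have h3 : is_derive r 1 (fun r : R => (1 + delta * r)^-1) (- (1 + delta * r) ^- 2 * delta).
  exact: (@is_deriveV R (fun r : R => 1 + delta * r) r delta 1 (lt0r_neq0 n1) h2).
apply: is_derive_eq (is_deriveM h1 h3) _.
by rewrite /tau /tslope /GRing.scale /=; field; rewrite !gt_eqF.
Qed.

Lemma tslope_derive (r : R) : 0 <= r -> is_derive r 1 tslope (tslope' r).
Proof.
move=> r0; have n1 := den1 r0; have n2 := den2 r0.
have h1 : is_derive r 1 (fun r : R => r + delta) 1.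
  by apply: is_derive_eq; rewrite addr0.
have h2 : is_derive r 1 (fun r : R => 1 + delta * r) delta.
  have h := is_deriveD (is_derive_cst (1 : R) r 1) (is_deriveZ delta (is_derive_id r (1 : R))).
  by apply: is_derive_eq h _; rewrite add0r /GRing.scale /= mulr1.
have h3 : is_derive r 1 (fun r : R => ((1 + delta * r) * (r + delta))^-1)
    (- ((1 + delta * r) * (r + delta)) ^- 2 * ((1 + delta * r) * 1 + (r + delta) * delta)).
  exact: (@is_deriveV R (fun r : R => (1 + delta * r) * (r + delta)) r _ 1
    (lt0r_neq0 (mulr_gt0 n1 n2)) (is_deriveM h2 h1)).
apply: is_derive_eq (is_deriveZ (1 - delta ^+ 2) h3) _.
by rewrite /tslope' /tslope /GRing.scale /=; field; rewrite !gt_eqF.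
Qed.

Lemma ln_tau_derive (r : R) : 0 <= r -> is_derive r 1 (fun r => ln (tau r)) (tslope r).
Proof.
move=> r0; have t0 := tau_gt0 r0.
have := is_derive1_comp (is_derive1_ln t0) (tau_derive r0).
by move/is_derive_eq; apply; rewrite mulrA mulVf ?mul1r// gt_eqF.
Qed.

Lemma tau_pow_derive (r : R) : 0 <= r ->
  is_derive r 1 (fun r => tau r `^ (m - 1)) ((m - 1) * (tau r `^ (m - 1) * tslope r)).
Proof.
move=> r0; have t0 := tau_gt0 r0.
have := is_derive1_comp (is_derive1_powR (m - 1) t0) (tau_derive r0).
move/is_derive_eq; apply; move: (tau r) t0 => T T0.
have TT : T `^ (m - 1 - 1) * T = T `^ (m - 1).
  by rewrite -{2}[T]powRr1 ?ltW// -powRD ?subrK// (gt_eqF T0) implybT.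
by rewrite -TT; ring.
Qed.

Lemma Gd_derive (r : R) : 0 <= r -> is_derive r 1 Gd (Gd1 r).
Proof.
move=> r0.
have h1 : is_derive r 1 (fun r : R => lambda * ln (tau r)) (lambda * tslope r) :=
  is_deriveZ lambda (ln_tau_derive r0).
have h2 : is_derive r 1 (fun r : R => eta / (m - 1) * tau r `^ (m - 1))
  (eta / (m - 1) * ((m - 1) * (tau r `^ (m - 1) * tslope r))) := is_deriveZ (eta / (m - 1)) (tau_pow_derive r0).
have h3 : is_derive r 1 (fun r : R => lambda * ln (tau r) + eta / (m - 1) * tau r `^ (m - 1))
  (lambda * tslope r + eta / (m - 1) * ((m - 1) * (tau r `^ (m - 1) * tslope r))) := is_deriveD h1 h2.
have h4 : is_derive r 1 (fun r : R => r) 1 := is_derive_id r (1 : R).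
apply: is_derive_eq (is_deriveM h4 h3) _.
by rewrite /Gd1 /GRing.scale /=; field; rewrite gt_eqF.
Qed.

Lemma Gd1_derive (r : R) : 0 <= r -> is_derive r 1 Gd1 (Gd2 r).
Proof.
move=> r0.
have h1 : is_derive r 1 (fun r : R => lambda * ln (tau r)) (lambda * tslope r) :=
  is_deriveZ lambda (ln_tau_derive r0).
have h2 : is_derive r 1 (fun r : R => eta / (m - 1) * tau r `^ (m - 1))
  (eta / (m - 1) * ((m - 1) * (tau r `^ (m - 1) * tslope r))) := is_deriveZ (eta / (m - 1)) (tau_pow_derive r0).
have h3 : is_derive r 1 (fun r : R => lambda * ln (tau r) + eta / (m - 1) * tau r `^ (m - 1))
  (lambda * tslope r + eta / (m - 1) * ((m - 1) * (tau r `^ (m - 1) * tslope r))) := is_deriveD h1 h2.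
have h4 : is_derive r 1 (fun r : R => r) 1 := is_derive_id r (1 : R).
have h5 : is_derive r 1 (fun r : R => r * tslope r) (r * tslope' r + tslope r * 1) :=
  is_deriveM h4 (tslope_derive r0).
have h6 : is_derive r 1 (fun r : R => eta * tau r `^ (m - 1)) (eta * ((m - 1) * (tau r `^ (m - 1) * tslope r))) :=
  is_deriveZ eta (tau_pow_derive r0).
have h7 : is_derive r 1 (fun r : R => lambda + eta * tau r `^ (m - 1)) (0 + eta * ((m - 1) * (tau r `^ (m - 1) * tslope r))) :=
  is_deriveD (is_derive_cst lambda r (1 : R)) h6.
have h8 : is_derive r 1 (fun r : R => r * tslope r * (lambda + eta * tau r `^ (m - 1))) _ := is_deriveM h5 h7.
apply: is_derive_eq (is_deriveD h3 h8) _.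
by rewrite /Gd2 /GRing.scale /=; field; rewrite gt_eqF.
Qed.

Lemma Gd2_continuous (r : R) : 0 <= r -> {for r, continuous Gd2}.
Proof.
move=> r0; have n1 := den1 r0; have n2 := den2 r0.
have dc (f : R -> R) (a : R) : is_derive r 1 f a -> {for r, continuous f}.
  by move=> h; apply/differentiable_continuous/derivable1_diffP; case: h.
have cs := dc _ _ (tslope_derive r0); have cp := dc _ _ (tau_pow_derive r0).
have cid : {for r, continuous (fun r : R => r)} by exact: cvg_id.
have ccst (c : R) : {for r, continuous (fun _ : R => c)} by exact: cvg_cst.
have cs' : {for r, continuous tslope'}.
  apply: cvgM; first by apply: cvgN; exact: cs.
  apply: cvgM.
    by apply: cvgD; [exact: ccst|apply: cvgM; [exact: ccst|exact: cid]].
  apply: cvgV; first by rewrite gt_eqF// mulr_gt0.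
  apply: cvgM; apply: cvgD; [exact: ccst|apply: cvgM; [exact: ccst|exact: cid]|exact: cid|exact: ccst].
apply: cvgD; apply: cvgM.
- by apply: cvgD; apply: cvgM; [exact: ccst|exact: cs|exact: cid|exact: cs'].
- by apply: cvgD; [exact: ccst|apply: cvgM; [exact: ccst|exact: cp]].
- by apply: cvgM; [exact: cid|exact: cs].
- by apply: cvgM; [exact: ccst|apply: cvgM; [exact: cp|exact: cs]].
Qed.

Lemma tau_pow_le r : 0 <= r -> tau r `^ (m - 1) <= 1 + r `^ (m - 1).
Proof.
move=> r0; have t0 := tau_gt0 r0.
apply: (@le_trans _ _ (Num.max r 1 `^ (m - 1))).
  apply: ge0_ler_powR; [exact: ltW|by rewrite nnegrE ltW|by rewrite nnegrE le_max r0|exact: tau_le_max].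
have [_|_] := leP r 1; first by rewrite powR1 lerDl powR_ge0.
by rewrite lerDr.
Qed.

Lemma r_Gd2_tau r : 0 <= r -> `|r * Gd2 r| <= 4 * (lambda + eta * m * tau r `^ (m - 1)).
Proof.
move=> r0; have s0 := ltW (tslope_gt0 r0); have u1 := r_tslope_le1 r0.
have u0 : 0 <= r * tslope r by rewrite mulr_ge0.
have T0 : 0 <= tau r `^ (m - 1) by exact: powR_ge0.
have := r_tslope'_le r0; set a := r * tslope' r => ha.
have ra : `|r * a| <= 2.
  rewrite normrM (ger0_norm r0); apply: le_trans (ler_wpM2l r0 ha) _.
  by rewrite mulrCA -[leRHS]mulr1 ler_wpM2l.
have -> : r * Gd2 r = (2 * (r * tslope r) + r * a) * (lambda + eta * tau r `^ (m - 1)) +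
    (r * tslope r) * (r * tslope r) * (eta * (m - 1) * tau r `^ (m - 1)).
  by rewrite /Gd2 /a; ring.
have A0 : 0 <= lambda + eta * tau r `^ (m - 1) by rewrite addr_ge0 ?mulr_ge0// ltW.
have B0 : 0 <= eta * (m - 1) * tau r `^ (m - 1) by rewrite !mulr_ge0// ltW.
apply: le_trans (ler_normD _ _) _; rewrite normrM (ger0_norm A0).
have h1 : `|2 * (r * tslope r) + r * a| <= 4.
  have e : `|2 * (r * tslope r)| = 2 * (r * tslope r) by rewrite ger0_norm// mulr_ge0.
  apply: le_trans (ler_normD _ _) _; rewrite e; lra.
have h2 : `|(r * tslope r) * (r * tslope r) * (eta * (m - 1) * tau r `^ (m - 1))| <= eta * (m - 1) * tau r `^ (m - 1).
  apply: norm_mul_le1 => //; first exact: mulr_ge0.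
  by rewrite -[leRHS]mulr1 ler_pM.
apply: le_trans (lerD (ler_wpM2r A0 h1) h2) _.
have := mulr_ge0 (mulr_ge0 (ltW eta0) (ltW m10)) T0.
nra.
Qed.

Lemma Gd2_tau r : 0 <= r -> `|Gd2 r| <= 4 * (lambda + eta * m * tau r `^ (m - 1)) * delta^-1.
Proof.
move=> r0; have s0 := ltW (tslope_gt0 r0); have u1 := r_tslope_le1 r0.
have u0 : 0 <= r * tslope r by rewrite mulr_ge0.
have T0 : 0 <= tau r `^ (m - 1) by exact: powR_ge0.
have sd := tslope_le r0.
have ha := r_tslope'_le r0.
have A0 : 0 <= lambda + eta * tau r `^ (m - 1) by rewrite addr_ge0 ?mulr_ge0// ltW.
have B0 : 0 <= eta * (m - 1) * tau r `^ (m - 1) by rewrite !mulr_ge0// ltW.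
have h1 : `|2 * tslope r + r * tslope' r| <= 4 * tslope r.
  have e : `|2 * tslope r| = 2 * tslope r by rewrite ger0_norm// mulr_ge0.
  apply: le_trans (ler_normD _ _) _; rewrite e; lra.
rewrite /Gd2; apply: le_trans (ler_normD _ _) _; rewrite normrM (ger0_norm A0).
have h2 : `|r * tslope r * (eta * (m - 1) * (tau r `^ (m - 1) * tslope r))| <=
    eta * (m - 1) * tau r `^ (m - 1) * tslope r.
  have -> : r * tslope r * (eta * (m - 1) * (tau r `^ (m - 1) * tslope r)) =
     r * tslope r * (eta * (m - 1) * tau r `^ (m - 1) * tslope r) by ring.
  by apply: norm_mul_le1 => //; exact: mulr_ge0.
apply: le_trans (lerD (ler_wpM2r A0 h1) h2) _.
apply: (@le_trans _ _ (4 * (lambda + eta * m * tau r `^ (m - 1)) * tslope r)); last first.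
  by rewrite ler_wpM2l// mulr_ge0// addr_ge0 ?(ltW lambda0)// !mulr_ge0 ?(ltW eta0)// ltW// (lt_trans _ m1).
have -> : 4 * tslope r * (lambda + eta * tau r `^ (m - 1)) + eta * (m - 1) * tau r `^ (m - 1) * tslope r =
  (4 * (lambda + eta * tau r `^ (m - 1)) + eta * (m - 1) * tau r `^ (m - 1)) * tslope r by ring.
rewrite ler_wpM2r//; have := mulr_ge0 (mulr_ge0 (ltW eta0) (ltW m10)) T0.
lra.
Qed.

(** Uniform in [delta], at the price of the unbounded factor L_F'(r) on the right. The constant
    comes from tau^(m-1) <= 1 + r^(m-1), the summand 1 being absorbed by lambda. *)
Lemma r_Gd2_le r : 0 <= r ->
  `|r * Gd2 r| <= 4 * (1 + eta * m / lambda) * (lambda + eta * m * r `^ (m - 1)).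
Proof.
move=> r0; apply: le_trans (r_Gd2_tau r0) _.
have em : 0 < eta * m by rewrite mulr_gt0// (lt_trans _ m1).
apply: (@le_trans _ _ (4 * (lambda + eta * m * (1 + r `^ (m - 1))))).
  by rewrite ler_wpM2l// lerD2l ler_wpM2l ?tau_pow_le// ltW.
rewrite -[leRHS]mulrA ler_wpM2l//.
have -> : (1 + eta * m / lambda) * (lambda + eta * m * r `^ (m - 1)) =
  lambda + eta * m * (1 + r `^ (m - 1)) + eta * m * (eta * m * r `^ (m - 1)) / lambda.
  by field; rewrite gt_eqF.
rewrite lerDl; apply: divr_ge0 (ltW lambda0).
by apply: mulr_ge0 (ltW em) _; apply: mulr_ge0 (ltW em) _; exact: powR_ge0.
Qed.

(** Bounds for a fixed truncation. They degenerate as [delta] tends to 0, which the radius of the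
    cut-off has to compensate. *)
Lemma Gd_half_line : exists2 L, 0 < L & C2_half_line Gd Gd1 Gd2 L.
Proof.
pose T := delta^-1 `^ (m - 1); pose A := 4 * (lambda + eta * m * T).
have di0 : 0 < delta^-1 by rewrite invr_gt0.
have T0 : 0 <= T by exact: powR_ge0.
have em : 0 < eta * m by rewrite mulr_gt0// (lt_trans _ m1).
have A0 : 0 <= A by rewrite mulr_ge0// addr_ge0 ?(ltW lambda0)// mulr_ge0// ltW.
have tT r : 0 <= r -> tau r `^ (m - 1) <= T.
  move=> r0; apply: ge0_ler_powR; [exact: ltW|by rewrite nnegrE ltW ?tau_gt0|by rewrite nnegrE ltW|exact: tau_le].
have tA r : 0 <= r -> 4 * (lambda + eta * m * tau r `^ (m - 1)) <= A.
  by move=> r0; rewrite ler_wpM2l// lerD2l ler_wpM2l ?tT// ltW.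
have k0 : 0 <= eta / (m - 1) by rewrite divr_ge0 ?(ltW eta0) ?(ltW m10).
have dln : 0 <= ln delta^-1.
  by rewrite ln_ge0// invf_ge1// ltW.
have lnT r : 0 <= r -> `|ln (tau r)| <= ln delta^-1.
  move=> r0; have t0 := tau_gt0 r0; rewrite ler_norml lnV ?posrE// opprK; apply/andP; split.
    by rewrite ler_ln ?posrE// tau_ge.
  by rewrite -lnV ?posrE// ler_ln ?posrE// tau_le.
pose B := lambda * ln delta^-1 + eta / (m - 1) * T + A.
have B0 : 0 <= B by rewrite !addr_ge0// mulr_ge0// ltW.
have Ad : 0 <= A * delta^-1 by rewrite mulr_ge0// ltW.
exists (1 + B + A * delta^-1); first by rewrite ltr_wpDr// ltr_wpDr.
split; [exact: addr_ge0 (addr_ge0 ler01 B0) Ad|exact: Gd_derive|exact: Gd1_derive|exact: Gd2_continuous|].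
move=> r r0; have s0 := ltW (tslope_gt0 r0); have u1 := r_tslope_le1 r0.
have u0 : 0 <= r * tslope r by rewrite mulr_ge0.
have tp : 0 <= tau r `^ (m - 1) by exact: powR_ge0.
split; last 2 first.
- apply: le_trans (Gd2_tau r0) _.
  apply: (@le_trans _ _ (A * delta^-1)); last by rewrite lerDr addr_ge0.
  by rewrite ler_wpM2r ?tA// ltW.
- apply: le_trans (r_Gd2_tau r0) _; apply: le_trans (tA _ r0) _.
  apply: (@le_trans _ _ B); first by rewrite lerDr addr_ge0// mulr_ge0// ltW.
  by rewrite -addrA addrCA lerDl addr_ge0.
apply: (@le_trans _ _ B); last by rewrite -addrA addrCA lerDl addr_ge0.
rewrite /Gd1; apply: le_trans (ler_normD _ _) _; apply: lerD.
  apply: le_trans (ler_normD _ _) _; apply: lerD.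
    by rewrite normrM (gtr0_norm lambda0) ler_wpM2l ?lnT// ltW.
  by rewrite normrM (ger0_norm k0) (ger0_norm tp) ler_wpM2l ?tT.
have y0 : 0 <= lambda + eta * tau r `^ (m - 1) by rewrite addr_ge0 ?(ltW lambda0)// mulr_ge0// ltW.
apply: le_trans (norm_mul_le1 u0 u1 y0) _; apply: le_trans (tA _ r0).
have := mulr_ge0 (mulr_ge0 (ltW eta0) (ltW m10)) tp; have := ltW lambda0.
have := mulr_ge0 (ltW eta0) tp; lra.
Qed.

(** As [tau r] lies between [r] and 1, the logarithm only shrinks in modulus. The majorant does not
    depend on [delta] and is integrable for finite energy. *)
Lemma Gd_le r : 0 <= r -> `|Gd r| <= `|entH lambda r| + eta / (m - 1) * (r + r `^ m).
Proof.
move=> r0; have k0 : 0 <= eta / (m - 1) by rewrite divr_ge0 ?(ltW eta0) ?(ltW m10).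
have [->|rn] := eqVneq r 0.
  by rewrite /Gd /entH mul0r normr0 mulr0 mul0r normr0 add0r mulr_ge0// addr_ge0// powR_ge0.
have {}rn : 0 < r by rewrite lt_neqAle eq_sym rn.
have t0 := tau_gt0 r0.
rewrite /Gd mulrDr; apply: le_trans (ler_normD _ _) _; apply: lerD.
  rewrite /entH -mulrA mulrCA [in leRHS]normrM [in leLHS]normrM ler_wpM2l// !normrM ler_wpM2l//.
  have [r1|/ltW r1] := leP 1 r.
    have t1 : 1 <= tau r by apply: le_trans (tau_ge_min r0); rewrite le_min r1 lexx.
    rewrite !ger0_norm ?ln_ge0// ler_ln ?posrE//.
    by apply: le_trans (tau_le_max r0) _; rewrite ge_max lexx.
  have t1 : tau r <= 1 by apply: le_trans (tau_le_max r0) _; rewrite ge_max r1 lexx.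
  rewrite !ler0_norm ?ln_le0// lerN2 ler_ln ?posrE//.
  by apply: le_trans (tau_ge_min r0); rewrite le_min lexx.
have tp : 0 <= tau r `^ (m - 1) by exact: powR_ge0.
rewrite ger0_norm; last by apply: mulr_ge0 => //; exact: mulr_ge0.
rewrite mulrCA ler_wpM2l//.
apply: le_trans (ler_wpM2l r0 (tau_pow_le r0)) _; rewrite mulrDr mulr1 lerD2l.
have -> : r * r `^ (m - 1) = r `^ 1 * r `^ (m - 1) by rewrite powRr1.
rewrite -powRD; last by rewrite (gt_eqF rn) implybT.
by rewrite (_ : 1 + (m - 1) = m)//; ring.
Qed.

(** The lower bound needed for Fatou: for r >= 1 both terms of [Gd] are nonnegative, and for r <= 1
    moving towards 1 increases the logarithm. *)
Lemma Gd_ge r : 0 <= r -> - Num.max (- entH lambda r) 0 <= Gd r.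
Proof.
move=> r0; have k0 : 0 <= eta / (m - 1) by rewrite divr_ge0 ?(ltW eta0) ?(ltW m10).
have [->|rn] := eqVneq r 0; first by rewrite /Gd /entH mul0r mulr0 mul0r oppr0 maxxx oppr0.
have {}rn : 0 < r by rewrite lt_neqAle eq_sym rn.
have t0 := tau_gt0 r0; have tp : 0 <= tau r `^ (m - 1) by exact: powR_ge0.
have h2 : 0 <= r * (eta / (m - 1) * tau r `^ (m - 1)) by rewrite mulr_ge0// mulr_ge0.
rewrite lerNl le_max; apply/orP.
have [r1|/ltW r1] := leP 1 r.
  right; rewrite oppr_le0 /Gd mulrDr addr_ge0//.
  rewrite mulr_ge0// mulr_ge0 ?(ltW lambda0)// ln_ge0//.
  by apply: le_trans (tau_ge_min r0); rewrite le_min r1 lexx.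
left; rewrite lerN2 /Gd /entH mulrDr -[leLHS]addr0 lerD//.
rewrite -mulrA mulrCA ler_wpM2l// ler_wpM2l ?(ltW lambda0)// ler_ln ?posrE//.
by apply: le_trans (tau_ge_min r0); rewrite le_min lexx.
Qed.

End truncated_energy.

Section truncation_limit.
Context (R : realType) (lambda eta m : R).
Hypotheses (m1 : 1 < m).

(** The shift by two gives [dn n] < 1 also for n = 0. *)
Definition dn (n : nat) : R := n.+2%:R^-1.
Lemma dn_gt0 n : 0 < dn n. Proof. by rewrite invr_gt0. Qed.
Lemma dn_lt1 n : dn n < 1. Proof. by rewrite invf_lt1// ltr1n. Qed.

Lemma dn_cvg : dn n @[n --> \oo] --> (0 : R).
Proof. by have := @cvg_harmonic R; rewrite -(cvg_shiftS (fun n => n.+1%:R^-1 : R)). Qed.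

Let m10 : 0 < m - 1. Proof. by rewrite subr_gt0. Qed.
Let dr (r : R) : dn n * r @[n --> \oo] --> (0 : R).
Proof. by rewrite -[X in _ --> X](mul0r r); apply: cvgM; [exact: dn_cvg|exact: cvg_cst]. Qed.
Let c1 (r : R) : 1 + dn n * r @[n --> \oo] --> (1 : R).
Proof. by rewrite -[X in _ --> X]addr0; apply: cvgD; [exact: cvg_cst|exact: dr]. Qed.
Let c2 (r : R) : r + dn n @[n --> \oo] --> r.
Proof. by rewrite -[X in _ --> X]addr0; apply: cvgD; [exact: cvg_cst|exact: dn_cvg]. Qed.
Let c3 : 1 - dn n ^+ 2 @[n --> \oo] --> (1 : R).
Proof.
rewrite -[X in _ --> X]subr0; apply: cvgB; first exact: cvg_cst.
by rewrite -[X in _ --> X](mul0r (0 : R)); exact: (cvgM dn_cvg dn_cvg).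
Qed.

Lemma tau_cvg r : tau (dn n) r @[n --> \oo] --> r.
Proof.
rewrite -[X in _ --> X]divr1; apply: cvgM; first exact: c2.
by apply: cvgV; [exact: oner_neq0|exact: c1].
Qed.

Lemma tslope_cvg r : 0 < r -> tslope (dn n) r @[n --> \oo] --> r^-1.
Proof.
move=> r0; rewrite -[X in _ --> X]mul1r; apply: cvgM; first exact: c3.
apply: cvgV; first by rewrite gt_eqF.
by rewrite -[X in _ --> X]mul1r; apply: cvgM; [exact: c1|exact: c2].
Qed.

Lemma tslope'_cvg r : 0 < r -> tslope' (dn n) r @[n --> \oo] --> - (r^-1 * r^-1).
Proof.
move=> r0; rewrite -mulNr; apply: cvgM; first by apply: cvgN; exact: tslope_cvg.
rewrite -[X in _ --> X]mul1r; apply: cvgM.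
  rewrite -[X in _ --> X]addr0 -[X in _ --> X + _]addr0; apply: cvgD; first apply: cvgD.
  - exact: cvg_cst.
  - by rewrite -[X in _ --> X](mul0r (0 : R)); exact: (cvgM dn_cvg dn_cvg).
  - rewrite (_ : (fun n => _) = (fun n => 2 * (dn n * r))); last by apply/funext => n; rewrite mulrA.
    by rewrite -[X in _ --> X](mulr0 (2 : R)); apply: cvgM; [exact: cvg_cst|exact: dr].
apply: cvgV; first by rewrite gt_eqF.
by rewrite -[X in _ --> X]mul1r; apply: cvgM; [exact: c1|exact: c2].
Qed.

Lemma ln_tau_cvg r : 0 < r -> ln (tau (dn n) r) @[n --> \oo] --> ln r.
Proof. by move=> r0; exact: (cvg_comp _ _ (@tau_cvg r) (continuous_ln r0)). Qed.

Lemma tau_pow_cvg r : 0 < r -> tau (dn n) r `^ (m - 1) @[n --> \oo] --> r `^ (m - 1).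
Proof.
move=> r0; have cp : {for r, continuous (fun x : R => x `^ (m - 1))}.
  by apply/differentiable_continuous/derivable1_diffP; case: (is_derive1_powR (m - 1) r0).
exact: (cvg_comp _ _ (@tau_cvg r) cp).
Qed.

Lemma Gd_cvg r : 0 <= r -> Gd lambda eta m (dn n) r @[n --> \oo] --> entF lambda eta m r.
Proof.
rewrite le_eqVlt => /predU1P[<-|r0].
  rewrite /Gd /entF /entH mulr0 !mul0r powR0 ?mulr0 ?addr0; last by rewrite gt_eqF// (lt_trans _ m1).
  by under eq_fun do rewrite mul0r; exact: cvg_cst.
have -> : entF lambda eta m r = r * (lambda * ln r + eta / (m - 1) * r `^ (m - 1)).
  rewrite /entF /entH mulrDr; congr (_ + _); first by ring.
  rewrite mulrCA; congr (_ * _); rewrite -{2}[r]powRr1 ?(ltW r0)// -powRD ?(gt_eqF r0) ?implybT//.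
  by congr (_ `^ _); ring.
apply: cvgM; first exact: cvg_cst.
by apply: cvgD; apply: cvgM; [exact: cvg_cst|exact: ln_tau_cvg|exact: cvg_cst|exact: tau_pow_cvg].
Qed.

Lemma Gd2_cvg r : 0 < r ->
  Gd2 lambda eta m (dn n) r @[n --> \oo] --> (lambda + eta * m * r `^ (m - 1)) / r.
Proof.
move=> r0.
have -> : (lambda + eta * m * r `^ (m - 1)) / r =
  (2 * r^-1 + r * - (r^-1 * r^-1)) * (lambda + eta * r `^ (m - 1)) +
  r * r^-1 * (eta * (m - 1) * (r `^ (m - 1) * r^-1)) by field; rewrite gt_eqF.
have cs := tslope_cvg r0; have cp := tau_pow_cvg r0.
have cc (k : R) : (fun=> k) @ \oo --> k by exact: cvg_cst.
apply: cvgD; apply: cvgM.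
- by apply: cvgD; apply: cvgM => //; exact: tslope'_cvg.
- by apply: cvgD => //; apply: cvgM.
- exact: cvgM.
- by apply: cvgM => //; apply: cvgM.
Qed.

End truncation_limit.


(** * Cut-offs in space and the energy functional *)

Section cutoff.
Context (R : realType) (d : nat).
Local Notation leb := (lebesgue_rV R d).
Local Notation V := 'rV[R]_d.
Local Notation e_ i := (delta_mx 0 i : V).

Lemma edot_continuous : continuous (fun y : V => edot y y).
Proof. by apply: cts_sum => i; apply: ctsM; exact: rV_coord_continuous. Qed.

Lemma edot_derive (i : 'I_d) (x : V) : is_derive x (e_ i) (fun y : V => edot y y) (2 * x 0 i).
Proof.
apply: is_derive_of_line.
have E : (fun h : R => edot (x + h *: e_ i) (x + h *: e_ i)) =
    (fun h : R => edot x x + (2 * x 0 i * h + h * h)).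
  apply/funext => h; rewrite /edot (bigD1 i)//= [in RHS](bigD1 i)//=.
  rewrite !mxE !eqxx /= mulr1.
  rewrite (eq_bigr (fun j => x 0 j * x 0 j)); first by ring.
  by move=> j ji; rewrite !mxE (negbTE ji) andbF mulr0 addr0.
rewrite E.
have h1 : is_derive (0 : R) 1 (fun h : R => h) 1 := is_derive_id (0 : R) (1 : R).
have h2 : is_derive (0 : R) 1 (fun h : R => 2 * x 0 i * h) (2 * x 0 i * 1) := is_deriveZ (2 * x 0 i) h1.
have h3 : is_derive (0 : R) 1 (fun h : R => h * h) _ := is_deriveM h1 h1.
have h4 : is_derive (0 : R) 1 (fun h : R => 2 * x 0 i * h + h * h) _ := is_deriveD h2 h3.
apply: is_derive_eq (is_deriveD (is_derive_cst (edot x x) (0 : R) (1 : R)) h4) _.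
by rewrite /GRing.scale /=; ring.
Qed.

Lemma norm_le_enorm_sqr (y : V) : `|y| ^+ 2 <= edot y y.
Proof.
have e0 := edot_ge0 y; rewrite -(sqr_sqrtr e0) ler_pXn2r ?nnegrE ?sqrtr_ge0//.
apply/rV_normP => [|i]; first exact: sqrtr_ge0.
rewrite -sqrtr_sqr ler_sqrt// /edot (bigD1 i)//= expr2 lerDl; apply: sumr_ge0 => j _.
by rewrite -expr2 sqr_ge0.
Qed.

(** The square of a positive part is C^1, which is all the energy balance requires of a cut-off, and
    its gradient is explicit and of order 1 / r. *)
Definition chi (r : R) (y : V) : R := ppow 2 (1 - edot y y / r ^+ 2).
Definition dchi (r : R) (i : 'I_d) (y : V) : R :=
  - (4 * y 0 i / r ^+ 2) * ppow 1 (1 - edot y y / r ^+ 2).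

Variable r : R.
Hypothesis r0 : 0 < r.
Let r20 : 0 < r ^+ 2. Proof. by rewrite exprn_gt0. Qed.

Lemma chi_arg_le1 (y : V) : 1 - edot y y / r ^+ 2 <= 1.
Proof. by rewrite gerBl divr_ge0 ?edot_ge0// ltW. Qed.

Lemma chi_arg_continuous : continuous (fun y : V => 1 - edot y y / r ^+ 2).
Proof.
apply: ctsB; first exact: cts_cst.
by apply: ctsM; [exact: edot_continuous|exact: cts_cst].
Qed.

Lemma chi_continuous : continuous (chi r).
Proof.
move=> y; apply: (@continuous_comp _ _ _ (fun y : V => 1 - edot y y / r ^+ 2) (ppow 2)).
  exact: chi_arg_continuous.
exact: ppow_continuous.
Qed.

Lemma chi_C1dir (i : 'I_d) : C1dir (e_ i) (chi r) /\ 'D_(e_ i) (chi r) = dchi r i.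
Proof.
apply: C1dir_is_derive; first exact: chi_continuous.
  move=> x; have h1 := edot_derive i x.
  have h2 : is_derive (edot x x) 1 (fun s : R => 1 - s / r ^+ 2) (- (r ^+ 2)^-1).
    have h : is_derive (edot x x) 1 (fun s : R => - (r ^+ 2)^-1 * s) (- (r ^+ 2)^-1 * 1) :=
      is_deriveZ (- (r ^+ 2)^-1) (is_derive_id (edot x x) (1 : R)).
    have h' : is_derive (edot x x) 1 (fun s : R => 1 + - (r ^+ 2)^-1 * s) (0 + - (r ^+ 2)^-1 * 1) :=
      is_deriveD (is_derive_cst (1 : R) (edot x x) (1 : R)) h.
    rewrite (_ : (fun s : R => 1 - s / r ^+ 2) = (fun s : R => 1 + - (r ^+ 2)^-1 * s)).
      by apply: is_derive_eq h' _; rewrite add0r mulr1.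
    by apply/funext => s; ring.
  have h3 := is_derive_comp h2 (ppow_derive (1 - edot x x / r ^+ 2) (ltr1n R 2 : (1 : R) < 2)).
  have h4 := is_derive_comp h1 h3.
  apply: is_derive_eq h4 _; rewrite /dchi (_ : 2 - 1 = 1 :> R); last by ring.
  by field; rewrite gt_eqF.
apply: ctsM; last first.
  move=> y; apply: (@continuous_comp _ _ _ (fun y : V => 1 - edot y y / r ^+ 2) (ppow 1)).
    exact: chi_arg_continuous.
  exact: ppow_continuous.
apply: ctsN; apply: ctsM; last exact: cts_cst.
by apply: ctsM; [exact: cts_cst|exact: rV_coord_continuous].
Qed.

Lemma chi_off : vanishes_off r (chi r).
Proof.
move=> y ry; apply: ppow_le0; rewrite ?pnatr_eq0// subr_le0 ler_pdivlMr// mul1r.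
apply: le_trans (norm_le_enorm_sqr y); rewrite ler_pXn2r ?nnegrE ?(ltW r0)//; exact: ltW.
Qed.

Lemma chi_ge0 y : 0 <= chi r y. Proof. exact: ppow_ge0. Qed.

Lemma ppow_le1 (a x : R) : 0 <= a -> x <= 1 -> ppow a x <= 1.
Proof.
move=> a0 x1; apply: (@le_trans _ _ (1 `^ a)); last by rewrite powR1.
rewrite /ppow; apply: ge0_ler_powR => //.
- by rewrite nnegrE le_max lexx orbT.
- by rewrite nnegrE.
- by rewrite ge_max x1 ler01.
Qed.

Lemma chi_le1 y : chi r y <= 1. Proof. exact/ppow_le1/chi_arg_le1. Qed.

Lemma dchi_le i y : `|dchi r i y| <= 4 / r.
Proof.
have [ry|yr] := ltP (r ^+ 2) (edot y y).
  rewrite /dchi ppow_le0 ?oner_neq0//; first by rewrite mulr0 normr0 divr_ge0// ltW.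
  by rewrite subr_le0 ler_pdivlMr// mul1r ltW.
have yi : `|y 0 i| <= r.
  rewrite -(@ler_pXn2r _ 2)// ?nnegrE ?(ltW r0)// real_normK ?num_real//.
  apply: le_trans yr; rewrite /edot (bigD1 i)//= expr2 lerDl; apply: sumr_ge0 => j _.
  by rewrite -expr2 sqr_ge0.
rewrite /dchi mulNr normrN normrM (ger0_norm (ppow_ge0 _ _)).
apply: (@le_trans _ _ (`|4 * y 0 i / r ^+ 2| * 1)).
  by rewrite ler_wpM2l// ppow_le1// chi_arg_le1.
rewrite mulr1 !normrM (ger0_norm (_ : 0 <= 4))// (ger0_norm (_ : 0 <= (r ^+ 2)^-1)); last by rewrite invr_ge0 ltW.
rewrite ler_pdivrMr//; have -> : 4 / r * r ^+ 2 = 4 * r by field; rewrite gt_eqF.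
by rewrite ler_wpM2l.
Qed.

End cutoff.

Lemma chi_cvg (R : realType) (d : nat) (rn : nat -> R) (y : 'rV[R]_d) :
  (forall n, n.+1%:R <= rn n) -> chi (rn n) y @[n --> \oo] --> (1 : R).
Proof.
move=> rnn; have rn0 n : 0 < rn n by apply: lt_le_trans (rnn n).
have h : (rn n)^-1 @[n --> \oo] --> (0 : R).
  apply: (@squeeze_cvgr _ _ _ _ (fun=> 0) (fun n => n.+1%:R^-1)).
  - by apply: nearW => n; rewrite invr_ge0 (ltW (rn0 n))/= lef_pV2 ?posrE.
  - exact: cvg_cst.
  - exact: cvg_harmonic.
have h2 : 1 - edot y y / rn n ^+ 2 @[n --> \oo] --> (1 : R).
  rewrite -[X in _ --> X]subr0; apply: cvgB; first exact: cvg_cst.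
  rewrite -[X in _ --> X](mulr0 (edot y y)); apply: cvgM; first exact: cvg_cst.
  rewrite (_ : (fun n => (rn n ^+ 2)^-1) = (fun n => (rn n)^-1 * (rn n)^-1)); last first.
    by apply/funext => n; rewrite -exprVn expr2.
  by rewrite -[X in _ --> X](mulr0 (0 : R)); exact: (cvgM h h).
have := @ppow_continuous R 2 (ltr0n R 2 : (0 : R) < 2) 1 => c.
have -> : (1 : R) = ppow 2 1 by rewrite ppow_gt0E// powR1.
exact: (cvg_comp _ _ h2 c).
Qed.

Lemma entH_measurable (R : realType) (lambda : R) d0 (T : measurableType d0) (u : T -> R) :
  measurable_fun setT u -> measurable_fun setT (fun y => entH lambda (u y)).
Proof.
move=> mu; rewrite /entH; apply: measurable_funM; first exact: measurable_funM.
exact: (measurableT_comp (@measurable_ln R) mu).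
Qed.

(* Since [ln x <= x - 1], [- r ln r <= w - r ln w] for every [w > 0]. *)
Lemma neg_entropy_Rint (R : realType) (d : nat) (lambda : R) (u : 'rV[R]_d -> R) :
  0 < lambda -> density2 u -> Rint (lebesgue_rV R d) setT (fun y => Num.max (- entH lambda (u y)) 0).
Proof.
move=> l0 du; have i2 := density2_Rint du; have [i1 _] := density_Rint (proj1 du).
have u0 y : 0 <= u y by case: du => -[].
have mu := @Rint_meas _ _ _ (lebesgue_rV R d) _ _ i1.
have [w [mw w0 wi [C wC]]] := gaussian_weight R d.
have iw : Rint (lebesgue_rV R d) setT w.
  apply: RintP => //; under eq_integral do rewrite gtr0_norm//; exact: wi.
have i3 : Rint (lebesgue_rV R d) setT (fun y => lambda * (w y + (`|C| * u y + enorm y ^+ 2 * u y))).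
  by apply: RintZ; apply: RintD => //; apply: RintD => //; exact: RintZ.
apply: (Rint_le _ i3) => [|y _].
  by apply: measurable_maxr => //; apply: measurableT_comp => //; exact: entH_measurable.
have b0 : 0 <= w y + (`|C| * u y + enorm y ^+ 2 * u y).
  by rewrite addr_ge0 ?(ltW (w0 y))// addr_ge0// mulr_ge0// sqr_ge0.
rewrite ger0_norm; last by rewrite le_max lexx orbT.
rewrite ge_max; apply/andP; split; last by rewrite mulr_ge0// ltW.
rewrite /entH -mulrA -mulrN ler_wpM2l ?(ltW l0)//.
have [->|un] := eqVneq (u y) 0; first by rewrite mul0r oppr0 !mulr0 !addr0 ltW.
have up : 0 < u y by rewrite lt_neqAle eq_sym un u0.
have h : ln (w y) - ln (u y) <= w y / u y - 1.
  rewrite -ln_div ?posrE//; have := @le_ln1Dx R (w y / u y - 1).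
  by rewrite addrCA subrr addr0; apply; rewrite ltrBDr addNr divr_gt0.
have h2 : u y * (ln (w y) - ln (u y)) <= w y.
  apply: le_trans (ler_wpM2l (u0 y) h) _; rewrite mulrBr mulr1 mulrCA divff// mulr1 gerBl//.
have h3 : u y * - ln (w y) <= u y * (`|C| + enorm y ^+ 2).
  rewrite ler_wpM2l//; apply: le_trans (wC y) _; rewrite enorm_sqr lerD2r; exact: ler_norm.
have -> : - (u y * ln (u y)) = u y * (ln (w y) - ln (u y)) + u y * - ln (w y) by ring.
by apply: le_trans (lerD h2 h3) _; rewrite lerD2l mulrDr !(mulrC (u y)).
Qed.

Section energy_functional.
Context (R : realType) (d : nat) (lambda eta m : R) (Psi : 'rV[R]_d -> R).
Local Notation leb := (lebesgue_rV R d).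
Local Notation V := 'rV[R]_d.
Hypotheses (lambda0 : 0 < lambda) (eta0 : 0 < eta) (m1 : 1 < m).
Hypotheses (Psi0 : forall y, 0 <= Psi y) (cPsi : continuous Psi).

(** Bounded by 1 / [dn n] = n + 2, so that it can multiply the gradient of a cut-off, while its own
    gradient stays dominated by that of [Psi]. *)
Definition Psin (n : nat) (y : V) : R := Psi y / (1 + dn R n * Psi y).

Lemma Psin_den n y : 0 < 1 + dn R n * Psi y.
Proof. by rewrite ltr_wpDr// mulr_ge0// ltW// dn_gt0. Qed.

Lemma Psin_ge0 n y : 0 <= Psin n y.
Proof. by rewrite divr_ge0// ltW// Psin_den. Qed.

Lemma Psin_le n y : Psin n y <= Psi y.
Proof.
rewrite ler_pdivrMr ?Psin_den// mulrDr mulr1 lerDl mulr_ge0// mulr_ge0//.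
by rewrite ltW// dn_gt0.
Qed.

Lemma Psin_le_n n y : Psin n y <= n.+2%:R.
Proof.
rewrite ler_pdivrMr ?Psin_den// mulrDr mulr1 mulrA mulfV ?pnatr_eq0// mul1r lerDr.
by rewrite ler0n.
Qed.

Lemma Psin_continuous n : continuous (Psin n).
Proof.
move=> y; apply: (@continuous_comp _ _ _ Psi (fun s : R => s / (1 + dn R n * s))); first exact: cPsi.
apply: cvgM; first exact: cvg_id.
apply: cvgV; first by rewrite gt_eqF// Psin_den.
by apply: cvgD; [exact: cvg_cst|apply: cvgM; [exact: cvg_cst|exact: cvg_id]].
Qed.

Lemma Psin_cvg y : Psin n y @[n --> \oo] --> Psi y.
Proof.
rewrite -[X in _ --> X]divr1; apply: cvgM; first exact: cvg_cst.
apply: cvgV; first exact: oner_neq0.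
rewrite -[X in _ --> X]addr0; apply: cvgD; first exact: cvg_cst.
by rewrite -[X in _ --> X](mul0r (Psi y)); apply: cvgM; [exact: dn_cvg|exact: cvg_cst].
Qed.

(** For densities with finite second moment this is equivalent to [J] being finite, in terms of real
    integrals that can be split and compared. *)
Definition finite_energy (u : V -> R) : Prop :=
  [/\ Rint leb setT (fun y => Psi y * u y), Rint leb setT (fun y => entH lambda (u y)) &
      Rint leb setT (fun y => u y `^ m)].

Local Notation G n := (Gd lambda eta m (dn R n)).

Lemma Gd_measurable n (u : V -> R) : measurable_fun setT u -> (forall y, 0 <= u y) ->
  measurable_fun setT (fun y => G n (u y)).
Proof.
move=> mu u0; apply: measurable_half_line => // r r0.
have [L _ GL] := Gd_half_line lambda0 eta0 m1 (dn_gt0 R n) (dn_lt1 R n).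
by case: (C2_half_line_continuous GL r0).
Qed.

Lemma entF_Rint u : finite_energy u -> Rint leb setT (fun y => entF lambda eta m (u y)).
Proof. by case=> _ i1 i2; apply: RintD => //; exact: RintZ. Qed.

Lemma cutoff_potential_cvg (rn : nat -> R) (u : V -> R) : (forall n, n.+1%:R <= rn n) ->
  density2 u -> finite_energy u ->
  \int[leb]_y (chi (rn n) y * Psin n y * u y) @[n --> \oo] --> \int[leb]_y (Psi y * u y).
Proof.
move=> rnn du [i1 _ _]; have rn0 n : 0 < rn n by apply: lt_le_trans (rnn n).
have u0 y : 0 <= u y by case: du => -[].
have [iu _] := density_Rint (proj1 du); have mu := @Rint_meas _ _ _ leb _ _ iu.
have [] // := @Rint_DCT _ _ R leb setT (fun n y => chi (rn n) y * Psin n y * u y)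
  (fun y => Psi y * u y) (fun y => Psi y * u y) _ _ _ i1.
- move=> n; apply: measurable_funM => //; apply: continuous_measurable_rV.
  by apply: ctsM; [exact: chi_continuous|exact: Psin_continuous].
- exact: Rint_meas i1.
- apply: aeW => y _; apply: cvgMl; rewrite -[X in _ --> X]mul1r.
  by apply: cvgM; [exact: chi_cvg|exact: Psin_cvg].
apply: aeW => y _ n; rewrite ger0_norm; last by exact: mulr_ge0 (mulr_ge0 (chi_ge0 _ _) (Psin_ge0 n y)) (u0 y).
rewrite ler_wpM2r//; apply: le_trans (Psin_le n y).
by rewrite ler_piMl ?Psin_ge0 ?chi_le1.
Qed.

Lemma cutoff_entropy_cvg (rn : nat -> R) (u : V -> R) : (forall n, n.+1%:R <= rn n) ->
  density2 u -> finite_energy u ->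
  \int[leb]_y (chi (rn n) y * G n (u y)) @[n --> \oo] --> \int[leb]_y (entF lambda eta m (u y)).
Proof.
move=> rnn du fu; have [_ i2 i3] := fu; have rn0 n : 0 < rn n by apply: lt_le_trans (rnn n).
have u0 y : 0 <= u y by case: du => -[].
have [iu _] := density_Rint (proj1 du); have mu := @Rint_meas _ _ _ leb _ _ iu.
have ig : Rint leb setT (fun y => `|entH lambda (u y)| + eta / (m - 1) * (u y + u y `^ m)).
  by apply: RintD; [exact: Rint_abs|apply: RintZ; exact: RintD].
have [] // := @Rint_DCT _ _ R leb setT (fun n y => chi (rn n) y * G n (u y))
  (fun y => entF lambda eta m (u y)) _ _ _ _ ig.
- move=> n; apply: measurable_funM; last exact: Gd_measurable.
  by apply: continuous_measurable_rV; exact: chi_continuous.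
- exact: Rint_meas (entF_Rint fu).
- apply: aeW => y _; rewrite -[X in _ --> X]mul1r.
  by apply: cvgM; [exact: chi_cvg|exact: Gd_cvg].
apply: aeW => y _ n; rewrite normrM ger0_norm ?chi_ge0//.
have h := Gd_le lambda eta0 m1 (dn_gt0 R n) (dn_lt1 R n) (u0 y).
by apply: le_trans _ h; rewrite ler_piMl ?chi_le1.
Qed.

Lemma J_finite (u : V -> R) : density2 u -> finite_energy u ->
  J lambda eta m Psi u =
    (\int[leb]_y (Psi y * u y) + \int[leb]_y (entF lambda eta m (u y)))%:E.
Proof.
move=> du fu; have [i1 i2 i3] := fu.
have i4 := neg_entropy_Rint lambda0 du.
have i5 : Rint leb setT (fun y => Num.max (entH lambda (u y)) 0).
  apply: (Rint_le _ (Rint_abs i2)) => [|y _].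
    by apply: measurable_maxr => //; exact: Rint_meas i2.
  rewrite ger0_norm; last by rewrite le_max lexx orbT.
  by rewrite ge_max ler_norm normr_ge0.
have i6 : Rint leb setT (fun y => eta / (m - 1) * u y `^ m) by exact: RintZ.
rewrite /J (Rint_EFin i1) (Rint_EFin i5) (Rint_EFin i4) (Rint_EFin i6).
apply: (f_equal EFin).
have -> : \int[leb]_y entF lambda eta m (u y) = \int[leb]_y entH lambda (u y) +
    \int[leb]_y (eta / (m - 1) * u y `^ m) by rewrite -RIntD.
have -> : \int[leb]_y entH lambda (u y) = \int[leb]_y Num.max (entH lambda (u y)) 0 -
    \int[leb]_y Num.max (- entH lambda (u y)) 0.
  rewrite -RIntB//; apply: eq_Rintegral => y _.
  by case: (leP (entH lambda (u y)) 0) => h; case: (leP (- entH lambda (u y)) 0) => h'; lra.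
by ring.
Qed.

(** The subtracted term is finite by [neg_entropy_Rint] and the other three are nonnegative, so each
    of them must be finite. *)
Lemma finite_energy_of_J (u : V -> R) : density2 u -> (J lambda eta m Psi u < +oo)%E ->
  finite_energy u.
Proof.
move=> du; have i4 := neg_entropy_Rint lambda0 du.
have u0 y : 0 <= u y by case: du => -[].
have [iu _] := density_Rint (proj1 du); have mu := @Rint_meas _ _ _ leb _ _ iu.
have mH := entH_measurable lambda mu.
have k0 : 0 < eta / (m - 1) by rewrite divr_gt0// subr_gt0.
rewrite /J (Rint_EFin i4).
have a0 : (0 <= \int[leb]_y (Psi y * u y)%:E)%E.
  by apply: integral_ge0 => y _; rewrite lee_fin mulr_ge0.
have b0 : (0 <= \int[leb]_y (Num.max (entH lambda (u y)) 0)%:E)%E.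
  by apply: integral_ge0 => y _; rewrite lee_fin le_max lexx orbT.
have c0 : (0 <= \int[leb]_y (eta / (m - 1) * u y `^ m)%:E)%E.
  by apply: integral_ge0 => y _; rewrite lee_fin mulr_ge0 ?powR_ge0// ltW.
move=> H.
have [ha hb hc] : [/\ (\int[leb]_y (Psi y * u y)%:E < +oo)%E,
    (\int[leb]_y (Num.max (entH lambda (u y)) 0)%:E < +oo)%E &
    (\int[leb]_y (eta / (m - 1) * u y `^ m)%:E < +oo)%E].
  move: a0 b0 c0 H; case: (\int[leb]_y (Psi y * u y)%:E)%E => [a| |] //;
  case: (\int[leb]_y (Num.max (entH lambda (u y)) 0)%:E)%E => [b| |] //;
  case: (\int[leb]_y (eta / (m - 1) * u y `^ m)%:E)%E => [c| |] // _ _ _ _; split; exact: ltry.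
have mm : measurable_fun setT (fun y => u y `^ m).
  exact: (measurableT_comp (measurable_powR m) mu).
have i5 : Rint leb setT (fun y => Num.max (entH lambda (u y)) 0).
  apply: RintP => //; first exact: measurable_maxr.
  rewrite (eq_integral (fun y => (Num.max (entH lambda (u y)) 0)%:E))// => y _.
  by rewrite ger0_norm// le_max lexx orbT.
have i6 : Rint leb setT (fun y => eta / (m - 1) * u y `^ m).
  apply: RintP => //; first exact: measurable_funM.
  rewrite (eq_integral (fun y => (eta / (m - 1) * u y `^ m)%:E))// => y _.
  by rewrite ger0_norm// mulr_ge0 ?powR_ge0// ltW.
split.
- apply: RintP => //; first by apply: measurable_funM => //; exact: continuous_measurable_rV.
  rewrite (eq_integral (fun y => (Psi y * u y)%:E))// => y _.
  by rewrite ger0_norm// mulr_ge0.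
- apply: (Rint_le mH (RintD i5 i4)) => y _.
  move: (entH lambda (u y)) => {a0 b0 c0 H ha hb hc k0} a; rewrite ler_norml.
  by case: (leP a 0) => h; case: (leP (- a) 0) => h'; apply/andP; split; lra.
apply: (eq_Rint (f := fun y => (eta / (m - 1))^-1 * (eta / (m - 1) * u y `^ m))) (RintZ _ i6) => y _.
by rewrite mulrA mulVf ?mul1r// gt_eqF.
Qed.

Lemma J_ae_eq (u w : V -> R) : measurable_fun setT u -> measurable_fun setT w ->
  {ae leb, forall y, u y = w y} -> J lambda eta m Psi u = J lambda eta m Psi w.
Proof.
move=> mu mw uw; rewrite /J.
have mP := continuous_measurable_rV cPsi.
have mm (z : V -> R) : measurable_fun setT z -> measurable_fun setT (fun y => z y `^ m).
  by move=> mz; exact: (measurableT_comp (measurable_powR m) mz).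
congr (_ + _ - _ + _)%E; apply: ae_eq_integral => //;
  try (by apply: filterS uw => y -> _);
  apply/measurable_EFinP.
- exact: measurable_funM.
- exact: measurable_funM.
- by apply: measurable_maxr => //; exact: entH_measurable.
- by apply: measurable_maxr => //; exact: entH_measurable.
- by apply: measurable_maxr => //; apply: measurableT_comp => //; exact: entH_measurable.
- by apply: measurable_maxr => //; apply: measurableT_comp => //; exact: entH_measurable.
- by apply: measurable_funM => //; exact: mm.
- by apply: measurable_funM => //; exact: mm.
Qed.

End energy_functional.

Lemma L1_locMc (R : realType) (d : nat) (f g : 'rV[R]_d -> R) :
  L1_loc f -> continuous g -> L1_loc (fun x => f x * g x).
Proof.
move=> fl cg; have mg := continuous_measurable_rV cg.
apply: L1_locP => [|C cC]; first by apply: measurable_funM => //; case: fl.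
have [M [_ HM]] := compact_bounded cC.
pose r := `|M| + 1; have Cr x : C x -> `|x| <= r.
  by apply: HM; rewrite (le_lt_trans (ler_norm M))// ltrDl.
have [B _ gB] := continuous_bounded_on_ball r cg.
have iB := L1_loc_ball r fl.
have [_ h] := RintMb iB (measurable_funTS mg) (fun x (xr : `|x| <= r) => gB x xr).
split; first exact: compact_measurable_rV.
rewrite (_ : EFin \o _ = (fun x => (g x * f x)%:E)); last first.
  by apply/funext => x /=; rewrite mulrC.
by apply: (integrableS _ _ Cr h) => //; [exact: closed_ball_measurable|exact: compact_measurable_rV].
Qed.

Lemma wgrad_measurable (R : realType) (d : nat) (f : 'rV[R]_d -> R) i :
  measurable_fun setT (fun y => wgrad f y 0 i).
Proof.
rewrite /wgrad; case: xgetP => [G _ [lG _]|_]; first by case: (lG i).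
by rewrite (_ : (fun y => _) = cst 0)//; apply/funext => y; rewrite mxE.
Qed.

Lemma integral_lty_ae d0 (T : measurableType d0) (R : realType) (mu : {measure set T -> \bar R})
    (D : set T) (f : T -> \bar R) : measurable D -> measurable_fun D f -> (forall x, 0 <= f x)%E ->
  (\int[mu]_(x in D) f x < +oo)%E -> {ae mu, forall x, D x -> (f x < +oo)%E}.
Proof.
move=> mD mf f0 fi; have i1 : mu.-integrable D f.
  by apply/integrableP; split => //; under eq_integral do rewrite gee0_abs//.
by apply: filterS (integrable_ae mD i1) => x H /H; rewrite ge0_fin_numE.
Qed.

Lemma ae_eq_itv (R : realType) (f g : R -> R) (s t : R) :
  measurable_fun setT f -> measurable_fun setT g ->
  {ae (@lebesgue_measure R), forall r : R, f r = g r} -> Rint (@lebesgue_measure R) `[s, t] g ->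
  Rint (@lebesgue_measure R) `[s, t] f /\
  \int[@lebesgue_measure R]_(r in `[s, t]) f r = \int[@lebesgue_measure R]_(r in `[s, t]) g r.
Proof.
move=> mf mg fg ig.
have mf' : measurable_fun `[s, t] f by exact: (@measurable_funTS _ _ _ _ _ _ mf).
have mg' : measurable_fun `[s, t] g by exact: (@measurable_funTS _ _ _ _ _ _ mg).
have h : {ae (@lebesgue_measure R), forall r : R, `[s, t]%classic r -> f r = g r}.
  by move: fg; apply: negligibleS => r; apply: contra_not => H _.
have mI : measurable (`[s, t]%classic : set R) by exact: measurable_itv.
split; last exact: (@ae_eq_RInt _ _ R (@lebesgue_measure R) _ f g mI mf' mg' h).
apply: (@ae_eq_Rint _ _ R (@lebesgue_measure R) _ g f mf' ig); move: h; apply: negligibleS => r; apply: contra_not => H rst.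
by rewrite H.
Qed.

Lemma measurable_inv_ge0 (R : realType) d0 (T : measurableType d0) (f : T -> R) :
  measurable_fun setT f -> (forall y, 0 <= f y) -> measurable_fun setT (fun y => (f y)^-1).
Proof.
move=> mf f0; rewrite (_ : (fun y => _) = (fun x : R => x `^ (-1)) \o f); last first.
  by apply/funext => y /=; rewrite powR_inv1.
exact: (measurableT_comp (measurable_powR (-1)) mf).
Qed.

Lemma measurable_off_zero (R : realType) d0 (T : measurableType d0) (f g : T -> R) :
  measurable_fun setT f -> measurable_fun setT g ->
  measurable_fun setT (fun y => if f y == 0 then 0 else g y).
Proof.
move=> mf mg; have mA : measurable (f @^-1` [set 0]) by rewrite -[X in measurable X]setTI; exact: mf.
have -> : (fun y => if f y == 0 then 0 else g y) = (fun y => g y * \1_(~` (f @^-1` [set 0])) y).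
  apply/funext => y; rewrite indicE; case: eqP => fy; last by rewrite mem_set ?mulr1.
  by rewrite memNset ?mulr0//= => h; apply: h.
by apply: measurable_funM => //; apply: measurable_indic; exact: measurableC.
Qed.

(** * The Fokker-Planck flow *)

Section flow.
Context (R : realType) (d : nat) (lambda eta m : R) (Psi : 'rV[R]_d -> R).
Local Notation mu := (@lebesgue_measure R).
Local Notation leb := (lebesgue_rV R d).
Local Notation V := 'rV[R]_d.
Local Notation conv n := (cv (@moll R d n)).
Local Notation e_ i := (delta_mx 0 i : V).
Hypotheses (lambda0 : 0 < lambda) (eta0 : 0 < eta) (m1 : 1 < m) (PsiC1 : Ck 1 Psi).
Variables (rho0 : V -> R) (rho : R -> V -> R).
Hypotheses (hrho2 : forall t : R, 0 <= t -> density2 (rho t))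
  (hsol : FP_solution lambda eta m Psi rho0 rho).

(** Extension to negative times by the initial value, so that continuity and measurability in time
    can be stated on the whole line. *)
Definition rhop (t : R) : V -> R := rho (Num.max t 0).

Let m0 : 0 < m. Proof. by rewrite (lt_trans _ m1). Qed.

Lemma rhopE t : 0 <= t -> rhop t = rho t.
Proof. by move=> t0; rewrite /rhop max_l. Qed.

Lemma rhop_density2 t : density2 (rhop t).
Proof. by apply: hrho2; rewrite le_max lexx orbT. Qed.

Lemma rhop_ge0 t y : 0 <= rhop t y.
Proof. by case: (rhop_density2 t) => -[_ h _] _. Qed.

Lemma rhop_Rint t : Rint leb setT (rhop t).
Proof. by case: (rhop_density2 t) => /density_Rint[]. Qed.

Lemma rhop_mass t : \int[leb]_y rhop t y = 1.
Proof. by case: (rhop_density2 t) => /density_Rint[]. Qed.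

Lemma rhop_measurable t : measurable_fun setT (rhop t).
Proof. exact: Rint_meas (rhop_Rint t). Qed.

Lemma rhop_L1_loc t : L1_loc (rhop t). Proof. exact/Rint_L1_loc/rhop_Rint. Qed.

Lemma rhop_continuous (f : V -> R) (C : R) : continuous f -> (forall y, `|f y| <= C) ->
  continuous (fun t => \int[leb]_y (f y * rhop t y)).
Proof.
move=> cf fC; apply: (within_ge0_continuous (g := fun t => \int[leb]_y (f y * rho t y))).
by case: hsol => _ /(_ f cf) h _ _ _; apply: h; exists C.
Qed.

Lemma rhop_Cc_continuous (f : V -> R) (r : R) : continuous f -> vanishes_off r f ->
  continuous (fun t => \int[leb]_y (rhop t y * f y)).
Proof.
move=> cf fr; have [C _ fC] := continuous_bounded_support cf fr.
have -> : (fun t => \int[leb]_y (rhop t y * f y)) = (fun t => \int[leb]_y (f y * rhop t y)).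
  by apply/funext => t; apply: eq_Rintegral => y _; rewrite mulrC.
exact: rhop_continuous cf fC.
Qed.

Lemma moll_translate_off n (x : V) : vanishes_off (n.+1%:R^-1 + `|x|) (fun z : V => moll n (z - x)).
Proof. exact/vanishes_translate/moll_vanishes. Qed.

Lemma moll_translate_continuous n (x : V) : continuous (fun z : V => @moll R d n (z - x)).
Proof. exact/cts_translate/moll_continuous. Qed.

Lemma conv_rhop_continuous n x : continuous (fun t => conv n (rhop t) x).
Proof.
exact: rhop_Cc_continuous (@moll_translate_continuous n x) (@moll_translate_off n x).
Qed.

Lemma conv_rhop_measurable n x : measurable_fun setT (fun t => conv n (rhop t) x).
Proof. by apply: continuous_measurable_fun; exact: conv_rhop_continuous. Qed.

Definition dPsi (i : 'I_d) (y : V) : R := grad Psi y 0 i.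

Lemma dPsi_continuous i : continuous (dPsi i).
Proof.
have -> : dPsi i = (fun y => 'D_(e_ i) Psi y) by apply/funext => y; rewrite /dPsi mxE.
by have [_ /(_ (e_ i))[_ []]] := PsiC1.
Qed.

Definition dLF (t : R) : V -> V := wgrad (fun z => LF lambda eta m (rhop t z)).
(** The diffusion coefficient L_F'(rho), bounded below by [lambda] but not above. *)
Definition dif (t : R) (y : V) : R := lambda + eta * m * rhop t y `^ (m - 1).
Definition flux (t : R) (i : 'I_d) (y : V) : R := rhop t y * dPsi i y + dLF t y 0 i.

Lemma dif_ge t y : lambda <= dif t y.
Proof. by rewrite lerDl !mulr_ge0 ?powR_ge0// ltW. Qed.

Lemma dif_gt0 t y : 0 < dif t y. Proof. exact: lt_le_trans (dif_ge t y). Qed.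

Lemma slice t : 0 < t ->
  [/\ L1_loc (fun y => rhop t y `^ m), is_weak_grad (rhop t) (wgrad (rhop t)),
      is_weak_grad (fun y => LF lambda eta m (rhop t y)) (dLF t) &
      {ae leb, forall y, [/\ lambda *: wgrad (rhop t) y + eta *: wgrad (fun z => rhop t z `^ m) y = dLF t y,
        dLF t y = dif t y *: wgrad (rhop t) y &
        rhop t y = 0 -> dLF t y = 0 /\ wgrad (rhop t) y = 0]}].
Proof.
move=> t0; have reg : W11_loc (fun y => LF lambda eta m (rhop t y)).
  by rewrite (rhopE (ltW t0)); case: hsol => _ _ _ /(_ t t0).
by have [_ h1 h2 h3 h4] := slice_weak_grad lambda0 eta0 m1 (@rhop_ge0 t) reg.
Qed.

(** Restricts to the times at which Sobolev regularity is given; at time 0 the functionals below may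
    be meaningless. *)
Definition pos (t : R) : R := if 0 < t then 1 else 0.

Lemma pos_measurable : measurable_fun setT pos.
Proof.
have -> : pos = \1_(`]0, +oo[%classic : set R).
  by apply/funext => t; rewrite /pos indicE mem_setE in_itv/= andbT; case: ifP.
by apply: measurable_indic; exact: measurable_itv.
Qed.

(** The power is unbounded, so it is capped at [k] to fit [measurable_bounded_functional]; at
    positive times local integrability of rho^m removes the cap. *)
Lemma pow_measurable (zeta : V -> R) (r : R) : continuous zeta -> vanishes_off r zeta ->
  measurable_fun setT (fun t => pos t * \int[leb]_y (rhop t y `^ m * zeta y)).
Proof.
move=> cz zr; pose g (k : nat) (s : R) := Num.min (ppow m s) k%:R.
have g0 k s : 0 <= g k s by rewrite le_min ppow_ge0 ler0n.
have cg k : continuous (g k).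
  move=> s; have cm : continuous (fun y : R => Num.min y k%:R).
    by move: (k%:R : R) => K y; apply: continuous_min; [exact: cvg_id|exact: cvg_cst].
  exact: (cvg_comp _ _ (@ppow_continuous R m m0 s) (cm (ppow m s))).
have gb k s : `|g k s| <= k%:R by rewrite ger0_norm// ge_min lexx orbT.
have mz := continuous_measurable_rV cz.
apply: (measurable_fun_cvg (h := fun k t => pos t * \int[leb]_y (g k (rhop t y) * zeta y))).
  move=> k; apply: measurable_funM; first exact: pos_measurable.
  exact: (measurable_bounded_functional rhop_L1_loc conv_rhop_measurable (cg k) (gb k) cz zr).
move=> t _; rewrite /pos; case: ifPn => [t0|_]; last first.
  by rewrite mul0r; under eq_fun do rewrite mul0r; exact: cvg_cst.
have [lm _ _ _] := slice t0.
have ig : Rint leb setT (fun y => `|rhop t y `^ m * zeta y|).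
  by apply: Rint_abs; exact: L1_loc_Cc lm cz zr.
apply: cvgMr.
have [] // := @Rint_DCT _ _ R leb setT (fun k y => g k (rhop t y) * zeta y) (fun y => rhop t y `^ m * zeta y)
   (fun y => `|rhop t y `^ m * zeta y|) _ _ _ ig.
- move=> k; apply: measurable_funM => //.
  exact: measurableT_comp (continuous_measurable_fun (cg k)) (rhop_measurable t).
- by apply: measurable_funM => //; case: lm.
- apply: aeW => y _; apply: cvgMl; apply: cvg_near_cst; near=> k.
  rewrite /g ppow_gt0E ?rhop_ge0// min_l//.
  by near: k; exact: nbhs_infty_ger.
apply: aeW => y _ k; rewrite !normrM ler_wpM2r// ger0_norm//.
rewrite (ger0_norm (powR_ge0 _ _)) /g ppow_gt0E ?rhop_ge0//.
by rewrite ge_min lexx.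
Unshelve. all: by end_near.
Qed.

Lemma flux_L1_loc t i : 0 < t -> L1_loc (flux t i).
Proof.
move=> t0; have [_ _ [lG _] _] := slice t0; apply: L1_locD => //.
by apply: L1_locMc; [exact: rhop_L1_loc|exact: dPsi_continuous].
Qed.

(** [wgrad] selects a gradient independently at each time. The right-hand side is free of this
    choice, and measurability of the flux in time is read off from it. *)
Lemma flux_test t i (zeta : V -> R) : 0 < t -> test_function [set: V] zeta ->
  \int[leb]_y (flux t i y * zeta y) =
  \int[leb]_y (rhop t y * (dPsi i y * zeta y)) -
  (lambda * \int[leb]_y (rhop t y * 'D_(e_ i) zeta y) + eta * \int[leb]_y (rhop t y `^ m * 'D_(e_ i) zeta y)).
Proof.
move=> t0 tz; have [lm _ [lG wG] _] := slice t0.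
have [r zr Cz] := test_functionP tz.
have cz : continuous zeta by case: (Cz 0).
have cDz : continuous ('D_(e_ i) zeta) by case: (Cz (e_ i)).
have Dzr := vanishes_derive (e_ i) zr.
have i1 : Rint leb setT (fun y => rhop t y * (dPsi i y * zeta y)).
  apply: (L1_loc_Cc (r := r) (rhop_L1_loc t)); first by apply: ctsM => //; exact: dPsi_continuous.
  by move=> y ry; rewrite zr// mulr0.
have i2 : Rint leb setT (fun y => dLF t y 0 i * zeta y) by exact: L1_loc_Cc (lG i) cz zr.
transitivity (\int[leb]_y (rhop t y * (dPsi i y * zeta y)) + \int[leb]_y (dLF t y 0 i * zeta y)).
  by rewrite -RIntD//; apply: eq_Rintegral => y _; rewrite /flux mulrDl mulrA.
congr (_ + _); apply: oppr_inj; rewrite opprK -(wG zeta tz i).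
have i3 := L1_loc_Cc (rhop_L1_loc t) cDz Dzr; have i4 := L1_loc_Cc lm cDz Dzr.
rewrite -!RIntZ// -RIntD; [|exact: RintZ|exact: RintZ].
by apply: eq_Rintegral => y _; rewrite /LF mulrDl !mulrA.
Qed.

Lemma flux_measurable i (zeta : V -> R) : test_function [set: V] zeta ->
  measurable_fun setT (fun t => pos t * \int[leb]_y (flux t i y * zeta y)).
Proof.
move=> tz.
have [r zr Cz] := test_functionP tz.
have cz : continuous zeta by case: (Cz 0).
have cDz : continuous ('D_(e_ i) zeta) by case: (Cz (e_ i)).
have Dzr := vanishes_derive (e_ i) zr.
have -> : (fun t => pos t * \int[leb]_y (flux t i y * zeta y)) =
   (fun t => pos t * \int[leb]_y (rhop t y * (dPsi i y * zeta y)) -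
  (lambda * (pos t * \int[leb]_y (rhop t y * 'D_(e_ i) zeta y)) +
   eta * (pos t * \int[leb]_y (rhop t y `^ m * 'D_(e_ i) zeta y)))).
  apply/funext => t; rewrite /pos; case: ifPn => [t0|_]; last by ring.
  by rewrite flux_test//; ring.
have mc (f : V -> R) : continuous f -> vanishes_off r f ->
    measurable_fun setT (fun t => pos t * \int[leb]_y (rhop t y * f y)).
  move=> cf fr; apply: measurable_funM; first exact: pos_measurable.
  by apply: continuous_measurable_fun; exact: rhop_Cc_continuous cf fr.
apply: measurable_funB.
  apply: mc; first by apply: ctsM => //; exact: dPsi_continuous.
  by move=> y ry; rewrite zr// mulr0.
apply: measurable_funD; apply: measurable_funM => //; first exact: mc.
exact: pow_measurable cDz Dzr.
Qed.

(** A representative of the flux that vanishes wherever the density does, at every point and not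
    merely almost everywhere, so that |flux0|^2 is rho times [kin0] without exception. *)
Definition flux0 (t : R) (i : 'I_d) (y : V) : R :=
  if 0 < t then if rhop t y == 0 then 0 else flux t i y else 0.

Lemma flux_meas t i : 0 < t -> measurable_fun setT (flux t i).
Proof. by move=> t0; case: (flux_L1_loc i t0). Qed.

Lemma flux0_meas t i : measurable_fun setT (flux0 t i).
Proof.
have [t0|t0] := boolP (0 < t); last first.
  by rewrite (_ : flux0 t i = cst 0)//; apply/funext => y; rewrite /flux0 (negbTE t0).
rewrite (_ : flux0 t i = fun y => if rhop t y == 0 then 0 else flux t i y).
  by apply: measurable_off_zero; [exact: rhop_measurable|exact: flux_meas].
by apply/funext => y; rewrite /flux0 t0.
Qed.

Lemma flux0_ae t i : 0 < t -> {ae leb, forall y, flux0 t i y = flux t i y}.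
Proof.
move=> t0; have [_ _ _] := slice t0; apply: filterS => y [_ _ z].
rewrite /flux0 t0; case: eqP => // r0.
by rewrite /flux r0 mul0r add0r (proj1 (z r0)) mxE.
Qed.

Lemma flux0_L1_loc t i : L1_loc (flux0 t i).
Proof.
have [t0|t0] := boolP (0 < t).
  apply: (L1_loc_le (flux0_meas t i) (flux_L1_loc i t0)) => y; rewrite /flux0 t0.
  by case: eqP => // _; rewrite normr0.
rewrite (_ : flux0 t i = fun=> 0); first exact: L1_loc_cst.
by apply/funext => y; rewrite /flux0 (negbTE t0).
Qed.

Lemma flux0_integral t i (zeta : V -> R) : measurable_fun setT zeta ->
  \int[leb]_y (flux0 t i y * zeta y) = pos t * \int[leb]_y (flux t i y * zeta y).
Proof.
move=> mz; rewrite /pos; have [t0|t0] := boolP (0 < t); last first.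
  rewrite mul0r; under eq_Rintegral do rewrite /flux0 (negbTE t0) mul0r.
  by rewrite Rintegral_cst// mul0r.
rewrite mul1r; apply: ae_eq_RInt => //.
- by apply: measurable_funM => //; exact: flux0_meas.
- by apply: measurable_funM => //; exact: flux_meas.
by apply: filterS (flux0_ae i t0) => y -> .
Qed.

Lemma flux0_measurable i (zeta : V -> R) : test_function [set: V] zeta ->
  measurable_fun setT (fun t => \int[leb]_y (flux0 t i y * zeta y)).
Proof.
move=> tz; have [r zr Cz] := test_functionP tz.
have mz : measurable_fun setT zeta by apply: continuous_measurable_rV; case: (Cz 0).
under eq_fun do rewrite flux0_integral//; exact: flux_measurable.
Qed.

Lemma moll_derive_test n (x : V) (v : V) :
  test_function [set: V] (fun z => 'D_v (@moll R d n) (z - x)).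
Proof.
apply: (@test_function_translate _ _ ('D_v (@moll R d n)) n.+1%:R^-1 x).
  by move=> k; have [_ /(_ v)[_]] := @moll_smooth R d n k.+1.
by apply: smooth_supp_derive; exact: moll_supp.
Qed.

Definition kin0 (t : R) (y : V) : R := (\sum_i flux0 t i y ^+ 2) / rhop t y.

Lemma kin0_ge0 t y : 0 <= kin0 t y.
Proof. by rewrite divr_ge0 ?rhop_ge0//; apply: sumr_ge0 => i _; exact: sqr_ge0. Qed.

Lemma kin0_meas t : measurable_fun setT (kin0 t).
Proof.
rewrite (_ : kin0 t = fun y => if rhop t y == 0 then 0 else (\sum_i flux0 t i y ^+ 2) * (rhop t y)^-1); last first.
  by apply/funext => y; rewrite /kin0; case: eqP => // ->; rewrite invr0 mulr0.
apply: measurable_off_zero; first exact: rhop_measurable.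
apply: measurable_funM.
  by apply: measurable_sum => i; apply: measurable_funX; exact: flux0_meas.
by apply: measurable_inv_ge0; [exact: rhop_measurable|exact: rhop_ge0].
Qed.

Definition diss (t : R) : \bar R := (\int[leb]_y (kin0 t y)%:E)%E.

Lemma diss_ge0 t : (0 <= diss t)%E.
Proof. by apply: integral_ge0 => y _; rewrite lee_fin kin0_ge0. Qed.

(** Monotone convergence from below: the cap is [k], the denominator is shifted by 1 / (k + 1), and
    the ball has radius [k]. All three changes act in the same direction. *)
Lemma diss_measurable : measurable_fun setT diss.
Proof.
pose b (k : nat) : V -> R := \1_[set x : V | `|x| <= k%:R].
pose S t y := \sum_i flux0 t i y ^+ 2.
have S0 t y : 0 <= S t y by apply: sumr_ge0 => i _; exact: sqr_ge0.
have r0 := rhop_ge0.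
pose F (k : nat) t y : R := Num.min (S t y / (rhop t y + k.+1%:R^-1)) k%:R * b k y.
have pos_den k t y : 0 < rhop t y + k.+1%:R^-1 by rewrite ltr_wpDl// invr_gt0.
have b0 k y : 0 <= b k y by rewrite /b indicE.
have m0' k t y : 0 <= Num.min (S t y / (rhop t y + k.+1%:R^-1)) k%:R.
  by rewrite le_min ler0n andbT divr_ge0// ltW.
have F0 k t y : 0 <= F k t y by rewrite mulr_ge0.
have mb k : measurable_fun setT (b k) by apply: measurable_indic; exact: closed_ball_measurable.
have iF k t : Rint leb setT (F k t).
  have ib : Rint leb setT (fun y => k%:R * b k y).
    by apply: RintZ; apply: Rint_indic => //; [exact: closed_ball_measurable|exact: leb_ball_lty].
  apply: (Rint_le _ ib) => [|y _]; last by rewrite ger0_norm// ler_wpM2r// ge_min lexx orbT.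
  apply: measurable_funM => //; apply: measurable_minr => //; apply: measurable_funM.
    by apply: measurable_sum => i; apply: measurable_funX; exact: flux0_meas.
  apply: measurable_inv_ge0 => [|y]; last exact: ltW.
  by apply: measurable_funD => //; exact: rhop_measurable.
apply: (emeasurable_fun_cvg (fun k t => (\int[leb]_y F k t y)%:E)).
  move=> k; apply/measurable_EFinP.
  apply: (measurable_kinetic_functional (q := flux0)) => //.
  - exact: rhop_L1_loc.
  - exact: conv_rhop_measurable.
  - exact: flux0_L1_loc.
  - by move=> n i x; apply: (@flux0_measurable i (fun z => moll n (z - x))); exact: moll_test.
move=> t _; under eq_fun do rewrite -(Rint_EFin (iF _ t)).
have cvF y : F k t y @[k --> \oo] --> kin0 t y.
  have c1 : S t y / (rhop t y + k.+1%:R^-1) @[k --> \oo] --> kin0 t y.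
    have [z|nz] := eqVneq (rhop t y) 0.
      have Sz : S t y = 0.
        by rewrite /S big1// => i _; rewrite /flux0 z eqxx; case: ifP; rewrite expr0n.
      by rewrite /kin0 z invr0 mulr0 Sz; under eq_fun do rewrite mul0r; exact: cvg_cst.
    apply: cvgMr; apply: cvgV => //.
    rewrite -[X in _ --> X]addr0; apply: cvgD; first exact: cvg_cst.
    exact: cvg_harmonic.
  apply: cvg_trans c1; apply: near_eq_cvg; near=> k.
  have ky : `|y| <= k%:R by near: k; exact: nbhs_infty_ger.
  have kk : kin0 t y <= k%:R by near: k; exact: nbhs_infty_ger.
  rewrite /F /b indicE mem_set// mulr1 min_l//; apply: le_trans kk.
  have [z|nz] := eqVneq (rhop t y) 0.
    have Sz : S t y = 0.
      by rewrite /S big1// => i _; rewrite /flux0 z eqxx; case: ifP; rewrite expr0n.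
    by rewrite Sz mul0r kin0_ge0.
  by rewrite ler_wpM2l// lef_pV2 ?posrE// ?lerDl ?invr_ge0// lt_neqAle eq_sym nz r0.
have -> : diss t = (\int[leb]_y limn (fun k => (F k t y)%:E))%E.
  apply: eq_integral => y _; apply/esym/cvg_lim => //.
  by apply: (@cvg_comp _ _ _ (fun k => F k t y) EFin); [exact: cvF|exact: cvg_refl].
apply: cvg_monotone_convergence => //.
- by move=> k; apply/measurable_EFinP; exact: Rint_meas (iF k t).
- by move=> k y _; rewrite lee_fin.
move=> y _ k l kl; rewrite lee_fin /F ler_pM//.
  rewrite le_min !ge_min; apply/andP; split; apply/orP; last by right; rewrite ler_nat.
  left; rewrite ler_wpM2l// lef_pV2 ?posrE// lerD2l lef_pV2 ?posrE//.
  by rewrite ler_nat ltnS.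
rewrite /b !indicE ler_nat; case: (boolP (y \in [set x : V | `|x| <= k%:R])) => // /set_mem /= yk.
by rewrite mem_set//=; apply: le_trans yk _; rewrite ler_nat.
Unshelve. all: by end_near.
Qed.

(** Where the density is positive, the flux is -rho times [vel] by the linear relation between the
    weak gradients in [slice]. Where it vanishes, [vel] has weight zero and [flux0] is zero. *)
Lemma diss_vnorm2 t : 0 < t -> vnorm2 lambda eta m Psi rho t = diss t.
Proof.
move=> t0; rewrite /vnorm2 /vel -(rhopE (ltW t0)); apply: ae_eq_integral => //.
- apply/measurable_EFinP; apply: measurable_funM; last exact: rhop_measurable.
  under eq_fun do rewrite enorm_sqr /edot.
  have minv : measurable_fun setT (fun y => (rhop t y)^-1).
    by apply: measurable_inv_ge0; [exact: rhop_measurable|exact: rhop_ge0].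
  apply: measurable_sum => i; rewrite -[X in measurable_fun _ X]/(fun y => _ ^+ 2); apply: measurable_funX.
  under eq_fun do rewrite !mxE.
  apply: measurableT_comp => //; apply: measurable_funD; first apply: measurable_funD.
  + by apply: continuous_measurable_rV; have := @dPsi_continuous i; rewrite /dPsi; under eq_fun do rewrite mxE.
  + apply: measurable_funM; last exact: wgrad_measurable.
    by apply: measurable_funM.
  + apply: measurable_funM; last exact: wgrad_measurable.
    by apply: measurable_funM.
- by apply/measurable_EFinP; exact: kin0_meas.
have [_ _ _] := slice t0; apply: filterS => y [h _ _] _; congr EFin.
rewrite enormN enorm_sqr /edot /kin0 mulr_suml mulr_suml; apply: eq_bigr => i _.
rewrite /flux0 t0 !mxE; case: eqP => [->|/eqP nz]; first by rewrite invr0 !mulr0.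
have := congr1 (fun w : V => w 0 i) h; rewrite /flux !mxE => <-.
by rewrite /dPsi mxE; field.
Qed.

(** Almost every positive time is good. Setting flux, gradient and majorant to zero at the others
    makes the hypotheses of [energy_balance] hold at every real time, without altering time
    integrals over positive times. *)
Definition good (t : R) : bool := (0 < t) && (diss t < +oo)%E.
Definition rate (t : R) : R := if good t then fine (diss t) else 0.

Lemma good_measurable : measurable [set t : R | good t].
Proof.
rewrite (_ : [set t | good t] = `]0, +oo[%classic `&` (setT `&` [set t | (diss t < +oo)%E])).
  apply: measurableI; first exact: measurable_itv.
  exact: (emeasurable_fun_infty_o measurableT diss_measurable).
apply/seteqP; split => t /=; rewrite /good in_itv/= andbT; first by move=> /andP[].
by move=> [-> [_ ->]].
Qed.

Lemma measurable_if_good (f : R -> R) : measurable_fun setT f ->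
  measurable_fun setT (fun t => if good t then f t else 0).
Proof.
move=> mf; rewrite (_ : (fun t => _) = (fun t => f t * \1_[set t | good t] t)).
  by apply: measurable_funM => //; apply: measurable_indic; exact: good_measurable.
by apply/funext => t; rewrite indicE; case: ifPn => g; [rewrite mem_set ?mulr1|rewrite memNset ?mulr0//=; exact/negP].
Qed.

Lemma rate_measurable : measurable_fun setT rate.
Proof.
by apply: measurable_if_good; apply: measurableT_comp => //; exact: diss_measurable.
Qed.

Lemma rate_ge0 t : 0 <= rate t.
Proof. by rewrite /rate; case: ifP => // _; rewrite fine_ge0// diss_ge0. Qed.

Lemma good_rate t : good t -> diss t = (rate t)%:E.
Proof.
move=> g; rewrite /rate g fineK// ge0_fin_numE ?diss_ge0//; by case/andP: g.
Qed.

Lemma kin0_Rint t : good t -> Rint leb setT (kin0 t) /\ \int[leb]_y kin0 t y = rate t.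
Proof.
move=> g; have E := good_rate g.
have i1 : Rint leb setT (kin0 t).
  apply: RintP => //; first exact: kin0_meas.
  have -> : (\int[leb]_y `|kin0 t y|%:E = diss t)%E.
    by apply: eq_integral => y _; rewrite ger0_norm// kin0_ge0.
  by rewrite E ltry.
by split => //; rewrite /Rintegral -/(diss t) E.
Qed.

Hypothesis (hv : forall T : R, 0 < T ->
  (\int[lebesgue_measure]_(t in `]0%R, T[) vnorm2 lambda eta m Psi rho t < +oo)%E).

Lemma diss_lty T : 0 < T -> (\int[mu]_(t in `]0%R, T[) diss t < +oo)%E.
Proof.
move=> T0; apply: le_lt_trans (hv T0); rewrite le_eqVlt; apply/orP; left; apply/eqP.
by apply: eq_integral => t /set_mem; rewrite /= in_itv/= => /andP[t0 _]; rewrite diss_vnorm2.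
Qed.

Lemma good_ae : {ae mu, forall t : R, 0 < t -> good t}.
Proof.
have h (k : nat) : {ae mu, forall t : R, `]0%R, k.+1%:R[%classic t -> (diss t < +oo)%E}.
  have mI : measurable (`]0%R, k.+1%:R[%classic : set R) by exact: measurable_itv.
  apply: (@integral_lty_ae _ _ R mu (`]0%R, k.+1%:R[%classic : set R) diss) => //.
  - exact: (@measurable_funTS _ _ _ _ _ _ diss_measurable).
  - exact: diss_ge0.
  - exact: diss_lty.
have := ae_foralln h; apply: negligibleS => t; apply: contra_not => H t0.
rewrite /good t0 /=; apply: (H (Num.bound t)); rewrite /= in_itv/= t0/=.
by rewrite (lt_le_trans (archi_boundP (ltW t0)))// ler_nat.
Qed.

Lemma rate_Rint (s T : R) : 0 <= s -> Rint mu `[s, T] rate.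
Proof.
move=> s0; pose T' := Num.max T 1; have T'0 : 0 < T' by rewrite lt_max ltr01 orbT.
suff : Rint mu `[0, T'] rate by move/Rint_itvS; apply => //; rewrite le_max lexx.
have mI : measurable (`[0, T']%classic : set R) by exact: measurable_itv.
have mr b : measurable_fun b (EFin \o rate).
  by apply/measurable_EFinP; exact: (@measurable_funTS _ _ _ _ _ _ rate_measurable).
apply: RintP => //; first exact: (@measurable_funTS _ _ _ _ _ _ rate_measurable).
have -> : (\int[mu]_(x in `[0%R, T']) `|rate x|%:E = \int[mu]_(x in `[0%R, T']) (rate x)%:E)%E.
  by apply: eq_integral => t _; rewrite ger0_norm ?rate_ge0.
rewrite integral_itv_bndoo//; apply: le_lt_trans (diss_lty T'0).
apply: ge0_le_integral => //.
- by move=> t _; rewrite lee_fin rate_ge0.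
- exact: mr.
- exact: (@measurable_funTS _ _ _ _ _ _ diss_measurable).
move=> t _ /=; rewrite /rate; case: ifPn => g; last exact: diss_ge0.
by rewrite (good_rate g).
Qed.

Variables (K : R).
Hypotheses (K0 : 0 < K) (PsiK : forall y, enorm (grad Psi y) <= K * (1 + enorm y)).

Definition q (t : R) (i : 'I_d) (y : V) : R := if good t then flux0 t i y else 0.
(** A representative of grad rho. Dividing the gradient of L_F(rho) by [dif] makes the relation
    [q_p] between flux and gradient hold at every point of a good time. *)
Definition p (t : R) (i : 'I_d) (y : V) : R :=
  if good t then if rhop t y == 0 then 0 else dLF t y 0 i / dif t y else 0.
(** The second summand bounds the gradient: [dif] p = q - rho grad Psi with [dif] at least [lambda],
    and the square of a difference is at most twice the sum of the squares. *)
Definition kin (t : R) (y : V) : R :=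
  if good t then kin0 t y + 2 / lambda ^+ 2 * (kin0 t y + enorm (grad Psi y) ^+ 2 * rhop t y) else 0.

Lemma q_meas t i : measurable_fun setT (q t i).
Proof.
have [g|g] := boolP (good t).
  by rewrite (_ : q t i = flux0 t i); [exact: flux0_meas|apply/funext => y; rewrite /q g].
by rewrite (_ : q t i = cst 0)//; apply/funext => y; rewrite /q (negbTE g).
Qed.

Lemma good_pos t : good t -> 0 < t. Proof. by case/andP. Qed.

Lemma p_meas t i : measurable_fun setT (p t i).
Proof.
have [g|g] := boolP (good t); last first.
  by rewrite (_ : p t i = cst 0)//; apply/funext => y; rewrite /p (negbTE g).
rewrite (_ : p t i = fun y => if rhop t y == 0 then 0 else dLF t y 0 i / dif t y); last first.
  by apply/funext => y; rewrite /p g.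
apply: measurable_off_zero; first exact: rhop_measurable.
apply: measurable_funM; first exact: wgrad_measurable.
apply: measurable_inv_ge0 => [|y]; last exact/ltW/dif_gt0.
apply: measurable_funD => //; apply: measurable_funM => //.
exact: (measurableT_comp (measurable_powR (m - 1)) (rhop_measurable t)).
Qed.

Lemma p_ae t i : good t -> {ae leb, forall y, p t i y = wgrad (rhop t) y 0 i}.
Proof.
move=> g; have [_ _ _] := slice (good_pos g); apply: filterS => y [_ E z].
rewrite /p g; case: eqP => [r0|_]; first by rewrite (proj2 (z r0)) mxE.
by rewrite E mxE mulrAC divff ?mul1r ?gt_eqF ?dif_gt0.
Qed.

Lemma q_p t i y : good t -> q t i y = rhop t y * dPsi i y + dif t y * p t i y.
Proof.
move=> g; rewrite /q /p g /flux0 (good_pos g); case: eqP => [->|_]; first by rewrite mul0r mulr0 addr0.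
by rewrite /flux [dif t y * _]mulrC divfK// gt_eqF ?dif_gt0.
Qed.

Lemma kin_ge0 t y : 0 <= kin t y.
Proof.
rewrite /kin; case: ifP => // _; have k0 := kin0_ge0 t y.
by rewrite addr_ge0// mulr_ge0 ?divr_ge0 ?sqr_ge0// addr_ge0// mulr_ge0 ?sqr_ge0 ?rhop_ge0.
Qed.

Lemma sum_q_sqr t y : good t -> \sum_i q t i y ^+ 2 = rhop t y * kin0 t y.
Proof.
move=> g; rewrite /kin0; have -> : \sum_i q t i y ^+ 2 = \sum_i flux0 t i y ^+ 2.
  by apply: eq_bigr => i _; rewrite /q g.
have [z|nz] := eqVneq (rhop t y) 0; last by rewrite mulrC mulfVK.
by rewrite z mul0r big1// => i _; rewrite /flux0 z eqxx; case: ifP; rewrite expr0n.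
Qed.

Lemma q_sqr_le0 t i y : good t -> q t i y ^+ 2 <= rhop t y * kin0 t y.
Proof.
move=> g; rewrite -sum_q_sqr// (bigD1 i)//= lerDl; apply: sumr_ge0 => j _; exact: sqr_ge0.
Qed.

Lemma dPsi_sqr_le i y : dPsi i y ^+ 2 <= enorm (grad Psi y) ^+ 2.
Proof.
rewrite enorm_sqr /edot (bigD1 i)//= -expr2 lerDl; apply: sumr_ge0 => j _.
by rewrite -expr2 sqr_ge0.
Qed.

Lemma kin0_le t y : good t -> kin0 t y <= kin t y.
Proof.
move=> g; rewrite /kin g lerDl; have k0 := kin0_ge0 t y.
by rewrite mulr_ge0 ?divr_ge0 ?sqr_ge0// addr_ge0// mulr_ge0 ?sqr_ge0 ?rhop_ge0.
Qed.

Lemma q_sqr_le t i y : q t i y ^+ 2 <= rhop t y * kin t y.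
Proof.
have [g|g] := boolP (good t); last first.
  by rewrite /q (negbTE g) expr0n mulr_ge0 ?rhop_ge0 ?kin_ge0.
by apply: le_trans (q_sqr_le0 i y g) _; rewrite ler_wpM2l ?rhop_ge0// kin0_le.
Qed.

Lemma p_sqr_le t i y : p t i y ^+ 2 <= rhop t y * kin t y.
Proof.
have [g|g] := boolP (good t); last first.
  by rewrite /p (negbTE g) expr0n mulr_ge0 ?rhop_ge0 ?kin_ge0.
have r0 := rhop_ge0 t y; have k0 := kin0_ge0 t y.
have l20 : 0 < lambda ^+ 2 by rewrite exprn_gt0.
have h1 : (dif t y * p t i y) ^+ 2 <= 2 * (rhop t y * (kin0 t y + enorm (grad Psi y) ^+ 2 * rhop t y)).
  have -> : dif t y * p t i y = q t i y - rhop t y * dPsi i y by rewrite q_p//; ring.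
  have h2 := q_sqr_le0 i y g; have h3 := dPsi_sqr_le i y.
  have h4 : (rhop t y * dPsi i y) ^+ 2 <= rhop t y * (enorm (grad Psi y) ^+ 2 * rhop t y).
    by rewrite exprMn expr2 -mulrA [rhop t y * dPsi _ _ ^+ 2]mulrC ler_wpM2l// ler_wpM2r.
  have h5 : (q t i y - rhop t y * dPsi i y) ^+ 2 <= 2 * (q t i y ^+ 2 + (rhop t y * dPsi i y) ^+ 2).
    by have := sqr_ge0 (q t i y + rhop t y * dPsi i y); rewrite !expr2; lra.
  by apply: le_trans h5 _; rewrite ler_pM2l// mulrDr lerD.
have h2 : lambda ^+ 2 * p t i y ^+ 2 <= (dif t y * p t i y) ^+ 2.
  rewrite exprMn ler_wpM2r ?sqr_ge0// ler_pXn2r ?nnegrE ?dif_ge ?ltW ?dif_gt0//.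
have h3 := le_trans h2 h1; rewrite -(ler_pM2l l20); apply: le_trans h3 _.
rewrite /kin g.
have -> : lambda ^+ 2 * (rhop t y * (kin0 t y + 2 / lambda ^+ 2 * (kin0 t y + enorm (grad Psi y) ^+ 2 * rhop t y))) =
   lambda ^+ 2 * (rhop t y * kin0 t y) + 2 * (rhop t y * (kin0 t y + enorm (grad Psi y) ^+ 2 * rhop t y)).
  by field; rewrite gt_eqF.
by rewrite lerDr; exact: mulr_ge0 (ltW l20) (mulr_ge0 r0 k0).
Qed.

Variables (gW : R -> R).
Hypotheses (mgW : measurable_fun (`[0%R, +oo[%classic : set R) gW)
  (igW : forall T : R, (\int[lebesgue_measure]_(z in `[0%R, T]) (gW z ^+ 2)%:E < +oo)%E)
  (hW : forall s t : R, 0 <= s -> s <= t ->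
     (W2 (dmeasure (rho t)) (dmeasure (rho s)) <= \int[lebesgue_measure]_(z in `[s, t]) (gW z)%:E)%E).

(** Dominates the length of the curve up to [t], because |g| <= 1 + g^2; it is continuous in [t],
    which makes [cost] integrable. *)
Definition budget (t : R) : R := \int[mu]_(z in `[0, t]) (1 + gW z ^+ 2).

Lemma gW_meas T : measurable_fun (`[0, T]%classic : set R) gW.
Proof.
apply: (measurable_funS _ _ mgW); first exact: measurable_itv.
by apply: subset_itv; rewrite bnd_simp.
Qed.

Lemma budget_Rint T : Rint mu `[0, T] (fun z => 1 + gW z ^+ 2).
Proof.
have mI : measurable (`[0, T]%classic : set R) by exact: measurable_itv.
apply: RintD.
  apply: Rint_continuous_itv; exact/continuous_subspaceT/cst_continuous.
apply: RintP => //; first by apply: measurable_funX; exact: gW_meas.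
have -> : (\int[mu]_(z in `[0%R, T]) `|gW z ^+ 2|%:E = \int[mu]_(z in `[0%R, T]) (gW z ^+ 2)%:E)%E.
  by apply: eq_integral => z _; rewrite ger0_norm ?sqr_ge0.
exact: igW.
Qed.

Lemma budget_ge0 t : 0 <= budget t.
Proof. by apply: Rintegral_ge0 => z _; rewrite addr_ge0 ?sqr_ge0. Qed.

Lemma moment2_bound t : 0 <= t -> moment2 (rhop t) <= 2 * moment2 (rho 0) + 2 * budget t ^+ 2.
Proof.
move=> t0; rewrite rhopE//; apply: W2_moment2; [exact: hrho2|exact: hrho2|exact: budget_ge0|].
apply: le_trans (hW (lexx 0) t0) _.
have h z : `|gW z| <= 1 + gW z ^+ 2.
  by rewrite -(real_normK (num_real (gW z))); have := sqr_ge0 (`|gW z| - 1); have := sqr_ge0 `|gW z|; rewrite !expr2; lra.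
have ig : Rint mu `[0, t] gW by apply: (Rint_le _ (budget_Rint t)) => [|z _]; [exact: gW_meas|exact: h].
rewrite (Rint_EFin ig) lee_fin; apply: le_RInt => //; first exact: budget_Rint.
by move=> z _; apply: le_trans (h z); exact: ler_norm.
Qed.

(** A bound for the mass of [kin]: the first term stems from [kin0], the second from |grad Psi|^2 <=
    2 K^2 (1 + |y|^2) and the second moment controlled by [budget]. *)
Definition cost (t : R) : R := (1 + 2 / lambda ^+ 2) * rate t +
  2 / lambda ^+ 2 * (2 * K ^+ 2 * (1 + (2 * moment2 (rho 0) + 2 * budget t ^+ 2))).

Let l2 : 0 <= 2 / lambda ^+ 2. Proof. by rewrite divr_ge0 ?sqr_ge0. Qed.

Lemma moment2_ge0 t : 0 <= moment2 (rhop t).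
Proof. by apply: Rintegral_ge0 => y _; rewrite mulr_ge0 ?sqr_ge0 ?rhop_ge0. Qed.

Lemma cost_rate t : (1 + 2 / lambda ^+ 2) * rate t <= cost t.
Proof.
have := moment2_ge0 0; rewrite rhopE// => h.
rewrite /cost lerDl; apply: mulr_ge0 => //; apply: mulr_ge0; first by rewrite mulr_ge0// sqr_ge0.
by rewrite !addr_ge0// mulr_ge0// sqr_ge0.
Qed.

Lemma cost_ge0 t : 0 <= cost t.
Proof. by apply: le_trans (cost_rate t); rewrite mulr_ge0 ?rate_ge0// addr_ge0. Qed.

Lemma cost_Rint T : Rint mu `[0, T] cost.
Proof.
pose T' := Num.max T 0; have T'0 : 0 <= T' by rewrite le_max lexx orbT.
suff : Rint mu `[0, T'] cost by move/Rint_itvS; apply => //; rewrite le_max lexx.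
have cb : {within `[0, T'], continuous budget}.
  by apply: RInt_indef_continuous => //; exact: budget_Rint.
have cst1 (k : R) : {within `[0, T'], continuous (fun=> k)}.
  by apply: continuous_subspaceT; exact: cst_continuous.
apply: RintD; first by apply: RintZ; exact: rate_Rint.
do 2 apply: RintZ; apply: RintD; first exact: Rint_continuous_itv.
apply: RintD; first exact: Rint_continuous_itv.
apply: RintZ; apply: Rint_continuous_itv => x; rewrite /continuous_at.
exact: (cvgM (cb x) (cb x)).
Qed.

Lemma grad_sqr_le y : enorm (grad Psi y) ^+ 2 <= 2 * K ^+ 2 * (1 + enorm y ^+ 2).
Proof.
have h0 : 0 <= enorm (grad Psi y) by exact: sqrtr_ge0.
have h1 : 0 <= K * (1 + enorm y) by rewrite mulr_ge0 ?(ltW K0)// addr_ge0// sqrtr_ge0.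
have : enorm (grad Psi y) ^+ 2 <= (K * (1 + enorm y)) ^+ 2.
  by rewrite ler_pXn2r// ?nnegrE.
move/le_trans; apply; rewrite exprMn -mulrA [2 * _]mulrCA ler_wpM2l ?sqr_ge0//.
have := sqr_ge0 (1 - enorm y); rewrite !expr2; lra.
Qed.

Lemma grad_sqr_Rint t : Rint leb setT (fun y => enorm (grad Psi y) ^+ 2 * rhop t y) /\
  \int[leb]_y (enorm (grad Psi y) ^+ 2 * rhop t y) <= 2 * K ^+ 2 * (1 + moment2 (rhop t)).
Proof.
have i1 := rhop_Rint t; have i2 := density2_Rint (rhop_density2 t).
have i3 : Rint leb setT (fun y => 2 * K ^+ 2 * (rhop t y + enorm y ^+ 2 * rhop t y)).
  by apply: RintZ; exact: RintD.
have h y : enorm (grad Psi y) ^+ 2 * rhop t y <= 2 * K ^+ 2 * (rhop t y + enorm y ^+ 2 * rhop t y).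
  have -> : rhop t y + enorm y ^+ 2 * rhop t y = (1 + enorm y ^+ 2) * rhop t y by ring.
  by rewrite mulrA ler_wpM2r ?rhop_ge0// grad_sqr_le.
have i4 : Rint leb setT (fun y => enorm (grad Psi y) ^+ 2 * rhop t y).
  apply: (Rint_le _ i3) => [|y _].
    apply: measurable_funM; last exact: rhop_measurable.
    under eq_fun do rewrite enorm_sqr /edot; apply: measurable_sum => i.
    by apply: measurable_funM; apply: continuous_measurable_rV; exact: dPsi_continuous.
  by rewrite ger0_norm// mulr_ge0 ?sqr_ge0 ?rhop_ge0.
split => //; apply: le_trans (_ : \int[leb]_y (2 * K ^+ 2 * (rhop t y + enorm y ^+ 2 * rhop t y)) <= _).
  exact: le_RInt.
by rewrite RIntZ; [rewrite RIntD// rhop_mass|exact: RintD].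
Qed.

Lemma kin_Rint t : Rint leb setT (kin t) /\ \int[leb]_y kin t y <= cost t.
Proof.
have [g|g] := boolP (good t); last first.
  have E : kin t = fun=> 0 by apply/funext => y; rewrite /kin (negbTE g).
  by rewrite E Rintegral_cst// mul0r; split; [exact: Rint0|exact: cost_ge0].
have [i1 E1] := kin0_Rint g; have [i2 h2] := grad_sqr_Rint t.
have i3 : Rint leb setT (fun y => 2 / lambda ^+ 2 * (kin0 t y + enorm (grad Psi y) ^+ 2 * rhop t y)).
  by apply: RintZ; exact: RintD.
have E : kin t = fun y => kin0 t y + 2 / lambda ^+ 2 * (kin0 t y + enorm (grad Psi y) ^+ 2 * rhop t y).
  by apply/funext => y; rewrite /kin g.
rewrite E; split; first exact: RintD.
rewrite RIntD// E1 RIntZ; last exact: RintD.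
rewrite RIntD// E1.
have -> : cost t = rate t + 2 / lambda ^+ 2 * (rate t +
    2 * K ^+ 2 * (1 + (2 * moment2 (rho 0) + 2 * budget t ^+ 2))) by rewrite /cost; ring.
rewrite lerD2l ler_wpM2l// lerD2l.
apply: le_trans h2 _; rewrite ler_wpM2l//; first by rewrite mulr_ge0// sqr_ge0.
by rewrite lerD2l moment2_bound// ltW// good_pos.
Qed.

Lemma conv_q_measurable i (zeta : V -> R) : test_function [set: V] zeta ->
  measurable_fun setT (fun t => \int[leb]_y (q t i y * zeta y)).
Proof.
move=> tz; rewrite (_ : (fun t => _) = (fun t => if good t then \int[leb]_y (flux0 t i y * zeta y) else 0)).
  by apply: measurable_if_good; exact: flux0_measurable.
apply/funext => t; rewrite /q; case: ifP => // _.
by under eq_Rintegral do rewrite mul0r; rewrite Rintegral_cst// mul0r.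
Qed.

Lemma p_integral t i (zeta : V -> R) : good t -> measurable_fun setT zeta ->
  \int[leb]_y (p t i y * zeta y) = \int[leb]_y (wgrad (rhop t) y 0 i * zeta y).
Proof.
move=> g mz; apply: ae_eq_RInt => //.
- by apply: measurable_funM => //; exact: p_meas.
- by apply: measurable_funM => //; exact: wgrad_measurable.
by apply: filterS (p_ae i g) => y ->.
Qed.

Lemma moll_translate_meas n (x : V) : measurable_fun setT (fun z : V => @moll R d n (z - x)).
Proof. by apply: continuous_measurable_rV; exact: moll_translate_continuous. Qed.

Lemma conv_p_measurable n i x : measurable_fun setT (fun t => conv n (p t i) x).
Proof.
pose zeta z := @moll R d n (z - x).
have tz : test_function [set: V] zeta by exact: moll_test.
have [r zr Cz] := test_functionP tz.
rewrite (_ : (fun t => _) = (fun t => if good t then - \int[leb]_y (rhop t y * 'D_(e_ i) zeta y) else 0)).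
  apply: measurable_if_good; apply: measurableT_comp => //; apply: continuous_measurable_fun.
  apply: (rhop_Cc_continuous (r := r)); last exact: vanishes_derive.
  by case: (Cz (e_ i)).
apply/funext => t; rewrite /cv; case: ifPn => g; last first.
  by under eq_Rintegral do rewrite /p (negbTE g) mul0r; rewrite Rintegral_cst// mul0r.
rewrite p_integral//; last exact: moll_translate_meas.
by have [_ [_ W] _ _] := slice (good_pos g); rewrite (W zeta tz i) opprK.
Qed.

Lemma conv_p_derive t : (forall i x, q t i x = 0) \/
  forall n (i : 'I_d) x, is_derive x (e_ i) (conv n (rhop t)) (conv n (p t i) x).
Proof.
have [g|g] := boolP (good t); last by left => i x; rewrite /q (negbTE g).
right => n i x; have [_ W _ _] := slice (good_pos g).
have := conv_weak_grad n x i (rhop_L1_loc t) W.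
by rewrite /cv -(p_integral i g)//; exact: moll_translate_meas.
Qed.

Lemma q_Rint t i : Rint leb setT (q t i).
Proof.
have [i1 _] := kin_Rint t.
apply: (Rint_le (q_meas t i) (RintD (rhop_Rint t) i1)) => y _.
by apply: sqr_le_mul_add; [exact: rhop_ge0|exact: kin_ge0|exact: q_sqr_le].
Qed.

Lemma q_mass t i : \int[leb]_y `|q t i y| <= 1 + cost t.
Proof.
have [i1 h1] := kin_Rint t.
apply: (@le_trans _ _ (\int[leb]_y (rhop t y + kin t y))).
  apply: le_RInt => [||y _]; [exact/Rint_abs/q_Rint|by apply: RintD => //; exact: rhop_Rint|].
  by apply: sqr_le_mul_add; [exact: rhop_ge0|exact: kin_ge0|exact: q_sqr_le].
by rewrite RIntD//; [rewrite rhop_mass lerD2l|exact: rhop_Rint].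
Qed.

Lemma FP_test (beta : V -> R) (r : R) (alpha alpha' : R -> R) (a b : R) :
  smooth beta -> vanishes_off r beta -> 0 < a -> (forall k, Ck k alpha) ->
  (forall x : R, is_derive x 1 alpha (alpha' x)) ->
  (forall x, ~~ (a <= x <= b) -> alpha x = 0) ->
  (\int[mu]_(t in `]0%R, +oo[) (alpha' t * \int[leb]_y (rhop t y * beta y) -
     alpha t * \sum_i \int[leb]_y (flux0 t i y * 'D_(e_ i) beta y))%:E = 0)%E.
Proof.
move=> sb br a0 ca da aE.
have tphi := test_function_time a0 ca sb aE br.
have [r' br' Cb] := test_functionP (test_function_rV sb br).
have cb : continuous beta by case: (Cb 0).
have := FP_equation hsol tphi => H.
rewrite -[RHS]H; apply: eq_integral => t /set_mem; rewrite /= in_itv/= andbT => t0.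
have tE := rhopE (ltW t0).
have fi i : Rint leb setT (fun y => flux t i y * 'D_(e_ i) beta y).
  apply: (L1_loc_Cc (r := r) (flux_L1_loc i t0)); last exact: vanishes_derive.
  by case: (Cb (e_ i)).
have i0 : Rint leb setT (fun y => rhop t y * beta y) by exact: L1_loc_Cc (rhop_L1_loc t) cb br.
have i1 : Rint leb setT (fun y => alpha t * \sum_i (flux t i y * 'D_(e_ i) beta y)).
  by apply: RintZ; exact: Rint_sum.
have i2 : Rint leb setT (fun y => alpha' t * (rhop t y * beta y)) by exact: RintZ.
transitivity (\int[leb]_y (alpha' t * (rhop t y * beta y) - alpha t * \sum_i (flux t i y * 'D_(e_ i) beta y)))%:E.
  congr EFin; rewrite RIntB// !RIntZ//; last exact: Rint_sum.
  rewrite RInt_sum//; congr (_ - _ * _); apply: eq_bigr => i _.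
  rewrite flux0_integral /pos ?t0 ?mul1r//; apply: continuous_measurable_rV; by case: (Cb (e_ i)).
rewrite -(Rint_EFin (RintB i2 i1)); apply: eq_integral => y _; congr EFin.
have -> : derive1 (fun s : R => alpha s * beta y) t = alpha' t * beta y.
  rewrite derive1E; have dat := da t.
  by rewrite deriveMr ?derive_val// mulrC.
congr (_ - _); first by rewrite tE; ring.
rewrite /edot mulr_sumr; apply: eq_bigr => i _.
rewrite !mxE /= deriveMl; last by case: (Cb (e_ i)).
by rewrite /flux /dPsi /dLF mxE tE; ring.
Qed.

Lemma flux0_q_ae : {ae mu, forall r : R, flux0 r = q r}.
Proof.
have := good_ae; apply: negligibleS => r; apply: contra_not => H.
apply/funext => i; apply/funext => y; rewrite /q; case: ifPn => // g.
by rewrite /flux0; case: ifP => // r0; move: g; rewrite H.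
Qed.

(** The equation tested with time cut-offs times the mollifier centred at [x], then
    [du_bois_reymond]. The flux may be replaced by [q] because they agree at almost every time. *)
Lemma rhop_evolution n x s t : 0 <= s -> s <= t ->
  conv n (rhop t) x - conv n (rhop s) x =
  - \int[mu]_(r in `[s, t]) \sum_i cv ('D_(e_ i) (@moll R d n)) (q r i) x.
Proof.
move=> s0 st; have t0 := le_trans s0 st.
pose beta z := @moll R d n (z - x).
have sb : smooth beta by move=> k; apply: Ck_translate; exact: moll_smooth.
have br : vanishes_off (n.+1%:R^-1 + `|x|) beta by exact: moll_translate_off.
have DE i y : 'D_(e_ i) beta y = 'D_(e_ i) (@moll R d n) (y - x) by exact: derive_translate.
pose B r := \sum_i \int[leb]_y (flux0 r i y * 'D_(e_ i) beta y).
pose Bq r := \sum_i cv ('D_(e_ i) (@moll R d n)) (q r i) x.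
have BBq : {ae mu, forall r : R, B r = Bq r}.
  have := flux0_q_ae; apply: negligibleS => r; apply: contra_not => /= H.
  rewrite /B /Bq H; apply: eq_bigr => i _; rewrite /cv; apply: eq_Rintegral => y _.
  by rewrite DE.
have mB : measurable_fun setT B.
  apply: measurable_sum => i; under eq_fun do under eq_Rintegral do rewrite DE.
  exact: (flux0_measurable i (moll_derive_test n x (e_ i))).
have mBq : measurable_fun setT Bq.
  by apply: measurable_sum => i; exact: (conv_q_measurable i (moll_derive_test n x (e_ i))).
have ics : Rint mu `[s, t] cost by exact: Rint_itvS (cost_Rint t) _ _.
have ic1 : Rint mu `[s, t] (fun a => 1 + cost a).
  apply: RintD => //; apply: Rint_continuous_itv; exact/continuous_subspaceT/cst_continuous.
have cD i : continuous ('D_(e_ i) (@moll R d n)) by case: (@moll_C1dir R d n (e_ i)).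
have /fin_all_exists2[C C0 DC] : forall i : 'I_d, exists2 C, 0 < C &
    forall z, `|'D_(e_ i) (@moll R d n) z| <= C.
  move=> i; apply: (continuous_bounded_support (cD i)).
  exact: (vanishes_derive (e_ i) (@moll_vanishes R d n)).
have iBq : Rint mu `[s, t] Bq.
  have ig : Rint mu `[s, t] (fun a => (\sum_i C i) * (1 + cost a)) by exact: RintZ.
  apply: (Rint_le _ ig) => [|a _]; first exact: (@measurable_funTS _ _ _ _ _ _ mBq).
  apply: le_trans (ler_norm_sum _ _ _) _; rewrite mulr_suml; apply: ler_sum => i _.
  apply: le_trans (cv_bound _ (q_Rint a i) (continuous_measurable_rV (cD i)) (DC i)) _.
  by rewrite ler_wpM2l ?q_mass// ltW.
have [iB EB] := ae_eq_itv mB mBq BBq iBq.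
transitivity (- \int[mu]_(r in `[s, t]) B r); last refine (f_equal (fun z : R => - z) EB).
clear EB.
have cA : {within `[s, t], continuous (fun t => conv n (rhop t) x)}.
  by apply: continuous_subspaceT => r; exact: conv_rhop_continuous.
apply: (du_bois_reymond s0 st cA iB).
by move=> alpha alpha' a b a0 ca da aE; exact: FP_test sb br a0 ca da aE.
Qed.

Lemma rhop_energy_balance (beta : V -> R) (r : R) (G G1 G2 : R -> R) (L : R) :
  (forall i : 'I_d, C1dir (e_ i) beta) -> vanishes_off r beta -> continuous beta ->
  C2_half_line G G1 G2 L -> forall s t, 0 <= s -> s <= t ->
  Rint mu `[s, t] (fun a => \sum_i \int[leb]_x (q a i x *
    (beta x * (G2 (rhop a x) * p a i x) + G1 (rhop a x) * 'D_(e_ i) beta x))) /\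
  \int[leb]_x (beta x * G (rhop t x)) - \int[leb]_x (beta x * G (rhop s x)) =
  - \int[mu]_(a in `[s, t]) \sum_i \int[leb]_x (q a i x *
    (beta x * (G2 (rhop a x) * p a i x) + G1 (rhop a x) * 'D_(e_ i) beta x)).
Proof.
move=> Cb br cb GL s t; apply: (energy_balance (b := kin) (c := cost)) Cb br cb GL s t.
- exact: rhop_ge0.
- exact: rhop_Rint.
- exact: rhop_mass.
- exact: kin_ge0.
- by move=> t; case: (kin_Rint t).
- by move=> t; case: (kin_Rint t).
- exact: q_meas.
- exact: p_meas.
- exact: q_sqr_le.
- exact: p_sqr_le.
- exact: conv_rhop_measurable.
- by move=> n i x; exact: (conv_q_measurable i (moll_test n x)).
- exact: conv_p_measurable.
- by move=> n i x; exact: (conv_q_measurable i (moll_derive_test n x (e_ i))).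
- exact: conv_p_derive.
- by move=> n x s t; exact: rhop_evolution.
- exact: cost_Rint.
Qed.

(** The dissipation splits into the rates of the potential and of the internal energy, the factor
    [dif / rhop] being F''(rho), the limit of [Gd2]. *)
Lemma rate_sum t i y : (q t i y ^+ 2) / rhop t y =
  q t i y * dPsi i y + q t i y * (dif t y / rhop t y * p t i y).
Proof.
have [r0|r0] := eqVneq (rhop t y) 0.
  have q0 : q t i y = 0.
    have := q_sqr_le t i y; rewrite r0 mul0r => h.
    by apply/eqP; rewrite -sqrf_eq0 eq_le h sqr_ge0.
  by rewrite q0 expr0n !mul0r addr0.
case: (boolP (good t)) => gt; last by rewrite /q (negbTE gt) expr0n !mul0r addr0.
by rewrite expr2 {2}(q_p i y gt); field.
Qed.

Lemma sum_rate t : (forall i : 'I_d, Rint leb setT (fun y => q t i y * dPsi i y)) ->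
  (forall i : 'I_d, Rint leb setT (fun y => q t i y * (dif t y / rhop t y * p t i y))) ->
  \sum_i \int[leb]_y (q t i y * dPsi i y) +
  \sum_i \int[leb]_y (q t i y * (dif t y / rhop t y * p t i y)) = rate t.
Proof.
move=> iA iB; rewrite -big_split/=.
transitivity (\sum_(i < d) \int[leb]_y (q t i y ^+ 2 / rhop t y)).
  apply: eq_bigr => i _; rewrite -RIntD//.
  by apply: eq_Rintegral => y _; rewrite rate_sum.
rewrite -RInt_sum//; last first.
  move=> i; apply: (eq_Rint (f := fun y => q t i y * dPsi i y + q t i y * (dif t y / rhop t y * p t i y))).
    by move=> y _; rewrite rate_sum.
  exact: RintD (iA i) (iB i).
case: (boolP (good t)) => gt.
  have [_ <-] := kin0_Rint gt; apply: eq_Rintegral => y _.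
  rewrite -mulr_suml; congr (_ / _); apply: eq_bigr => i _.
  by rewrite /q gt.
rewrite /rate (negbTE gt) /Rintegral integral0_eq// => y _.
by rewrite big1// => i _; rewrite /q (negbTE gt) expr0n mul0r.
Qed.

Lemma kin_parts t y : good t -> 
  kin0 t y + enorm (grad Psi y) ^+ 2 * rhop t y <= lambda ^+ 2 / 2 * kin t y.
Proof.
move=> gt; rewrite /kin gt mulrDr (mulrA (lambda ^+ 2 / 2) (2 / lambda ^+ 2)).
have -> : lambda ^+ 2 / 2 * (2 / lambda ^+ 2) = 1 by field; rewrite gt_eqF.
by rewrite mul1r lerDr mulr_ge0 ?kin0_ge0// divr_ge0// sqr_ge0.
Qed.

Lemma q_dPsi_le t i y : `|q t i y * dPsi i y| <= lambda ^+ 2 / 2 * kin t y.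
Proof.
case: (boolP (good t)) => gt; last by rewrite /q /kin (negbTE gt) mul0r normr0 mulr0.
apply: le_trans (kin_parts y gt); apply: sqr_le_mul_add; first exact: kin0_ge0.
  by rewrite mulr_ge0 ?rhop_ge0 ?sqr_ge0.
rewrite exprMn; apply: (@le_trans _ _ ((rhop t y * kin0 t y) * enorm (grad Psi y) ^+ 2)).
  apply: (ler_pM (sqr_ge0 _) (sqr_ge0 _)); [exact: q_sqr_le0|exact: dPsi_sqr_le].
by rewrite le_eqVlt; apply/orP; left; apply/eqP; ring.
Qed.

Definition slope_const : R := 4 * (1 + eta * m / lambda).

Lemma slope_const_ge0 : 0 <= slope_const.
Proof.
by rewrite mulr_ge0// addr_ge0// divr_ge0 ?(ltW lambda0)// mulr_ge0 ?(ltW eta0) ?(ltW m0).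
Qed.

(** Combining |q p| <= rho k with the bound on rho G''(rho) would leave the unbounded factor [dif].
    Instead [dif] is kept with p, and [dif] p = q - rho grad Psi is again controlled by sqrt (rho
    k). *)
Lemma q_Gd2_p_le n t i y :
  `|q t i y * (Gd2 lambda eta m (dn R n) (rhop t y) * p t i y)| <=
    slope_const * (1 + lambda ^+ 2 / 2) * kin t y.
Proof.
have C0 := slope_const_ge0.
have k0 := kin_ge0 t y.
have R0 : 0 <= slope_const * (1 + lambda ^+ 2 / 2) * kin t y.
  by rewrite mulr_ge0// mulr_ge0// addr_ge0// divr_ge0// sqr_ge0.
case: (boolP (good t)) => gt; last by rewrite /q (negbTE gt) mul0r normr0.
have [r0|r0] := eqVneq (rhop t y) 0.
  have q0 : q t i y = 0.
    have := q_sqr_le t i y; rewrite r0 mul0r => h.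
    by apply/eqP; rewrite -sqrf_eq0 eq_le h sqr_ge0.
  by rewrite q0 mul0r normr0.
have rp : 0 < rhop t y by rewrite lt_neqAle eq_sym r0 rhop_ge0.
have h1 := r_Gd2_le lambda0 eta0 m1 (dn_gt0 R n) (dn_lt1 R n) (ltW rp).
have h2 : `|q t i y * (dif t y * p t i y)| <= rhop t y * ((1 + lambda ^+ 2 / 2) * kin t y).
  have -> : dif t y * p t i y = q t i y - rhop t y * dPsi i y by rewrite (q_p i y gt); ring.
  rewrite mulrBr -expr2; apply: le_trans (ler_normB _ _) _.
  rewrite (ger0_norm (sqr_ge0 _)) mulrCA normrM (gtr0_norm rp) mulrDl mul1r mulrDr.
  apply: lerD; last by rewrite ler_pM2l// q_dPsi_le.
  by apply: le_trans (q_sqr_le0 i y gt) _; rewrite ler_pM2l// kin0_le.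
rewrite -(ler_pM2l rp).
apply: (@le_trans _ _ (`|rhop t y * Gd2 lambda eta m (dn R n) (rhop t y)| * `|q t i y * p t i y|)).
  rewrite !normrM (gtr0_norm rp) le_eqVlt; apply/orP; left; apply/eqP; ring.
apply: le_trans (ler_wpM2r (normr_ge0 _) h1) _.
rewrite -/slope_const -/(dif t y) -(mulrA slope_const (dif t y)).
have -> : rhop t y * (slope_const * (1 + lambda ^+ 2 / 2) * kin t y) =
  slope_const * (rhop t y * ((1 + lambda ^+ 2 / 2) * kin t y)) by ring.
rewrite ler_wpM2l//; apply: le_trans h2.
by rewrite -[X in X * _](gtr0_norm (dif_gt0 t y)) -normrM mulrCA.
Qed.

(** Dominated convergence in space and then in time, shared by the potential and the entropy. In the
    majorant, [kin] covers the main terms and 4 |q| those containing the gradient of the cut-off. *)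
Lemma flow_pairing_limit (E : nat -> R -> 'I_d -> V -> R) (e : R -> 'I_d -> V -> R) (C s t : R) :
  0 <= s -> 0 <= C -> (forall n a i, measurable_fun setT (E n a i)) ->
  (forall a i x, E n a i x @[n --> \oo] --> e a i x) ->
  (forall n a i x, `|E n a i x| <= C * kin a x + 4 * `|q a i x|) ->
  (forall n, Rint mu `[s, t] (fun a => \sum_i \int[leb]_x E n a i x)) ->
  [/\ forall a i, Rint leb setT (e a i),
      Rint mu `[s, t] (fun a => \sum_i \int[leb]_x e a i x) &
      \int[mu]_(a in `[s, t]) \sum_i \int[leb]_x E n a i x @[n --> \oo] -->
      \int[mu]_(a in `[s, t]) \sum_i \int[leb]_x e a i x].
Proof.
move=> s0 C0 mE Ee bE iE.
have ib a i : Rint leb setT (fun x => C * kin a x + 4 * `|q a i x|).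
  by apply: RintD; apply: RintZ; [exact: (kin_Rint a).1|apply: Rint_abs; exact: q_Rint].
have me a i : measurable_fun setT (e a i).
  by apply: (measurable_fun_cvg (mE ^~ a ^~ i)) => x _; exact: Ee.
have D a i : [/\ Rint leb setT (e a i), forall n, Rint leb setT (E n a i) &
    \int[leb]_x E n a i x @[n --> \oo] --> \int[leb]_x e a i x].
  apply: (Rint_DCT (g := fun x => C * kin a x + 4 * `|q a i x|)) => //.
  - by apply: aeW => x _; exact: Ee.
  - by apply: aeW => x _ n; exact: bE.
have S a : \sum_i \int[leb]_x E n a i x @[n --> \oo] --> \sum_i \int[leb]_x e a i x.
  by apply: cvg_sumR => i; case: (D a i).
have mS : measurable_fun `[s, t] (fun a => \sum_i \int[leb]_x e a i x).
  apply: (measurable_fun_cvg (h := fun n a => \sum_i \int[leb]_x E n a i x)).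
    by move=> n; exact: Rint_meas (iE n).
  by move=> a _; exact: S.
have ic : Rint mu `[s, t] cost by apply: Rint_itvS (cost_Rint t) s0 (lexx t).
have i1 : Rint mu `[s, t] (fun=> 1) by apply: Rint_continuous_itv => x; exact: cvg_cst.
have [] := @Rint_DCT _ _ R mu `[s, t] (fun n a => \sum_i \int[leb]_x E n a i x)
  (fun a => \sum_i \int[leb]_x e a i x)
  (fun a => \sum_(i < d) (C * cost a + 4 * (1 + cost a))).
- by move=> n; exact: Rint_meas (iE n).
- exact: mS.
- by apply: aeW => a _; exact: S.
- apply: Rint_sum => // i; apply: RintD; apply: RintZ => //; exact: RintD.
- apply: aeW => a _ n; apply: le_trans (ler_norm_sum _ _ _) _; apply: ler_sum => i _.
  have [_ iEn _] := D a i.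
  apply: le_trans (le_normr_Rintegral measurableT (Rint_int (iEn n))) _.
  apply: (@le_trans _ _ (\int[leb]_x (C * kin a x + 4 * `|q a i x|))).
    by apply: (le_RInt (Rint_abs (iEn n)) (ib a i)) => x _; exact: bE.
  have ik := (kin_Rint a).1; have iq := Rint_abs (q_Rint a i).
  rewrite (RIntD (RintZ C ik) (RintZ 4 iq)) (RIntZ _ ik) (RIntZ _ iq).
  apply: lerD; first by rewrite ler_wpM2l// (kin_Rint a).2.
  by rewrite ler_wpM2l// q_mass.
by move=> h1 _ h3; split => // a i; case: (D a i).
Qed.

(** * Convergence of the truncated energies and the dissipation identity *)

Hypothesis (Psi0 : forall y, 0 <= Psi y).

Let cPsi : continuous Psi. Proof. by case: PsiC1. Qed.

Let Psi_derive i (x : V) : is_derive x (e_ i) Psi (dPsi i x).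
Proof.
have [_ /(_ (e_ i))[dP _]] := PsiC1.
by rewrite /dPsi /grad mxE; exact: (DeriveDef (dP x) erefl).
Qed.

Definition dPsin (n : nat) (i : 'I_d) (y : V) : R := dPsi i y / (1 + dn R n * Psi y) ^+ 2.

Lemma dPsin_le n i y : `|dPsin n i y| <= `|dPsi i y|.
Proof.
have h : 1 <= 1 + dn R n * Psi y by rewrite lerDl mulr_ge0// ltW// dn_gt0.
rewrite normrM ler_piMr// ger0_norm; last by rewrite invr_ge0 sqr_ge0.
by rewrite invf_le1 ?exprn_gt0 ?(lt_le_trans ltr01 h)// exprn_ege1.
Qed.

Lemma dPsin_cvg i y : dPsin n i y @[n --> \oo] --> dPsi i y.
Proof.
rewrite -[X in _ --> X]divr1; apply: cvgM; first exact: cvg_cst.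
apply: cvgV; first exact: oner_neq0.
have h : 1 + dn R n * Psi y @[n --> \oo] --> (1 : R).
  rewrite -[X in _ --> X]addr0; apply: cvgD; first exact: cvg_cst.
  by rewrite -[X in _ --> X](mul0r (Psi y)); apply: cvgM; [exact: dn_cvg|exact: cvg_cst].
by rewrite -[X in _ --> X](mulr1 1); exact: (cvgM h h).
Qed.

Lemma Psin_C1dir n i : C1dir (e_ i) (Psin Psi n) /\ 'D_(e_ i) (Psin Psi n) = dPsin n i.
Proof.
have den y : 1 + dn R n * Psi y != 0 by rewrite gt_eqF// Psin_den.
apply: C1dir_is_derive; first exact: Psin_continuous.
  move=> x; have h1 := Psi_derive i x.
  have h2 : is_derive (Psi x) 1 (fun s : R => 1 + dn R n * s) (0 + dn R n *: 1) :=
    is_deriveD (is_derive_cst (1 : R) (Psi x) (1 : R)) (is_deriveZ (dn R n) (is_derive_id (Psi x) (1 : R))).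
  have h3 := @is_deriveV R (fun s : R => 1 + dn R n * s) (Psi x) _ 1 (den x) h2.
  have h4 : is_derive (Psi x) 1 (fun s : R => s / (1 + dn R n * s)) _ :=
    is_deriveM (is_derive_id (Psi x) (1 : R)) h3.
  apply: is_derive_eq (is_derive_comp h1 h4) _.
  rewrite /dPsin /GRing.scale /=; field; exact: den.
move=> x; apply: (cvgM (@dPsi_continuous i x)).
apply: cvgV; first by rewrite sqrf_eq0.
have h : continuous (fun y : V => 1 + dn R n * Psi y).
  by apply: ctsD; [exact: cts_cst|apply: ctsM; [exact: cts_cst|exact: cPsi]].
exact: (cvgM (h x) (h x)).
Qed.

Variable (Ln : nat -> R).
Local Notation Gn n := (Gd lambda eta m (dn R n)).
Local Notation Gn1 n := (Gd1 lambda eta m (dn R n)).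
Local Notation Gn2 n := (Gd2 lambda eta m (dn R n)).
Hypothesis (GnL : forall n, C2_half_line (Gn n) (Gn1 n) (Gn2 n) (Ln n)).

(* The cut-off radius outgrows the bounds on [Psin] and on the derivative of
   the truncated entropy, so that the gradient of the cut-off is negligible. *)
Definition Rn (n : nat) : R := n.+1%:R * (n.+2%:R + Ln n).

Let Ln0 n : 0 <= Ln n. Proof. by case: (GnL n). Qed.

Lemma Rn_ge n : n.+1%:R <= Rn n.
Proof.
rewrite ler_peMr// (@le_trans _ _ n.+2%:R)//; first by rewrite -natr1 lerDr.
by rewrite lerDl.
Qed.

Lemma Rn_gt0 n : 0 < Rn n. Proof. exact: lt_le_trans (Rn_ge n). Qed.

Lemma dchi_small n i (y : V) (c : R) : `|c| <= n.+2%:R + Ln n ->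
  `|c * dchi (Rn n) i y| <= 4 * n.+1%:R^-1.
Proof.
move=> cn; have a0 : 0 < n.+2%:R + Ln n by rewrite ltr_wpDr// ltr0n.
rewrite normrM; apply: le_trans (ler_pM _ _ cn (dchi_le (Rn_gt0 n) i y)) _ => //.
rewrite /Rn le_eqVlt; apply/orP; left; apply/eqP; field.
have := ler0n R n; have := Ln0 n => l0 n0.
by apply/andP; split; apply: lt0r_neq0; lra.
Qed.

Lemma dchi_cvg i (y : V) (c : nat -> R) : (forall n, `|c n| <= n.+2%:R + Ln n) ->
  c n * dchi (Rn n) i y @[n --> \oo] --> (0 : R).
Proof.
move=> cn; apply: norm_cvg0; apply: (@squeeze_cvgr _ _ _ _ (fun=> 0) (fun n => 4 * n.+1%:R^-1)).
- by apply: nearW => n; rewrite normr_ge0/=; exact: dchi_small.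
- exact: cvg_cst.
- by rewrite -[X in _ --> X](mulr0 (4 : R)); apply: cvgM; [exact: cvg_cst|exact: cvg_harmonic].
Qed.

Lemma q_dchi_le t n i y (c : R) : `|c| <= n.+2%:R + Ln n ->
  `|q t i y * (c * dchi (Rn n) i y)| <= 4 * `|q t i y|.
Proof.
move=> cn; rewrite normrM mulrC ler_wpM2r//; apply: le_trans (dchi_small i y cn) _.
by rewrite ler_piMr// invf_le1// ler1n.
Qed.

Let Psin_small n y : `|Psin Psi n y| <= n.+2%:R + Ln n.
Proof.
rewrite ger0_norm ?Psin_ge0//; apply: le_trans (Psin_le_n _ n y) _ => //.
by rewrite lerDl.
Qed.

Let Gn1_small n t y : `|Gn1 n (rhop t y)| <= n.+2%:R + Ln n.
Proof.
have [_ _ _ _ /(_ _ (rhop_ge0 t y))[h _ _]] := GnL n; apply: le_trans h _.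
by rewrite lerDr.
Qed.

Definition cut_energy (n : nat) (t : R) : R :=
  \int[leb]_y (chi (Rn n) y * Psin Psi n y * rhop t y) + \int[leb]_y (chi (Rn n) y * Gn n (rhop t y)).

Definition EA n (a : R) (i : 'I_d) (x : V) : R :=
  q a i x * (chi (Rn n) x * dPsin n i x + Psin Psi n x * dchi (Rn n) i x).
Definition EB n (a : R) (i : 'I_d) (x : V) : R :=
  q a i x * (chi (Rn n) x * (Gn2 n (rhop a x) * p a i x) + Gn1 n (rhop a x) * dchi (Rn n) i x).

Lemma cut_energy_balance n s t : 0 <= s -> s <= t ->
  [/\ Rint mu `[s, t] (fun a => \sum_i \int[leb]_x EA n a i x),
      Rint mu `[s, t] (fun a => \sum_i \int[leb]_x EB n a i x) &
      cut_energy n t - cut_energy n s =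
        - (\int[mu]_(a in `[s, t]) \sum_i \int[leb]_x EA n a i x +
           \int[mu]_(a in `[s, t]) \sum_i \int[leb]_x EB n a i x)].
Proof.
have E (x y z w u v : R) : x - y = - u -> z - w = - v -> x + z - (y + w) = - (u + v).
  by move=> h h'; rewrite [RHS]opprD -h -h'; ring.
move=> s0 st; have R0 := Rn_gt0 n.
have chiC (i : 'I_d) := (chi_C1dir R0 i).1; have chiD (i : 'I_d) := (chi_C1dir R0 i).2.
have PC (i : 'I_d) := (Psin_C1dir n i).1; have PD (i : 'I_d) := (Psin_C1dir n i).2.
have HA (i : 'I_d) : C1dir (e_ i) (fun y => chi (Rn n) y * Psin Psi n y) by exact: C1dirM.
have DA (i : 'I_d) (x : V) : 'D_(e_ i) (fun y => chi (Rn n) y * Psin Psi n y) x =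
    chi (Rn n) x * dPsin n i x + Psin Psi n x * dchi (Rn n) i x.
  have [[_ d1 _] [_ d2 _]] := (chiC i, PC i).
  rewrite -PD -chiD; exact: (deriveM (d1 x) (d2 x)).
have offA : vanishes_off (Rn n) (fun y => chi (Rn n) y * Psin Psi n y).
  by move=> y ry; rewrite (chi_off R0 ry) mul0r.
have cA : continuous (fun y => chi (Rn n) y * Psin Psi n y).
  by apply: ctsM; [exact: chi_continuous|exact: Psin_continuous].
have idL : C2_half_line (fun r : R => r) (fun=> 1) (fun=> 0) 1.
  split => [//|r _|r _|r _|r _]; [exact: is_derive_id|exact: is_derive_cst|exact: cvg_cst|].
  by rewrite mulr0 normr0 normr1.
have [iA eA] := rhop_energy_balance HA offA cA idL s0 st.
have [iB eB] := rhop_energy_balance chiC (chi_off R0) (@chi_continuous _ _ _) (GnL n) s0 st.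
have EAE : (fun a => \sum_i \int[leb]_x (q a i x * (chi (Rn n) x * Psin Psi n x * (0 * p a i x) +
    1 * 'D_(e_ i) (fun y => chi (Rn n) y * Psin Psi n y) x))) =
    (fun a => \sum_i \int[leb]_x EA n a i x).
  apply/funext => a; apply: eq_bigr => i _; apply: eq_Rintegral => x _.
  by rewrite DA mul0r mulr0 add0r mul1r.
have EBE : (fun a => \sum_i \int[leb]_x (q a i x * (chi (Rn n) x * (Gn2 n (rhop a x) * p a i x) +
    Gn1 n (rhop a x) * 'D_(e_ i) (chi (Rn n)) x))) = (fun a => \sum_i \int[leb]_x EB n a i x).
  apply/funext => a; apply: eq_bigr => i _; apply: eq_Rintegral => x _.
  by rewrite /EB -(chiD i).
rewrite EAE in iA eA; rewrite EBE in iB eB; split => //.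
exact: (E _ _ _ _ _ _ eA eB).
Qed.

(** Concerns differences of truncated energies, hence holds before the energy at either time is
    known to be finite; [flow_finite_energy] relies on this. *)
Lemma cut_energy_cvg s t : 0 <= s -> s <= t ->
  cut_energy n t - cut_energy n s @[n --> \oo] --> - \int[mu]_(a in `[s, t]) rate a.
Proof.
move=> s0 st.
have B n := cut_energy_balance n s0 st.
have mchi n := continuous_measurable_rV (@chi_continuous R d (Rn n)).
have mdchi n i : measurable_fun setT (dchi (Rn n) i).
  have [[_ _ c] <-] := chi_C1dir (Rn_gt0 n) i; exact: continuous_measurable_rV.
have mPsin n := continuous_measurable_rV (@Psin_continuous R d Psi Psi0 cPsi n).
have mdPsin n i : measurable_fun setT (dPsin n i).
  have [[_ _ c] <-] := Psin_C1dir n i; exact: continuous_measurable_rV.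
have mG1 n a : measurable_fun setT (fun y => Gn1 n (rhop a y)).
  apply: measurable_half_line; [|exact: rhop_measurable|exact: rhop_ge0] => r r0.
  by case: (C2_half_line_continuous (GnL n) r0).
have mG2 n a : measurable_fun setT (fun y => Gn2 n (rhop a y)).
  apply: measurable_half_line; [|exact: rhop_measurable|exact: rhop_ge0] => r r0.
  by case: (C2_half_line_continuous (GnL n) r0).
have l20 : 0 <= lambda ^+ 2 / 2 by rewrite divr_ge0// sqr_ge0.
have chi1 n (x : V) : `|chi (Rn n) x| <= 1.
  rewrite ger0_norm; last exact: chi_ge0.
  exact: (chi_le1 (Rn_gt0 n)).
have [|||iA iA' cA] := @flow_pairing_limit EA (fun a i x => q a i x * dPsi i x) (lambda ^+ 2 / 2) s t
  s0 l20 _ _ _ (fun n => let: And3 h _ _ := B n in h).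
- move=> n a i; apply: measurable_funM; first exact: q_meas.
  apply: measurable_funD; apply: measurable_funM;
    [exact: mchi|exact: mdPsin|exact: mPsin|exact: mdchi].
- move=> a i x; apply: cvgM; first exact: cvg_cst.
  rewrite -[X in _ --> X]addr0; apply: cvgD; last by apply: dchi_cvg => n; exact: Psin_small.
  rewrite -[X in _ --> X]mul1r; apply: cvgM; last exact: dPsin_cvg.
  by apply: chi_cvg; exact: Rn_ge.
- move=> n a i x; rewrite /EA mulrDr; apply: le_trans (ler_normD _ _) _; apply: lerD.
    apply: le_trans (q_dPsi_le a i x); rewrite [leLHS]normrM [leRHS]normrM ler_wpM2l// normrM.
    by apply: le_trans (dPsin_le n i x); rewrite ler_piMl.
  exact: q_dchi_le (Psin_small n x).
have [||||iB iB' cB] := @flow_pairing_limit EB (fun a i x => q a i x * (dif a x / rhop a x * p a i x))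
  (slope_const * (1 + lambda ^+ 2 / 2)) s t s0 _ _ _ _ (fun n => let: And3 _ h _ := B n in h).
- by apply: mulr_ge0; [exact: slope_const_ge0|exact: addr_ge0].
- move=> n a i; apply: measurable_funM; first exact: q_meas.
  apply: measurable_funD; apply: measurable_funM; [exact: mchi| |exact: mG1|exact: mdchi].
  by apply: measurable_funM; [exact: mG2|exact: p_meas].
- move=> a i x; have [r0|r0] := eqVneq (rhop a x) 0.
    have q0 : q a i x = 0.
      have := q_sqr_le a i x; rewrite r0 mul0r => h.
      by apply/eqP; rewrite -sqrf_eq0 eq_le h sqr_ge0.
    by rewrite /EB q0 mul0r; under eq_fun do rewrite mul0r; exact: cvg_cst.
  have rp : 0 < rhop a x by rewrite lt_neqAle eq_sym r0 rhop_ge0.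
  apply: cvgM; first exact: cvg_cst.
  rewrite -[X in _ --> X]addr0; apply: cvgD; last by apply: dchi_cvg => n; exact: Gn1_small.
  rewrite -[X in _ --> X]mul1r; apply: cvgM; first by apply: chi_cvg; exact: Rn_ge.
  by apply: cvgM; [exact: (@Gd2_cvg R lambda eta m _ rp)|exact: cvg_cst].
- move=> n a i x; rewrite /EB mulrDr; apply: le_trans (ler_normD _ _) _; apply: lerD.
    apply: le_trans (q_Gd2_p_le n a i x); rewrite mulrCA normrM.
    by rewrite ler_piMl.
  exact: q_dchi_le (Gn1_small n a x).
have -> : \int[mu]_(a in `[s, t]) rate a =
    \int[mu]_(a in `[s, t]) \sum_i \int[leb]_x (q a i x * dPsi i x) +
    \int[mu]_(a in `[s, t]) \sum_i \int[leb]_x (q a i x * (dif a x / rhop a x * p a i x)).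
  by rewrite -RIntD//; apply: eq_Rintegral => a _; rewrite sum_rate.
under eq_fun => n do (have [_ _ ->] := B n).
exact: cvgN (cvgD cA cB).
Qed.
Lemma cut_energy_lim t : finite_energy lambda m Psi (rhop t) ->
  cut_energy n t @[n --> \oo] --> \int[leb]_y (Psi y * rhop t y) + \int[leb]_y entF lambda eta m (rhop t y).
Proof.
move=> ft; have dt := rhop_density2 t.
apply: cvgD; first exact: (@cutoff_potential_cvg R d lambda m Psi Psi0 cPsi Rn (rhop t) Rn_ge dt ft).
exact: (@cutoff_entropy_cvg R d lambda eta m Psi lambda0 eta0 m1 Rn (rhop t) Rn_ge dt ft).
Qed.

(** The truncated energies converge at time 0, and so do their differences between 0 and [t]; hence
    they are bounded at time [t], and Fatou applies. *)
Lemma flow_finite_energy t : finite_energy lambda m Psi (rhop 0) -> 0 <= t ->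
  finite_energy lambda m Psi (rhop t).
Proof.
move=> f0 t0; have dt := rhop_density2 t; have it := rhop_Rint t; have u0 := rhop_ge0 t.
have mt := rhop_measurable t.
have [c cut_le] : exists c, forall n, cut_energy n t <= c.
  have cv : cut_energy n t @[n --> \oo] --> (- \int[mu]_(a in `[0, t]) rate a) +
      (\int[leb]_y (Psi y * rhop 0 y) + \int[leb]_y entF lambda eta m (rhop 0 y)).
    rewrite (_ : (fun n => cut_energy n t) = (fun n => (cut_energy n t - cut_energy n 0) + cut_energy n 0));
      last by apply/funext => n; rewrite subrK.
    exact: (cvgD (@cut_energy_cvg _ _ (lexx 0) t0) (@cut_energy_lim _ f0)).
  have [M [_ hM]] := cvg_seq_bounded (cvgP _ cv).
  exists (M + 1) => n; apply: le_trans (ler_norm _) _.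
  by apply: (hM (M + 1)) => //; rewrite ltrDl.
have iN := neg_entropy_Rint lambda0 dt.
have mchi n := continuous_measurable_rV (@chi_continuous R d (Rn n)).
have mPsin n := continuous_measurable_rV (@Psin_continuous R d Psi Psi0 cPsi n).
have chi01 n (x : V) : 0 <= chi (Rn n) x <= 1.
  by rewrite chi_ge0/=; exact: (chi_le1 (Rn_gt0 n)).
have iA n : Rint leb setT (fun y => chi (Rn n) y * Psin Psi n y * rhop t y).
  apply: (RintMb (C := n.+2%:R) it); first by apply: measurable_funM; [exact: mchi|exact: mPsin].
  move=> y _; have /andP[c0 c1] := chi01 n y.
  rewrite normrM !ger0_norm ?Psin_ge0//; apply: le_trans (Psin_le_n Psi0 n y).
  by rewrite ler_piMl// Psin_ge0.
have mG n : measurable_fun setT (fun y => Gn n (rhop t y)).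
  apply: measurable_half_line; [|exact: mt|exact: u0] => r r0.
  by case: (C2_half_line_continuous (GnL n) r0).
have iB n : Rint leb setT (fun y => chi (Rn n) y * Gn n (rhop t y)).
  have ic : Rint leb setT (chi (Rn n)).
    by apply: (@Rint_Cc _ _ _ (Rn n)); [exact: chi_continuous|exact: (chi_off (Rn_gt0 n))].
  apply: (Rint_le _ (RintD (RintZ `|Gn n 0| ic) (RintZ (Ln n) it))) => [|y _].
    by apply: measurable_funM; [exact: mchi|exact: mG].
  have /andP[c0 c1] := chi01 n y.
  rewrite normrM ger0_norm//; apply: le_trans (ler_wpM2l c0 (C2_half_line_bound (GnL n) (u0 y))) _.
  rewrite mulrDr (mulrC (`|Gn n 0|) (chi (Rn n) y)) lerD2l.
  exact: (ler_piMl (mulr_ge0 (Ln0 n) (u0 y)) c1).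
(* Adding the negative part of the entropy, integrable for any density with finite second moment,
   makes the integrand nonnegative by [Gd_ge]; in the limit it cancels the negative part of H. *)
pose f n y : R := chi (Rn n) y * Psin Psi n y * rhop t y + chi (Rn n) y * Gn n (rhop t y) +
  Num.max (- entH lambda (rhop t y)) 0.
have iF n : Rint leb setT (f n) by exact: RintD (RintD (iA n) (iB n)) iN.
have F0 n y : 0 <= f n y.
  have /andP[c0 c1] := chi01 n y.
  have N0 : 0 <= Num.max (- entH lambda (rhop t y)) 0 by rewrite le_max lexx orbT.
  have h := Gd_ge lambda0 eta0 m1 (dn_gt0 R n) (dn_lt1 R n) (u0 y).
  have h1 : 0 <= chi (Rn n) y * Psin Psi n y * rhop t y.
    exact: mulr_ge0 (mulr_ge0 c0 (Psin_ge0 Psi0 n y)) (u0 y).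
  have h2 : - Num.max (- entH lambda (rhop t y)) 0 <= chi (Rn n) y * Gn n (rhop t y).
    apply: le_trans (ler_wpM2l c0 h); rewrite mulrN lerN2.
    by rewrite ler_piMl.
  rewrite /f -addrA; apply: addr_ge0 h1 _.
  by rewrite -lerBlDr sub0r.
pose fl y := Psi y * rhop t y + entF lambda eta m (rhop t y) + Num.max (- entH lambda (rhop t y)) 0.
have flE y : fl y = Psi y * rhop t y + (Num.max (entH lambda (rhop t y)) 0 + eta / (m - 1) * rhop t y `^ m).
  rewrite /fl /entF; move: (entH _ _) => a; rewrite -!addrA; congr (_ + _).
  by rewrite addrCA; case: (leP a 0) => h; case: (leP (- a) 0) => h'; lra.
have Fcv y : f n y @[n --> \oo] --> fl y.
  apply: cvgD; last exact: cvg_cst.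
  have cchi : chi (Rn n) y @[n --> \oo] --> (1 : R) by apply: chi_cvg; exact: Rn_ge.
  apply: cvgD.
    apply: cvgM; last exact: cvg_cst.
    by rewrite -[X in _ --> X]mul1r; apply: cvgM; [exact: cchi|exact: Psin_cvg].
  rewrite -[X in _ --> X]mul1r; apply: cvgM; first exact: cchi.
  exact: (@Gd_cvg R lambda eta m m1 _ (u0 y)).
have mH := entH_measurable lambda mt.
have mm : measurable_fun setT (fun y => rhop t y `^ m).
  exact: (measurableT_comp (measurable_powR m) mt).
have mfl : measurable_fun setT fl.
  by apply: (measurable_fun_cvg (h := f)) => [n|y _]; [exact: Rint_meas (iF n)|exact: Fcv].
have [ifl _] := @Rint_fatou _ _ R leb setT f fl (c + \int[leb]_y Num.max (- entH lambda (rhop t y)) 0)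
  iF (fun n y _ => F0 n y) mfl (aeW _ (fun y _ => Fcv y))
  (fun n => ltac:(rewrite (RIntD (RintD (iA n) (iB n)) iN) (RIntD (iA n) (iB n)) lerD2r; exact: cut_le)).
have k0 : 0 < eta / (m - 1) by rewrite divr_gt0// subr_gt0.
have a0 y : 0 <= Psi y * rhop t y by exact: mulr_ge0.
have b0 y : 0 <= Num.max (entH lambda (rhop t y)) 0 by rewrite le_max lexx orbT.
have c0 y : 0 <= eta / (m - 1) * rhop t y `^ m by rewrite mulr_ge0 ?powR_ge0// ltW.
split.
- apply: (Rint_le _ ifl) => [|y _].
    by apply: measurable_funM; [exact: (continuous_measurable_rV cPsi)|exact: mt].
  by rewrite ger0_norm// flE lerDl addr_ge0.
- apply: (Rint_le mH (RintD ifl iN)) => y _; rewrite flE.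
  have := a0 y; have := c0 y.
  move: (Psi y * rhop t y) (entH lambda (rhop t y)) (eta / (m - 1) * rhop t y `^ m) => z a w h1 h2.
  rewrite ler_norml.
  by case: (leP a 0) => h; case: (leP (- a) 0) => h'; apply/andP; split; lra.
apply: (eq_Rint (f := fun y => (eta / (m - 1))^-1 * (eta / (m - 1) * rhop t y `^ m))).
  by move=> y _; rewrite mulrA mulVf ?mul1r// gt_eqF.
apply: RintZ; apply: (Rint_le _ ifl) => [|y _]; first exact: measurable_funM.
by rewrite ger0_norm// flE addrA lerDr addr_ge0.
Qed.

Lemma flow_energy_identity s t : finite_energy lambda m Psi (rhop 0) -> 0 <= s -> s <= t ->
  (\int[leb]_y (Psi y * rhop t y) + \int[leb]_y entF lambda eta m (rhop t y)) -
  (\int[leb]_y (Psi y * rhop s y) + \int[leb]_y entF lambda eta m (rhop s y)) =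
  - \int[mu]_(a in `[s, t]) rate a.
Proof.
move=> f0 s0 st; have t0 := le_trans s0 st.
have h2 : cut_energy n t - cut_energy n s @[n --> \oo] -->
    (\int[leb]_y (Psi y * rhop t y) + \int[leb]_y entF lambda eta m (rhop t y)) -
    (\int[leb]_y (Psi y * rhop s y) + \int[leb]_y entF lambda eta m (rhop s y)).
  exact: (cvgB (@cut_energy_lim _ (flow_finite_energy f0 t0)) (@cut_energy_lim _ (flow_finite_energy f0 s0))).
by rewrite -(cvg_lim (@Rhausdorff R) (@cut_energy_cvg _ _ s0 st)) (cvg_lim (@Rhausdorff R) h2).
Qed.

(** Since [rate] vanishes at nonpositive times, a compact set contributes only through an interval
    starting at 0. *)
Lemma rate_locally_integrable : locally_integrable [set: R] rate.
Proof.
split; [exact: rate_measurable|exact: openT|move=> A _ cA].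
have [M [_ hM]] := compact_bounded cA.
have AM x : A x -> `|x| <= M + 1 by move=> Ax; apply: (hM (M + 1)) => //; rewrite ltrDl.
have mA := compact_measurable cA.
pose f := (fun x : R => `|rate x|%:E) \_ `[0, M + 1].
have fA : {in A, (fun x => `|rate x|%:E)%E =1 f}.
  move=> x; rewrite inE => /AM xM; rewrite /f patchE; case: ifPn => //.
  rewrite notin_setE/= in_itv/= => /negP; rewrite negb_and -!ltNge => h.
  have x0 : x <= 0 by case/orP: h => [/ltW//|]; move=> h; have := ler_norm x; lra.
  by rewrite /rate /good ltNge x0 normr0.
have -> : (\int[mu]_(x in A) `|rate x|%:E = \int[mu]_(x in A) f x)%E.
  by apply: eq_integral => x xA; exact: fA.
have i0 := rate_Rint (M + 1) (lexx 0).
apply: (@le_lt_trans _ _ (\int[mu]_x f x)%E).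
  apply: ge0_subset_integral => //.
    apply/(measurable_restrictT _ _).1 => //.
    by apply/measurable_EFinP; apply: measurableT_comp => //; exact: Rint_meas i0.
  by move=> x _; rewrite /f patchE; case: ifP => // _; rewrite lee_fin.
by rewrite /f -integral_mkcond; exact: Rint_lty i0.
Qed.

Lemma rate_FTC : {ae mu, forall t : R, 0 < t ->
  is_derive t 1 (fun x : R => \int[mu]_(a in `[0, x]) rate a) (rate t)}.
Proof.
have := @FTC1 R rate (BLeft 0) (fun y => Rint_int (rate_Rint y (lexx 0))) rate_locally_integrable.
apply: negligibleS => t; apply: contra_not => H t0.
have [|d1 d2] := H; first by rewrite lte_fin.
by rewrite -d2 derive1E; exact: DeriveDef.
Qed.

Hypotheses (hrho0 : density2 rho0) (hJ0 : (J lambda eta m Psi rho0 < +oo)%E).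

Lemma J_initial : J lambda eta m Psi (rho 0) = J lambda eta m Psi rho0.
Proof.
apply: (J_ae_eq lambda eta m cPsi _ _ (FP_initial hsol)).
  by case: (hrho2 (lexx 0)) => -[].
by case: hrho0 => -[].
Qed.

Lemma finite_energy_initial : finite_energy lambda m Psi (rhop 0).
Proof.
apply: (@finite_energy_of_J R d lambda eta m Psi lambda0 eta0 m1 Psi0 cPsi); first exact: rhop_density2.
by rewrite (rhopE (lexx 0)) J_initial; exact: hJ0.
Qed.

Lemma J_flow t : 0 <= t -> J lambda eta m Psi (rho t) =
  (\int[leb]_y (Psi y * rhop t y) + \int[leb]_y entF lambda eta m (rhop t y))%:E.
Proof.
move=> t0; rewrite -(J_finite eta lambda0 (rhop_density2 t) (flow_finite_energy finite_energy_initial t0)).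
by rewrite rhopE.
Qed.

Lemma J_dissipation t : 0 <= t -> J lambda eta m Psi (rho t) =
  (fine (J lambda eta m Psi (rho 0)) - \int[mu]_(a in `[0, t]) rate a)%:E.
Proof.
move=> t0; rewrite (J_flow t0) (J_flow (lexx 0)); apply: (f_equal EFin).
rewrite -(flow_energy_identity finite_energy_initial (lexx 0) t0).
by rewrite [RHS]addrC subrK.
Qed.

Lemma vnorm2_integral t : 0 <= t ->
  (\int[mu]_(r in `]0%R, t[) vnorm2 lambda eta m Psi rho r)%E = (\int[mu]_(r in `[0, t]) rate r)%:E.
Proof.
move=> t0; have -> : (\int[mu]_(r in `]0%R, t[) vnorm2 lambda eta m Psi rho r =
    \int[mu]_(r in `]0%R, t[) diss r)%E.
  by apply: eq_integral => r; rewrite inE/= in_itv/= => /andP[r0 _]; exact: diss_vnorm2.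
have mr (D : set R) : measurable_fun D (EFin \o rate).
  by apply/measurable_EFinP; exact: (@measurable_funTS _ _ _ _ _ _ rate_measurable).
rewrite -(Rint_EFin (rate_Rint t (lexx 0))) -(integral_itv_obnd_cbnd (mr _)).
rewrite -(integral_itv_bndo_bndc (mr _)).
apply: ae_eq_integral => //; first exact: (@measurable_funTS _ _ _ _ _ _ diss_measurable).
  exact: mr.
have := good_ae; apply: negligibleS => r; apply: contra_not => H /=.
by rewrite in_itv/= => /andP[r0 _]; apply: good_rate; exact: H.
Qed.

Lemma dissipation_ae : {ae mu, forall t : R, 0 < t ->
  [/\ vnorm2 lambda eta m Psi rho t \is a fin_num,
      \forall s \near t, J lambda eta m Psi (rho s) \is a fin_num &
      is_derive t 1 (fun s : R => fine (J lambda eta m Psi (rho s)))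
        (- fine (vnorm2 lambda eta m Psi rho t))]}.
Proof.
apply: (negligibleS _ (negligibleU good_ae rate_FTC)) => t /= H; apply: contrapT => /not_orP[h1 h2].
apply: H => t0; move/contrapT: h1 => /(_ t0) gt; move/contrapT: h2 => /(_ t0) dt.
have nt : \forall s \near t, 0 < s by exact: lt_nbhsr.
rewrite (diss_vnorm2 t0) (good_rate gt); split => //.
  by apply: filterS nt => s /ltW s0; rewrite J_dissipation.
apply: (@near_eq_is_derive _ _ _
  (fun s : R => fine (J lambda eta m Psi (rho 0)) - \int[mu]_(a in `[0, s]) rate a)).
  by apply: filterS nt => s /ltW s0; rewrite (J_dissipation s0).
rewrite /= -[- rate t]add0r.
exact: (is_deriveD (is_derive_cst _ t (1 : R)) (is_deriveN dt)).
Qed.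

(** By [J_dissipation] the two sides are equal. *)
Lemma energy_inequality t : 0 <= t ->
  (J lambda eta m Psi (rho t) <= J lambda eta m Psi rho0 -
     \int[mu]_(r in `]0%R, t[) vnorm2 lambda eta m Psi rho r)%E.
Proof.
move=> t0; rewrite (vnorm2_integral t0) -J_initial (J_dissipation t0) EFinB.
by rewrite fineK// (J_flow (lexx 0)).
Qed.

End flow.

Theorem proposition7p1 (R : realType) (d : nat) (hd : (0 < d)%N)
  (lambda eta m : R)
  (hlambda0 : 0 < lambda) (hlambda : lambda < expR 1 / 2)
  (heta : 0 < eta) (hm : 1 < m)
  (Psi : 'rV[R]_d -> R)
  (hPsi_ge0 : forall y, 0 <= Psi y)
  (hPsi_C1 : Ck 1 Psi)
  (hPsi_growth : exists2 K : R, 0 < K &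
     forall y, enorm (grad Psi y) <= K * (1 + enorm y))
  (hPsi_lip : exists L : R,
     forall x y, enorm (grad Psi x - grad Psi y) <= L * enorm (x - y))
  (rho0 : 'rV[R]_d -> R)
  (hrho0 : density2 rho0)
  (hJ0 : (J lambda eta m Psi rho0 < +oo)%E)
  (rho : R -> 'rV[R]_d -> R)
  (hrho2 : forall t : R, 0 <= t -> density2 (rho t))
  (hsol : FP_solution lambda eta m Psi rho0 rho)
  (hAC : AC2_loc (fun t => dmeasure (rho t)))
  (hv : forall T : R, 0 < T ->
     (\int[lebesgue_measure]_(t in `]0%R, T[) vnorm2 lambda eta m Psi rho t
      < +oo)%E) :
  {ae (@lebesgue_measure R), forall t : R, 0 < t ->
     [/\ vnorm2 lambda eta m Psi rho t \is a fin_num,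
         \forall s \near t, J lambda eta m Psi (rho s) \is a fin_num &
         is_derive t 1 (fun s : R => fine (J lambda eta m Psi (rho s)))
           (- fine (vnorm2 lambda eta m Psi rho t))]}
  /\
  (forall t : R, 0 <= t ->
     (J lambda eta m Psi (rho t)
      <= J lambda eta m Psi rho0
         - \int[lebesgue_measure]_(r in `]0%R, t[) vnorm2 lambda eta m Psi rho r)%E).
Proof.
have [K K0 PsiK] := hPsi_growth; have [gW [mgW igW hW]] := hAC.
(* The bounds are fixed as a sequence at this point because the cut-off radii [Rn] are built from
   them. *)
have /choice[Ln GnL] : forall n, exists L : R, C2_half_line (Gd lambda eta m (dn R n))
    (Gd1 lambda eta m (dn R n)) (Gd2 lambda eta m (dn R n)) L.
  by move=> n; have [L _ h] := Gd_half_line hlambda0 heta hm (dn_gt0 R n) (dn_lt1 R n); exists L.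
split; first exact: (dissipation_ae hlambda0 heta hm hPsi_C1 hrho2 hsol hv K0 PsiK mgW igW hW
    hPsi_ge0 GnL hrho0 hJ0).
exact: (energy_inequality hlambda0 heta hm hPsi_C1 hrho2 hsol hv K0 PsiK mgW igW hW
    hPsi_ge0 GnL hrho0 hJ0).
Qed.
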